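(* Let $p\ge 3$ be a prime, let $K$ be a number field, and let $E_1,E_2$ be elliptic curves over $K$. Assume there is a $G_K$-module isomorphism $E_1[p]\cong E_2[p]$. Then $E_1$ and $E_2$ are $p$-twisted Selmer near-companions over $K$.
   Context: $\mu_p$ denotes the group of $p$-th roots of unity in $\bar K$ and $\mathcal{C}(K):=\mathrm{Hom}(G_K,\mu_p)$; for a place $v$, $\chi_v$ is the restriction of $\chi$ to $G_{K_v}$. For an elliptic curve $E/K$ and a nontrivial character $\psi$ of $G_F$ ($F=K$ or $K_v$) with values in $\mu_p$, let $L/F$ be the cyclic degree-$p$ extension cut out by $\psi$, $\mathcal{I}_L:=\ker(\mathbb{Z}[G(L/F)]\to\mathbb{Z})$, and $E^\psi:=\mathcal{I}_L\otimes E=\ker(\mathrm{Res}^L_F E\to E)$, an abelian variety of dimension $p-1$ with an action of $\mathcal{O}=\mathbb{Z}[\mu_p]$; with $\mathfrak{p}$ the prime of $\mathcal{O}$ above $p$ there is a canonical $G_F$-isomorphism $E^\psi[\mathfrak{p}]\cong E[p]$. For $\psi\in\mathrm{Hom}(G_{K_v},\mu_p)$, $\gamma_v(\psi)\subset H^1(K_v,E[p])$ is the image of the Kummer map $E^\psi(K_v)/\mathfrak{p}E^\psi(K_v)\to H^1(K_v,E^\psi[\mathfrak{p}])\cong H^1(K_v,E[p])$ if $\psi\ne 1$, and the image of $E(K_v)/pE(K_v)\to H^1(K_v,E[p])$ if $\psi=1$. For $\chi\in\mathcal{C}(K)$, $\mathrm{Sel}_p(E/K,\chi):=\{c\in H^1(K,E[p]):\mathrm{loc}_v(c)\in\gamma_v(\chi_v)\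 \forall v\}$. $E_1,E_2$ are $p$-twisted Selmer near-companions over $K$ if there is a constant $C$ with $|\dim_{\mathbb{F}_p}\mathrm{Sel}_p(E_2/K,\chi)-\dim_{\mathbb{F}_p}\mathrm{Sel}_p(E_1/K,\chi)|<C$ for all $\chi\in\mathcal{C}(K)$. *)

(* Defs.v *)
From HB Require Import structures.
From mathcomp Require Import all_boot all_order all_algebra all_field.
From mathcomp Require Import boolp reals.

Set Implicit Arguments.
Unset Strict Implicit.
Unset Printing Implicit Defensive.

Import Order.TTheory GRing.Theory Num.Theory.
Local Open Scope ring_scope.

(** ** Elliptic curves *)

(* y^2 + a1 x y + a3 y = x^3 + a2 x^2 + a4 x + a6 *)
Record weierstrass (F : Type) :=
  Weierstrass { wa1 : F; wa2 : F; wa3 : F; wa4 : F; wa6 : F }.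

Definition map_weierstrass (F L : Type) (f : F -> L) (W : weierstrass F) :=
  Weierstrass (f (wa1 W)) (f (wa2 W)) (f (wa3 W)) (f (wa4 W)) (f (wa6 W)).

Section Discriminant.
Variables (F : fieldType) (W : weierstrass F).
Let a1 := wa1 W. Let a2 := wa2 W. Let a3 := wa3 W.
Let a4 := wa4 W. Let a6 := wa6 W.

Definition wb2 := a1 ^+ 2 + 4 * a2.
Definition wb4 := 2 * a4 + a1 * a3.
Definition wb6 := a3 ^+ 2 + 4 * a6.
Definition wb8 := a1 ^+ 2 * a6 + 4 * a2 * a6 - a1 * a3 * a4
                  + a2 * a3 ^+ 2 - a4 ^+ 2.
Definition wdisc :=
  - wb2 ^+ 2 * wb8 - 8 * wb4 ^+ 3 - 27 * wb6 ^+ 2 + 9 * wb2 * wb4 * wb6.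
End Discriminant.

Record ellipticCurve (F : fieldType) := EllipticCurve {
  ec_eqn :> weierstrass F;
  ec_disc_neq0 : wdisc ec_eqn != 0 }.

(* Points are raw; membership in the curve is the predicate [on_curve], and
   [padd], [popp] are the group law only on points satisfying it. *)
Inductive point (L : Type) := Infty | Aff (x y : L).
Arguments Infty {L}.

Definition map_point (L M : Type) (f : L -> M) (P : point L) : point M :=
  if P is Aff x y then Aff (f x) (f y) else Infty.

Section GroupLaw.
Variables (L : fieldType) (W : weierstrass L).
Let a1 := wa1 W. Let a2 := wa2 W. Let a3 := wa3 W.
Let a4 := wa4 W. Let a6 := wa6 W.

Definition on_curve (P : point L) : bool :=
  if P is Aff x y then
    y ^+ 2 + a1 * x * y + a3 * y == x ^+ 3 + a2 * x ^+ 2 + a4 * x + a6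
  else true.

Definition popp (P : point L) : point L :=
  if P is Aff x y then Aff x (- y - a1 * x - a3) else Infty.

Definition padd (P Q : point L) : point L :=
  match P, Q with
  | Infty, _ => Q
  | _, Infty => P
  | Aff x1 y1, Aff x2 y2 =>
    if (x1 == x2) && (y2 == - y1 - a1 * x1 - a3) then Infty
    else
      let l := if x1 == x2
        then (3 * x1 ^+ 2 + 2 * a2 * x1 + a4 - a1 * y1) / (2 * y1 + a1 * x1 + a3)
        else (y2 - y1) / (x2 - x1) in
      let x3 := l ^+ 2 + a1 * l - a2 - x1 - x2 in
      popp (Aff x3 (l * (x3 - x1) + y1))
  end.

Definition psub (P Q : point L) : point L := padd P (popp Q).

Definition pmul (n : nat) (P : point L) : point L := iter n (padd P) Infty.

Definition ptorsion (n : nat) (P : point L) : Prop :=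
  on_curve P /\ pmul n P = Infty.
End GroupLaw.

(** ** Absolute Galois groups *)

Record algClosure (F : fieldType) := AlgClosure {
  ac_field :> closedFieldType;
  ac_emb : {rmorphism F -> ac_field};
  ac_alg : forall x : ac_field, algebraicOver ac_emb x }.

Record absGal (F : fieldType) (Fb : algClosure F) := AbsGal {
  gal_fun :> {rmorphism Fb -> Fb};
  gal_fix : forall x : F, gal_fun (ac_emb Fb x) = ac_emb Fb x;
  gal_bij : bijective gal_fun }.

Section AbsGal.
Variables (F : fieldType) (Fb : algClosure F).

Program Definition gal_one : absGal Fb :=
  @AbsGal F Fb (idfun : {rmorphism Fb -> Fb}) _ _.
Next Obligation. by exists idfun. Qed.

Program Definition gal_mul (s t : absGal Fb) : absGal Fb :=
  @AbsGal F Fb (s \o t : {rmorphism Fb -> Fb}) _ _.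
Next Obligation. by rewrite /= !gal_fix. Qed.
Next Obligation. exact: bij_comp (gal_bij s) (gal_bij t). Qed.

Lemma gal_inv_ex (s : absGal Fb) : exists t : absGal Fb, cancel s t /\ cancel t s.
Proof.
have [g sK gK] := gal_bij s.
have gB : zmod_morphism g by move=> x y; apply: (can_inj sK); rewrite rmorphB !gK.
have gM : monoid_morphism g.
  by split=> [|x y]; apply: (can_inj sK); rewrite ?rmorphM ?rmorph1 !gK.
pose gA := GRing.isZmodMorphism.Build _ _ g gB.
pose gR := GRing.isMonoidMorphism.Build _ _ g gM.
pose h : {rmorphism Fb -> Fb} := HB.pack g gA gR.
have hfix x : h (ac_emb Fb x) = ac_emb Fb x.
  by apply: (can_inj sK); rewrite gal_fix; exact: gK.
have hbij : bijective h by exists s.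
by exists (AbsGal hfix hbij).
Qed.

Definition gal_inv (s : absGal Fb) : absGal Fb := sval (cid (gal_inv_ex s)).

Definition gal_exp (s : absGal Fb) (n : nat) : absGal Fb :=
  iter n (gal_mul s) gal_one.

(* Continuity for the Krull topology on the source and the discrete topology
   on the target. *)
Definition gal_continuous (T : Type) (c : absGal Fb -> T) : Prop :=
  forall s : absGal Fb, exists r : seq Fb, forall t : absGal Fb,
    {in r, s =1 t} -> c t = c s.
End AbsGal.

Section Restriction.
Variables (K : fieldType) (Kb : algClosure K) (F : fieldType) (Fb : algClosure F).
Variables (j : {rmorphism K -> F}) (i : {rmorphism Kb -> Fb}).
Hypothesis ij : forall x, i (ac_emb Kb x) = ac_emb Fb (j x).

Lemma gal_stable (t : absGal Fb) (x : Kb) : exists y : Kb, i y = t (i x).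
Proof.
have [q q0 /rootP qx] := ac_alg x.
have [r Er] := closed_field_poly_normal (map_poly (ac_emb Kb) q).
have : (map_poly i (map_poly (ac_emb Kb) q)).[t (i x)] = 0.
  have : t (i (map_poly (ac_emb Kb) q).[x]) = 0 by rewrite qx !rmorph0.
  rewrite -!horner_map; congr (_.[_] = _).
  rewrite -!map_poly_comp; apply: eq_map_poly => a /=.
  by rewrite ij gal_fix.
rewrite Er map_polyZ hornerZ => /eqP; rewrite mulf_eq0 fmorph_eq0 lead_coef_eq0.
rewrite map_poly_eq0 (negbTE q0) /= rmorph_prod horner_prod.
rewrite prodf_seq_eq0 => /hasP[a _]; rewrite /= rmorphB /= map_polyX map_polyC.
by rewrite !hornerE subr_eq0 => /eqP ->; exists a.
Qed.

Lemma gal_res_ex (t : absGal Fb) :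
  exists s : absGal Kb, forall x, i (s x) = t (i x).
Proof.
have [t' [tK t'K]] := gal_inv_ex t.
pose g x := sval (cid (gal_stable t x)).
pose g' x := sval (cid (gal_stable t' x)).
have gE x : i (g x) = t (i x) by rewrite /g; case: cid.
have g'E x : i (g' x) = t' (i x) by rewrite /g'; case: cid.
have ii : injective i := fmorph_inj i.
have gB : zmod_morphism g by move=> x y; apply: ii; rewrite rmorphB !gE !rmorphB.
have gM : monoid_morphism g.
  by split=> [|x y]; apply: ii; rewrite ?rmorphM ?rmorph1 !gE ?rmorphM ?rmorph1.
pose gA := GRing.isZmodMorphism.Build _ _ g gB.
pose gR := GRing.isMonoidMorphism.Build _ _ g gM.
pose h : {rmorphism Kb -> Kb} := HB.pack g gA gR.
have hfix x : h (ac_emb Kb x) = ac_emb Kb x.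
  by apply: ii; rewrite gE ij gal_fix.
have hbij : bijective h.
  by exists g' => x; apply: ii; rewrite ?gE ?g'E ?gE ?tK ?t'K.
by exists (AbsGal hfix hbij).
Qed.

Definition gal_res (t : absGal Fb) : absGal Kb := sval (cid (gal_res_ex t)).
End Restriction.

(** ** The group H^1(F, E[p]) *)

Section Cohomology.
Variables (F : fieldType) (Fb : algClosure F) (p : nat) (E : weierstrass F).
Let W := map_weierstrass (ac_emb Fb) E.
Let cochain := absGal Fb -> point Fb.

Definition cocycle (c : cochain) : Prop :=
  [/\ forall s, ptorsion W p (c s),
      forall s t, c (gal_mul s t) = padd W (c s) (map_point s (c t))
    & gal_continuous c].

Definition cohomologous (c d : cochain) : Prop :=
  exists2 T, ptorsion W p T &
    forall s, d s = padd W (c s) (psub W (map_point s T) T).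

Definition lincomb (n : nat) (a : 'I_n -> 'F_p) (e : 'I_n -> cochain) : cochain :=
  fun s => \big[padd W/Infty]_(k < n) pmul W (a k) (e k s).

(* A subspace of H^1(F, E[p]) is given by the set S of all cocycles whose class
   lies in it; e is then a basis of that subspace. *)
Definition has_dim (S : cochain -> Prop) (n : nat) : Prop :=
  exists2 e : 'I_n -> cochain, (forall k, S (e k)) &
    forall c, S c -> exists! a : {ffun 'I_n -> 'F_p}, cohomologous (lincomb a e) c.

(** ** The local conditions *)

Definition on_E_rat (P : point Fb) : Prop :=
  on_curve W P /\ forall s : absGal Fb, map_point s P = P.

Definition kummer (d : cochain) : Prop :=
  exists Q R, [/\ on_E_rat Q, on_curve W R, pmul W p R = Q
                & forall s, d s = psub W (map_point s R) R].

Section Twist.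
Variables (M : fieldType) (psi : absGal Fb -> M).

(* For psi <> 1, G(L/F) = G_F / ker psi, and sum_g g (x) P_g in
   Z[G(L/F)] (x) E(Fb) = (Res^L_F E)(Fb) is encoded by the function
   s |-> P_(s ker psi).  If psi g <> 1, the powers g^k, k < p, represent
   G(L/F). *)
Definition on_twist (f : cochain) : Prop :=
  [/\ forall s, on_curve W (f s),
      forall s t, psi s = psi t -> f s = f t
    & forall g, psi g <> 1 ->
        \big[padd W/Infty]_(k < p) f (gal_exp g k) = Infty].

(* s (sum_g g (x) P_g) = sum_g s g (x) s P_g *)
Definition twist_act (s : absGal Fb) (f : cochain) : cochain :=
  fun t => map_point s (f (gal_mul (gal_inv s) t)).

Definition on_twist_rat (f : cochain) : Prop :=
  on_twist f /\ forall s, twist_act s f =1 f.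

(* zeta = psi g acts on I_L (x) E as the element g of Z[G(L/F)]; when
   psi g <> 1, the element zeta - 1 generates the prime above p. *)
Definition twist_pi (g : absGal Fb) (f : cochain) : cochain :=
  fun t => psub W (f (gal_mul (gal_inv g) t)) (f t).

(* The p-torsion point T of E corresponds to the element sum_g g (x) T of
   E^psi[pp], i.e. to a constant function. *)
Definition twist_kummer (d : cochain) : Prop :=
  exists g Q R, [/\ psi g <> 1, on_twist_rat Q, on_twist R, twist_pi g R =1 Q
    & forall s t, psub W (twist_act s R t) (R t) = d s].

Definition gamma (c : cochain) : Prop :=
  cocycle c /\
  exists2 d, cohomologous d c &
    ((forall s, psi s = 1) /\ kummer d) \/
    ((exists s, psi s <> 1) /\ twist_kummer d).
End Twist.
End Cohomology.

(** ** Places and completions *)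

Record absVal (R : realType) (F : fieldType) := AbsVal {
  av_fun :> F -> R;
  av_ge0 : forall x, 0 <= av_fun x;
  av_eq0 : forall x, av_fun x = 0 <-> x = 0;
  av_mul : forall x y, av_fun (x * y) = av_fun x * av_fun y;
  av_add : forall x y, av_fun (x + y) <= av_fun x + av_fun y }.

(* Equivalent absolute values, which define the same place, are not
   identified; they have the same completions as fields. *)
Record place (R : realType) (K : fieldType) := Place {
  pl_abs :> absVal R K;
  pl_nontrivial : exists x, x <> 0 /\ pl_abs x <> 1 }.

Record completion (R : realType) (K : fieldType) (v : place R K) := Completion {
  co_field :> fieldType;
  co_abs : absVal R co_field;
  co_emb : {rmorphism K -> co_field};
  co_absE : forall x, co_abs (co_emb x) = v x;
  co_dense : forall (x : co_field) (e : R), 0 < e ->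
    exists a, co_abs (x - co_emb a) < e;
  co_complete : forall u : nat -> co_field,
    (forall e : R, 0 < e -> exists N, forall m n,
       (N <= m)%N -> (N <= n)%N -> co_abs (u m - u n) < e) ->
    exists l, forall e : R, 0 < e -> exists N, forall n,
       (N <= n)%N -> co_abs (u n - l) < e }.

(* A choice of algebraic closure of K_v and of an embedding of Kb in it. *)
Record localData (R : realType) (K : fieldType) (Kb : algClosure K) := LocalData {
  ld_place : place R K;
  ld_field : completion ld_place;
  ld_bar : algClosure ld_field;
  ld_emb : {rmorphism Kb -> ld_bar};
  ld_compat : forall x, ld_emb (ac_emb Kb x) = ac_emb ld_bar (co_emb ld_field x) }.

(** ** Selmer groups *)

Section Selmer.
Variables (R : realType) (K : fieldType) (Kb : algClosure K) (p : nat).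

Record character := Character {
  ch_fun :> absGal Kb -> Kb;
  ch_mu : forall s, ch_fun s ^+ p = 1;
  ch_mul : forall s t, ch_fun (gal_mul s t) = ch_fun s * ch_fun t;
  ch_cont : gal_continuous ch_fun }.

Definition ld_res (D : localData R Kb) : absGal (ld_bar D) -> absGal Kb :=
  gal_res (@ld_compat R K Kb D).

Definition ld_loc (D : localData R Kb) (c : absGal Kb -> point Kb) :
    absGal (ld_bar D) -> point (ld_bar D) :=
  fun t => map_point (ld_emb D) (c (ld_res t)).

(* The condition at a place does not depend on the choices in [localData]. *)
Definition selmer (E : ellipticCurve K) (chi : character)
    (c : absGal Kb -> point Kb) : Prop :=
  cocycle p E c /\
  forall D : localData R Kb,
    gamma p (map_weierstrass (co_emb (ld_field D)) E)
      (fun t => chi (@ld_res D t)) (ld_loc c).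

Definition near_companions (E1 E2 : ellipticCurve K) : Prop :=
  exists C : int, forall chi : character, exists n1 n2 : nat,
    [/\ has_dim p E1 (selmer E1 chi) n1, has_dim p E2 (selmer E2 chi) n2
      & `|n2%:Z - n1%:Z| < C].

Definition torsion_isomorphic (E1 E2 : ellipticCurve K) : Prop :=
  let W1 := map_weierstrass (ac_emb Kb) E1 in
  let W2 := map_weierstrass (ac_emb Kb) E2 in
  exists phi : point Kb -> point Kb,
  [/\ forall P, ptorsion W1 p P -> ptorsion W2 p (phi P),
      forall P Q, ptorsion W1 p P -> ptorsion W1 p Q -> phi P = phi Q -> P = Q,
      forall Q, ptorsion W2 p Q -> exists2 P, ptorsion W1 p P & phi P = Q,
      forall P Q, ptorsion W1 p P -> ptorsion W1 p Q ->
        phi (padd W1 P Q) = padd W2 (phi P) (phi Q)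
    & forall (s : absGal Kb) P, ptorsion W1 p P ->
        phi (map_point s P) = map_point s (phi P)].
End Selmer.

(* Main.v *)
From HB Require Import structures.
From mathcomp Require Import all_boot all_order all_algebra all_field.
From mathcomp Require Import boolp classical_sets functions filter reals ring lra zify.
From mathcomp Require Import complex cyclic.
Require Import Defs.

(** A cocycle with values in the [p]-torsion is Selmer for the twist by [chi]
if it satisfies a local condition at every place.  For one integer [N], at
every place away from [N] this condition depends only on the Galois module
[E[p]] and on [chi]: if [chi] is unramified it says that the class is
unramified, and if [chi] is ramified it says that the class dies in the
extension cut out by [chi].  A torsion isomorphism preserves it.  At the places
above [N] one colours cocycles by finitely many colours, independently of
[chi], in such a way that two cocycles of the same colour differ by a class that
is locally trivial there.  Hence a difference of two equally coloured Selmer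
classes of [E1] is carried to a Selmer class of [E2], so [|Sel(E1, chi)| <= c
|Sel(E2, chi)|] with [c] the number of colours. The Selmer groups are finite by
Kummer theory over the field of [p]-torsion and a pigeonhole
argument of Minkowski-Hurwitz type. *)

Set Implicit Arguments.
Unset Strict Implicit.
Unset Printing Implicit Defensive.

Import Order.TTheory GRing.Theory Num.Theory.
Local Open Scope ring_scope.

(** * The group law *)

(** Two obstacles shape the argument. At a good place the twisted condition must be made independent
    of the curve. For unramified [chi] this is a count showing that Frobenius minus one, or the norm
    of Frobenius, reaches every [p]-torsion point. For ramified [chi] an inertia element [g] with
    [chi g] nontrivial acts trivially on reductions, so its norm reduces to multiplication by [p],
    while the norm of the cocycle along [g] vanishes because [p] is odd. Globally, finiteness is
    phrased with valuation rings instead of ideals. On the stabiliser of a generator [th] of a large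
    Galois field a cocycle becomes a family of Kummer characters. A Hurwitz constant [t], in the
    role of the class number, lets their generators be integers with controlled inverses, and a
    lattice pigeonhole plays the role of the unit theorem. Since Selmer conditions speak only of
    completions with embedded closures, integrality at all of these must imply algebraic
    integrality: such data are built around any valuation ring, with an ultraproduct as common field
    for the completion and the closure of [K]. *)

Lemma expr1_neq0 (F : fieldType) (x : F) p : (0 < p)%N -> x ^+ p = 1 -> x != 0.
Proof. by move=> p0; apply: contra_eq_neq => ->; rewrite expr0n gtn_eqF // eq_sym oner_eq0. Qed.

Lemma perm_map_stable (T : eqType) (s : T -> T) o : uniq o -> injective s -> {subset [seq s y | y <- o] <= o} ->
 perm_eq o [seq s y | y <- o].
Proof.
move=> uo inj sub; have um : uniq [seq s y | y <- o] by rewrite map_inj_uniq.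
by rewrite perm_sym; apply: uniq_perm => //; apply: (uniq_min_size um sub _).2; rewrite size_map.
Qed.

Lemma exists_notin (L : fieldType) (xs : seq L) : injective (fun n => n%:R : L) -> exists x : L, x \notin xs.
Proof.
move=> inj; apply/not_existsP => h.
have : (size [seq n%:R : L | n <- iota 0 (size xs).+1] <= size xs)%N.
 apply: uniq_leq_size; first by rewrite map_inj_uniq ?iota_uniq.
 by move=> y _; apply/negP => /negP; exact: h.
by rewrite size_map size_iota ltnn.
Qed.

Arguments padd : simpl never.
Arguments popp : simpl never.
Arguments on_curve : simpl never.

(** * Associativity on [y^2 = f(x)]: general position, then translation *)

Section ShortGroupLaw.
Variables (L : closedFieldType) (a2 a4 a6 : L).
Hypothesis char0 : forall n, n.+1%:R != 0 :> L.
Let W := Weierstrass 0 a2 0 a4 a6.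
Let f x := x ^+ 3 + a2 * x ^+ 2 + a4 * x + a6.
Let f' x := 3 * x ^+ 2 + 2 * a2 * x + a4.
Hypothesis nonsing : forall x, f x = 0 -> f' x != 0.

Local Notation add := (padd W).
Local Notation opp := (popp W).
Local Notation onc := (on_curve W).

Let two0 : 2 != 0 :> L. Proof. exact: char0 1. Qed.

Lemma short_on_curveE x y : onc (Aff x y) = (y ^+ 2 == f x).
Proof. by rewrite /on_curve /= !mul0r !addr0. Qed.

Lemma short_oppE x y : opp (Aff x y) = Aff x (- y).
Proof. by rewrite /popp /= mul0r !subr0. Qed.

Lemma short_chordE x1 y1 x2 y2 : x1 != x2 ->
 add (Aff x1 y1) (Aff x2 y2) =
 let l := (y2 - y1) / (x2 - x1) in let x3 := l ^+ 2 - a2 - x1 - x2 in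
 Aff x3 (- (l * (x3 - x1) + y1)).
Proof.
by move=> /negbTE n12; rewrite /padd n12 /= !mul0r !addr0 /popp /= !mul0r !subr0.
Qed.

Lemma short_tangentE x1 y1 : y1 != 0 ->
 add (Aff x1 y1) (Aff x1 y1) =
 let l := f' x1 / (2 * y1) in let x3 := l ^+ 2 - a2 - x1 - x1 in
 Aff x3 (- (l * (x3 - x1) + y1)).
Proof.
move=> y0; rewrite /padd eqxx /= !mul0r !subr0 !addr0.
have -> : (y1 == - y1) = false by apply/negbTE; rewrite -subr_eq0 opprK -mulr2n -mulr_natl mulf_neq0.
by rewrite /popp /= !mul0r !subr0.
Qed.

Lemma short_addN x y : add (Aff x y) (Aff x (- y)) = Infty.
Proof. by rewrite /padd !eqxx /= mul0r !subr0 eqxx. Qed.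

Lemma short_same_x x y y' : onc (Aff x y) -> onc (Aff x y') -> y' = y \/ y' = - y.
Proof.
rewrite !short_on_curveE => /eqP <- /eqP/eqP; rewrite eqf_sqr.
by case/orP=> /eqP; [left|right].
Qed.

Lemma short_oppK P : opp (opp P) = P.
Proof. by case: P => [|x y] //; rewrite !short_oppE opprK. Qed.

Lemma short_onc_opp P : onc P -> onc (opp P).
Proof. by case: P => [|x y] //; rewrite short_oppE !short_on_curveE sqrrN. Qed.

Lemma short_addNr P : onc P -> add P (opp P) = Infty.
Proof. by case: P => [|x y] // _; rewrite short_oppE short_addN. Qed.

Lemma short_addC P Q : onc P -> onc Q -> add P Q = add Q P.
Proof.
case: P Q => [|x1 y1] [|x2 y2] // h1 h2.
have [e|n12] := eqVneq x1 x2; last first.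
 rewrite !short_chordE //= 1?eq_sym //.
 have d : x2 - x1 != 0 by rewrite subr_eq0 eq_sym.
 have d' : x1 - x2 != 0 by rewrite subr_eq0.
 by congr Aff; field; rewrite d d'.
subst x2; case: (short_same_x h1 h2) => -> //.
by rewrite short_addN -{2}[y1]opprK short_addN.
Qed.

Lemma short_add0 P : add P Infty = P. Proof. by case: P. Qed.

Lemma short_onc_add P Q : onc P -> onc Q -> onc (add P Q).
Proof.
case: P Q => [|x1 y1] [|x2 y2] // h1 h2.
have [e|n12] := eqVneq x1 x2.
 subst x2; case: (short_same_x h1 h2) => e; last by rewrite e short_addN.
 have [y0|y0] := eqVneq y1 0; first by rewrite e y0 -{2}oppr0 short_addN.
 rewrite e short_tangentE //=; set l := _ / _; set x3 := l ^+ 2 - a2 - x1 - x1.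
 have hl : f' x1 = 2 * y1 * l by rewrite /l mulrC divfK // mulf_neq0.
 move: h1; rewrite !short_on_curveE -![_ == f _]subr_eq0 => /eqP h1.
 apply/eqP; transitivity ((y1 ^+ 2 - f x1) - (x3 - x1) * (f' x1 - 2 * y1 * l)); last first.
  by rewrite h1 hl subrr mulr0 subr0.
 by rewrite /x3 /f /f'; ring.
rewrite short_chordE //=; set l := _ / _; set x3 := _ - x2.
have d : x2 - x1 != 0 by rewrite subr_eq0 eq_sym.
have hl : y2 = l * (x2 - x1) + y1 by rewrite /l mulfVK // subrK.
move: h1 h2; rewrite !short_on_curveE -![_ == f _]subr_eq0 => /eqP h1 /eqP h2.
suff : (x2 - x1) * ((- (l * (x3 - x1) + y1)) ^+ 2 - f x3) == 0.
 by rewrite mulf_eq0 (negbTE d).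
apply/eqP; transitivity ((x2 - x3) * (y1 ^+ 2 - f x1) + (x3 - x1) * (y2 ^+ 2 - f x2)).
 by rewrite hl /x3 /f; ring.
by rewrite h1 h2 !mulr0 addr0.
Qed.

Definition parab al be ga x : L := al * x ^+ 2 + be * x + ga.
(** The equation [parab^2 = f] is a quartic with leading coefficient [al^2]. By Vieta, when [x1],
    [x2], [x3] are three of its roots, [parab_k] is [al^2] times the fourth. *)
Definition parab_k al be x1 x2 x3 : L :=
 1 - 2 * al * be - al ^+ 2 * (x1 + x2 + x3).
(** Vieta for the coefficient of [x^2] in the same quartic. The relation makes sense with repeated
    abscissas, so it serves chords and tangents alike. *)
Definition parab_through al be ga x1 x2 x3 :=
 a2 = be ^+ 2 + 2 * al * ga - parab_k al be x1 x2 x3 * (x1 + x2 + x3)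
    - al ^+ 2 * (x1 * x2 + x2 * x3 + x1 * x3).
Definition parab_sum al be ga x1 x2 x3 :=
 let x4 := parab_k al be x1 x2 x3 / al ^+ 2 in Aff x4 (- parab al be ga x4).
(** The secant of the parabola between [x1] and [x2] has slope [al (x1 + x2) + be], which for
    [x1 = x2] is the slope of its tangent; hence one formula for chords and doublings. *)
Definition line_sum al be ga x1 x2 :=
 let l := al * (x1 + x2) + be in let x3 := l ^+ 2 - a2 - x1 - x2 in
 Aff x3 (- (l * (x3 - x1) + parab al be ga x1)).
Definition line_x al be x1 x2 := (al * (x1 + x2) + be) ^+ 2 - a2 - x1 - x2.

(* The parabola through A, B, S meets the curve in a fourth point -(A + B + S),
  which is visibly symmetric in A, B, S. *)
Lemma line_sum_add al be ga x1 x2 x3 : parab_through al be ga x1 x2 x3 ->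
 line_x al be x1 x2 != x3 ->
 add (line_sum al be ga x1 x2) (Aff x3 (parab al be ga x3)) =
 parab_sum al be ga x1 x2 x3.
Proof.
move=> ha2 nx; rewrite short_chordE //=.
have e1 : x3 - ((al * (x1 + x2) + be) ^+ 2 - a2 - x1 - x2) =
  al * (2 * parab al be ga x3 - al * (x3 - x1) * (x3 - x2)).
 by rewrite ha2 /parab_k /parab; ring.
have : al * (2 * parab al be ga x3 - al * (x3 - x1) * (x3 - x2)) != 0.
 by rewrite -e1 subr_eq0 eq_sym.
rewrite e1 mulf_eq0 negb_or => /andP[al0 g0].
have d : 2 * parab al be ga x3 - al * (x3 - x1) * (x3 - x2) != 0 by [].
rewrite /parab_sum /=.
set m := (parab al be ga x3 - _) / _.
have em : m = al * (parab_k al be x1 x2 x3 / al ^+ 2 + x3) + be.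
 apply: (mulIf (mulf_neq0 al0 d)); rewrite /m mulfVK ?mulf_neq0 //.
 rewrite ha2 /parab_k /parab; field; exact: al0.
have ex : m ^+ 2 - a2 - ((al * (x1 + x2) + be) ^+ 2 - a2 - x1 - x2) - x3 =
  parab_k al be x1 x2 x3 / al ^+ 2.
 by rewrite em ha2 /parab_k /parab; field; exact: al0.
rewrite ex; congr Aff; rewrite em ha2 /parab_k /parab; field; exact: al0.
Qed.

Lemma chord_line_sum al be ga x1 x2 : x1 != x2 ->
 add (Aff x1 (parab al be ga x1)) (Aff x2 (parab al be ga x2)) =
 line_sum al be ga x1 x2.
Proof.
move=> n12; rewrite short_chordE //= /line_sum /=.
suff -> : (parab al be ga x2 - parab al be ga x1) / (x2 - x1) = al * (x1 + x2) + be by [].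
by rewrite /parab; field; rewrite subr_eq0 eq_sym.
Qed.

Lemma tangent_line_sum al be ga x1 : parab al be ga x1 != 0 ->
 f' x1 = 2 * parab al be ga x1 * (2 * al * x1 + be) ->
 add (Aff x1 (parab al be ga x1)) (Aff x1 (parab al be ga x1)) =
 line_sum al be ga x1 x1.
Proof.
move=> q0 e; rewrite short_tangentE //= /line_sum /=.
suff -> : f' x1 / (2 * parab al be ga x1) = al * (x1 + x1) + be by [].
by rewrite e mulrAC divff ?mulf_neq0 // mul1r; ring.
Qed.

(** Newton interpolation gives the coefficients. Up to sign, [parab_through] is then the second
    divided difference of [parab^2 - f], which vanishes at the three abscissas. *)
Lemma parab_exists x1 y1 x2 y2 x3 y3 :
 onc (Aff x1 y1) -> onc (Aff x2 y2) -> onc (Aff x3 y3) ->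
 x1 != x2 -> x2 != x3 -> x1 != x3 ->
 exists al be ga, [/\ y1 = parab al be ga x1, y2 = parab al be ga x2,
  y3 = parab al be ga x3 & parab_through al be ga x1 x2 x3].
Proof.
move=> h1 h2 h3 n12 n23 n13.
have d12 : x2 - x1 != 0 by rewrite subr_eq0 eq_sym.
have d13 : x3 - x1 != 0 by rewrite subr_eq0 eq_sym.
have d23 : x3 - x2 != 0 by rewrite subr_eq0 eq_sym.
pose u := (y2 - y1) / (x2 - x1); pose al := ((y3 - y2) / (x3 - x2) - u) / (x3 - x1).
pose be := u - al * (x1 + x2); pose ga := y1 - al * x1 ^+ 2 - be * x1.
have e1 : y1 = parab al be ga x1 by rewrite /parab /ga; ring.
have e2 : y2 = parab al be ga x2.
 by rewrite /parab /ga /be /u; field.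
have e3 : y3 = parab al be ga x3.
 by rewrite /parab /ga /be /al /u; field; rewrite d12 d13.
exists al, be, ga; split=> //.
move: h1 h2 h3; rewrite !short_on_curveE -![_ == f _]subr_eq0.
rewrite {}e1 {}e2 {}e3; clearbody al be ga => /eqP h1 /eqP h2 /eqP h3.
apply/eqP; rewrite -subr_eq0.
suff : (x2 - x1) * (x3 - x1) * (x3 - x2) *
 (a2 - (be ^+ 2 + 2 * al * ga - parab_k al be x1 x2 x3 * (x1 + x2 + x3)
    - al ^+ 2 * (x1 * x2 + x2 * x3 + x1 * x3))) == 0.
 by rewrite !mulf_eq0 (negbTE d12) (negbTE d13) (negbTE d23).
apply/eqP; transitivity (- ((x3 - x2) * (parab al be ga x1 ^+ 2 - f x1)
  - (x3 - x1) * (parab al be ga x2 ^+ 2 - f x2)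
  + (x2 - x1) * (parab al be ga x3 ^+ 2 - f x3))); first by rewrite /f /parab_k /parab; ring.
by rewrite h1 h2 h3 !mulr0 subr0 addr0 oppr0.
Qed.

Lemma parab_tangent_exists x1 y1 x3 y3 :
 onc (Aff x1 y1) -> onc (Aff x3 y3) -> x1 != x3 -> y1 != 0 ->
 exists al be ga, [/\ y1 = parab al be ga x1, y3 = parab al be ga x3,
  f' x1 = 2 * y1 * (2 * al * x1 + be) & parab_through al be ga x1 x1 x3].
Proof.
move=> h1 h3 n13 y0.
have d13 : x3 - x1 != 0 by rewrite subr_eq0 eq_sym.
pose l := f' x1 / (2 * y1).
pose al := ((y3 - y1) / (x3 - x1) - l) / (x3 - x1).
pose be := l - 2 * al * x1; pose ga := y1 - al * x1 ^+ 2 - be * x1.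
have e1 : y1 = parab al be ga x1 by rewrite /parab /ga; ring.
have e3 : y3 = parab al be ga x3.
 by rewrite /parab /ga /be /al; field.
have el : f' x1 = 2 * y1 * (2 * al * x1 + be).
 by rewrite /be addrC subrK /l mulrC divfK // mulf_neq0.
exists al, be, ga; split=> //.
move: h1 h3; rewrite !short_on_curveE -![_ == f _]subr_eq0.
move/eqP: el; rewrite -subr_eq0.
rewrite {}e1 {}e3; clearbody al be ga => /eqP el /eqP h1 /eqP h3.
apply/eqP; rewrite -subr_eq0.
suff : (x3 - x1) ^+ 2 *
 (a2 - (be ^+ 2 + 2 * al * ga - parab_k al be x1 x1 x3 * (x1 + x1 + x3)
    - al ^+ 2 * (x1 * x1 + x1 * x3 + x1 * x3))) == 0.
 by rewrite !mulf_eq0 (negbTE d13).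
apply/eqP; transitivity ((parab al be ga x1 ^+ 2 - f x1)
  - (parab al be ga x3 ^+ 2 - f x3)
  - (x3 - x1) * (f' x1 - 2 * parab al be ga x1 * (2 * al * x1 + be))).
 by rewrite /f /f' /parab_k /parab; ring.
by rewrite h1 h3 el mulr0 !subr0.
Qed.

Lemma parab_sumC al be ga x1 x2 x3 :
 parab_sum al be ga x1 x2 x3 = parab_sum al be ga x2 x3 x1.
Proof. by rewrite /parab_sum /parab_k (addrC (x1 + x2)) addrA (addrC _ x2) addrA addrAC -addrA (addrC x1). Qed.

Lemma short_cancel A S : onc A -> onc S -> S <> A -> S <> opp A ->
 add A S <> A -> add A S <> opp A -> add (opp A) (add A S) = S.
Proof.
case: A S => [|x1 y1] [|x2 y2] //; try by move=> _ _ _ _ [].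
move=> h1 h2 n1 n2.
have [e|n12] := eqVneq x1 x2.
 subst x2; case: (short_same_x h1 h2) => e; subst y2; first by case: n1.
 by case: n2; rewrite short_oppE.
have hC := short_onc_add h1 h2.
rewrite !short_oppE; move: hC; rewrite short_chordE //=.
set l := _ / _; set x3 := _ - x2; set y3 := - _ => hC n3 n4.
have n13 : x1 != x3.
 apply/eqP=> e; rewrite -e in hC n3 n4.
 by case: (short_same_x h1 hC) => e'; rewrite e' in n3 n4; [case: n3|case: n4].
have d : x3 - x1 != 0 by rewrite subr_eq0 eq_sym.
have d2 : x2 - x1 != 0 by rewrite subr_eq0 eq_sym.
rewrite short_chordE //=.
have -> : (y3 - - y1) / (x3 - x1) = - l by rewrite /y3; field.
have e2 : (- l) ^+ 2 - a2 - x1 - x3 = x2 by rewrite /x3; ring.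
rewrite e2; congr Aff; rewrite /l; field; exact: d2.
Qed.

(** As long as associativity is unknown, this stands in for subtraction. The entry [opp (add A A)]
    is the case of a chord tangent at [A], where [T] has the abscissa of [A]. *)
Lemma short_finite_fibre A S T : onc A -> onc S -> add A S = T ->
 List.In S [:: Infty; A; opp A; add (opp A) T; opp (add A A)].
Proof.
case: A S => [|x1 y1] [|x2 y2]; try by move=> *; left.
 by move=> _ h2 <-; do 3!right; left.
move=> h1 h2 eT.
have [e|n12] := eqVneq x1 x2.
 subst x2; case: (short_same_x h1 h2) => ->; [by right; left|by do 2!right; left; rewrite short_oppE].
have [e3|n3] := pselect (T = Aff x1 y1 \/ T = opp (Aff x1 y1)); last first.
 do 3!right; left; rewrite -eT short_cancel //.
 - by case=> e _; rewrite e eqxx in n12.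
 - by rewrite short_oppE; case=> e _; rewrite e eqxx in n12.
 - by rewrite eT => e; apply: n3; left.
 - by rewrite eT => e; apply: n3; right.
do 4!right; left; move: eT; rewrite short_chordE //=.
set l := _ / _ => eT.
have d2 : x2 - x1 != 0 by rewrite subr_eq0 eq_sym.
have hl : y2 = l * (x2 - x1) + y1 by rewrite /l mulfVK // subrK.
have ex : l ^+ 2 - a2 - x1 - x2 = x1.
 by case: e3 eT => -> ; rewrite ?short_oppE => -[].
have ha2 : a2 = l ^+ 2 - x1 - x2 - x1 by rewrite -[X in _ - X]ex; ring.
have ef : f' x1 = 2 * y1 * l.
 move: h1 h2; rewrite !short_on_curveE -![_ == f _]subr_eq0 => /eqP h1 /eqP h2.
 apply/eqP; rewrite -subr_eq0.
 suff : (x2 - x1) * (f' x1 - 2 * y1 * l) == 0 by rewrite mulf_eq0 (negbTE d2).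
 apply/eqP; transitivity ((y1 ^+ 2 - f x1) - (y2 ^+ 2 - f x2)).
  by rewrite hl /f /f' ha2; ring.
 by rewrite h1 h2 subrr.
have y0 : y1 != 0.
 apply/eqP=> y0; have fx : f x1 = 0.
  by move: h1; rewrite short_on_curveE y0 expr0n eq_sym => /eqP.
 by move: (nonsing fx); rewrite ef y0 mulr0 mul0r eqxx.
rewrite short_tangentE // ef /= mulrC mulKf ?mulf_neq0 //.
have e2 : l ^+ 2 - a2 - x1 - x1 = x2 by rewrite ha2; ring.
by rewrite e2 short_oppE opprK -hl.
Qed.

Lemma natr_inj0 : injective (fun n : nat => n%:R : L).
Proof.
suff key m n : m%:R = n%:R :> L -> (m <= n)%N.
 by move=> m n e; apply/eqP; rewrite eqn_leq !key.
move=> e; rewrite leqNgt; apply/negP => lt.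
have : (m - n).-1.+1%:R != 0 :> L by exact: char0.
by rewrite prednK ?subn_gt0 // natrB ?(ltnW lt) // e subrr eqxx.
Qed.

Lemma short_avoid (xs : seq L) : exists x y, onc (Aff x y) /\ x \notin xs.
Proof.
have [x hx] : exists x : L, x \notin xs by apply: exists_notin; exact: natr_inj0.
have [y hy] := @solve_monicpoly L 2 (fun k => if k == 0%N then f x else 0) isT.
move: hy; rewrite !big_ord_recl big_ord0 /= expr0 mulr1 mul0r !addr0 => hy.
by exists x, y; rewrite short_on_curveE hy.
Qed.

Definition px (P : point L) : L := if P is Aff x _ then x else 0.

(** In general position both sides are, up to sign, the fourth intersection with the parabola
    through [A], [B], [S]. If [A = B] the parabola is taken tangent at [A]; if [B = opp A] the claim
    is [short_cancel]. *)
Lemma short_assoc_gen A B S : onc A -> onc B -> onc S ->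
 (forall P, List.In P [:: A; B; add A B] -> S <> P /\ S <> opp P) ->
 add B S <> A -> add B S <> opp A ->
 add (add A B) S = add A (add B S).
Proof.
case: A => [|x1 y1] //; case: B => [|x2 y2] //; case: S => [|x3 y3].
 by rewrite !short_add0.
move=> h1 h2 h3 gen g1 g2.
have nx x y : onc (Aff x y) -> Aff x3 y3 <> Aff x y /\ Aff x3 y3 <> opp (Aff x y) ->
  x != x3.
 move=> h [n n']; apply/eqP=> e; rewrite e in h n n'.
 by case: (short_same_x h h3) => e'; rewrite e' ?short_oppE in n n'; [case: n|case: n'].
have n13 : x1 != x3 by apply: (nx _ _ h1); apply: gen; left.
have n23 : x2 != x3 by apply: (nx _ _ h2); apply: gen; right; left.
have nb x y x' y' : onc (Aff x y) -> Aff x' y' <> Aff x y -> Aff x' y' <> opp (Aff x y) ->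
  onc (Aff x' y') -> x' != x.
 move=> h n n' h'; apply/eqP=> e; rewrite e in h' n n'.
 by case: (short_same_x h h') => e'; rewrite e' ?short_oppE in n n'; [case: n|case: n'].
have hAB := short_onc_add h1 h2; have hBS := short_onc_add h2 h3.
have gAB : Aff x3 y3 <> add (Aff x1 y1) (Aff x2 y2) /\ Aff x3 y3 <> opp (add (Aff x1 y1) (Aff x2 y2)).
 by apply: gen; do 2!right; left.
have [e|n12] := eqVneq x1 x2; last first.
 have [al [be [ga [e1 e2 e3 hp]]]] := parab_exists h1 h2 h3 n12 n23 n13.
 subst y1 y2 y3; rewrite (@short_addC (Aff x1 _) (add _ _)) //.
 rewrite !chord_line_sum // in hAB hBS gAB g1 g2 *.
 rewrite line_sum_add //; last by apply: nx hAB _.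
 rewrite line_sum_add //; last by apply: nb h1 _ _ hBS.
  by rewrite parab_sumC.
 move: hp; rewrite /parab_through /parab_k => ->; ring.
subst x2; case: (short_same_x h1 h2) => e; last first.
 rewrite e short_addN /=.
 have oE : Aff x1 (- y1) = opp (Aff x1 y1) by rewrite short_oppE.
 have [n n'] := gen _ (or_introl erefl).
 rewrite e oE in g1 g2 *; rewrite -{1}[Aff x1 y1]short_oppK short_cancel ?short_oppK //.
 exact: short_onc_opp.
have [y0|y0] := eqVneq y1 0.
 have oE : Aff x1 y2 = opp (Aff x1 y1) by rewrite e short_oppE y0 oppr0.
 have [n n'] := gen _ (or_introl erefl).
 rewrite oE in g1 g2 *; rewrite -{3}[Aff x1 y1]short_oppK short_cancel ?short_oppK ?short_addNr //.
 exact: short_onc_opp.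
subst y2; have [al [be [ga [e1 e3 ef hp]]]] := parab_tangent_exists h1 h3 n13 y0.
subst y1 y3; rewrite (@short_addC (Aff x1 _) (add (Aff _ _) (Aff x3 _))) //.
rewrite tangent_line_sum // chord_line_sum // in hAB hBS gAB g1 g2 *.
rewrite line_sum_add //; last by apply: nx hAB _.
rewrite line_sum_add //; last by apply: nb h1 _ _ hBS.
 by rewrite /parab_sum /parab_k (addrAC x1 x1 x3).
move: hp; rewrite /parab_through /parab_k => ->; ring.
Qed.

(** By the tangent formula the abscissa of [S] is a root of [f'^2 - 4 f (c + 2 x)], a monic quartic
    expanded in [p], unless [S] has order two and its abscissa is a root of [q = f]. The entry 0
    covers [Infty], to which [px] assigns 0. *)
Lemma short_double_finite T : exists xs : seq L, forall S, onc S -> add S S = T ->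
 px S \in xs.
Proof.
pose c := a2 + px T.
pose p := Poly [:: a4 ^+ 2 - 4 * a6 * c; 4 * a2 * a4 - 4 * a4 * c - 8 * a6;
 4 * a2 ^+ 2 + 6 * a4 - 4 * a2 * c - 8 * a4; 4 * a2 - 4 * c; 1].
pose q := Poly [:: a6; a4; a2; 1].
have p0 : p != 0.
 by apply/eqP=> /(congr1 (fun q : {poly L} => q`_4)); rewrite coef_Poly coef0 => /eqP; rewrite /= oner_eq0.
have q0 : q != 0.
 by apply/eqP=> /(congr1 (fun q : {poly L} => q`_3)); rewrite coef_Poly coef0 => /eqP; rewrite /= oner_eq0.
have rt (g : {poly L}) : g != 0 -> exists r : seq L, forall x, g.[x] = 0 -> x \in r.
 move=> g0; have [r er] := closed_field_poly_normal g.
 exists r => x /eqP; rewrite er hornerZ mulf_eq0 lead_coef_eq0 (negbTE g0) /=.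
 by rewrite -/(root _ x) root_prod_XsubC.
have [r1 h1] := rt _ p0; have [r2 h2] := rt _ q0.
exists (0 :: r1 ++ r2) => -[|x y] hS; first by rewrite inE eqxx.
rewrite inE mem_cat /=; move: (hS); rewrite short_on_curveE => /eqP ey.
have [y0|y0] := eqVneq y 0.
 move=> _; apply/orP; right; apply/orP; right; apply: h2.
 transitivity (f x); last by rewrite -ey y0 expr0n.
 by rewrite /q horner_Poly /= /f; ring.
rewrite short_tangentE //= => eT; apply/orP; right; apply/orP; left; apply: h1.
have : 4 * y ^+ 2 * ((f' x / (2 * y)) ^+ 2 - a2 - x - x - px T) = 0 by rewrite -eT /= subrr mulr0.
have -> : 4 * y ^+ 2 * ((f' x / (2 * y)) ^+ 2 - a2 - x - x - px T) =
 f' x ^+ 2 - 4 * y ^+ 2 * (c + 2 * x).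
 by rewrite /c; field; rewrite y0 two0.
rewrite ey => <-; rewrite /p horner_Poly /= /f /f' /c; ring.
Qed.

Let fib R Q := [:: Infty; R; opp R; add (opp R) Q; opp (add R R)].
Let fibs R l := flatten [seq fib R Q | Q <- l].
Let pm l := l ++ [seq opp P | P <- l].

Let In_cat (P : point L) l1 l2 : List.In P (l1 ++ l2) <-> List.In P l1 \/ List.In P l2.
Proof. exact: List.in_app_iff. Qed.

Let InL (P : point L) l1 l2 : List.In P l1 -> List.In P (l1 ++ l2).
Proof. by rewrite In_cat; left. Qed.
Let InR (P : point L) l1 l2 : List.In P l2 -> List.In P (l1 ++ l2).
Proof. by rewrite In_cat; right. Qed.

Let fibsP R l S : onc R -> onc S -> ~ List.In S (fibs R l) -> ~ List.In (add R S) l.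
Proof.
move=> hR hS; rewrite /fibs; elim: l => // Q l IH; rewrite [flatten _]/(fib R Q ++ flatten _) => h [e|h1].
 by apply: h; rewrite (In_cat _ (fib R Q)); left; exact: (short_finite_fibre hR hS (esym e)).
by apply: IH h1 => h'; apply: h; rewrite (In_cat _ (fib R Q)); right.
Qed.

Let pmP S P l : List.In P l -> ~ List.In S (pm l) -> S <> P /\ S <> opp P.
Proof.
rewrite /pm => h n; split=> e; apply: n; rewrite In_cat e; [by left|right].
by elim: l h => //= Q l IH [->|/IH]; [left|right].
Qed.

Let pxP S l : px S \notin [seq px P | P <- l] -> ~ List.In S l.
Proof.
elim: l => [_ []|Q l IH] /=; rewrite inE negb_or => /andP[n /IH h] [e|].
 by rewrite e eqxx in n.
by [].
Qed.

(** Translate by a point [S] outside a finite bad set: moving [S] through the brackets with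
    [short_assoc_gen] gives [X + S = X' + S] for the two bracketings, and then [S] is cancelled. *)
Lemma short_addA P Q R : onc P -> onc Q -> onc R ->
 add P (add Q R) = add (add P Q) R.
Proof.
move=> hP hQ hR.
have hPQ := short_onc_add hP hQ; have hQR := short_onc_add hQ hR.
set X := add (add P Q) R; set X' := add P (add Q R).
have hX : onc X by exact: short_onc_add.
have hX' : onc X' by exact: short_onc_add.
have [d1 hd1] := short_double_finite (opp X).
have [d2 hd2] := short_double_finite (opp X').
(* Everything [S] must avoid: the points involved, up to sign, and the fibres on which [R + S],
   [Q + (R + S)] or [(Q + R) + S] would leave general position. *)
have [l el] : exists l, l = Infty :: pm [:: P; Q; R; add P Q; add Q R; X; X'] ++
 fibs R (pm [:: P; Q; add P Q] ++ fibs Q (pm [:: P])) ++ fibs (add Q R) (pm [:: P]) by eexists.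
have [x [y [hS]]] := short_avoid ([seq px P | P <- l] ++ d1 ++ d2).
set S := Aff x y in hS *; rewrite mem_cat negb_or => /andP[nl]; rewrite mem_cat negb_or => /andP[n1 n2].
have {nl}nl := @pxP S l nl; rewrite {}el in nl.
have c0 : ~ List.In S (pm [:: P; Q; R; add P Q; add Q R; X; X']).
 by move=> h; apply: nl; right; exact: InL.
have c1 := fun T h => @pmP S T _ h c0.
have c2 : ~ List.In (add R S) (pm [:: P; Q; add P Q] ++ fibs Q (pm [:: P])).
 by apply: fibsP => // h; apply: nl; right; apply: InR; exact: InL.
have c3 : ~ List.In (add R S) (pm [:: P; Q; add P Q]) by move=> h; apply: c2; exact: InL.
have c4 := fun T h => @pmP (add R S) T _ h c3.
have hRS := short_onc_add hR hS.
have c5 : ~ List.In (add Q (add R S)) (pm [:: P]).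
 by apply: fibsP => // h; apply: c2; exact: InR.
have [c6 c6'] := @pmP _ P [:: P] (or_introl erefl) c5.
have c7 : ~ List.In (add (add Q R) S) (pm [:: P]).
 by apply: fibsP => // h; apply: nl; right; apply: InR; exact: InR.
have [c8 c8'] := @pmP _ P [:: P] (or_introl erefl) c7.
have e : add X S = add X' S.
 rewrite /X short_assoc_gen //; last 3 first.
 - move=> T /= [<-|[<-|[<-|//]]]; apply: c1; [do 3!right|do 2!right|do 5!right]; by left.
 - by have [] := c4 (add P Q); [do 2!right; left|].
 - by have [] := c4 (add P Q); [do 2!right; left|].
 rewrite short_assoc_gen //.
 rewrite -(short_assoc_gen hQ hR hS); last 3 first.
 - move=> T /= [<-|[<-|[<-|//]]]; apply: c1; [do 1!right|do 2!right|do 4!right]; by left.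
 - by have [] := c4 Q; [right; left|].
 - by have [] := c4 Q; [right; left|].
 rewrite /X' (short_assoc_gen hP hQR hS) //.
 move=> T /= [<-|[<-|[<-|//]]]; apply: c1; [|do 4!right|do 6!right]; by left.
(* Cancellation of [S]: the five candidates of [short_finite_fibre] shrink to [Infty] and
   [opp S + (S + Z)]. The lists [d1] and [d2] serve to exclude [S + S = opp Z]. *)
have dbl Z : onc Z -> S <> Z -> S <> opp Z -> add S S <> opp Z ->
  Z = Infty \/ Z = add (opp S) (add S Z).
 move=> hZ s1 s2 s3.
 case: (short_finite_fibre hS hZ erefl) => [<-|[e1|[e1|[->|[e1|//]]]]]; [by left| | |by right|].
 - by case: s1.
 - by case: s2; rewrite -e1 short_oppK.
 - by case: s3; rewrite -e1 short_oppK.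
have [] : X = Infty \/ X = add (opp S) (add S X).
 have [s1 s2] : S <> X /\ S <> opp X by apply: c1; do 5!right; left.
 apply: dbl => // /(hd1 _ hS) h; by rewrite h in n1.
all: have [s1 s2] : S <> X' /\ S <> opp X' by apply: c1; do 6!right; left.
all: have [] := dbl X' hX' s1 s2 (fun h => negP n2 (hd2 _ hS h)).
- by move=> -> ->.
- rewrite !(short_addC hS) // -e => -> ->.
 by rewrite /= short_addC ?short_onc_opp // short_addNr.
- move=> eX' ->; rewrite !(short_addC hS) // e eX'.
 by rewrite /= short_addC ?short_onc_opp // short_addNr.
- by move=> -> ->; rewrite !(short_addC hS) // e.
Qed.

End ShortGroupLaw.

Lemma map_poppE (L M : fieldType) (g : {rmorphism L -> M}) (W : weierstrass L) P :
 map_point g (popp W P) = popp (map_weierstrass g W) (map_point g P).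
Proof. by case: P => // x y; rewrite /popp /= !rmorphB rmorphN rmorphM. Qed.

Lemma map_paddE (L M : fieldType) (g : {rmorphism L -> M}) (W : weierstrass L) P Q :
 map_point g (padd W P Q) = padd (map_weierstrass g W) (map_point g P) (map_point g Q).
Proof.
case: P Q => [|x1 y1] [|x2 y2] //; rewrite /padd /= !(inj_eq (fmorph_inj g)).
have -> : (g y2 == - g y1 - g (wa1 W) * g x1 - g (wa3 W)) = (y2 == - y1 - wa1 W * x1 - wa3 W).
 by rewrite -(inj_eq (fmorph_inj g)) !rmorphB rmorphN rmorphM.
case: (_ && _) => //; rewrite map_poppE; congr (popp _ _).
set l := if x1 == x2 then _ else _.
set l' := if x1 == x2 then (3 * g x1 ^+ 2 + _ + _ - _) / _ else _.
have <- : g l = l'.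
 rewrite /l /l'; case: (x1 == x2); rewrite fmorph_div /= ?rmorphB ?rmorphD /= ?rmorphM /=.
  by rewrite !rmorph_nat.
 by [].
by rewrite /= !(rmorphD, rmorphN, rmorphM).
Qed.

Lemma map_on_curve (L M : fieldType) (g : {rmorphism L -> M}) (W : weierstrass L) P :
 on_curve (map_weierstrass g W) (map_point g P) = on_curve W P.
Proof.
case: P => // x y; rewrite /on_curve /= -(inj_eq (fmorph_inj g)).
by rewrite !rmorphD !rmorphM.
Qed.

(** * Reduction to [a1 = a3 = 0] and the points as a [zmodType] *)

Section CompleteSquare.
Variables (L : fieldType) (W : weierstrass L).
Hypothesis char0 : forall n, n.+1%:R != 0 :> L.
Let a1 := wa1 W. Let a2 := wa2 W. Let a3 := wa3 W.
Let a4 := wa4 W. Let a6 := wa6 W.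

Definition sqa2 := a2 + a1 ^+ 2 / 4.
Definition sqa4 := a4 + a1 * a3 / 2.
Definition sqa6 := a6 + a3 ^+ 2 / 4.
Definition sqW := Weierstrass 0 sqa2 0 sqa4 sqa6.
Definition sqpt (P : point L) := if P is Aff x y then Aff x (y + (a1 * x + a3) / 2) else Infty.

Let two0 : 2 != 0 :> L. Proof. exact: char0 1. Qed.
Let four0 : 4 != 0 :> L. Proof. exact: char0 3. Qed.

Arguments sqpt : simpl never.

Lemma sqpt_inj : injective sqpt.
Proof. by case=> [|x y] [|x' y'] //; rewrite /sqpt => -[-> /addIr ->]. Qed.

Lemma sqpt_surj P : exists Q, sqpt Q = P.
Proof.
case: P => [|x y]; first by exists Infty.
by exists (Aff x (y - (a1 * x + a3) / 2)); rewrite /sqpt subrK.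
Qed.

Lemma sqpt_on_curve P : on_curve sqW (sqpt P) = on_curve W P.
Proof.
case: P => // x y; rewrite /on_curve /sqpt /= -/a1 -/a2 -/a3 -/a4 -/a6.
rewrite -[RHS]subr_eq0 -[LHS]subr_eq0; congr (_ == _); rewrite /sqa2 /sqa4 /sqa6; field.
by rewrite two0 four0.
Qed.

Lemma sqpt_opp P : sqpt (popp W P) = popp sqW (sqpt P).
Proof.
case: P => // x y; rewrite /popp /sqpt /= -/a1 -/a2 -/a3; congr Aff; field; exact: two0.
Qed.

Lemma sqpt_add P Q : on_curve W P -> on_curve W Q ->
 sqpt (padd W P Q) = padd sqW (sqpt P) (sqpt Q).
Proof.
case: P Q => [|x1 y1] [|x2 y2] // h1 h2.
have [e|n12] := eqVneq x1 x2; last first.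
 rewrite /padd [sqpt (Aff x1 _)]/sqpt [sqpt (Aff x2 _)]/sqpt (negbTE n12) /= sqpt_opp; congr popp; rewrite /sqpt /= -/a1 -/a2 -/a3.
 rewrite /sqa2; congr Aff; field; rewrite ?two0 ?four0 subr_eq0 eq_sym n12 //.
subst x2; rewrite /padd [sqpt (Aff x1 y1)]/sqpt [sqpt (Aff x1 y2)]/sqpt !eqxx /= -/a1 -/a2 -/a3.
have [e|ne] := eqVneq y2 _; first by rewrite e ifT //; apply/eqP; field.
rewrite ifF; last first.
 apply/negbTE; apply: contra ne => /eqP e; apply/eqP; apply: (addIr ((a1 * x1 + a3) / 2)).
 by rewrite e; field.
have e : y2 = y1.
 move: h1 h2; rewrite /on_curve -/a1 -/a2 -/a3 => /eqP <- /eqP e.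
 have /eqP : (y2 - y1) * (y2 + y1 + a1 * x1 + a3) = 0.
  by transitivity ((y2 ^+ 2 + a1 * x1 * y2 + a3 * y2) - (y1 ^+ 2 + a1 * x1 * y1 + a3 * y1)); [ring|rewrite e subrr].
 rewrite mulf_eq0 subr_eq0 => /orP[/eqP//|h].
 case/eqP: ne; move/eqP: h => h; apply/eqP; rewrite -subr_eq0 -[X in _ == X]h; apply/eqP; ring.
have d : 2 * y1 + a1 * x1 + a3 != 0.
 apply: contra ne => /eqP d; rewrite e -subr_eq0; apply/eqP; rewrite -[RHS]d; ring.
rewrite sqpt_opp; congr popp; rewrite /sqpt /= -/a1 -/a2 -/a3 -/a4.
rewrite /sqa2 /sqa4; congr Aff; field; rewrite ?two0 ?four0 mulrC addrA d //.
Qed.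

(** The cubic is [x^3 + b2/4 x^2 + b4/2 x + b6/4]. A double root [x] expresses [b4] and [b6] through
    [b2] and [x], and with [4 b8 = b2 b6 - b4^2] the discriminant then vanishes identically. *)
Lemma sq_nonsing : wdisc W != 0 -> forall x,
 x ^+ 3 + sqa2 * x ^+ 2 + sqa4 * x + sqa6 = 0 ->
 3 * x ^+ 2 + 2 * sqa2 * x + sqa4 != 0.
Proof.
move=> /eqP d x e; apply/eqP=> e'; apply: d.
have b8 : wb8 W = (wb2 W * wb6 W - wb4 W ^+ 2) / 4.
 by rewrite /wb8 /wb2 /wb6 /wb4; field.
have b2 : sqa2 = wb2 W / 4 by rewrite /sqa2 /wb2 -/a1 -/a2; field.
have b4 : sqa4 = wb4 W / 2 by rewrite /sqa4 /wb4 -/a1 -/a2 -/a3 -/a4; field.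
have b6 : sqa6 = wb6 W / 4 by rewrite /sqa6 /wb6 -/a3 -/a6; field.
rewrite b2 b4 in e'; rewrite b2 b4 b6 in e.
have eb4 : wb4 W = - 6 * x ^+ 2 - wb2 W * x.
 apply/eqP; rewrite -subr_eq0; apply/eqP; rewrite -[RHS](mulr0 2) -[X in _ = _ * X]e'; field.
 by rewrite two0 four0.
have eb6 : wb6 W = 8 * x ^+ 3 + wb2 W * x ^+ 2.
 apply/eqP; rewrite -subr_eq0; apply/eqP; rewrite -[RHS](mulr0 4) -[X in _ = _ * X]e eb4; field.
 by rewrite two0 four0.
rewrite /wdisc b8 eb4 eb6; field; exact: four0.
Qed.
End CompleteSquare.

Record goodcurve (L : closedFieldType) := GoodCurve {
 gc_eqn :> weierstrass L;
 gc_char0 : forall n, n.+1%:R != 0 :> L;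
 gc_disc : wdisc gc_eqn != 0 }.

(** Raw points form no group off the curve. Packing the membership proof makes the points of a fixed
    curve a [zmodType], so that multiples and finite sums come from the library. *)
Record ecpt (L : closedFieldType) (W : goodcurve L) := Ecpt {
 pt :> point L; pt_on : on_curve W pt }.

Section EcptZmod.
Variables (L : closedFieldType) (W : goodcurve L).
Let c0 := gc_char0 W.
Let ns := sq_nonsing c0 (gc_disc W).

HB.instance Definition _ := gen_eqMixin (ecpt W).
HB.instance Definition _ := gen_choiceMixin (ecpt W).

Lemma pt_inj : injective (@pt L W).
Proof. by case=> [P hP] [Q hQ] /= e; subst Q; rewrite (bool_irrelevance hP hQ). Qed.

Lemma ecpt_add_on (P Q : ecpt W) : on_curve W (padd W P Q).
Proof.
rewrite -(sqpt_on_curve W c0) sqpt_add ?pt_on //.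
by apply: short_onc_add; rewrite ?(sqpt_on_curve W c0) ?pt_on.
Qed.

Lemma ecpt_opp_on (P : ecpt W) : on_curve W (popp W P).
Proof.
rewrite -(sqpt_on_curve W c0) sqpt_opp //.
by apply: short_onc_opp; rewrite ?(sqpt_on_curve W c0) ?pt_on.
Qed.

Definition ecpt_add P Q := Ecpt (ecpt_add_on P Q).
Definition ecpt_opp P := Ecpt (ecpt_opp_on P).
Definition ecpt_zero := @Ecpt L W Infty isT.

Lemma ecpt_addA : associative ecpt_add.
Proof.
move=> P Q R; apply/pt_inj/(@sqpt_inj _ W); rewrite /= !sqpt_add ?pt_on ?ecpt_add_on //.
by apply: short_addA; rewrite ?(sqpt_on_curve W c0) ?pt_on.
Qed.

Lemma ecpt_addC : commutative ecpt_add.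
Proof.
move=> P Q; apply/pt_inj/(@sqpt_inj _ W); rewrite /= !sqpt_add ?pt_on //.
by apply: short_addC; rewrite ?(sqpt_on_curve W c0) ?pt_on.
Qed.

Lemma ecpt_add0 : left_id ecpt_zero ecpt_add.
Proof. by move=> P; apply/pt_inj. Qed.

Lemma ecpt_addN : left_inverse ecpt_zero ecpt_opp ecpt_add.
Proof.
move=> P; rewrite ecpt_addC; apply/pt_inj/(@sqpt_inj _ W).
rewrite /= !sqpt_add ?pt_on ?ecpt_opp_on // sqpt_opp //.
by apply: short_addNr; rewrite (sqpt_on_curve W c0) ?pt_on.
Qed.

HB.instance Definition _ := GRing.isZmodule.Build (ecpt W)
 ecpt_addA ecpt_addC ecpt_add0 ecpt_addN.

Lemma ptD (P Q : ecpt W) : pt (P + Q) = padd W P Q. Proof. by []. Qed.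
Lemma ptN (P : ecpt W) : pt (- P) = popp W P. Proof. by []. Qed.
Lemma ptB (P Q : ecpt W) : pt (P - Q) = psub W P Q. Proof. by []. Qed.
Lemma ptMn (P : ecpt W) n : pt (P *+ n) = pmul W n P.
Proof. by elim: n => [|n IH]; rewrite ?mulr0n ?mulrS ?ptD ?IH. Qed.
Lemma pt_sum n (F : 'I_n -> ecpt W) :
 pt (\sum_(k < n) F k) = \big[padd W/Infty]_(k < n) pt (F k).
Proof. by elim/big_ind2: _ => // P P' Q Q' <- <-. Qed.
End EcptZmod.

(** * Galois theory of an algebraic closure *)

Definition subring_within (T : pzRingType) (G0 : set T) (Q : T -> Prop) (H : set T) := [/\ G0 `<=` H,
 (forall u v, H u -> H v -> H (u - v)), (forall u v, H u -> H v -> H (u * v)) & forall u, H u -> Q u]%classic.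

(** The condition [Q] is elementwise, hence passes to unions of chains. Zorn is applied to the sets
    [X] whose union with [G0] is good, so that the empty chain too has an upper bound. *)
Lemma max_subring_within (T : pzRingType) (G0 : set T) Q (good := subring_within G0 Q) : good G0 ->
 exists2 H, good H & forall H', good H' -> (H `<=` H')%classic -> (H' `<=` H)%classic.
Proof.
move=> G0good; pose P (X : set T) := good (X `|` G0)%classic.
have [|X [PX Xmax]] := @Zorn_bigcup T P.
 move=> C CP tot; rewrite /P.
 have [[X0 CX0]|noX] := pselect (exists X, C X); last first.
  suff -> : (\bigcup_(X in C) X = set0)%classic by rewrite set0U; exact: G0good.
  by apply/seteqP; split=> // u [X CX]; case: noX; exists X.
 have two (u v : T) : ((\bigcup_(X in C) X `|` G0) u -> (\bigcup_(X in C) X `|` G0) v ->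
   exists2 X, C X & (X `|` G0) u /\ (X `|` G0) v)%classic.
  move=> [[X CX Xu]|gu] [[Y CY Yv]|gv].
  - by case: (tot _ _ CX CY) => h; [exists Y|exists X] => //; split; left; auto.
  - by exists X => //; split; [left|right].
  - by exists Y => //; split; [right|left].
  - by exists X0 => //; split; right.
 have up (u : T) X : C X -> ((X `|` G0) u -> (\bigcup_(X in C) X `|` G0) u)%classic.
  by move=> CX [Xu|]; [left; exists X|right].
 split; first by move=> u; right.
 - move=> u v hu hv; have [X CX [Xu Xv]] := two _ _ hu hv.
  by apply: (up _ _ CX); case: (CP _ CX) => _ + _ _; apply.
 - move=> u v hu hv; have [X CX [Xu Xv]] := two _ _ hu hv.
  by apply: (up _ _ CX); case: (CP _ CX) => _ _ + _; apply.
 - move=> u hu; have [X CX [Xu _]] := two _ _ hu hu.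
  by case: (CP _ CX) => _ _ _; apply.
exists (X `|` G0)%classic => // H' gH' sub u H'u.
have PH' : P H'.
 rewrite /P; suff -> : (H' `|` G0 = H')%classic by [].
 by case: gH' => g _ _ _; apply/seteqP; split=> [v [|/g]|v]//; left.
have [nu|nu] := pselect (X u); first by left.
case: (Xmax H') => //; rewrite properEneq; split; last by move=> v Xv; apply: sub; left.
by apply/eqP => eX; apply: nu; rewrite eX.
Qed.

Lemma gal_ext (F : fieldType) (Fb : algClosure F) (s t : absGal Fb) :
 s =1 t -> s = t.
Proof.
case: s => [[f cf] h1 h2]; case: t => [[g cg] k1 k2] e.
have {}e : f = g by apply/funext.
subst g.
have ec : cf = cg.
 clear h1 h2 k1 k2; case: cf => m1 m2; case: cg => n1 n2.
 case: m1 m2 => a1; case: n1 n2 => b1; rewrite (Prop_irrelevance a1 b1).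
 by case=> a2 [b2]; rewrite (Prop_irrelevance a2 b2).
subst cg; by rewrite (Prop_irrelevance h1 k1) (Prop_irrelevance h2 k2).
Qed.

Section Extension.
Variables (F A : fieldType) (L : closedFieldType).
Variables (e : {rmorphism F -> A}) (f : {rmorphism F -> L}).
Hypothesis algA : forall x : A, algebraicOver e x.
Variables (al : A) (be : L).
Hypothesis albe : forall q : {poly F},
 (map_poly e q).[al] = 0 -> (map_poly f q).[be] = 0.

Let T := (A * L)%type.
Let ef (x : F) : T := (e x, f x).
Let G0 : set T := fun u => exists q : {poly F}, u = ((map_poly e q).[al], (map_poly f q).[be]).
Let good (H : set T) := [/\ G0 `<=` H, (forall u v, H u -> H v -> H (u - v)),
 (forall u v, H u -> H v -> H (u * v)) & forall y, H (0, y) -> y = 0]%classic.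

Let good0 : good G0.
Proof.
split=> //.
- move=> u v [p ->] [q ->]; exists (p - q); rewrite !rmorphB !hornerD !hornerN; by [].
- by move=> u v [p ->] [q ->]; exists (p * q); rewrite !rmorphM !hornerM.
- by move=> y [q [/esym/albe -> ->]].
Qed.

Let max_good : exists2 H, good H & forall H', good H' -> (H `<=` H')%classic -> (H' `<=` H)%classic.
Proof.
have gE H : good H <-> subring_within G0 (fun u : T => u.1 = 0 -> u.2 = 0) H.
 split=> [[h1 h2 h3 h4]|[h1 h2 h3 h4]]; split=> //; last by move=> y /h4; apply.
 by move=> [a b] /= hab ea; apply: h4; rewrite -ea.
have [H /gE gH Hm] := max_subring_within ((gE _).1 good0).
by exists H => // H' /gE; exact: Hm.
Qed.

(** The graph is found as a maximal subring [H] of [A * L] that contains the pairs of values of one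
    polynomial at [al] and [be], and no [(0, y)] with [y] nonzero. Such a ring is the graph of a
    function, and maximality makes it defined on all of [A]. *)
Lemma field_embedding_extends :
 exists g : {rmorphism A -> L}, (forall x, g (e x) = f x) /\ g al = be.
Proof.
have [H [gG gB gM gF] Hmax] := max_good.
have H1 : H 1.
 by apply: gG; exists 1; rewrite !rmorph1 !hornerC.
have H0 : H 0 by rewrite -(subrr 1); exact: gB.
have gN u : H u -> H (- u) by move=> hu; rewrite -sub0r; exact: gB.
have gD u v : H u -> H v -> H (u + v) by move=> hu hv; rewrite -[v]opprK; apply: (gB) => //; exact: gN.
have gX u n : H u -> H (u ^+ n) by move=> hu; elim: n => [|n IH]; rewrite ?expr0 ?exprS //; exact: gM.
have gsum I (r : seq I) (P : pred I) (E : I -> T) : (forall i, P i -> H (E i)) -> H (\sum_(i <- r | P i) E i).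
 by move=> h; elim/big_ind: _.
have gef x : H (ef x) by apply: gG; exists x%:P; rewrite !map_polyC !hornerC.
have gFs u : H u -> u.1 = 0 -> u = 0.
 by case: u => a b /= hu ea; rewrite ea in hu *; rewrite (gF _ hu).
(* [u.1] is algebraic over [F], so its inverse is a polynomial in it: factors ['X] are removed from
   an equation until the constant term is nonzero. *)
have ginv u : H u -> u.1 != 0 -> exists2 v, H v & v * u = 1.
 move=> hu u0; have [q q0 /rootP qu] := algA u.1.
 have [n] := ubnP (size q); elim: n q q0 qu => // n IH q q0 qu szq.
 have [c [q' eq]] : exists c q', q = q' * 'X + c%:P.
  by elim/poly_ind: q {IH q0 qu szq} => [|p c _]; [exists 0, 0; rewrite mul0r addr0|exists c, p].
 have [c0|c0] := eqVneq c 0.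
  rewrite eq c0 addr0 in q0 qu szq.
  have q'0 : q' != 0 by apply: contraNneq q0 => ->; rewrite mul0r.
  apply: (IH q' q'0); last by move: szq; rewrite size_mulX.
  move/eqP: qu; rewrite rmorphM /= map_polyX hornerM hornerX mulf_eq0 (negbTE u0) orbF.
  by move/eqP.
 pose w : T := \sum_(i < size q') ef q'`_i * u ^+ i.
 have hw : H w by apply: (gsum) => i _; apply: (gM) => //; exact: gX.
 have w1 : w.1 = (map_poly e q').[u.1].
  rewrite (horner_coef_wide _ (size_poly _ _)) /w (big_morph fst (id1 := 0) (op1 := +%R)) //.
  apply: eq_bigr => i _; rewrite coef_map /=; congr (_ * _).
  by elim: (nat_of_ord i) => [|k IHk]; rewrite ?expr0 ?exprS //= IHk.
 exists (- ef c^-1 * w); first by apply: (gM) => //; apply: (gN).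
 suff : (- ef c^-1 * w * u) - 1 = 0 by move/eqP; rewrite subr_eq0 => /eqP.
 apply: (gFs); first by apply: (gB) => //; apply: (gM) => //; apply: (gM) => //; apply: (gN).
 rewrite /= w1; move: qu; rewrite eq rmorphD rmorphM /= map_polyX map_polyC /= hornerMXaddC => qu.
 rewrite -mulrA; move/eqP: qu; rewrite addr_eq0 => /eqP ->.
 by rewrite mulrNN -rmorphM mulVf // rmorph1 subrr.
pose ov (q : {poly T}) := forall i, H q`_i.
have ovB p q : ov p -> ov q -> ov (p - q) by move=> hp hq i; rewrite coefB; exact: gB.
have ovM p q : ov p -> ov q -> ov (p * q).
 by move=> hp hq i; rewrite coefM; apply: (gsum) => j _; exact: gM.
have ovC c : H c -> ov c%:P by move=> hc i; rewrite coefC; case: eqP.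
have ovX : ov 'X by move=> i; rewrite coefX; case: eqP.
(* Take a monic [M] over [H] of least degree whose first projection kills [x], and a root [y] of its
   second projection. Division by [M] shows that adjoining [(x, y)] creates no nonzero pair above 0,
   so [(x, y)] is already in [H]. *)
have tot x : exists y, H (x, y).
 have [q q0 /rootP qx] := algA x.
 pose m (n : nat) := `[< exists M : {poly T}, [/\ ov M, M \is monic, (map_poly fst M).[x] = 0 & size M = n] >].
 have exm : exists n, m n.
  exists (size q); apply/asboolP; pose q1 := (lead_coef q)^-1 *: q.
  have q1m : q1 \is monic by rewrite monicE lead_coefZ mulVf ?lead_coef_eq0.
  have q1q : size q1 = size q by rewrite size_scale ?invr_eq0 ?lead_coef_eq0.
  exists (\poly_(i < size q1) ef q1`_i).
  have l1 : ef q1`_(size q1).-1 = 1 by rewrite -/(lead_coef q1) (monicP q1m) /ef !rmorph1.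
  have sz : size (\poly_(i < size q1) ef q1`_i) = size q1.
   by rewrite size_poly_eq // l1 oner_eq0.
  split; last by rewrite sz.
  - by move=> i; rewrite coef_poly; case: ifP.
  - have h : ((size q1).-1 < size q1)%N by rewrite ltn_predL q1q size_poly_gt0.
   by rewrite monicE lead_coefE sz coef_poly h l1.
  - have -> : map_poly fst (\poly_(i < size q1) ef q1`_i) = map_poly e q1.
    apply/polyP=> i; rewrite coef_map /= coef_poly coef_map; case: ltnP => //= h.
    by rewrite nth_default // rmorph0.
   by rewrite map_polyZ hornerZ qx mulr0.
 case: (ex_minnP exm) => n /asboolP[M [oM mM Mx szM]] nmin.
 have szM1 : (1 < size (map_poly snd M))%N.
  rewrite size_map_poly_id0; last by rewrite (monicP mM) oner_eq0.
  rewrite ltnNge; apply/negP => /size1_polyC eM.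
  have := mM; rewrite eM monicE lead_coefC => /eqP e1.
  by move: Mx; rewrite eM e1 map_polyC hornerC => /eqP; rewrite oner_eq0.
 have [y /rootP yM] := closed_rootP (map_poly snd M) (negbT (gtn_eqF szM1)).
 have key q1 : ov q1 -> (map_poly fst q1).[x] = 0 -> (map_poly snd q1).[y] = 0.
  have [k] := ubnP (size q1); elim: k q1 => // k IH q1 szq ov1 q1x.
  have [->|q10] := eqVneq q1 0; first by rewrite rmorph0 horner0.
  have [le|lt] := leqP (size M) (size q1).
   pose q2 := q1 - (lead_coef q1)%:P * 'X^(size q1 - size M) * M.
   have oX j : ov 'X^j.
    by elim: j => [|j IHj]; rewrite ?expr0 ?exprS; [exact: ovC|exact: ovM].
   have o2 : ov q2.
    by apply: (ovB) => //; apply: (ovM) => //; apply: (ovM) => //; apply: (ovC); exact: ov1.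
   have sz2 : (size q2 < size q1)%N.
    apply: (leq_ltn_trans (n := (size q1).-1)); last by rewrite ltn_predL size_poly_gt0.
    have Mgt : (0 < size M)%N by rewrite size_poly_gt0 monic_neq0.
    apply/leq_sizeP => j lj; rewrite coefB -mulrA coefCM coefXnM.
    have -> : (j < size q1 - size M)%N = false by lia.
    have [ej|nj] := eqVneq j (size q1).-1.
     have -> : (j - (size q1 - size M))%N = (size M).-1 by lia.
     by rewrite -lead_coefE (monicP mM) mulr1 ej -lead_coefE subrr.
    have c1 : (size q1 <= j)%N by lia.
    have c2 : (size M <= j - (size q1 - size M))%N by lia.
    by rewrite (nth_default _ c1) (nth_default _ c2) mulr0 subrr.
   have : (map_poly snd q2).[y] = 0.
    apply: IH => //; first exact: leq_trans sz2 _.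
    by rewrite rmorphB rmorphM hornerD hornerN hornerM q1x Mx mulr0 subr0.
   by rewrite rmorphB rmorphM hornerD hornerN hornerM yM mulr0 subr0.
  exfalso; have lc0 : (lead_coef q1).1 != 0.
   by apply: contraNneq q10 => /(gFs _ (ov1 _)) /eqP; rewrite lead_coef_eq0.
  have [d hd dE] := ginv _ (ov1 _) lc0.
  have szd : size (d%:P * q1) = size q1.
   apply/eqP; rewrite eqn_leq; apply/andP; split.
    by rewrite mul_polyC; exact: size_scale_leq.
   rewrite -[X in (X <= _)%N]prednK ?size_poly_gt0 //; apply: contraT; rewrite -leqNgt => /leq_sizeP h.
   by have /eqP := h _ (leqnn _); rewrite coefCM -lead_coefE dE oner_eq0.
  have : m (size q1).
   apply/asboolP; exists (d%:P * q1); split=> //.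
   - by apply: (ovM) => //; exact: ovC.
   - by rewrite monicE lead_coefE szd coefCM -lead_coefE dE.
   - by rewrite rmorphM hornerM q1x mulr0.
  by move/nmin; rewrite -szM leqNgt lt.
 pose H' : set T := fun u => exists2 q1, ov q1 & u = q1.[(x, y)].
 have h1 q1 : (q1.[(x, y)]).1 = (map_poly fst q1).[x] by rewrite -[x]/((x, y).1) horner_map.
 have h2 q1 : (q1.[(x, y)]).2 = (map_poly snd q1).[y] by rewrite -[y in RHS]/((x, y).2) horner_map.
 have HH' : (H `<=` H')%classic by move=> u hu; exists u%:P; rewrite ?hornerC //; exact: ovC.
 have gH' : good H'.
  split; first by move=> u /gG /HH'.
  - by move=> u v [p op ->] [r or ->]; exists (p - r); rewrite ?hornerD ?hornerN //; exact: ovB.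
  - by move=> u v [p op ->] [r or ->]; exists (p * r); rewrite ?hornerM //; exact: ovM.
  - move=> z [p op ez]; have := h1 p; rewrite -ez /= => /esym/(key _ op).
   by rewrite -h2 -ez.
 by exists y; apply: (Hmax _ gH' HH'); exists 'X; rewrite ?hornerX.
pose g x := sval (cid (tot x)).
have gH x : H (x, g x) by rewrite /g; case: cid.
have guniq x y : H (x, y) -> y = g x.
 move=> h; have := gB _ _ h (gH x).
 have -> : (x, y) - (x, g x) = (x - x, y - g x) :> T by [].
 rewrite subrr.
 by move/gF/eqP; rewrite subr_eq0 => /eqP.
have gBm : zmod_morphism g by move=> x y; apply/esym/guniq; exact: (gB _ _ (gH x) (gH y)).
have gMm : monoid_morphism g.
 split=> [|x y]; first by apply/esym/guniq; exact: H1.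
 by apply/esym/guniq; exact: (gM _ _ (gH x) (gH y)).
pose gA := GRing.isZmodMorphism.Build _ _ g gBm.
pose gR := GRing.isMonoidMorphism.Build _ _ g gMm.
pose h : {rmorphism A -> L} := HB.pack g gA gR.
exists h; split=> [x|]; apply/esym/guniq; first exact: gef.
by apply: gG; exists 'X; rewrite !map_polyX !hornerX.
Qed.
End Extension.

Section GaloisTheory.
Variables (F : fieldType) (Fb : algClosure F).
Local Notation emb := (ac_emb Fb).
Local Notation ev q x := ((map_poly emb q).[x]).

Lemma min_poly_ex (x : Fb) : exists q : {poly F}, [/\ q \is monic, ev q x = 0 &
 forall p : {poly F}, ev p x = 0 -> q %| p].
Proof.
have [q0 q00 /rootP q0x] := ac_alg x.
pose m n := `[< exists q : {poly F}, [/\ q != 0, ev q x = 0 & size q = n] >].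
have exm : exists n, m n by exists (size q0); apply/asboolP; exists q0.
case: (ex_minnP exm) => n /asboolP[q [qn0 qx sq]] nmin.
exists ((lead_coef q)^-1 *: q); split.
- by rewrite monicE lead_coefZ mulVf ?lead_coef_eq0.
- by rewrite map_polyZ hornerZ qx mulr0.
move=> p px; rewrite dvdpZl ?invr_eq0 ?lead_coef_eq0 // /dvdp; apply: contraT => r0.
have : m (size (p %% q)).
 apply/asboolP; exists (p %% q); split=> //.
 move: px; rewrite {1}(divp_eq p q) rmorphD rmorphM hornerD hornerM qx mulr0 add0r.
 by [].
by move/nmin; rewrite -sq leqNgt ltn_modp qn0.
Qed.

Lemma root_list (p : {poly Fb}) : p != 0 ->
 exists2 r : seq Fb, uniq r & forall x, (x \in r) = root p x.
Proof.
move=> p0; have [r er] := closed_field_poly_normal p.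
exists (undup r); first exact: undup_uniq.
by move=> x; rewrite mem_undup er rootZ ?lead_coef_eq0 // root_prod_XsubC.
Qed.

Lemma gal_root (s : absGal Fb) (q : {poly F}) x : ev q x = 0 -> ev q (s x) = 0.
Proof.
move=> h; have <- : s (ev q x) = ev q (s x).
 rewrite -horner_map -map_poly_comp; congr (_.[_]).
 by apply: eq_map_poly => a /=; rewrite gal_fix.
by rewrite h rmorph0.
Qed.

(** [field_embedding_extends] gives an endomorphism; it is onto because it permutes the finitely
    many roots of each polynomial over [F]. *)
Lemma gal_conj (x y : Fb) : (forall q : {poly F}, ev q x = 0 -> ev q y = 0) ->
 exists s : absGal Fb, s x = y.
Proof.
move=> h; have [g [ge gx]] := field_embedding_extends (@ac_alg _ Fb) h.
have gsurj z : exists w, g w = z.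
 have [q [mq qz _]] := min_poly_ex z.
 have [|r ur hr] := @root_list (map_poly emb q).
  by rewrite map_poly_eq0 monic_neq0.
 have sub : {subset map g r <= r}.
  move=> _ /mapP[w wr ->]; move: wr; rewrite !hr => /rootP w0; apply/rootP.
  have <- : g (ev q w) = ev q (g w).
   by rewrite -horner_map -map_poly_comp; congr (_.[_]); apply: eq_map_poly => a /=.
  by rewrite w0 rmorph0.
 have um : uniq (map g r) by rewrite map_inj_uniq //; exact: fmorph_inj.
 have [_ e] := uniq_min_size um sub (eq_leq (esym (size_map g r))).
 have : z \in map g r by rewrite e hr; apply/rootP.
 by case/mapP=> w _ ->; exists w.
have gb : bijective g.
 pose g' z := sval (cid (gsurj z)); have g'K z : g (g' z) = z by rewrite /g'; case: cid.
 by exists g' => // z; apply: (fmorph_inj g); rewrite g'K.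
by exists (AbsGal ge gb).
Qed.

Lemma gal_mulE (s t : absGal Fb) x : gal_mul s t x = s (t x). Proof. by []. Qed.
Lemma gal_oneE x : gal_one Fb x = x. Proof. by []. Qed.
Lemma gal_invK (s : absGal Fb) : cancel s (gal_inv s).
Proof. by rewrite /gal_inv; case: cid => t []. Qed.
Lemma gal_invVK (s : absGal Fb) : cancel (gal_inv s) s.
Proof. by rewrite /gal_inv; case: cid => t []. Qed.

Lemma gal_mulA (s t u : absGal Fb) : gal_mul s (gal_mul t u) = gal_mul (gal_mul s t) u.
Proof. exact: gal_ext. Qed.
Lemma gal_mul1 (s : absGal Fb) : gal_mul s (gal_one Fb) = s.
Proof. exact: gal_ext. Qed.
Lemma gal_1mul (s : absGal Fb) : gal_mul (gal_one Fb) s = s.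
Proof. exact: gal_ext. Qed.
Lemma gal_mulV (s : absGal Fb) : gal_mul s (gal_inv s) = gal_one Fb.
Proof. by apply: gal_ext => x; rewrite gal_mulE gal_invVK. Qed.
Lemma gal_Vmul (s : absGal Fb) : gal_mul (gal_inv s) s = gal_one Fb.
Proof. by apply: gal_ext => x; rewrite gal_mulE gal_invK. Qed.
Lemma orbit_list (H : absGal Fb -> Prop) x : exists2 r : seq Fb, uniq r &
 forall y, y \in r <-> exists2 s, H s & y = s x.
Proof.
have [q [mq qx _]] := min_poly_ex x.
have [|r ur hr] := @root_list (map_poly emb q); first by rewrite map_poly_eq0 monic_neq0.
exists [seq y <- r | `[< exists2 s, H s & y = s x >]]; first exact: filter_uniq.
move=> y; rewrite mem_filter; split=> [/andP[/asboolP]//|h].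
apply/andP; split; first exact/asboolP.
by case: h => s _ ->; rewrite hr; apply/rootP; exact: gal_root.
Qed.

Hypothesis char0 : forall n, n.+1%:R != 0 :> Fb.

(** All conjugates of [x] equal [x], so its minimal polynomial is a power of ['X - x]. Its second
    coefficient is minus the degree times [x], which in characteristic 0 puts [x] in [F]. *)
Lemma gal_fixed (x : Fb) : (forall s : absGal Fb, s x = x) -> exists a : F, x = emb a.
Proof.
move=> fx; have [q [mq qx qmin]] := min_poly_ex x.
have [r er] := closed_field_poly_normal (map_poly emb q).
have lq : lead_coef (map_poly emb q) = 1 by rewrite lead_coef_map (monicP mq) rmorph1.
rewrite lq scale1r in er.
have rx y : y \in r -> y = x.
 move=> yr; have [|s <-] := @gal_conj x y; last exact: fx.
 move=> p /qmin /dvdpP[u ->]; rewrite rmorphM /= hornerM er.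
 have /rootP -> : root (\prod_(z <- r) ('X - z%:P)) y by rewrite root_prod_XsubC.
 by rewrite mulr0.
have er' : map_poly emb q = ('X - x%:P) ^+ size r.
 rewrite er (eq_big_seq (fun=> 'X - x%:P)); last by move=> y /rx ->.
 by rewrite big_const_seq count_predT -Monoid.iteropE.
have nr : (0 < size r)%N.
 case: r er {rx er'} => // er; move: qx; rewrite er big_nil hornerC => /eqP.
 by rewrite oner_eq0.
have cq : emb q`_(size r).-1 = - (x *+ size r).
 rewrite -coef_map er'.
 rewrite -(prednK nr) /= {nr}; move: (size r).-1 => n.
 elim: n => [|n IH]; first by rewrite expr1 coefB coefX coefC sub0r.
 rewrite exprSr mulrBr coefB coefMX /= coefMC IH.
 have -> : (('X - x%:P) ^+ n.+1)`_n.+1 = 1.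
  have := size_exp_XsubC n.+1 x => sz; rewrite -[RHS](monicP (monic_exp n.+1 (monicXsubC x))).
  by rewrite lead_coefE sz.
 by rewrite mul1r [in RHS]mulrSr opprD.
exists (- (q`_(size r).-1 / (size r)%:R)).
have r0 : (size r)%:R != 0 :> Fb by rewrite -(prednK nr) char0.
by rewrite rmorphN fmorph_div rmorph_nat cq mulNr opprK -[x *+ _]mulr_natr mulfK.
Qed.
End GaloisTheory.

(** * Torsion and division *)

Section LeadCoef.
Variable R : fieldType.
(** The coefficient [c] may be 0, so that sums and products obey rules without side conditions on
    cancellation. *)
Definition lcof (k : nat) (c : R) (p : {poly R}) := (size p <= k.+1)%N /\ p`_k = c.

Lemma lcofD k c d p q : lcof k c p -> lcof k d q -> lcof k (c + d) (p + q).
Proof.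
move=> [sp <-] [sq <-]; split; last by rewrite coefD.
by apply: leq_trans (size_polyD _ _) _; rewrite geq_max sp.
Qed.
Lemma lcofE k c c' p : lcof k c p -> c = c' -> lcof k c' p.
Proof. by move=> ? <-. Qed.
Lemma lcofZ k c p a : lcof k c p -> lcof k (a * c) (a *: p).
Proof. by move=> [sp <-]; split; rewrite ?coefZ // (leq_trans (size_scale_leq _ _)). Qed.
Lemma lcofB k c d p q : lcof k c p -> lcof k d q -> lcof k (c - d) (p - q).
Proof. by move=> hp hq; rewrite -mulN1r -scaleN1r; apply: lcofD => //; exact: lcofZ. Qed.
Lemma lcofM k l c d p q : lcof k c p -> lcof l d q -> lcof (k + l) (c * d) (p * q).
Proof.
move=> [sp <-] [sq <-]; split.
 apply: leq_trans (size_polyMleq _ _) _; rewrite -subn1 leq_subLR.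
 by apply: leq_trans (leq_add sp sq) _; rewrite addSn addnS add1n.
rewrite coefM (bigD1 (inord k : 'I_(k + l).+1)) //= inordK ?ltnS ?leq_addr // addKn.
rewrite big1 ?addr0 // => i /negbTE ni.
have [lt|ge] := ltnP i k.
 by rewrite [q`_ _]nth_default ?mulr0 // (leq_trans sq) //; lia.
have gt : (k < i)%N.
 rewrite ltn_neqAle ge andbT; apply/eqP=> e; move/negP: ni; apply; apply/eqP/val_inj.
 by rewrite /= inordK ?ltnS ?leq_addr.
by rewrite nth_default ?mul0r // (leq_trans sp).
Qed.
Lemma lcofX k c p n : lcof k c p -> lcof (k * n) (c ^+ n) (p ^+ n).
Proof.
move=> h; elim: n => [|n IH]; first by rewrite muln0 !expr0; split; rewrite ?coefC // size_poly1.
by rewrite mulnS !exprS; exact: lcofM.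
Qed.
Lemma lcof_lt k (p : {poly R}) : (size p <= k)%N -> lcof k 0 p.
Proof. by move=> h; split; [exact: leq_trans h _|rewrite nth_default]. Qed.
Lemma lcof_size k c p : c != 0 -> lcof k c p -> size p = k.+1.
Proof.
move=> c0 [sp e]; apply/eqP; rewrite eqn_leq sp ltnNge; apply/negP => h.
by rewrite nth_default // in e; rewrite e eqxx in c0.
Qed.
Lemma lcofXn : lcof 1 1 'X. Proof. by split; rewrite ?size_polyX ?coefX. Qed.
Lemma lcofC c : lcof 0 c c%:P. Proof. by split; rewrite ?size_polyC_leq1 ?coefC. Qed.
Lemma lcof_neq0 k c p : c != 0 -> lcof k c p -> p != 0.
Proof. by move=> c0 h; rewrite -size_poly_gt0 (lcof_size c0 h). Qed.
Lemma lcof_weak k l c p : lcof k c p -> (k < l)%N -> lcof l 0 p.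
Proof. by move=> [sp _] h; apply: lcof_lt; apply: leq_trans sp _. Qed.
End LeadCoef.

Lemma sqa_map (F L : fieldType) (e : {rmorphism F -> L}) (E : weierstrass F) :
 [/\ sqa2 (map_weierstrass e E) = e (sqa2 E), sqa4 (map_weierstrass e E) = e (sqa4 E)
  & sqa6 (map_weierstrass e E) = e (sqa6 E)].
Proof.
by split; rewrite /sqa2 /sqa4 /sqa6 rmorphD fmorph_div rmorph_nat ?rmorphM ?rmorphXn.
Qed.

Section XCoord.
Variables (L : closedFieldType) (W : goodcurve L).
Let c0 := gc_char0 W.
Definition wf (x : L) := x ^+ 3 + sqa2 W * x ^+ 2 + sqa4 W * x + sqa6 W.
Definition wf' (x : L) := 3 * x ^+ 2 + 2 * sqa2 W * x + sqa4 W.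
Definition sq (P : ecpt W) := sqpt W P.
Let two0 : 2 != 0 :> L. Proof. exact: c0 1. Qed.

Lemma sq_on P : on_curve (sqW W) (sq P).
Proof. by rewrite sqpt_on_curve ?pt_on //; exact: c0. Qed.
Lemma sq_onE P x y : sq P = Aff x y -> y ^+ 2 = wf x.
Proof. by move=> e; have := sq_on P; rewrite e short_on_curveE => /eqP. Qed.
Lemma sq_inj : injective sq.
Proof. by move=> P Q /sqpt_inj/pt_inj. Qed.
Lemma sq0 : sq 0 = Infty. Proof. by []. Qed.
Lemma sqD P Q : sq (P + Q) = padd (sqW W) (sq P) (sq Q).
Proof. by rewrite /sq ptD sqpt_add ?pt_on //; exact: c0. Qed.
Lemma sqN P : sq (- P) = popp (sqW W) (sq P).
Proof. by rewrite /sq ptN sqpt_opp //; exact: c0. Qed.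
Lemma sqNE P x y : sq P = Aff x y -> sq (- P) = Aff x (- y).
Proof. by move=> e; rewrite sqN e short_oppE. Qed.
Lemma sq_surj x y : y ^+ 2 = wf x -> exists P, sq P = Aff x y.
Proof.
move=> e; have [Q eQ] := sqpt_surj W (Aff x y).
have oQ : on_curve W Q by rewrite -(sqpt_on_curve W c0) eQ short_on_curveE; apply/eqP.
by exists (Ecpt oQ).
Qed.
Lemma sq_ex x : exists P y, sq P = Aff x y.
Proof.
have [y hy] := @solve_monicpoly L 2 (fun k => if k == 0%N then wf x else 0) isT.
move: hy; rewrite !big_ord_recl big_ord0 /= expr0 mulr1 mul0r !addr0 => hy.
by have [P eP] := sq_surj hy; exists P, y.
Qed.
Lemma sq_same P Q x y y' : sq P = Aff x y -> sq Q = Aff x y' -> Q = P \/ Q = - P.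
Proof.
move=> eP eQ; have /eqP := sq_onE eQ; rewrite -(sq_onE eP) eqf_sqr => /orP[]/eqP e.
 by left; apply: sq_inj; rewrite eP eQ e.
by right; apply: sq_inj; rewrite (sqNE eP) eQ e.
Qed.
Lemma sq_eq0 P : sq P = Infty -> P = 0.
Proof. by move=> h; apply: sq_inj. Qed.
Lemma sq_cases P : P = 0 \/ exists x y, sq P = Aff x y.
Proof. by case e : (sq P) => [|x y]; [left; exact: sq_eq0|right; exists x, y]. Qed.

Definition ex (P : ecpt W) : L := px (sq P).

Lemma finite_x (xs : seq L) : exists l : seq (ecpt W), forall P x y,
 sq P = Aff x y -> x \in xs -> P \in l.
Proof.
elim: xs => [|x0 xs [l hl]]; first by exists [::].
have [P0 [y0 e0]] := sq_ex x0; exists [:: P0, - P0 & l] => P x y e.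
rewrite inE => /orP[/eqP ex|h]; last by rewrite !inE (hl _ _ _ e h) !orbT.
rewrite ex in e; rewrite !inE; case: (sq_same e0 e) => ->; rewrite eqxx ?orbT //.
Qed.

Lemma avoid_x (xs : seq L) : exists P x y, sq P = Aff x y /\ x \notin xs.
Proof.
have [x hx] : exists x : L, x \notin xs by apply: exists_notin; exact: natr_inj0.
by have [P [y e]] := sq_ex x; exists P, x, y.
Qed.

Lemma chord_x P Q x y u v : sq P = Aff x y -> sq Q = Aff u v -> x != u ->
 exists y', sq (P + Q) = Aff (((v - y) / (u - x)) ^+ 2 - sqa2 W - x - u) y'.
Proof.
move=> eP eQ n; rewrite sqD eP eQ short_chordE //=.
by eexists.
Qed.

Lemma tangent_x P x y : sq P = Aff x y -> y != 0 ->
 exists y', sq (P + P) = Aff ((wf' x / (2 * y)) ^+ 2 - sqa2 W - x - x) y'.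
Proof.
move=> eP n; rewrite sqD eP short_tangentE //=.
by eexists.
Qed.

(** In the sum of the abscissas of [P + Q] and [Q - P] the product of the ordinates cancels, so the
    result is rational in the abscissas alone. This drives the recursion for multiplication by
    [n]. *)
Lemma sum_x P Q x y u v : sq P = Aff x y -> sq Q = Aff u v -> x != u ->
 exists x1 y1 x2 y2, [/\ sq (P + Q) = Aff x1 y1, sq (Q - P) = Aff x2 y2 &
  x1 + x2 = 2 * (wf x + wf u) / (x - u) ^+ 2 - 2 * (sqa2 W + u + x)].
Proof.
move=> eP eQ n; have [y1 e1] := chord_x eP eQ n.
have [y2 e2] := chord_x (sqNE eP) eQ n.
do 4!eexists; rewrite e1 [Q - P]addrC e2; split=> //.
have d : x - u != 0 by rewrite subr_eq0.
have d' : u - x != 0 by rewrite subr_eq0 eq_sym.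
by rewrite -(sq_onE eP) -(sq_onE eQ); field; rewrite d d'.
Qed.
End XCoord.

Section Evp.
Variables (F L : fieldType) (e : {rmorphism F -> L}) (x : L).
Definition evp (q : {poly F}) := (map_poly e q).[x].
Lemma evpD p q : evp (p + q) = evp p + evp q.
Proof. by rewrite /evp rmorphD hornerD. Qed.
Lemma evpN p : evp (- p) = - evp p.
Proof. by rewrite /evp rmorphN hornerN. Qed.
Lemma evpM p q : evp (p * q) = evp p * evp q.
Proof. by rewrite /evp rmorphM hornerM. Qed.
Lemma evpX p n : evp (p ^+ n) = evp p ^+ n.
Proof. by rewrite /evp rmorphXn horner_exp. Qed.
Lemma evpZ a p : evp (a *: p) = e a * evp p.
Proof. by rewrite /evp map_polyZ hornerZ. Qed.
Lemma evpC a : evp a%:P = e a.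
Proof. by rewrite /evp map_polyC hornerC. Qed.
Lemma evp1 : evp 1 = 1.
Proof. by rewrite -(rmorph1 e) -evpC. Qed.
Lemma evp_X : evp 'X = x.
Proof. by rewrite /evp map_polyX hornerX. Qed.
Definition evpE := (evpD, evpN, evpM, evpX, evpZ, evpC, evp1, evp_X).
End Evp.

Section MulPoly.
Variables (F : fieldType) (E : weierstrass F).
Hypothesis char0 : forall n, n.+1%:R != 0 :> F.
Let a2 := sqa2 E. Let a4 := sqa4 E. Let a6 := sqa6 E.
Let f : {poly F} := 'X^3 + a2 *: 'X^2 + a4 *: 'X + a6%:P.
Let f' : {poly F} := 3 *: 'X^2 + (2 * a2) *: 'X + a4%:P.

(** [A / B] is multiplication by [n] on abscissas. It is claimed off the zeros of a third polynomial
    [Z], which absorbs all degenerate steps of the recursion. The polynomials live over [F] and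
    serve every closed field above it. *)
Definition mulpoly (n : nat) (A B Z : {poly F}) :=
 forall (L : closedFieldType) (e : {rmorphism F -> L}) (W : goodcurve L),
 gc_eqn W = map_weierstrass e E -> forall (P : ecpt W) x y, sq P = Aff x y ->
 (evp e x Z) != 0 ->
 (evp e x B) != 0 /\ exists y', sq (P *+ n) = Aff ((evp e x A) / (evp e x B)) y'.

Let evf (L : closedFieldType) (e : {rmorphism F -> L}) (W : goodcurve L) x :
 gc_eqn W = map_weierstrass e E -> (evp e x f) = wf W x.
Proof.
move=> eW; have [h2 h4 h6] := sqa_map e E; rewrite -eW in h2 h4 h6.
by rewrite /f !evpE /wf h2 h4 h6.
Qed.

Let evf' (L : closedFieldType) (e : {rmorphism F -> L}) (W : goodcurve L) x :
 gc_eqn W = map_weierstrass e E -> (evp e x f') = wf' W x.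
Proof.
move=> eW; have [h2 h4 h6] := sqa_map e E; rewrite -eW in h2 h4 h6.
by rewrite /f' !evpE rmorphM !rmorph_nat /wf' h2 h4.
Qed.

Let lf : lcof 3 1 f.
Proof.
rewrite /f; apply: (@lcofE _ _ (1 + 0 + 0 + 0)); last by ring.
apply: lcofD; [apply: lcofD; [apply: lcofD|]|].
- by split; rewrite ?size_polyXn ?coefXn.
- by apply: lcof_lt; rewrite (leq_trans (size_scale_leq _ _)) // size_polyXn.
- by apply: lcof_lt; rewrite (leq_trans (size_scale_leq _ _)) // size_polyX.
- by apply: lcof_lt; rewrite (leq_trans (size_polyC_leq1 _)).
Qed.

Let lf' : lcof 2 3 f'.
Proof.
rewrite /f'; apply: (@lcofE _ _ (3 * 1 + 0 + 0)); last by ring.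
apply: lcofD; [apply: lcofD|].
- by apply: lcofZ; split; rewrite ?size_polyXn ?coefXn.
- by apply: lcof_lt; rewrite (leq_trans (size_scale_leq _ _)) // size_polyX.
- by apply: lcof_lt; rewrite (leq_trans (size_polyC_leq1 _)).
Qed.

(** The ratio [n^2] of the leading coefficients is the trace of the formal group: it later makes
    multiplication by [n] surjective on the kernel of reduction when [n] is a unit. *)
Let good n := exists d a A B Z, [/\ a != 0, lcof d.+1 a A, lcof d (n%:R ^+ 2 * a) B, Z != 0
 & mulpoly n A B Z].

Let good1 : good 1.
Proof.
exists 0, 1, 'X, 1, 1; split; rewrite ?oner_eq0 //; first exact: lcofXn.
 by rewrite expr1n mulr1; exact: lcofC.
move=> L e W eW P x y eP _; rewrite !evpE oner_eq0 divr1.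
by split=> //; exists y.
Qed.

Let good2 : good 2.
Proof.
exists 3, 1, (f' ^+ 2 - 4 *: (f * (2 *: 'X + a2%:P))), (4 *: f), f; split; rewrite ?oner_eq0 //.
- apply: (@lcofE _ _ (3 ^+ 2 - 4 * (1 * (2 * 1 + 0)))); last by ring.
 apply: lcofB; first exact: (lcofX 2 lf').
 apply: lcofZ; apply: (lcofM lf); apply: lcofD; first by apply: lcofZ; exact: lcofXn.
 by apply: lcof_lt; exact: size_polyC_leq1.
- by apply: (@lcofE _ _ (4 * 1)); [exact: lcofZ|ring].
- exact: (lcof_neq0 (oner_neq0 F) lf).
move=> L e W eW P x y eP; rewrite (evf _ eW) -(sq_onE eP) expf_eq0 /= => y0.
have t0 := gc_char0 W 1; have f0 := gc_char0 W 3.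
have [h2 _ _] := sqa_map e E; rewrite -eW in h2.
rewrite evpZ rmorph_nat (evf _ eW) -(sq_onE eP) mulf_neq0 ?expf_neq0 //; split=> //.
have [y' e'] := tangent_x eP y0; exists y'; rewrite mulr2n e'; congr Aff.
rewrite (evpD e x (f' ^+ 2)) evpN (evpX e x f') evpZ (evpM e x f) (evpD e x (2 *: 'X)) evpZ evp_X evpC.
rewrite !rmorph_nat (evf _ eW) (evf' _ eW) -(sq_onE eP) -h2; field.
by rewrite y0 t0 f0.
Qed.

(** The abscissa of [(n+1)P] is the sum given by [sum_x] for [P] and [nP], minus the abscissa of
    [(n-1)P]. [N] and [D] are numerator and denominator of this expression; [u] vanishes where [P]
    and [nP] share their abscissa. *)
Let goodS n : (1 < n)%N -> good n.-1 -> good n -> good n.+1.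
Proof.
move=> n1 [d' [a' [A' [B' [Z' [a'0 lA' lB' Z'0 h']]]]]] [d [a [A [B [Z [a0 lA lB Z0 h]]]]]].
pose u := 'X * B - A; pose D := B * u ^+ 2 * B'.
pose N := 2 *: ((f * B ^+ 3 + A ^+ 3 + a2 *: (A ^+ 2 * B) + a4 *: (A * B ^+ 2) + a6 *: B ^+ 3) * B')
 - 2 *: ((a2%:P + 'X) * D) - 2 *: (A * u ^+ 2 * B') - A' * B * u ^+ 2.
have lu : lcof d.+1 ((n%:R ^+ 2 - 1) * a) u.
 by rewrite mulrBl mul1r; apply: lcofB => //; rewrite -[X in lcof _ X]mul1r -add1n; apply: lcofM => //; exact: lcofXn.
have n0 : (n%:R : F) != 0 by rewrite -(ltn_predK n1) char0.
have n10 : (n.-1%:R : F) != 0 by case: n n1 {lB lB' h h' lu n0} => [|[|n]] // _; exact: char0.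
have nE : n%:R = n.-1%:R + 1 :> F by rewrite natr1 (ltn_predK n1).
have n2 : (n.+1%:R : F) != 0 by exact: char0.
have n2E : n.+1%:R = n.-1%:R + 2 :> F by rewrite -natr1 nE -addrA.
have n21 : (n%:R ^+ 2 - 1 : F) != 0.
 rewrite (_ : _ - 1 = n.-1%:R * n.+1%:R) ?mulf_neq0 //.
 by rewrite nE n2E; ring.
set b := n%:R ^+ 2 * a in lB; set b' := n.-1%:R ^+ 2 * a' in lB'; set w := (n%:R ^+ 2 - 1) * a in lu.
have lD : lcof (d + d.+1 * 2 + d') (b * w ^+ 2 * b') D.
 by apply: lcofM => //; apply: lcofM => //; exact: lcofX.
pose m := n.-1%:R : F.
exists (d + d.+1 * 2 + d')%N, (n%:R ^+ 2 * m ^+ 4 * a ^+ 3 * a'), N, D, (Z * Z' * u).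
split.
- by rewrite !mulf_neq0 ?expf_neq0.
- apply: (@lcofE _ _ (2 * ((1 * b ^+ 3 + a ^+ 3 + a2 * 0 + a4 * 0 + a6 * 0) * b') - 2 * ((0 + 1) * (b * w ^+ 2 * b'))
   - 2 * (a * w ^+ 2 * b') - a' * b * w ^+ 2)); last first.
  by rewrite /b /b' /w /m nE; ring.
 have e1 : (d + d.+1 * 2 + d').+1 = (3 + d * 3 + d')%N by lia.
 apply: lcofB; [apply: lcofB; [apply: lcofB|]|].
 + apply: lcofZ; rewrite e1; apply: lcofM => //; do 4?apply: lcofD.
  * by apply: lcofM => //; exact: lcofX.
  * by have -> : (3 + d * 3 = d.+1 * 3)%N by [lia]; exact: lcofX.
  * by apply: lcofZ; apply: (lcof_weak (lcofM (lcofX 2 lA) lB)); lia.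
  * by apply: lcofZ; apply: (lcof_weak (lcofM lA (lcofX 2 lB))); lia.
  * by apply: lcofZ; apply: (lcof_weak (lcofX 3 lB)); lia.
 + apply: lcofZ; rewrite -add1n; apply: lcofM => //; apply: lcofD; last exact: lcofXn.
  by apply: lcof_lt; exact: size_polyC_leq1.
 + apply: lcofZ; have -> : (d + d.+1 * 2 + d').+1 = (d.+1 + d.+1 * 2 + d')%N by lia.
  by apply: lcofM => //; apply: lcofM => //; exact: lcofX.
 + have -> : (d + d.+1 * 2 + d').+1 = (d'.+1 + d + d.+1 * 2)%N by lia.
  by apply: lcofM => //; [apply: lcofM|exact: lcofX].
- have -> : n.+1%:R ^+ 2 * (n%:R ^+ 2 * m ^+ 4 * a ^+ 3 * a') = b * w ^+ 2 * b'.
  by rewrite /b /b' /w /m n2E nE; ring.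
 exact: lD.
- rewrite !mulf_neq0 //; apply: (lcof_neq0 _ lu); by rewrite mulf_neq0.
move=> L e W eW P x y eP; rewrite (evpM e x (Z * Z') u) (evpM e x Z) !mulf_eq0 !negb_or -andbA => /and3P[zn zn' un].
have [B0 [v eQ]] := h L e W eW P x y eP zn.
have [B'0 [v' eQ']] := h' L e W eW P x y eP zn'.
have uE : (evp e x u) = x * (evp e x B) - (evp e x A).
 by rewrite !evpE.
rewrite uE in un.
have nx : x != (evp e x A) / (evp e x B).
 apply: contraNneq un => ex; by rewrite {1}ex divfK ?subrr.
have [x1 [y1 [x2 [y2 [e1 e2 e3]]]]] := sum_x eP eQ nx.
have eQP : P *+ n - P = P *+ n.-1 by rewrite -{1}(ltn_predK n1) mulrSr addrK.
rewrite eQP eQ' in e2; case: e2 => e2 _.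
have DE : (evp e x D) = (evp e x B) * (x * (evp e x B) - (evp e x A)) ^+ 2 * (evp e x B').
 by rewrite -uE /D !(evpM, evpX).
have D0 : (evp e x D) != 0 by rewrite DE !mulf_neq0 ?expf_neq0.
split=> //; exists y1; rewrite mulrS e1; congr Aff.
have -> : x1 = x1 + x2 - (evp e x A') / (evp e x B') by rewrite e2 addrK.
have [h2 h4 h6] := sqa_map e E; rewrite -eW in h2 h4 h6.
have NE : (evp e x N) = 2 * ((wf W x * (evp e x B) ^+ 3 + (evp e x A) ^+ 3
  + sqa2 W * ((evp e x A) ^+ 2 * (evp e x B)) + sqa4 W * ((evp e x A) * (evp e x B) ^+ 2)
  + sqa6 W * (evp e x B) ^+ 3) * (evp e x B'))
  - 2 * ((sqa2 W + x) * (evp e x D))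
  - 2 * ((evp e x A) * (evp e x u) ^+ 2 * (evp e x B')) -
  (evp e x A') * (evp e x B) * (evp e x u) ^+ 2.
 by rewrite /N h2 h4 h6 -(evf x eW) !(evpD, evpN, evpZ, evpM, evpX, evpC, evp_X) !rmorph_nat.
rewrite e3 NE DE uE.
move: (evp e x A) (evp e x B) (evp e x A') (evp e x B') B0 B'0 nx un => q r q' r' r0 r'0 nx un.
rewrite {2}/wf; field.
by rewrite un r'0 r0.
Qed.

Lemma mulpoly_exists n : (0 < n)%N -> good n.
Proof.
case: n => // n _; suff: good n.+1 /\ good n.+2 by case.
elim: n => [|n [IH1 IH2]]; first by split; [exact: good1|exact: good2].
by split=> //; exact: goodS.
Qed.
End MulPoly.

Section TorsionDivision.
Variables (F : fieldType) (E : weierstrass F).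
Variables (L : closedFieldType) (e : {rmorphism F -> L}) (W : goodcurve L).
Hypothesis eW : gc_eqn W = map_weierstrass e E.
Let char0 n : n.+1%:R != 0 :> F.
Proof. by rewrite -(inj_eq (fmorph_inj e)) rmorph0 rmorph_nat; exact: gc_char0 W n. Qed.

Lemma root_listL (p : {poly L}) : p != 0 -> exists r : seq L, forall x, p.[x] = 0 -> x \in r.
Proof.
move=> p0; have [r er] := closed_field_poly_normal p.
exists r => x /eqP; rewrite er hornerZ mulf_eq0 lead_coef_eq0 (negbTE p0) /=.
by rewrite -/(root _ x) root_prod_XsubC.
Qed.

Lemma torsion_finite n : (0 < n)%N -> exists l : seq (ecpt W), forall P, P *+ n = 0 -> P \in l.
Proof.
move=> n0; have [d [a [A [B [Z [a0 lA lB Z0 h]]]]]] := mulpoly_exists E char0 n0.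
have [|r hr] := @root_listL (map_poly e Z); first by rewrite map_poly_eq0.
have [l hl] := finite_x W r; exists (0 :: l) => P Pn.
rewrite inE; case: (sq_cases P) => [->|[x [y eP]]]; first by rewrite eqxx.
apply/orP; right; apply: (hl _ _ _ eP); apply: hr.
apply/eqP/negP => /negP Zx; have [_ [y' e']] := h L e W eW P x y eP Zx.
by rewrite Pn sq0 in e'.
Qed.

(** To divide [Q], solve [A / B = x] after removing the gcd; the degrees differ by one, so the
    equation is never constant. Only finitely many [x] lead to a zero of [Z], and any [P] is a sum
    of two points whose abscissas avoid them. *)
Lemma divisible n : (0 < n)%N -> forall P : ecpt W, exists Q, Q *+ n = P.
Proof.
move=> n0; have [d [a [A [B [Z [a0 lA lB Z0 h]]]]]] := mulpoly_exists E char0 n0.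
have b0 : n%:R ^+ 2 * a != 0 by rewrite mulf_neq0 ?expf_neq0 // -(prednK n0) char0.
pose g := gcdp A B; pose A1 := A %/ g; pose B1 := B %/ g.
have B0 := lcof_neq0 b0 lB.
have g0 : g != 0 by rewrite gcdp_eq0 negb_and B0 orbT.
have eA : A = A1 * g by rewrite divpK ?dvdp_gcdl.
have eB : B = B1 * g by rewrite divpK ?dvdp_gcdr.
have cop : coprimep A1 B1 by rewrite /A1 /B1; apply: coprimep_div_gcd; rewrite B0 orbT.
have B10 : B1 != 0 by apply: contraNneq B0 => h0; rewrite eB h0 mul0r.
have sz : size A1 = (size B1).+1.
 have A10 : A1 != 0.
  apply: contraTneq (lcof_neq0 a0 lA) => h0; by rewrite eA h0 mul0r eqxx.
 have := lcof_size a0 lA; have := lcof_size b0 lB; rewrite eA eB !size_mul //.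
 have : (0 < size g)%N by rewrite size_poly_gt0.
 have : (0 < size B1)%N by rewrite size_poly_gt0.
 by move: (size B1) (size g) (size A1) => b c a'; lia.
have [|r hr] := @root_listL (map_poly e Z); first by rewrite map_poly_eq0.
pose bad := [seq evp e x A1 / evp e x B1 | x <- r].
have good (Q : ecpt W) x y : sq Q = Aff x y -> x \notin bad -> exists R, R *+ n = Q.
 move=> eQ xb; pose p := map_poly e A1 - x *: map_poly e B1.
 have szp : (size p != 1)%N.
  rewrite size_polyDl size_map_poly sz.
   by rewrite eqSS size_poly_eq0.
  by rewrite size_polyN (leq_ltn_trans (size_scale_leq _ _)) // size_map_poly.
 have [x0 /rootP] := closed_rootP p szp.
 rewrite hornerD hornerN hornerZ -/(evp e x0 A1) -/(evp e x0 B1) => /eqP; rewrite subr_eq0 => /eqP ex0.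
 have B1x : evp e x0 B1 != 0.
  apply/eqP=> h0; have A1x : evp e x0 A1 = 0 by rewrite ex0 h0 mulr0.
  have /Bezout_eq1_coprimepP[[u v] /= uv] := cop.
  have := congr1 (evp e x0) uv; rewrite evp1 evpD !evpM h0 A1x !mulr0 addr0 => /eqP.
  by rewrite eq_sym oner_eq0.
 have Zx : evp e x0 Z != 0.
  apply/eqP=> /hr xr; move/negP: xb; apply; apply/mapP; exists x0 => //.
  by rewrite ex0 mulfK.
 have [R [y0 eR]] := sq_ex W x0.
 have [Bx [y' eR']] := h L e W eW R x0 y0 eR Zx.
 have : evp e x0 A / evp e x0 B = x.
  move: Bx; rewrite eA eB !evpM mulf_eq0 negb_or => /andP[_ gx].
  by rewrite ex0; field; rewrite gx B1x.
 move=> exx; rewrite exx in eR'; case: (sq_same eR' eQ) => ->; first by exists R.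
 by exists (- R); rewrite mulNrn.
move=> P; have [l hl] := finite_x W bad.
pose xs := bad ++ [seq px (sq Q) | Q <- P :: [seq P - T | T <- l]].
have [Q [x [y [eQ]]]] := avoid_x W xs; rewrite mem_cat negb_or => /andP[xb xl].
case: (sq_cases (P - Q)) => [e0|[x' [y' e']]].
 case/negP: xl; apply/mapP; exists P; first by rewrite inE eqxx.
 have -> : P = Q by apply/eqP; rewrite -subr_eq0 e0.
 by rewrite eQ.
have [R2 e2] : exists R2, R2 *+ n = P - Q.
 apply: (good _ _ _ e'); apply/negP => x'b; case/negP: xl; apply/mapP; exists Q; last by rewrite eQ.
 rewrite inE; apply/orP; right; apply/mapP; exists (P - Q); first exact: hl e' x'b.
 by rewrite opprB addrC subrK.
have [R1 e1] : exists R1, R1 *+ n = Q by exact: good eQ xb.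
by exists (R1 + R2); rewrite mulrnDl e1 e2 addrC subrK.
Qed.
End TorsionDivision.

(** Lagrange interpolation: if all weighted power sums vanished, so would the weighted sum of the
    values of a polynomial that is zero at every point except [y0]. *)
Lemma weighted_power_sum (R : fieldType) (r : seq R) (w : R -> R) y0 :
 uniq r -> y0 \in r -> w y0 != 0 -> exists k, \sum_(y <- r) w y * y ^+ k != 0.
Proof.
move=> ur yr w0; apply/not_existsP => h.
have h0 k : \sum_(y <- r) w y * y ^+ k = 0 by apply/eqP/negP => /negP; exact: h.
pose P := \prod_(z <- rem y0 r) ('X - z%:P).
have : \sum_(y <- r) w y * P.[y] = 0.
 transitivity (\sum_(y <- r) \sum_(k < size P) P`_k * (w y * y ^+ k)).
  apply: eq_bigr => y _; rewrite horner_coef mulr_sumr; apply: eq_bigr => k _.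
  by rewrite mulrCA.
 by rewrite exchange_big big1 // => k _; rewrite -mulr_sumr h0 mulr0.
rewrite (big_rem y0) //= big1_seq ?addr0 => [/eqP|y /andP[_ yr']].
 rewrite mulf_eq0 (negbTE w0) /= -/(root P y0) root_prod_XsubC.
 by rewrite mem_rem_uniq // inE eqxx.
have /rootP -> : root P y by rewrite root_prod_XsubC.
by rewrite mulr0.
Qed.

Section Kummer.
Variables (F : fieldType) (Fb : algClosure F).
Hypothesis char0 : forall n, n.+1%:R != 0 :> Fb.

(** One element is adjoined at a time: the stabiliser of [th + n a] is the intersection of the two
    stabilisers unless [n] is one of finitely many quotients [(b - th) / (a - c)] of conjugates. *)
Lemma primitive_elt (r : seq Fb) : exists th : Fb, forall s : absGal Fb,
 s th = th <-> {in r, forall x, s x = x}.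
Proof.
elim: r => [|a r [th IH]]; first by exists 0 => s; rewrite rmorph0; split.
have [o1 _ h1] := orbit_list (fun _ : absGal Fb => True) th.
have [o2 _ h2] := orbit_list (fun _ : absGal Fb => True) a.
pose bad := [seq (b - th) / (a - c) | b <- o1, c <- o2].
have [n hn] : exists n : nat, n%:R \notin bad.
 apply/not_existsP => h.
 have : (size [seq n%:R : Fb | n <- iota 0 (size bad).+1] <= size bad)%N.
  apply: uniq_leq_size; first by rewrite map_inj_uniq ?iota_uniq //; exact: natr_inj0.
  by move=> _ /mapP[k _ ->]; apply/negP => /negP; exact: h.
 by rewrite size_map size_iota ltnn.
exists (th + n%:R * a) => s; split; last first.
 move=> h; rewrite rmorphD rmorphM rmorph_nat (h a) ?mem_head // (IH s).2 // => x xr.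
 by rewrite h // in_cons xr orbT.
move=> e x.
have sa : s a = a.
 apply/eqP/negP => /negP na; case/negP: hn; apply/allpairsP; exists (s th, s a) => /=.
 split; [by apply/h1; exists s|by apply/h2; exists s|].
 have d : a - s a != 0 by rewrite subr_eq0 eq_sym.
 apply: (mulIf d); rewrite divfK //; move: e; rewrite rmorphD rmorphM rmorph_nat => e.
 rewrite mulrBr; apply/eqP; rewrite subr_eq addrAC eq_sym subr_eq e addrC; apply/eqP.
 by rewrite addrC.
have sth : s th = th.
 by move: e; rewrite rmorphD rmorphM rmorph_nat sa => /addIr.
by rewrite inE => /orP[/eqP ->|]; [|exact: (IH s).1].
Qed.

(** Hilbert 90 with a Lagrange resolvent: [Y] is the sum of [eta(s)^-1 s(th)^k] over the [H]-orbit
    of [th], and [weighted_power_sum] provides an exponent [k] that makes it nonzero. *)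
Lemma kummer_generator (H : absGal Fb -> Prop) (eta : absGal Fb -> Fb) :
 H (gal_one Fb) -> (forall s t, H s -> H t -> H (gal_mul s t)) ->
 (forall s, H s -> H (gal_inv s)) ->
 (forall s t, H s -> H t -> eta (gal_mul s t) = eta s * eta t) ->
 (forall s t, H s -> H t -> s (eta t) = eta t) ->
 (exists r : seq Fb, forall s, H s -> {in r, forall x, s x = x} -> eta s = 1) ->
 exists2 Y, Y != 0 & forall s, H s -> s Y = eta s * Y.
Proof.
move=> H1 HM HV eM eF [r hr]; have [th hth] := primitive_elt r.
have e1 : eta (gal_one Fb) = 1 by apply: hr.
have eV s : H s -> eta (gal_inv s) * eta s = 1 by move=> hs; rewrite -eM ?gal_Vmul //; exact: HV.
have eN s : H s -> eta s != 0.
 by move=> hs; apply/eqP=> h0; have := eV s hs; rewrite h0 mulr0 => /eqP; rewrite eq_sym oner_eq0.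
have ew s t : H s -> H t -> s th = t th -> eta s = eta t.
 move=> hs ht e; have : eta (gal_mul (gal_inv t) s) = 1.
  apply: hr; first by apply: HM => //; exact: HV.
  by apply: (hth _).1; rewrite gal_mulE e gal_invK.
 rewrite eM //; last exact: HV.
 by move=> h; apply: (mulfI (eN _ (HV _ ht))); rewrite h eV.
have [o uo ho] := orbit_list H th.
have pick y : exists s, y \in o -> H s /\ y = s th.
 have [/ho[s hs ->]|ny] := boolP (y \in o); first by exists s.
 by exists (gal_one Fb).
pose sy y := sval (cid (pick y)).
have syP y : y \in o -> H (sy y) /\ y = sy y th by rewrite /sy; case: cid.
pose w y := (eta (sy y))^-1.
have tho : th \in o by apply/ho; exists (gal_one Fb).
have [k hk] := @weighted_power_sum _ o w th uo tho (invr_neq0 (eN _ (syP _ tho).1)).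
exists (\sum_(y <- o) w y * y ^+ k) => // s hs.
have pe : perm_eq [seq s y | y <- o] o.
 rewrite perm_sym; apply: perm_map_stable => //; first exact: fmorph_inj.
 move=> _ /mapP[y /ho[t ht ->] ->]; apply/ho; exists (gal_mul s t) => //; exact: HM.
rewrite rmorph_sum /= -[in RHS](perm_big _ pe) big_map mulr_sumr.
apply: eq_big_seq => y yo; rewrite rmorphM rmorphXn mulrA; congr (_ * _).
have [hsy ey] := syP _ yo.
have syo : s y \in o by apply/ho; exists (gal_mul s (sy y)); [exact: HM|rewrite gal_mulE -ey].
have [hssy essy] := syP _ syo.
rewrite /w fmorphV (eF _ _ hs hsy).
have -> : eta (sy (s y)) = eta s * eta (sy y).
 by rewrite -eM //; apply: ew => //; [exact: HM|rewrite gal_mulE -ey -essy].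
by rewrite invfM mulrA divff ?mul1r ?eN.
Qed.

Lemma poly_over_fixed (p : {poly Fb}) : (forall s : absGal Fb, map_poly s p = p) ->
 exists q : {poly F}, p = map_poly (ac_emb Fb) q.
Proof.
move=> h; have ex i : exists a, p`_i = ac_emb Fb a.
 by apply: gal_fixed => // s; rewrite -[in RHS](h s) coef_map.
exists (\poly_(i < size p) sval (cid (ex i))); apply/polyP=> i; rewrite coef_map coef_poly.
case: ltnP => hi; first by case: cid.
by rewrite nth_default //; apply/esym; exact: rmorph0.
Qed.

(** The Lagrange polynomial with value [s c] at each conjugate [s th] is invariant under the group,
    hence defined over [F]. *)
Lemma fixed_by_stabilizer (th c : Fb) :
 (forall s : absGal Fb, s th = th -> s c = c) ->
 exists g : {poly F}, c = (map_poly (ac_emb Fb) g).[th].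
Proof.
move=> hc; have [o uo ho] := orbit_list (fun _ : absGal Fb => True) th.
have pick y : exists s : absGal Fb, y \in o -> y = s th.
 have [/ho[s hs ->]|ny] := boolP (y \in o); first by exists s.
 by exists (gal_one Fb).
pose sy y := sval (cid (pick y)).
have syP y : y \in o -> y = sy y th by rewrite /sy; case: cid.
have ew (s t : absGal Fb) : s th = t th -> s c = t c.
 move=> e; have : gal_mul (gal_inv t) s c = c by apply: hc; rewrite gal_mulE e gal_invK.
 by rewrite gal_mulE => h; rewrite -[in RHS]h gal_invVK.
pose lag y := \prod_(z <- o | z != y) ((y - z)^-1 *: ('X - z%:P)).
pose g := \sum_(y <- o) (sy y c) *: lag y.
have lagE y y' : y \in o -> y' \in o -> (lag y).[y'] = (y' == y)%:R.
 move=> yo y'o; rewrite /lag horner_prod; have [->|ne] := eqVneq y' y.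
  rewrite big1 // => z zy; rewrite hornerZ hornerXsubC mulVf // subr_eq0 eq_sym //.
 by rewrite (big_rem y') //= ne hornerZ hornerXsubC subrr mulr0 mul0r.
have tho : th \in o by apply/ho; exists (gal_one Fb).
have [|q eq] := @poly_over_fixed g.
 move=> s; have pe : perm_eq [seq s y | y <- o] o.
  rewrite perm_sym; apply: perm_map_stable => //; first exact: fmorph_inj.
  by move=> _ /mapP[y /ho[t _ ->] ->]; apply/ho; exists (gal_mul s t).
 rewrite /g rmorph_sum /= -[in RHS](perm_big _ pe) big_map; apply: eq_big_seq => y yo.
 rewrite map_polyZ; congr (_ *: _).
  rewrite -[LHS]/(gal_mul s (sy y) c); apply: ew; rewrite gal_mulE -syP //.
  by rewrite -syP //; apply/ho; exists (gal_mul s (sy y)); rewrite ?gal_mulE -?syP.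
 rewrite /lag -[in RHS](perm_big _ pe) big_map rmorph_prod; apply: eq_big => z.
  by rewrite (inj_eq (fmorph_inj s)).
 by move=> _; rewrite /= map_polyZ fmorphV rmorphB /= rmorphB /= map_polyX map_polyC.
exists q; rewrite -eq /g horner_sum (big_rem th) //= hornerZ lagE // eqxx mulr1.
rewrite big1_seq ?addr0 => [|y /andP[_ yr]].
 by apply/esym; rewrite -[RHS]/(gal_one Fb c); apply: ew; rewrite -syP.
move: yr; rewrite mem_rem_uniq // !inE => /andP[ne yo].
by rewrite hornerZ lagE // eq_sym (negbTE ne) mulr0.
Qed.
End Kummer.

(** * Valuation rings and absolute values *)

Record subringP (K : fieldType) := SubringP {
 sr_mem :> K -> Prop;
 sr1 : sr_mem 1;
 srB : forall x y, sr_mem x -> sr_mem y -> sr_mem (x - y);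
 srM : forall x y, sr_mem x -> sr_mem y -> sr_mem (x * y) }.

Section SubringTheory.
Variables (K : fieldType) (S : subringP K).
Lemma sr0 : S 0. Proof. by rewrite -(subrr 1); apply: srB; exact: sr1. Qed.
Lemma srN x : S x -> S (- x).
Proof. by move=> h; rewrite -sub0r; apply: srB => //; exact: sr0. Qed.
Lemma srD x y : S x -> S y -> S (x + y).
Proof. by move=> hx hy; rewrite -[y]opprK; apply: srB => //; exact: srN. Qed.
Lemma srX x n : S x -> S (x ^+ n).
Proof. by move=> h; elim: n => [|n IH]; rewrite ?expr0 ?exprS; [exact: sr1|exact: srM]. Qed.
Lemma sr_sum I (r : seq I) (P : pred I) (E : I -> K) :
 (forall i, P i -> S (E i)) -> S (\sum_(i <- r | P i) E i).
Proof. by move=> h; elim/big_ind: _ => //; [exact: sr0|exact: srD]. Qed.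
Lemma sr_prod I (r : seq I) (P : pred I) (E : I -> K) :
 (forall i, P i -> S (E i)) -> S (\prod_(i <- r | P i) E i).
Proof. by move=> h; elim/big_ind: _ => //; [exact: sr1|exact: srM]. Qed.
Lemma sr_sum_seq (I : eqType) (r : seq I) (E : I -> K) :
 (forall i, i \in r -> S (E i)) -> S (\sum_(i <- r) E i).
Proof.
move=> h; rewrite big_seq; elim/big_ind: _ => //; [exact: sr0|exact: srD].
Qed.
Lemma sr_nat n : S n%:R.
Proof. by elim: n => [|n IH]; [exact: sr0|rewrite -natr1; apply: srD => //; exact: sr1]. Qed.
Lemma sr_int (n : int) : S n%:~R.
Proof. by case: n => n; rewrite ?NegzE ?mulrNz; [exact: sr_nat|apply: srN; exact: sr_nat]. Qed.
Lemma sr_horner (p : {poly K}) x : (forall i, S p`_i) -> S x -> S p.[x].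
Proof.
by move=> hp hx; rewrite horner_coef; apply: sr_sum => i _; apply: srM => //; exact: srX.
Qed.

Definition integ (x : K) := exists q : {poly K}, [/\ q \is monic, forall i, S q`_i & q.[x] = 0].

Definition srp : {pred K} := fun x => `[< S x >].
Lemma srp_closed : subring_closed srp.
Proof.
split; rewrite ?unfold_in; first by apply/asboolP; exact: sr1.
 by move=> x y; rewrite !unfold_in => /asboolP hx /asboolP hy; apply/asboolP; exact: srB.
by move=> x y; rewrite !unfold_in => /asboolP hx /asboolP hy; apply/asboolP; exact: srM.
Qed.
Record srt := Srt { srt_val : K; srt_p : srp srt_val }.
HB.instance Definition _ := [isSub for srt_val].
HB.instance Definition _ := [Choice of srt by <:].
HB.instance Definition _ := GRing.SubChoice_isSubComNzRing.Build K srp srt srp_closed.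

(** Passes to the library notion of integrality over the subtype [srt], from which closure under
    subtraction and multiplication is borrowed. *)
Lemma integP x : integ x <-> integralOver (val : srt -> K) x.
Proof.
split=> [[q [mq hq qx]]|[q mq /rootP qx]].
 have hq' i : srp q`_i by apply/asboolP.
 exists (\poly_(i < size q) (Sub q`_i (hq' i) : srt)).
  have sz : size (\poly_(i < size q) (Sub q`_i (hq' i) : srt)) = size q.
   rewrite size_poly_eq // -(inj_eq val_inj) SubK -lead_coefE (monicP mq).
   by rewrite rmorph0 oner_eq0.
  rewrite monicE lead_coefE sz coef_poly ltn_predL size_poly_gt0 monic_neq0 //.
 apply/rootP; rewrite -[RHS]qx; congr (_.[x]); apply/polyP=> i.
 rewrite coef_map coef_poly; case: ltnP => h; first by [].
 by rewrite nth_default //; exact: rmorph0.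
exists (map_poly val q); split=> //; first by exact: monic_map.
by move=> i; rewrite coef_map; apply/asboolP; exact: (valP q`_i).
Qed.

Lemma sub_integ x : S x -> integ x.
Proof.
move=> h; exists ('X - x%:P); split; rewrite ?monicXsubC ?hornerXsubC ?subrr //.
move=> i; rewrite coefB coefX coefC; apply: srB; [exact: sr_nat|case: eqP => _ //; exact: sr0].
Qed.

Lemma integB x y : integ x -> integ y -> integ (x - y).
Proof. by rewrite !integP; exact: integral_sub. Qed.
Lemma integM x y : integ x -> integ y -> integ (x * y).
Proof. by rewrite !integP; exact: integral_mul. Qed.
Definition integR := SubringP (sub_integ (sr1 S)) integB integM.
End SubringTheory.

Lemma integ_mono (K : fieldType) (S S' : subringP K) : (forall x, S x -> S' x) ->
 forall x, integ S x -> integ S' x.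
Proof. by move=> h x [q [mq hq qx]]; exists q; split=> // i; exact: h. Qed.

Lemma integ_map (K K' : fieldType) (g : {rmorphism K -> K'}) (S : subringP K) (S' : subringP K') :
 (forall x, S x -> S' (g x)) -> forall x, integ S x -> integ S' (g x).
Proof.
move=> h x [q [mq hq qx]]; exists (map_poly g q); split; first by rewrite map_monic.
 by move=> i; rewrite coef_map; exact: h.
by rewrite horner_map qx rmorph0.
Qed.

Record valring (K : fieldType) := Valring {
 vr_sub :> subringP K;
 vrV : forall x, x != 0 -> vr_sub x \/ vr_sub x^-1 }.

Section ValringTheory.
Variables (K : fieldType) (O : valring K).
Definition vm (x : K) := x = 0 \/ ~ O x^-1.

Lemma vm_O x : vm x -> O x.
Proof.
case=> [->|h]; first exact: sr0.
have [->|x0] := eqVneq x 0; first exact: sr0.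
by case: (vrV O x0).
Qed.
Lemma vm0 : vm 0. Proof. by left. Qed.
Lemma vm1 : ~ vm 1.
Proof. by case=> [/eqP|]; rewrite ?oner_eq0 // invr1; case; exact: sr1. Qed.
Lemma vmMl x y : O x -> vm y -> vm (x * y).
Proof.
move=> Ox; case=> [->|h]; first by rewrite mulr0; left.
have [->|x0] := eqVneq x 0; first by rewrite mul0r; left.
have [->|y0] := eqVneq y 0; first by rewrite mulr0; left.
right; rewrite invfM => h'; apply: h.
by rewrite -[y^-1](mulVKf x0); apply: srM.
Qed.
Lemma vmMr x y : O y -> vm x -> vm (x * y).
Proof. by move=> hy hx; rewrite mulrC; exact: vmMl. Qed.
Lemma vmN x : vm x -> vm (- x).
Proof. by move=> h; rewrite -mulN1r; apply: vmMl => //; apply: srN; exact: sr1. Qed.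
Lemma vmD x y : vm x -> vm y -> vm (x + y).
Proof.
move=> hx hy; have [->|x0] := eqVneq x 0; first by rewrite add0r.
have [->|y0] := eqVneq y 0; first by rewrite addr0.
have h : x / y != 0 by rewrite mulf_neq0 ?invr_eq0.
case: (vrV O h) => h'.
 have -> : x + y = (x / y + 1) * y by rewrite mulrDl divfK // mul1r.
 by apply: vmMl => //; apply: srD => //; exact: sr1.
have -> : x + y = (1 + (x / y)^-1) * x by rewrite mulrDl mul1r invf_div divfK.
by apply: vmMl => //; apply: srD => //; exact: sr1.
Qed.
Lemma vmB x y : vm x -> vm y -> vm (x - y).
Proof. by move=> hx hy; apply: vmD => //; exact: vmN. Qed.
Lemma vunit x : O x -> ~ vm x -> x != 0 /\ O x^-1.
Proof.
move=> Ox nx; have x0 : x != 0 by apply/eqP=> e; apply: nx; left.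
by split=> //; apply: contrapT => h; apply: nx; right.
Qed.
Lemma vmP x : x != 0 -> O x^-1 -> ~ vm x.
Proof. by move=> x0 h [e|//]; rewrite e eqxx in x0. Qed.
Lemma vm_prime x y : O x -> O y -> vm (x * y) -> vm x \/ vm y.
Proof.
move=> Ox Oy h; apply: contrapT => /not_orP[nx ny].
have [x0 Vx] := vunit Ox nx; have [y0 Vy] := vunit Oy ny.
by apply: (vmP _ _ h); rewrite ?mulf_neq0 // invfM; apply: srM.
Qed.
Lemma vm_exp x n : O x -> vm (x ^+ n.+1) -> vm x.
Proof.
move=> Ox; elim: n => [|n IH]; rewrite ?expr1 // exprS => /vm_prime[]//; first exact: srX.
Qed.
Lemma vm_prod (I : eqType) (r : seq I) (E : I -> K) : (forall i, i \in r -> O (E i)) ->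
 vm (\prod_(i <- r) E i) -> exists2 i, i \in r & vm (E i).
Proof.
elim: r => [|i r IH] h; first by rewrite big_nil => /vm1.
have h' j : j \in r -> O (E j) by move=> jr; apply: h; rewrite inE jr orbT.
rewrite big_cons => /vm_prime[].
- by apply: h; rewrite inE eqxx.
- by rewrite big_seq; apply: sr_prod => j jr; exact: h'.
- by move=> hi; exists i; rewrite ?inE ?eqxx.
move=> /IH[j jr|j jr hj]; first by apply: h; rewrite inE jr orbT.
by exists j; rewrite ?inE ?jr ?orbT.
Qed.
Lemma vm_sum I (r : seq I) (P : pred I) (E : I -> K) :
 (forall i, P i -> vm (E i)) -> vm (\sum_(i <- r | P i) E i).
Proof. by move=> h; elim/big_ind: _ => //; [exact: vm0|exact: vmD]. Qed.
Lemma vinv_vm x : ~ O x -> vm x^-1.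
Proof. by move=> h; right; rewrite invrK. Qed.
Lemma v_not_O x : ~ O x -> x != 0.
Proof. by move=> h; apply/eqP=> e; apply: h; rewrite e; exact: sr0. Qed.

(** If [x] were outside [O], dividing the equation by [x^n] would write 1 as a sum of elements of
    the maximal ideal. *)
Lemma vr_integ x : integ O x -> O x.
Proof.
move=> [q [mq hq qx]]; apply: contrapT => nx; have x0 := v_not_O nx.
have sz : (0 < size q)%N by rewrite size_poly_gt0 monic_neq0.
have : vm 1; last exact: vm1.
pose n := (size q).-1.
have en : size q = n.+1 by rewrite prednK.
have e : q.[x] = \sum_(i < n) q`_i * x ^+ i + x ^+ n.
 by rewrite horner_coef en big_ord_recr /= -[n in q`_n]/(n.+1.-1) -en -lead_coefE (monicP mq) mul1r.
rewrite e in qx; have : 1 = - \sum_(i < n) q`_i * (x^-1) ^+ (n - i).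
 apply: (mulIf (expf_neq0 n x0)); rewrite mul1r mulNr mulr_suml.
 transitivity (- \sum_(i < n) q`_i * x ^+ i).
  by apply/eqP; rewrite -addr_eq0 addrC; apply/eqP.
 congr (- _); apply: eq_bigr => i _.
 rewrite -mulrA exprVn; congr (_ * _).
 have -> : x ^+ n = x ^+ (n - i) * x ^+ i by rewrite -exprD subnK // ltnW.
 by rewrite mulKf ?expf_neq0.
move->; apply: vmN; apply: vm_sum => i _; apply: vmMl => //.
have : (0 < n - i)%N by rewrite subn_gt0.
case: (n - i)%N => // k _; rewrite exprSr; apply: vmMl; last exact: vinv_vm.
by apply: srX; apply: vm_O; exact: vinv_vm.
Qed.
End ValringTheory.

Section MaxQuotient.
Variables (T : comPzRingType) (B N : T -> Prop).
Hypotheses (B1 : B 1) (BB : forall x y, B x -> B y -> B (x - y))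
 (BM : forall x y, B x -> B y -> B (x * y)).
Hypotheses (NB : forall x, N x -> B x) (NS : forall x y, N x -> N y -> N (x - y))
 (NM : forall x y, B x -> N y -> N (x * y)) (N1 : ~ N 1) (N0 : N 0).
Hypothesis Nmax : forall x, B x -> ~ N x -> exists2 y, B y & N (x * y - 1).

(** Ring and maximal ideal are predicates on a larger ring, which lets one construction produce
    residue fields, completions (Cauchy modulo null sequences) and an ultraproduct. *)
Lemma max_quotient : exists (k : fieldType) (pi : T -> k), [/\ pi 1 = 1,
 forall x y, B x -> B y -> pi (x - y) = pi x - pi y,
 forall x y, B x -> B y -> pi (x * y) = pi x * pi y,
 forall a, exists2 x, B x & pi x = a & forall x, B x -> (pi x = 0 <-> N x)].
Proof.
have B0 : B 0 by exact: NB.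
have BN x : B x -> B (- x) by move=> h; rewrite -sub0r; exact: BB.
have BD x y : B x -> B y -> B (x + y) by move=> hx hy; rewrite -[y]opprK; apply: (BB) => //; exact: BN.
have NN x : N x -> N (- x) by move=> h; rewrite -sub0r; exact: NS.
have ND x y : N x -> N y -> N (x + y) by move=> hx hy; rewrite -[y]opprK; apply: (NS) => //; exact: NN.
(* A canonical representative: it is drawn from the whole class of [x], so congruent elements have
   the same one. *)
pose rep x := xget 0 [set y | B y /\ N (x - y)]%classic.
have repP x : B x -> B (rep x) /\ N (x - rep x).
 move=> hx; have h : B x /\ N (x - x) by rewrite subrr.
 exact: (@xgetI T 0 (fun y => B y /\ N (x - y)) x h).
have repE x y : N (x - y) -> rep x = rep y.
 move=> h; rewrite /rep; congr (xget 0 _); apply/seteqP; split=> z [Bz Nz]; split=> //.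
  by rewrite (_ : y - z = (x - z) - (x - y)); [exact: NS|rewrite opprB [RHS]addrC addrA subrK].
 by rewrite (_ : x - z = (x - y) + (y - z)); [exact: ND|rewrite addrA subrK].
have repK x : B x -> rep (rep x) = rep x.
 by move=> hx; apply: repE; rewrite -opprB; apply: NN; case: (repP x hx).
pose Q := {x : T | `[< B x /\ rep x = x >]}.
have mkP x : B x -> `[< B (rep x) /\ rep (rep x) = rep x >].
 by move=> hx; apply/asboolP; split; [case: (repP x hx)|exact: repK].
pose mk x : Q := match pselect (B x) with left h => exist _ (rep x) (mkP x h) | right _ => exist _ (rep 0) (mkP 0 B0) end.
have mkE x : B x -> sval (mk x) = rep x by rewrite /mk; case: pselect.
have vB (a : Q) : B (sval a) by case: a => x /= /asboolP[].
have vR (a : Q) : rep (sval a) = sval a by case: a => x /= /asboolP[].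
have mkV (a : Q) : mk (sval a) = a by apply: val_inj; rewrite /= mkE.
have mk_eq x y : B x -> B y -> (mk x = mk y <-> N (x - y)).
 move=> hx hy; split=> [e|h]; last by apply: val_inj; rewrite /= !mkE //; exact: repE.
 have := congr1 sval e; rewrite !mkE // => er.
 rewrite (_ : x - y = (x - rep x) - (y - rep y)).
  by apply: NS; [case: (repP x hx)|case: (repP y hy)].
 by rewrite er opprB addrA subrK.
have mkr x : B x -> N (sval (mk x) - x).
 by move=> hx; rewrite mkE // -opprB; apply: NN; case: (repP x hx).
pose qadd (a b : Q) := mk (sval a + sval b); pose qopp (a : Q) := mk (- sval a).
pose qmul (a b : Q) := mk (sval a * sval b).
have qaddE x y : B x -> B y -> qadd (mk x) (mk y) = mk (x + y).
 move=> hx hy; apply/mk_eq; [by apply: BD|exact: BD|].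
 rewrite opprD addrACA; apply: ND; exact: mkr.
have qmulE x y : B x -> B y -> qmul (mk x) (mk y) = mk (x * y).
 move=> hx hy; apply/mk_eq; [by apply: BM|exact: BM|].
 rewrite (_ : _ - _ = sval (mk x) * (sval (mk y) - y) + y * (sval (mk x) - x)).
  by apply: ND; apply: NM => //; exact: mkr.
 by rewrite !mulrBr addrA [y * _]mulrC subrK [y * x]mulrC.
have qoppE x : B x -> qopp (mk x) = mk (- x).
 move=> hx; apply/mk_eq; [by apply: BN|exact: BN|].
 by rewrite -opprD; apply: NN; exact: mkr.
have addA : associative qadd.
 by move=> a b c; rewrite -(mkV a) -(mkV b) -(mkV c) !qaddE ?addrA //; apply: BD.
have addC : commutative qadd by move=> a b; rewrite /qadd addrC.
have add0 : left_id (mk 0) qadd by move=> a; rewrite -(mkV a) qaddE // add0r.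
have addN : left_inverse (mk 0) qopp qadd.
 by move=> a; rewrite -(mkV a) qoppE // qaddE ?addNr //; exact: BN.
pose Z := GRing.isZmodule.Build Q addA addC add0 addN.
pose QZ : zmodType := HB.pack Q Z.
have mulA : associative (qmul : QZ -> QZ -> QZ).
 by move=> a b c; rewrite -(mkV a) -(mkV b) -(mkV c) !qmulE ?mulrA //; apply: BM.
have mulC : commutative (qmul : QZ -> QZ -> QZ) by move=> a b; rewrite /qmul mulrC.
have mul1 : left_id (mk 1 : QZ) (qmul : QZ -> QZ -> QZ) by move=> a; rewrite -(mkV a) qmulE // mul1r.
have mulD : left_distributive (qmul : QZ -> QZ -> QZ) +%R.
 move=> a b c; rewrite -[a]mkV -[b]mkV -[c]mkV -[_ + _ in LHS]/(qadd _ _) -[_ + _ in RHS]/(qadd _ _).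
 rewrite (qaddE (sval (a : Q)) (sval (b : Q))) // (qmulE (sval (a : Q) + sval (b : Q))) //; last exact: BD.
 rewrite (qmulE (sval (a : Q))) // (qmulE (sval (b : Q))) // qaddE; [by rewrite mulrDl| |]; exact: BM.
have one0 : (mk 1 : QZ) != 0.
 apply/eqP => /(mk_eq _ _ B1 B0); by rewrite subr0.
pose C := GRing.Zmodule_isComNzRing.Build QZ mulA mulC mul1 mulD one0.
pose QC : comNzRingType := HB.pack Q Z C.
have exinv (a : QC) : exists b : QC, (a != 0 -> b * a = 1) /\ (a = 0 -> b = 0).
 have [->|a0] := eqVneq a 0; first by exists 0; split; rewrite ?eqxx.
 have na : ~ N (sval (a : Q)).
  by move=> h; case/eqP: a0; rewrite -[a]mkV; apply/mk_eq; rewrite ?subr0.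
 have [y By Ny] := Nmax (vB a) na; exists (mk y); split=> [_|e]; last by rewrite e eqxx in a0.
 rewrite -[a]mkV -[LHS]/(qmul _ _) qmulE //; apply/mk_eq => //; first exact: BM.
 by rewrite mulrC.
pose inv (a : QC) : QC := sval (cid (exinv a)).
have mulV (a : QC) : a != 0 -> inv a * a = 1 by rewrite /inv; case: cid => b [].
have inv0 : inv 0 = 0 by rewrite /inv; case: cid => b /= [_ h]; exact: h.
pose Fm := GRing.ComNzRing_isField.Build QC mulV inv0.
pose k : fieldType := HB.pack Q Z C Fm.
exists k, (mk : T -> k); split=> //.
- move=> x y hx hy; rewrite -[RHS]/(qadd (mk x) (qopp (mk y))) qoppE // qaddE //.
 exact: BN.
- by move=> x y hx hy; rewrite -[RHS]/(qmul (mk x) (mk y)) qmulE.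
- by move=> a; exists (sval (a : Q)) => //; exact: mkV.
- by move=> x hx; rewrite -[0]/(mk 0) mk_eq // subr0.
Qed.
End MaxQuotient.

Section AbsValTheory.
Variables (R : realType) (F : fieldType) (v : absVal R F).
Lemma av0 : v 0 = 0. Proof. by apply/av_eq0. Qed.
Lemma av_neq0 x : x != 0 -> 0 < v x.
Proof.
move=> x0; rewrite lt_neqAle av_ge0 andbT; apply/eqP=> h.
by move: x0; rewrite (proj1 (av_eq0 v x) (esym h)) eqxx.
Qed.
Lemma av1 : v 1 = 1.
Proof.
have h : v 1 * v 1 = v 1 by rewrite -av_mul mulr1.
by apply: (mulfI (lt0r_neq0 (av_neq0 (oner_neq0 F)))); rewrite h mulr1.
Qed.
Lemma avN1 : v (-1) = 1.
Proof.
have h : v (-1) ^+ 2 = 1 by rewrite expr2 -av_mul mulrNN mulr1 av1.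
move/eqP: h; rewrite sqrf_eq1 => /orP[/eqP//|/eqP h].
by have := av_ge0 v (-1); rewrite h ler0N1.
Qed.
Lemma avN x : v (- x) = v x.
Proof. by rewrite -mulN1r av_mul avN1 mul1r. Qed.
Lemma avB x y : v (x - y) <= v x + v y.
Proof. by rewrite -(avN y); exact: av_add. Qed.
Lemma avX x n : v (x ^+ n) = v x ^+ n.
Proof. by elim: n => [|n IH]; rewrite ?expr0 ?av1 // !exprS av_mul IH. Qed.
Lemma avV x : v x^-1 = (v x)^-1.
Proof.
have [->|x0] := eqVneq x 0; first by rewrite invr0 av0 invr0.
apply: (mulfI (lt0r_neq0 (av_neq0 x0))); rewrite -av_mul divff // av1 divff //.
exact: lt0r_neq0 (av_neq0 x0).
Qed.
Lemma av_prod I (r : seq I) (P : pred I) (E : I -> F) :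
 v (\prod_(i <- r | P i) E i) = \prod_(i <- r | P i) v (E i).
Proof. exact: (big_morph _ (av_mul v) av1). Qed.
End AbsValTheory.

Lemma bernoulli (R : realType) (d : R) n : 0 <= d -> 1 + n%:R * d <= (1 + d) ^+ n.
Proof.
move=> d0; elim: n => [|n IH]; first by rewrite mul0r addr0 expr0.
rewrite exprS; apply: (le_trans _ (ler_wpM2l _ IH)); last by rewrite addr_ge0.
have h : 0 <= n%:R * (d * d) by rewrite !mulr_ge0.
by rewrite -natr1; nra.
Qed.

Lemma expr_small (R : realType) (c e : R) : 0 <= c -> c < 1 -> 0 < e -> exists n : nat, c ^+ n < e.
Proof.
move=> c0 c1 e0; have [->|cn0] := eqVneq c 0; first by exists 1%N; rewrite expr1.
have cp : 0 < c by rewrite lt_neqAle eq_sym cn0.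
pose d := c^-1 - 1; have d0 : 0 < d by rewrite subr_gt0 invf_gt1.
have [n hn] : exists n : nat, e^-1 / d < n%:R.
 exists (Num.Def.archi_bound (e^-1 / d)); apply: archi_boundP.
 by rewrite divr_ge0 // ?invr_ge0 ltW.
exists n; rewrite -[c]invrK exprVn invf_plt ?posrE ?exprn_gt0 ?invr_gt0 //.
have -> : c^-1 = 1 + d by rewrite addrC subrK.
apply: (lt_le_trans _ (bernoulli n (ltW d0))).
by rewrite ltr_pdivrMr // in hn; apply: (lt_le_trans hn); rewrite lerDr.
Qed.

(** * Hensel factorisation over a complete nonarchimedean field *)

Section Hensel.
Variables (R : realType) (F : fieldType) (v : absVal R F).
Hypothesis na : forall x y, v (x + y) <= Num.max (v x) (v y).
Hypothesis complete : forall u : nat -> F,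
 (forall e : R, 0 < e -> exists N, forall m n,
   (N <= m)%N -> (N <= n)%N -> v (u m - u n) < e) ->
 exists l, forall e : R, 0 < e -> exists N, forall n, (N <= n)%N -> v (u n - l) < e.

Lemma na_add_le c x y : v x <= c -> v y <= c -> v (x + y) <= c.
Proof. by move=> hx hy; apply: (le_trans (na x y)); rewrite ge_max hx. Qed.
Lemma naB c x y : v x <= c -> v y <= c -> v (x - y) <= c.
Proof. by move=> hx hy; apply: na_add_le; rewrite ?avN. Qed.
Lemma na_sum I (r : seq I) (P : pred I) (E : I -> F) c : 0 <= c ->
 (forall i, P i -> v (E i) <= c) -> v (\sum_(i <- r | P i) E i) <= c.
Proof. by move=> c0 h; elim/big_ind: _ => //; [rewrite av0|exact: na_add_le]. Qed.

Definition gb c (p : {poly F}) := forall i, v p`_i <= c.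

Lemma gbD c p q : gb c p -> gb c q -> gb c (p + q).
Proof. by move=> hp hq i; rewrite coefD; exact: na_add_le. Qed.
Lemma gbB c p q : gb c p -> gb c q -> gb c (p - q).
Proof. by move=> hp hq i; rewrite coefB; exact: naB. Qed.
Lemma gbM c d p q : 0 <= c -> 0 <= d -> gb c p -> gb d q -> gb (c * d) (p * q).
Proof.
move=> c0 d0 hp hq i; rewrite coefM; apply: na_sum; first exact: mulr_ge0.
by move=> j _; rewrite av_mul; apply: ler_pM => //; exact: av_ge0.
Qed.
Lemma gb_le c d p : c <= d -> gb c p -> gb d p.
Proof. by move=> h hp i; exact: le_trans (hp i) h. Qed.

Lemma gb_div c (g e : {poly F}) : 0 <= c -> g \is monic -> gb 1 g -> gb c e ->
 exists q r, [/\ e = q * g + r, (size r < size g)%N, gb c q, gb c r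
  & (size q <= size e - (size g).-1)%N].
Proof.
move=> c0 mg hg; have g0 : (0 < size g)%N by rewrite size_poly_gt0 monic_neq0.
have [k] := ubnP (size e); elim: k e => // k IH e szk he.
have gb0 : gb c 0 by move=> i; rewrite coef0 av0.
have [lt|ge] := ltnP (size e) (size g).
 by exists 0, e; split; rewrite ?mul0r ?add0r ?size_poly0.
have e0 : (0 < size e)%N by exact: leq_trans ge.
pose a := lead_coef e; pose m := a%:P * 'X^(size e - size g).
pose e' := e - m * g.
have hm : gb c m.
 move=> i; rewrite /m coefCM coefXn av_mul; case: eqP => _ /=; rewrite ?av1 ?av0 ?mulr1 ?mulr0 //.
 exact: he.
have sz' : (size e' < size e)%N.
 apply: (leq_ltn_trans (n := (size e).-1)); last by rewrite ltn_predL.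
 apply/leq_sizeP => j lj; rewrite coefB -mulrA coefCM coefXnM.
 have -> : (j < size e - size g)%N = false by lia.
 have [ej|nj] := eqVneq j (size e).-1.
  have -> : (j - (size e - size g))%N = (size g).-1 by lia.
  by rewrite -lead_coefE (monicP mg) mulr1 ej -lead_coefE subrr.
 have c1 : (size e <= j)%N by lia.
 have c2 : (size g <= j - (size e - size g))%N by lia.
 by rewrite (nth_default _ c1) (nth_default _ c2) mulr0 subrr.
have he' : gb c e' by apply: gbB => //; rewrite -[c]mulr1; apply: gbM.
have [q [r [ee sr hq hr sq]]] := IH e' (leq_trans sz' szk) he'.
exists (m + q), r; split=> //; last 1 first.
- apply: leq_trans (size_polyD _ _) _; rewrite geq_max; apply/andP; split.
  apply: leq_trans (size_polyMleq _ _) _; rewrite size_polyXn.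
  have := size_polyC_leq1 a; lia.
 by apply: (leq_trans sq); lia.
- by rewrite mulrDl -addrA -ee /e' addrC subrK.
- exact: gbD.
Qed.

Lemma geom_limit (u : nat -> F) (e : R) : 0 <= e -> e < 1 ->
 (forall n, v (u n.+1 - u n) <= e ^+ n) -> exists l, forall n, v (u n - l) <= e ^+ n.
Proof.
move=> e0 e1 h.
have mono m n : (n <= m)%N -> e ^+ m <= e ^+ n by move=> le; apply: ler_wiXn2l; rewrite // ltW.
have hmn m n : (n <= m)%N -> v (u m - u n) <= e ^+ n.
 move=> /subnK <-; elim: (m - n)%N => [|k IH]; first by rewrite subrr av0 exprn_ge0.
 rewrite addSn -[_ - _](subrKA (u (k + n)%N)); apply: na_add_le => //.
 by apply: (le_trans (h _)); apply: mono; rewrite leq_addl.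
have [l hl] : exists l, forall e : R, 0 < e -> exists N, forall n, (N <= n)%N -> v (u n - l) < e.
 apply: complete => d d0; have [N hN] := expr_small e0 e1 d0; exists N => m n hm hn.
 apply: (le_lt_trans _ hN); rewrite -[_ - _](subrKA (u N)); apply: na_add_le; first exact: hmn.
 by rewrite -avN opprB; exact: hmn.
exists l => n; rewrite leNgt; apply/negP => lt.
have d0 : 0 < v (u n - l) by apply: le_lt_trans lt; exact: exprn_ge0.
have [N hN] := hl _ d0.
pose m := maxn N n.
have h1 := hN m (leq_maxl _ _).
have : v (u n - l) <= Num.max (e ^+ n) (v (u m - l)).
 rewrite -[u n - l](subrKA (u m)); apply: (le_trans (na _ _)).
 rewrite ge_max !le_max lexx orbT andbT; apply/orP; left.
 by rewrite -avN opprB; apply: hmn; exact: leq_maxr.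
by rewrite le_max leNgt lt /= leNgt h1.
Qed.

(** Start from the truncation of [f] at degree [r] with cofactor 1. Dividing the error by the monic
    factor corrects both factors, and the error bound gains a factor [e] each time. *)
Lemma hensel_factor (f : {poly F}) (r : nat) : gb 1 f -> f`_r = 1 ->
 (forall i, (r < i)%N -> v f`_i < 1) -> (r < size f)%N ->
 exists g h : {poly F}, [/\ f = g * h, size g = r.+1 & g \is monic].
Proof.
move=> hf fr flt rs.
(* The default [2^-1] keeps [e] positive when the coefficients above [r] vanish. *)
pose e := \big[Num.max/2^-1]_(i < size f | (r < i)%N) v f`_i.
have e1 : e < 1.
 by apply/bigmax_ltP; split; [rewrite invf_lt1 ?ltr1n|move=> i; exact: flt].
have e0 : 0 < e.
 by apply: (lt_le_trans (_ : 0 < 2^-1)); rewrite ?invr_gt0 //; exact: bigmax_ge_id.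
have ele i : (r < i)%N -> v f`_i <= e.
 move=> ri; have [lt|ge] := ltnP i (size f); last by rewrite nth_default // av0 ltW.
 exact: (@le_bigmax_cond _ _ _ _ (Ordinal lt) (fun i : 'I_(size f) => (r < i)%N) (fun i => v f`_i)).
have en n : 0 <= e ^+ n by apply: exprn_ge0; exact: ltW.
pose s := (size f - r)%N.
pose inv n (x : {poly F} * {poly F}) := [/\ x.1 \is monic, size x.1 = r.+1, gb 1 x.1,
 gb e (x.2 - 1) & (size x.2 <= s)%N /\ gb (e ^+ n.+1) (f - x.1 * x.2)].
have gb1 : gb 1 1 by move=> i; rewrite coefC; case: eqP => _; rewrite ?av1 ?av0.
have step n x : inv n x -> exists y, [/\ inv n.+1 y, gb (e ^+ n) (y.1 - x.1) & gb (e ^+ n) (y.2 - x.2)].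
 case: x => g h [/= mg sg hg hh [sh he]].
 have [q [t [ee st hq ht sq]]] := gb_div (en n.+1) mg hg he.
 have le1 : e ^+ n.+1 <= 1 by rewrite exprn_ile1 // ltW.
 have leE : e ^+ n.+1 <= e by rewrite exprS ler_piMr ?exprn_ile1 // ltW.
 have leS : e ^+ n.+1 <= e ^+ n by rewrite exprS ler_piMl // ltW.
 have sgt : size (g + t) = r.+1 by rewrite size_polyDl ?sg // -sg.
 have mgt : g + t \is monic by rewrite monicE lead_coefDl // (monicP mg).
 exists (g + t, h + q); split; last 2 first.
 - by rewrite /= addrC addKr; exact: gb_le ht.
 - by rewrite /= addrC addKr; exact: gb_le hq.
 split=> //=.
 - by apply: gbD => //; exact: gb_le ht.
 - by rewrite addrAC; apply: gbD => //; exact: gb_le hq.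
 - split.
   apply: leq_trans (size_polyD _ _) _; rewrite geq_max sh /=.
   apply: (leq_trans sq); rewrite sg /s leq_sub2r //.
   apply: leq_trans (size_polyD _ _) _; rewrite size_polyN geq_max leqnn /=.
   by apply: leq_trans (size_polyMleq _ _) _; rewrite sg addSn; apply: (leq_trans (leq_add (leqnn r) sh)); rewrite /s subnKC // ltnW.
  have -> : f - (g + t) * (h + q) = - (t * (h - 1)) - t * q.
   transitivity ((f - g * h) - q * g - t * h - t * q); first by ring.
   by rewrite ee; ring.
  apply: gbB.
   have := gbM (en n.+1) (ltW e0) ht hh; rewrite -exprSr => h1 i.
   by rewrite coefN avN; exact: h1.
  apply: (@gb_le (e ^+ n.+1 * e ^+ n.+1)); last exact: gbM.
  by rewrite [X in _ <= X]exprSr ler_wpM2l.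
(* The default [(0, 0)] is never reached, since the invariant holds at every stage. *)
pose st := fix st n := match n with
 | 0 => (\poly_(i < r.+1) f`_i, 1)
 | n.+1 => if pselect (inv n (st n)) is left h then sval (cid (step n (st n) h)) else (0, 0) end.
have inv0 : inv 0%N (st 0%N).
 have mg : (\poly_(i < r.+1) f`_i) \is monic.
  by rewrite monicE lead_coefE size_poly_eq ?fr ?oner_eq0 //= coef_poly ltnSn fr.
 split=> //=.
 - by rewrite size_poly_eq ?fr ?oner_eq0.
 - by move=> i; rewrite coef_poly; case: ifP => _; rewrite ?av0.
 - by rewrite subrr => i; rewrite coef0 av0 ltW.
 - split; first by rewrite size_poly1 subn_gt0.
  move=> i; rewrite mulr1 coefB coef_poly expr1; case: ltnP => h; first by rewrite subrr av0 ltW.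
  by rewrite subr0; exact: ele.
have invS n : inv n (st n) -> [/\ inv n.+1 (st n.+1), gb (e ^+ n) ((st n.+1).1 - (st n).1)
  & gb (e ^+ n) ((st n.+1).2 - (st n).2)].
 by move=> h /=; case: pselect => // h'; case: cid.
have invn n : inv n (st n) by elim: n => [//|n IH]; case: (invS n IH).
have lim1 i : exists l, forall n, v ((st n).1`_i - l) <= e ^+ n.
 by apply: geom_limit => //; [exact: ltW|move=> n; case: (invS n (invn n)) => _ h _; rewrite -coefB; exact: h].
have lim2 i : exists l, forall n, v ((st n).2`_i - l) <= e ^+ n.
 by apply: geom_limit => //; [exact: ltW|move=> n; case: (invS n (invn n)) => _ _ h; rewrite -coefB; exact: h].
have small x : (forall n, v x <= e ^+ n) -> x = 0.
 move=> h; apply/eqP; apply: contraT => x0.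
 have [n hn] := expr_small (ltW e0) e1 (av_neq0 v x0).
 by move: (h n); rewrite leNgt hn.
pose g := \poly_(i < r.+1) sval (cid (lim1 i)); pose h := \poly_(i < s) sval (cid (lim2 i)).
have hg n : gb (e ^+ n) ((st n).1 - g).
 move=> i; rewrite coefB coef_poly; case: ltnP => hi; first by case: cid.
 by case: (invn n) => _ sg _ _ _; rewrite nth_default ?sg // subr0 av0.
have hh n : gb (e ^+ n) ((st n).2 - h).
 move=> i; rewrite coefB coef_poly; case: ltnP => hi; first by case: cid.
 by case: (invn n) => _ _ _ _ [sh _]; rewrite nth_default ?(leq_trans sh) // subr0 av0.
have gr : g`_r = 1.
 apply/eqP; rewrite -subr_eq0 -opprB oppr_eq0; apply/eqP/small => n.
 have := hg n r; rewrite coefB; case: (invn n) => mg sg _ _ _.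
 by have := monicP mg; rewrite lead_coefE sg /= => ->.
have sg : size g = r.+1.
 by rewrite size_poly_eq //; move: gr; rewrite coef_poly ltnSn => ->; rewrite oner_eq0.
have g1 : gb 1 g.
 have -> : g = (st 0%N).1 - ((st 0%N).1 - g) by rewrite opprB addrC subrK.
 by apply: gbB; [case: (invn 0%N)|have := hg 0%N; rewrite expr0].
exists g, h; split=> //; last by rewrite monicE lead_coefE sg /= gr.
apply/eqP; rewrite -subr_eq0; apply/eqP/polyP=> i; rewrite coef0; apply: small => n.
case: (invn n) => mg sgn hgn hhn [_ hen].
have -> : f - g * h = (f - (st n).1 * (st n).2) + (((st n).1 - g) * (st n).2 + g * ((st n).2 - h)) by ring.
have h2 : gb 1 (st n).2.
 rewrite -[(st n).2](subrK 1); apply: gbD => //; apply: gb_le hhn; exact: ltW.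
apply: gbD.
 by apply: gb_le hen; rewrite exprS ler_piMl // ltW.
by apply: gbD; rewrite -[e ^+ n]mulr1; [|rewrite mulrC]; apply: gbM.
Qed.
End Hensel.

Section IntegralClosure.
Variables (R : realType) (F : fieldType) (v : absVal R F) (Fb : algClosure F).
Hypothesis na : forall x y, v (x + y) <= Num.max (v x) (v y).
Hypothesis complete : forall u : nat -> F,
 (forall e : R, 0 < e -> exists N, forall m n,
   (N <= m)%N -> (N <= n)%N -> v (u m - u n) < e) ->
 exists l, forall e : R, 0 < e -> exists N, forall n, (N <= n)%N -> v (u n - l) < e.
Local Notation emb := (ac_emb Fb).

(** Suppose a coefficient exceeds this bound. Scaled by its last coefficient of largest absolute
    value, the polynomial satisfies the hypotheses of [hensel_factor] and splits properly, against
    minimality. *)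
Lemma min_poly_bound (x : Fb) (q : {poly F}) : q \is monic ->
 (map_poly emb q).[x] = 0 ->
 (forall p : {poly F}, (map_poly emb p).[x] = 0 -> q %| p) ->
 forall i, v q`_i <= Num.max 1 (v q`_0).
Proof.
move=> mq qx qmin i0; rewrite leNgt; apply/negP => hi0.
have q0 := monic_neq0 mq.
have sq : (0 < size q)%N by rewrite size_poly_gt0.
pose c := \big[Num.max/0]_(i < size q) v q`_i.
have cle i : v q`_i <= c.
 have [lt|ge] := ltnP i (size q); last by rewrite nth_default // av0 bigmax_ge_id.
 exact: (@le_bigmax_cond _ _ _ _ (Ordinal lt) predT (fun i => v q`_i)).
have cgt : Num.max 1 (v q`_0) < c by exact: lt_le_trans hi0 (cle i0).
move: (cgt); rewrite gt_max => /andP[c1 cq0].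
have c0 : 0 < c by exact: lt_trans c1.
pose P j := (j < size q)%N && (v q`_j == c).
have exP : exists j, P j.
 have [j _ /esym ej] : exists2 j : 'I_(size q), true & c = v q`_j.
  have [|j _ ej] := @eq_bigmax _ R 'I_(size q) 0 (Ordinal sq) predT (fun i => v q`_i) isT.
   by move=> k _; exact: av_ge0.
  by exists j.
 by exists j; rewrite /P ltn_ord; apply/eqP.
have Pb j : P j -> (j <= size q)%N by case/andP=> /ltnW.
case: (ex_maxnP exP Pb) => r /andP[rs /eqP er] rmax.
have qr0 : q`_r != 0 by apply: contraTneq c0 => h; rewrite -er h av0 ltxx.
have [||||g [h [eg sg mg]]] := @hensel_factor R F v na complete ((q`_r)^-1 *: q) r.
- by move=> i; rewrite coefZ av_mul avV er mulrC ler_pdivrMr // mul1r.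
- by rewrite coefZ mulVf.
- move=> i ri; rewrite coefZ av_mul avV er mulrC ltr_pdivrMr // mul1r.
 rewrite lt_neqAle cle andbT; apply/eqP => ei.
 have [lt|ge] := ltnP i (size q); last first.
  by rewrite nth_default // av0 in ei; rewrite -ei ltxx in c0.
 by have := rmax i; rewrite /P lt ei eqxx => /(_ isT); rewrite leqNgt ri.
- by rewrite size_scale ?invr_eq0.
have r0 : (0 < r)%N by rewrite lt0n; apply/eqP=> e; rewrite -er e ltxx in cq0.
have rl : (r.+1 < size q)%N.
 rewrite ltn_neqAle rs andbT; apply/eqP => e.
 by rewrite -er -[r]/(r.+1.-1) e -lead_coefE (monicP mq) av1 ltxx in c1.
have eq : q = g * (q`_r *: h).
 by rewrite -scalerAr -eg scalerA mulfV // scale1r.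
have : (map_poly emb g).[x] * (map_poly emb h).[x] = 0.
 have := qx; rewrite {1}eq rmorphM /= hornerM map_polyZ hornerZ mulrCA => /eqP.
 by rewrite mulf_eq0 fmorph_eq0 (negbTE qr0) /= => /eqP.
move/eqP; rewrite mulf_eq0 => /orP[]/eqP/qmin hd.
 by have := dvdp_leq (monic_neq0 mg) hd; rewrite sg leqNgt rl.
have h0 : h != 0.
 by apply: contraTneq q0 => e; rewrite eq e scaler0 mulr0 eqxx.
have := dvdp_leq h0 hd; rewrite leqNgt; case/negP.
have -> : size q = size (g * (q`_r *: h)) by rewrite -eq.
have h1 : q`_r *: h != 0 by rewrite scaler_eq0 negb_or qr0.
rewrite (size_mul (monic_neq0 mg) h1) sg size_scale //.
by rewrite addSn /= -{1}[size h]add0n ltn_add2r.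
Qed.

Definition vOF_mem (x : Fb) := exists2 a, v a <= 1 & x = emb a.
Lemma vOF1 : vOF_mem 1. Proof. by exists 1; rewrite ?av1 ?rmorph1. Qed.
Lemma vOFB x y : vOF_mem x -> vOF_mem y -> vOF_mem (x - y).
Proof.
by move=> [a ha ->] [b hb ->]; exists (a - b); rewrite ?rmorphB //; exact: naB.
Qed.
Lemma vOFM x y : vOF_mem x -> vOF_mem y -> vOF_mem (x * y).
Proof.
move=> [a ha ->] [b hb ->]; exists (a * b); rewrite ?rmorphM // av_mul.
by rewrite mulr_ile1 ?av_ge0.
Qed.
Definition vOF := SubringP vOF1 vOFB vOFM.
Definition Ob := integR vOF.

Lemma Ob_poly (x : Fb) (q : {poly F}) : q \is monic -> (forall i, v q`_i <= 1) ->
 (map_poly emb q).[x] = 0 -> Ob x.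
Proof.
move=> mq hq qx; exists (map_poly emb q); split=> //; first by rewrite map_monic.
by move=> i; rewrite coef_map; exists q`_i.
Qed.

(** If the constant term of the minimal polynomial is integral, so are all coefficients by
    [min_poly_bound]. Otherwise the reversed polynomial, divided by that constant term, is an
    integral equation of [x^-1]. *)
Lemma Ob_val (x : Fb) : x != 0 -> Ob x \/ Ob x^-1.
Proof.
move=> x0; have [q [mq qx qmin]] := min_poly_ex x.
have hb := min_poly_bound mq qx qmin.
have [h1|h1] := lerP (v q`_0) 1.
 left; apply: (Ob_poly mq) => // i; apply: (le_trans (hb i)).
 by rewrite ge_max lexx.
right; have q00 : q`_0 != 0 by apply: contraTneq h1 => ->; rewrite av0 ltNge ler01.
pose n := (size q).-1; have sq : size q = n.+1 by rewrite prednK // size_poly_gt0 monic_neq0.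
pose p := \poly_(j < n.+1) (q`_(n - j) / q`_0).
have pn : p`_n = 1 by rewrite coef_poly ltnSn subnn divff.
have sp : size p = n.+1 by rewrite size_poly_eq // subnn divff ?oner_eq0.
apply: (@Ob_poly _ p).
- by rewrite monicE lead_coefE sp /= pn.
- move=> i; rewrite coef_poly; case: ifP => _; rewrite ?av0 // av_mul avV.
 rewrite ler_pdivrMr ?mul1r ?av_neq0 //; apply: (le_trans (hb _)).
 by rewrite ge_max lexx andbT ltW.
apply: (mulIf (expf_neq0 n x0)); rewrite mul0r.
rewrite horner_coef size_map_poly sp mulr_suml.
transitivity (emb (q`_0)^-1 * (map_poly emb q).[x]); last by rewrite qx mulr0.
rewrite horner_coef size_map_poly sq mulr_sumr.
rewrite (reindex_inj rev_ord_inj) /=; apply: eq_bigr => i _.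
rewrite !coef_map /= subSS coef_poly ltnS leq_subr subKn ?leq_ord // rmorphM.
rewrite [emb q`_i * _]mulrC -!mulrA; congr (_ * (_ * _)).
have -> : x ^+ n = x ^+ (n - i) * x ^+ i by rewrite -exprD subnK // leq_ord.
by rewrite exprVn mulKf ?expf_neq0.
Qed.

Definition Obv := Valring Ob_val.
Definition mb := vm Obv.

Lemma Ob_emb a : Ob (emb a) <-> v a <= 1.
Proof.
split=> [|h]; last by apply: sub_integ; exists a.
move=> [q [mq hq qa]]; rewrite leNgt; apply/negP => va.
have sz : (0 < size q)%N by rewrite size_poly_gt0 monic_neq0.
pose n := (size q).-1; have en : size q = n.+1 by rewrite prednK.
have [b hb] : exists b : nat -> F, forall i, v (b i) <= 1 /\ q`_i = emb (b i).
 have ex i : exists b, v b <= 1 /\ q`_i = emb b by case: (hq i) => b h1 h2; exists b.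
 by exists (fun i => sval (cid (ex i))) => i; case: cid.
have e : q.[emb a] = emb (\sum_(i < n) b i * a ^+ i + a ^+ n).
 rewrite horner_coef en big_ord_recr /= -[n in q`_n]/(n.+1.-1) -en -lead_coefE (monicP mq) mul1r.
 rewrite rmorphD rmorph_sum rmorphXn; congr (_ + _); apply: eq_bigr => i _.
 by rewrite rmorphM rmorphXn (hb i).2.
move: qa; rewrite e => /eqP; rewrite fmorph_eq0 addrC addr_eq0 => /eqP ea.
have a0 : 0 < v a by exact: lt_trans va.
have n0 : (0 < n)%N.
 rewrite lt0n; apply/eqP => n0; move: ea; rewrite n0 big_ord0 expr0 oppr0 => /eqP.
 by rewrite oner_eq0.
have : v (a ^+ n) <= v a ^+ n.-1.
 rewrite ea avN; apply: na_sum => //; first by rewrite exprn_ge0 // ltW.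
 move=> i _; rewrite av_mul avX; apply: (@le_trans _ _ (1 * v a ^+ i)).
  by rewrite ler_wpM2r ?exprn_ge0 ?(hb i).1 // ltW.
 by rewrite mul1r; apply: ler_weXn2l; rewrite ?(ltW va) //; have := ltn_ord i; lia.
by rewrite avX -{1}(prednK n0) exprS ger_pMl ?exprn_gt0 // leNgt va.
Qed.

Lemma Ob_gal (s : absGal Fb) x : Ob x -> Ob (s x).
Proof.
by apply: integ_map => _ [a ha ->]; exists a => //; rewrite gal_fix.
Qed.
Lemma mb_emb a : mb (emb a) <-> v a < 1.
Proof.
split=> [[/eqP|h]|h].
- by rewrite fmorph_eq0 => /eqP ->; rewrite av0.
- rewrite ltNge; apply/negP => h'; apply: h; rewrite -fmorphV Ob_emb avV.
 have a0 : 0 < v a by exact: lt_le_trans h'.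
 by rewrite invf_le1.
have [->|a0] := eqVneq a 0; first by left; rewrite rmorph0.
right; rewrite -fmorphV Ob_emb avV invf_le1 ?av_neq0 //.
by apply/negP; rewrite -ltNge.
Qed.

Hypothesis nontriv : exists2 a, 0 < v a & v a < 1.

Lemma small_multiple (x : Fb) : exists2 f : F, f != 0 & Ob (emb f * x).
Proof.
have [w w0 w1] := nontriv; have [q [mq qx _]] := min_poly_ex x.
pose n := (size q).-1; have sq : size q = n.+1 by rewrite prednK // size_poly_gt0 monic_neq0.
pose c := \big[Num.max/1]_(i < size q) v q`_i.
have c1 : 1 <= c by exact: bigmax_ge_id.
have cle i : v q`_i <= c.
 have [lt|ge] := ltnP i (size q); last by rewrite nth_default // av0; exact: le_trans c1.
 exact: (@le_bigmax_cond _ _ _ _ (Ordinal lt) predT (fun i => v q`_i)).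
have c0 : 0 < c by exact: lt_le_trans c1.
have cv0 : 0 < c^-1 by rewrite invr_gt0.
have [k hk] := expr_small (ltW w0) w1 cv0.
pose f := w ^+ k; exists f.
 by rewrite expf_neq0 //; apply: contraTneq w0 => ->; rewrite av0 ltxx.
have vf : v f <= c^-1 by rewrite avX ltW.
have vf1 : v f <= 1 by apply: (le_trans vf); rewrite invf_le1.
pose p := \poly_(i < n.+1) (q`_i * f ^+ (n - i)).
have qn : q`_n = 1 by rewrite -[n]/(n.+1.-1) -sq -lead_coefE (monicP mq).
have sp : size p = n.+1 by rewrite size_poly_eq // subnn expr0 mulr1 qn oner_eq0.
apply: (@Ob_poly _ p).
- by rewrite monicE lead_coefE sp coef_poly ltnSn subnn expr0 mulr1 qn.
- move=> i; rewrite coef_poly; case: ltnP => hi; rewrite ?av0 // av_mul avX.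
 have [->|ni] := eqVneq i n; first by rewrite subnn expr0 mulr1 qn av1.
 have : (0 < n - i)%N by lia.
 case: (n - i)%N => // m _; rewrite exprS mulrA.
 apply: mulr_ile1; rewrite ?mulr_ge0 ?exprn_ge0 ?av_ge0 ?exprn_ile1 ?av_ge0 //.
 apply: (@le_trans _ _ (c * c^-1)); last by rewrite divff // lt0r_neq0.
 by apply: ler_pM; rewrite ?av_ge0.
rewrite horner_coef size_map_poly sp.
transitivity (emb f ^+ n * (map_poly emb q).[x]); last by rewrite qx mulr0.
rewrite horner_coef size_map_poly sq mulr_sumr; apply: eq_bigr => i _.
rewrite !coef_map /= coef_poly ltn_ord rmorphM rmorphXn exprMn [RHS]mulrCA -!mulrA.
by congr (_ * _); rewrite mulrA -exprD subnK // leq_ord.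
Qed.

Lemma small_below (x : Fb) : x != 0 -> exists2 f : F, f != 0 & mb (emb f / x).
Proof.
move=> x0; have [f f0 hf] := small_multiple x^-1; have [w w0 w1] := nontriv.
have wn : w != 0 by apply: contraTneq w0 => ->; rewrite av0 ltxx.
exists (w * f); first by rewrite mulf_neq0.
rewrite rmorphM -mulrA; apply: vmMr => //; exact/mb_emb.
Qed.
End IntegralClosure.

Definition nonarch (R : realType) (F : fieldType) (v : absVal R F) :=
 forall x y, v (x + y) <= Num.max (v x) (v y).

Lemma completion_nonarch (R : realType) (K : fieldType) (v : place R K) (F : completion v) :
 nonarch v -> nonarch (co_abs F).
Proof.
move=> na x y; rewrite leNgt; apply/negP => lt.
set m := Num.max _ _ in lt; pose e := (co_abs F (x + y) - m) / 4.
have e0 : 0 < e by rewrite divr_gt0 // subr_gt0.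
have [a ha] := co_dense x e0; have [b hb] := co_dense y e0.
have va : v a <= m + e.
 rewrite -(co_absE F) (_ : co_emb F a = x - (x - co_emb F a)); last by rewrite opprB addrC subrK.
 apply: (le_trans (avB _ _ _)); apply: lerD; last exact: ltW.
 by rewrite /m le_max lexx.
have vb : v b <= m + e.
 rewrite -(co_absE F) (_ : co_emb F b = y - (y - co_emb F b)); last by rewrite opprB addrC subrK.
 apply: (le_trans (avB _ _ _)); apply: lerD; last exact: ltW.
 by rewrite /m le_max lexx orbT.
have vab : v (a + b) <= m + e by apply: (le_trans (na a b)); rewrite ge_max va.
have : co_abs F (x + y) <= e + e + (m + e).
 have -> : x + y = (x - co_emb F a) + (y - co_emb F b) + co_emb F (a + b) by rewrite rmorphD; ring.
 apply: (le_trans (av_add _ _ _)); apply: lerD; last by rewrite co_absE.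
 by apply: (le_trans (av_add _ _ _)); apply: lerD; exact: ltW.
by rewrite leNgt; case/negP; rewrite /e; lra.
Qed.

Lemma na_int (R : realType) (F : fieldType) (v : absVal R F) (n : int) : nonarch v -> v n%:~R <= 1.
Proof.
move=> na; have h k : v k%:R <= 1.
 by elim: k => [|k IH]; rewrite ?av0 // -natr1; apply: na_add_le; rewrite ?av1.
by case: n => n; rewrite ?NegzE ?mulrNz ?avN; exact: h.
Qed.

Section NumberPlace.
Variables (R : realType) (K : fieldExtType rat) (v : absVal R K).
Hypothesis na : nonarch v.

Lemma number_alg (x : K) : exists2 q : {poly rat}, q \is monic & (map_poly (in_alg K) q).[x] = 0.
Proof.
have /polyOver1P[q eq] := minPolyOver 1%AS x.
exists q; last by rewrite -eq; apply/rootP; exact: root_minPoly.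
by rewrite -(map_monic (in_alg K)) -eq monic_minPoly.
Qed.

Lemma in_alg_ratE (q : rat) : in_alg K q = (numq q)%:~R / (denq q)%:~R.
Proof. by rewrite -{1}(divq_num_den q) fmorph_div !rmorph_int. Qed.

(** If no prime were small, all nonzero integers and rationals would have absolute value 1. Monic
    equations would then bound every element by 1, and also its inverse, against nontriviality. *)
Lemma residue_char : (exists x, x <> 0 /\ v x <> 1) -> exists2 l : nat, prime l & v l%:R < 1.
Proof.
move=> [x0 [x00 vx0]]; apply: contrapT => /forall2NP hl.
have v1 n : (0 < n)%N -> v n%:R = 1.
 have [k] := ubnP n; elim: k n => // k IH n nk n0.
 have [n1|n1] := leqP n 1; first by rewrite (_ : n = 1%N) ?av1 //; apply/eqP; rewrite eqn_leq n1.
 have pp := pdiv_prime n1; have dv := pdiv_dvd n.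
 rewrite -(divnK dv) natrM av_mul IH; last 2 first.
 - by rewrite -ltnS; apply: leq_trans nk; rewrite ltnS ltn_Pdiv // prime_gt1.
 - by rewrite divn_gt0 ?pdiv_gt0 //; apply: dvdn_leq.
 rewrite mul1r; case: (hl (pdiv n)) => // /negP; rewrite -leNgt => h.
 by apply/eqP; rewrite eq_le h andbT (na_int (pdiv n) na).
have vz (z : int) : z != 0 -> v z%:~R = 1.
 case: z => n; rewrite ?NegzE ?mulrNz ?avN => n0; last exact: v1.
 by apply: v1; rewrite lt0n; move: n0.
have vq (q : rat) : v (in_alg K q) <= 1.
 have [->|q0] := eqVneq q 0; first by rewrite rmorph0 av0.
 by rewrite in_alg_ratE av_mul avV !vz ?invr1 ?mulr1 ?denq_neq0 ?numq_eq0.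
have le1 x : v x <= 1.
 rewrite leNgt; apply/negP => vx; have [q mq qx] := number_alg x.
 have sz : (0 < size q)%N by rewrite size_poly_gt0 monic_neq0.
 pose n := (size q).-1; have en : size q = n.+1 by rewrite prednK.
 move: qx; rewrite horner_coef size_map_poly en big_ord_recr /= coef_map /=.
 have -> : q`_n = 1 by rewrite -[n]/(n.+1.-1) -en -lead_coefE (monicP mq).
 rewrite scale1r mul1r addrC => /eqP.
 rewrite addr_eq0 => /eqP ea.
 have vx00 : 0 < v x by exact: lt_trans vx.
 have n0 : (0 < n)%N.
  rewrite lt0n; apply/eqP => n0; move: ea; rewrite n0 big_ord0 expr0 oppr0 => /eqP.
  by rewrite oner_eq0.
 have : v (x ^+ n) <= v x ^+ n.-1.
  rewrite ea avN; apply: na_sum => //; first by rewrite exprn_ge0 // ltW.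
  move=> i _; rewrite av_mul avX; apply: (@le_trans _ _ (1 * v x ^+ i)).
   by rewrite ler_wpM2r ?exprn_ge0 ?coef_map ?vq // ltW.
  by rewrite mul1r; apply: ler_weXn2l; rewrite ?(ltW vx) //; have := ltn_ord i; lia.
 by rewrite avX -{1}(prednK n0) exprS ger_pMl ?exprn_gt0 // leNgt vx.
apply: vx0; apply/eqP; rewrite eq_le le1 /= -[x0]invrK avV invf_ge1 //.
by rewrite av_neq0 // invr_eq0; apply/eqP.
Qed.

End NumberPlace.

(** [A] modulo [B] is killed by [l], and the last hypothesis bounds independent families. One of
    maximal size spans, since in a dependence with a further [x] the coefficient of [x] is prime to
    [l]. [A] and [B] are predicates because lattices, torsion points and Selmer groups all use
    this. *)
Lemma independent_basis (T : zmodType) (n l : nat) (A B : T -> Prop) : prime l ->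
 A 0 -> (forall x y, A x -> A y -> A (x - y)) ->
 B 0 -> (forall x y, B x -> B y -> B (x - y)) -> (forall x, A x -> B (x *+ l)) ->
 (forall a : 'I_n.+1 -> T, (forall i, A (a i)) -> exists2 c : 'I_n.+1 -> int,
   exists i, ~~ (l%:Z %| c i)%Z & B (\sum_i a i *~ c i)) ->
 exists m (a : 'I_m -> T), [/\ forall i, A (a i),
  forall c : 'I_m -> int, B (\sum_i a i *~ c i) -> forall i, (l%:Z %| c i)%Z &
  forall x, A x -> exists c : 'I_m -> 'I_l, B (x - \sum_i a i *+ c i)].
Proof.
move=> pl A0 AB B0 BB Al dep.
have BN x : B x -> B (- x) by move=> h; rewrite -sub0r; exact: BB.
have BD x y : B x -> B y -> B (x + y) by move=> hx hy; rewrite -[y]opprK; apply: BB => //; exact: BN.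
have BMn x k : B x -> B (x *+ k).
 by move=> h; elim: k => [|k IH]; rewrite ?mulr0n // mulrS; exact: BD.
have BMz x (k : int) : B x -> B (x *~ k).
 move=> h; case: k => k; rewrite ?NegzE ?mulrNz; first exact: BMn.
 by apply: BN; exact: BMn.
have Bl x (k : int) : (l%:Z %| k)%Z -> A x -> B (x *~ k).
 by move=> /divzK <- Ax; rewrite mulrC mulrzA; apply: BMz; exact: Al.
pose P m := `[< exists a : 'I_m -> T, (forall i, A (a i)) /\
 forall c : 'I_m -> int, B (\sum_i a i *~ c i) -> forall i, (l%:Z %| c i)%Z >].
have P0 : P 0%N by apply/asboolP; exists (fun=> 0); split=> [[]|c _ []].
have PS m : P m.+1 -> P m.
 move=> /asboolP[a [ha hi]]; apply/asboolP; exists (fun i => a (lift ord0 i)); split=> // c hc i.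
 have := hi (fun j => if unlift ord0 j is Some k then c k else 0).
 rewrite big_ord_recl unlift_none mulr0z add0r.
 under eq_bigr do rewrite liftK.
 by move=> /(_ hc (lift ord0 i)); rewrite liftK.
have Pn m : P m -> (m <= n)%N.
 move=> Pm; rewrite leqNgt; apply/negP => lt; have : P n.+1.
  by rewrite -(subnK lt) in Pm; elim: (m - n.+1)%N Pm => // k IH; rewrite addSn => /PS.
 move=> /asboolP[a [ha hi]]; have [c [i ci] cs] := dep a ha.
 by move: (hi c cs i); rewrite (negbTE ci).
have exP : exists m, P m by exists 0%N.
case: (ex_maxnP exP Pn) => m /asboolP[a [ha hi]] mmax.
exists m, a; split=> // x Ax.
have nP : ~ P m.+1 by move=> /mmax; rewrite ltnn.
pose f i := if unlift ord0 i is Some k then a k else x.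
have [c [ic [hc ci]]] : exists (c : 'I_m.+1 -> int) i, B (\sum_i f i *~ c i) /\ ~~ (l%:Z %| c i)%Z.
 apply: contrapT => h; apply: nP; apply/asboolP; exists f; split.
  by rewrite /f => i; case: unlift.
 by move=> c hc i; apply: contrapT => /negP ci; apply: h; exists c, i.
move: hc; rewrite big_ord_recl {1}/f unlift_none => hc.
have ef (c' : 'I_m -> int) : \sum_i f (lift ord0 i) *~ c' i = \sum_i a i *~ c' i.
 by apply: eq_bigr => i _; rewrite /f liftK.
rewrite (ef (fun i => c (lift ord0 i))) in hc.
have ncx : ~~ (l%:Z %| c ord0)%Z.
 apply/negP => d0; move: ci; case: (unliftP ord0 ic) => [j ->|->]; last by rewrite d0.
 have /hi/(_ j) -> // : B (\sum_i a i *~ c (lift ord0 i)).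
 by rewrite -[X in B X](addKr (x *~ c ord0)) addrC; apply: BB => //; exact: Bl.
(* Bezout turns the coefficient of [x] into 1 modulo [l]; the other coefficients are then reduced to
   natural numbers below [l]. *)
have /coprimezP[[u w] /= euw] : coprimez (c ord0) l%:Z.
 by rewrite coprimez_sym coprimezE /= prime_coprime.
have lz : l%:Z != 0 by rewrite -lt0n prime_gt0.
pose k i := `|(- (u * c (lift ord0 i)) %% l%:Z)%Z|%N.
have kl i : (k i < l)%N.
 by rewrite -ltz_nat /k gez0_abs ?modz_ge0 // ltz_pmod // ltz_nat prime_gt0.
exists (fun i => Ordinal (kl i)).
have ex : x = x *~ (u * c ord0) + x *~ (w * l%:Z).
 by rewrite -mulrzDr euw mulr1z.
have key : B (x + (\sum_i a i *~ c (lift ord0 i)) *~ u).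
 rewrite {1}ex addrAC; apply: BD; last by apply: Bl => //; rewrite dvdz_mull.
 by rewrite mulrC mulrzA -mulrzDl; exact: BMz.
set S := \sum_(i < m) _ *+ _; rewrite -[x - S](subrKA (- ((\sum_i a i *~ c (lift ord0 i)) *~ u))) opprK.
apply: (BD) => //; rewrite -opprD; apply: BN; rewrite /S mulrz_suml -big_split /=; apply: (big_ind B B0 BD) => i _.
rewrite -[a i *+ k i]/(a i *~ (k i)%:Z) -mulrzA -mulrzDr; apply: Bl => //.
rewrite /k gez0_abs ?modz_ge0 // addrC -[X in _ + X]opprK -eqz_mod_dvd modz_mod.
by rewrite mulrC.
Qed.

Section IntegerSpan.
Variables (T : fieldType) (n : nat) (e : 'I_n -> T).
Hypothesis char0 : forall n, n.+1%:R != 0 :> T.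

Definition zspan (x : T) := exists (d : int) (z : 'I_n -> int),
 d != 0 /\ d%:~R * x = \sum_j (z j)%:~R * e j.

Lemma intr0 (z : int) : z != 0 -> z%:~R != 0 :> T.
Proof.
case: z => [[|k]|k] // _; first exact: char0.
by rewrite NegzE mulrNz oppr_eq0; exact: char0.
Qed.

(** A rational dependence of [n + 1] vectors in dimension [n], cleared of denominators and divided
    by [l] as long as all coefficients allow it. The descent is on the sum of their absolute
    values. *)
Lemma zspan_dep (l : nat) (a : 'I_n.+1 -> T) : prime l -> (forall i, zspan (a i)) ->
 exists2 c : 'I_n.+1 -> int, (exists i, ~~ (l%:Z %| c i)%Z) & \sum_i (c i)%:~R * a i = 0.
Proof.
move=> pl /choice[d] /choice[z] hz.
have [c [c0 cs]] : exists c : 'I_n.+1 -> int, (exists i, c i != 0) /\ \sum_i (c i)%:~R * a i = 0.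
 pose Z : 'M[rat]_(n.+1, n) := \matrix_(i, j) (z i j)%:~R.
 have /rowV0Pn[r /sub_kermxP rZ r0] : kermx Z != 0.
  by rewrite kermx_eq0 /row_free; apply/eqP => h; have := rank_leq_col Z; rewrite h ltnn.
 pose D := \prod_i denq (r 0 i).
 have D0 : D != 0 by apply/prodf_neq0 => i _; exact: denq_neq0.
 have /choice[w hw] : forall i, exists w : int, w%:~R = D%:~R * r 0 i.
  move=> i; rewrite /D (bigD1 i) //= intrM.
  exists (\prod_(j < n.+1 | j != i) denq (r 0 j) * numq (r 0 i)).
  by rewrite intrM numqE; ring.
 have ws j : \sum_i w i * z i j = 0.
  apply/eqP; rewrite -(intr_eq0 rat) rmorph_sum /=; apply/eqP.
  transitivity (D%:~R * (r *m Z) 0 j); last by rewrite rZ mxE mulr0.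
  by rewrite mxE mulr_sumr; apply: eq_bigr => i _; rewrite intrM hw mxE mulrA.
 exists (fun i => w i * d i); split.
  have [i ri] : exists i, r 0 i != 0.
   apply: contrapT => h; case/eqP: r0; apply/rowP => i; rewrite mxE.
   by apply: contrapT => /eqP hi; apply: h; exists i.
  exists i; rewrite mulf_neq0 ?(hz i).1 // -(intr_eq0 rat) hw mulf_neq0 //.
  by rewrite intr_eq0.
 transitivity (\sum_j (\sum_i w i * z i j)%:~R * e j); last first.
  by rewrite big1 // => j _; rewrite ws mul0r.
 rewrite (eq_bigr (fun i => \sum_j (w i * z i j)%:~R * e j)); last first.
  move=> i _; rewrite intrM -mulrA (hz i).2 mulr_sumr.
  by apply: eq_bigr => j _; rewrite intrM mulrA.
 rewrite exchange_big /=; apply: eq_bigr => j _.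
 by rewrite rmorph_sum /= mulr_suml.
have [k] := ubnP (\sum_i `|c i|)%N; elim: k c c0 cs => // k IH c c0 cs hk.
have [h|h] := pselect (exists i, ~~ (l%:Z %| c i)%Z); first by exists c.
have dv i : (l%:Z %| c i)%Z by apply: contrapT => /negP hi; apply: h; exists i.
pose c' i := (c i %/ l%:Z)%Z.
have ec i : c i = c' i * l%:Z by rewrite divzK.
have l0 : (l%:R : T) != 0 by move: (prime_gt0 pl); case: (l).
apply: (IH c').
- case: c0 => i ci; exists i; apply: contraNneq ci => h0; by rewrite ec h0 mul0r.
- apply: (mulIf l0); rewrite mul0r mulr_suml -[RHS]cs; apply: eq_bigr => i _.
 by rewrite [in RHS]ec intrM mulrAC.
rewrite -ltnS; apply: (leq_trans _ hk); rewrite ltnS; case: c0 => i ci.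
rewrite (bigD1 i) //= [X in (_ < X)%N](bigD1 i) //= -addSn; apply: leq_add.
 rewrite [in X in (_ < X)%N]ec abszM /= ltn_Pmulr ?prime_gt1 // lt0n absz_eq0.
 by apply: contraNneq ci => h0; rewrite ec h0 mul0r.
by apply: leq_sum => j _; rewrite [in X in (_ <= X)%N]ec abszM /= leq_pmulr // prime_gt0.
Qed.

Lemma quotient_basis (l : nat) (A B : T -> Prop) : prime l ->
 (forall x, A x -> zspan x) -> A 0 -> (forall x y, A x -> A y -> A (x - y)) ->
 B 0 -> (forall x y, B x -> B y -> B (x - y)) -> (forall x, A x -> B (l%:R * x)) ->
 exists m (a : 'I_m -> T), [/\ forall i, A (a i),
  forall c : 'I_m -> int, B (\sum_i (c i)%:~R * a i) -> forall i, (l%:Z %| c i)%Z &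
  forall x, A x -> exists c : 'I_m -> 'I_l, B (x - \sum_i (c i)%:R * a i)].
Proof.
move=> pl As A0 AB B0 BB Al.
have [||m [a [h1 h2 h3]]] := @independent_basis T n l A B pl A0 AB B0 BB.
- by move=> x /Al; rewrite mulr_natl.
- move=> a ha; have [c ci cs] := zspan_dep pl (fun i => As _ (ha i)); exists c => //.
 by rewrite (eq_bigr _ (fun i _ => esym (mulrzl _ _))) cs.
exists m, a; split=> // [c hc|x /h3[c hc]].
 by apply: h2; rewrite (eq_bigr _ (fun i _ => esym (mulrzl _ _))).
by exists c; rewrite (eq_bigr _ (fun i _ => mulr_natl _ _)).
Qed.
End IntegerSpan.

Lemma nat_pigeonhole (T : eqType) (r : seq T) (f : nat -> T) : (forall i, f i \in r) ->
 exists i j, (i < j)%N /\ f i = f j.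
Proof.
move=> h; have /uniqPn-/(_ (f 0%N)) : ~~ uniq (map f (iota 0 (size r).+1)).
 apply/negP => u; have := uniq_leq_size u (s2 := r); rewrite size_map size_iota ltnn.
 by move=> H; suff: false by []; apply: H => x /mapP[i _ ->].
case=> i [j [ij]]; rewrite size_map size_iota => jl.
rewrite !(nth_map 0%N) ?size_iota ?(ltn_trans ij) // !nth_iota ?(ltn_trans ij) // => e.
by exists i, j.
Qed.

Lemma root_counted (k : fieldType) (p : {poly k}) (rs : seq k) z : p != 0 -> uniq rs ->
 {in rs, forall x, root p x} -> (size p <= (size rs).+1)%N -> root p z -> z \in rs.
Proof.
move=> p0 u h sz pz; apply: contraT => zr.
have al : all (root p) (z :: rs) by rewrite /= pz; apply/allP.
have uz : uniq (z :: rs) by rewrite /= zr.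
by have := max_poly_roots p0 al uz; rewrite ltnNge sz.
Qed.

Lemma orbit_poly (F : fieldType) (Fb : algClosure F) (x : Fb) :
 (forall n, n.+1%:R != 0 :> Fb) -> exists (P : {poly F}) (r : seq Fb),
 [/\ uniq r, forall y, y \in r <-> exists s : absGal Fb, y = s x
  & map_poly (ac_emb Fb) P = \prod_(y <- r) ('X - y%:P)].
Proof.
move=> c0; have [r ur hr] := orbit_list (fun=> True) x.
have hr' y : y \in r <-> exists s : absGal Fb, y = s x.
 by rewrite hr; split=> [[s _ ->]|[s ->]]; exists s.
have [s|P eP] := poly_over_fixed c0 (p := \prod_(y <- r) ('X - y%:P)).
 rewrite rmorph_prod /=; under eq_bigr do rewrite map_polyXsubC.
 rewrite -(big_map s predT (fun y => 'X - y%:P)); apply: perm_big.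
 apply: uniq_perm => //; first by rewrite map_inj_uniq //; exact: fmorph_inj.
 move=> y; apply/mapP/idP => [[z /hr'[t ->] ->]|/hr'[t ->]].
  by apply/hr'; exists (gal_mul s t).
 by exists (gal_mul (gal_inv s) t x); [apply/hr'; exists (gal_mul (gal_inv s) t)|rewrite /= gal_invVK].
by exists P, r; split.
Qed.

(** * Residue fields and Frobenius *)

Section Residue.
Variables (L : fieldType) (O : valring L).

Lemma residue_ex : exists (k : fieldType) (rsd : L -> k), [/\ rsd 1 = 1,
 forall x y, O x -> O y -> rsd (x - y) = rsd x - rsd y,
 forall x y, O x -> O y -> rsd (x * y) = rsd x * rsd y,
 forall a, exists2 x, O x & rsd x = a & forall x, O x -> (rsd x = 0 <-> vm O x)].
Proof.
apply: max_quotient; [exact: sr1|exact: srB|exact: srM|exact: vm_O|exact: vmB| |exact: vm1|exact: vm0|].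
 by move=> x y hx hy; exact: vmMl.
move=> x hx nx; have [x0 hV] := vunit hx nx.
by exists x^-1; rewrite ?divff // subrr; exact: vm0.
Qed.

Definition kres : fieldType := sval (cid residue_ex).
Definition rsd : L -> kres := sval (cid (svalP (cid residue_ex))).
Let rsdP : [/\ rsd 1 = 1,
 forall x y, O x -> O y -> rsd (x - y) = rsd x - rsd y,
 forall x y, O x -> O y -> rsd (x * y) = rsd x * rsd y,
 forall a, exists2 x, O x & rsd x = a & forall x, O x -> (rsd x = 0 <-> vm O x)].
Proof. exact: svalP (cid (svalP (cid residue_ex))). Qed.

Lemma rsd1 : rsd 1 = 1. Proof. by case: rsdP. Qed.
Lemma rsdB x y : O x -> O y -> rsd (x - y) = rsd x - rsd y. Proof. by case: rsdP => _ h _ _ _; exact: h. Qed.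
Lemma rsdM x y : O x -> O y -> rsd (x * y) = rsd x * rsd y. Proof. by case: rsdP => _ _ h _ _; exact: h. Qed.
Lemma rsd_eq0 x : O x -> (rsd x = 0 <-> vm O x). Proof. by case: rsdP => _ _ _ _ h; exact: h. Qed.
Lemma rsd0 : rsd 0 = 0. Proof. by rewrite -(subrr 1) rsdB ?subrr //; exact: sr1. Qed.
Lemma rsdN x : O x -> rsd (- x) = - rsd x.
Proof. by move=> hx; rewrite -sub0r rsdB ?rsd0 ?sub0r //; exact: sr0. Qed.
Lemma rsdD x y : O x -> O y -> rsd (x + y) = rsd x + rsd y.
Proof. by move=> hx hy; rewrite -[y]opprK rsdB ?rsdN ?opprK //; exact: srN. Qed.
Lemma rsdX x n : O x -> rsd (x ^+ n) = rsd x ^+ n.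
Proof.
by move=> hx; elim: n => [|n IH]; rewrite ?expr0 ?rsd1 // !exprS rsdM ?IH //; exact: srX.
Qed.
Lemma rsd_nat n : rsd n%:R = n%:R.
Proof. by elim: n => [|n IH]; rewrite ?rsd0 // -!natr1 rsdD ?IH ?rsd1 //; [exact: sr_nat|exact: sr1]. Qed.
Lemma rsd_sum I (r : seq I) (E : I -> L) : (forall i, O (E i)) ->
 rsd (\sum_(i <- r) E i) = \sum_(i <- r) rsd (E i).
Proof.
move=> h; elim: r => [|i r IH]; rewrite ?big_nil ?rsd0 // !big_cons rsdD ?IH //.
by apply: sr_sum.
Qed.
Lemma rsd_eq x y : O x -> O y -> (rsd x = rsd y <-> vm O (x - y)).
Proof.
move=> hx hy; rewrite -rsd_eq0 ?rsdB //; last exact: srB.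
by split=> [->|/eqP]; rewrite ?subrr // subr_eq0 => /eqP.
Qed.

Lemma prodXsub_coef (r : seq L) : {in r, forall y, O y} ->
 forall i, O (\prod_(y <- r) ('X - y%:P))`_i /\
 (\prod_(y <- r) ('X - (rsd y)%:P))`_i = rsd (\prod_(y <- r) ('X - y%:P))`_i.
Proof.
elim: r => [|y r IH] h i.
 by rewrite !big_nil !coefC; case: eqP => _; split; rewrite ?rsd1 ?rsd0 //; [exact: sr1|exact: sr0].
have hy : O y by apply: h; rewrite mem_head.
have hr : {in r, forall y, O y} by move=> z zr; apply: h; rewrite inE zr orbT.
rewrite !big_cons !mulrBl !coefB !coefXM !coefCM.
have {}IH := IH hr; have [h1 e1] := IH i; have [h2 e2] := IH i.-1.
case: eqP => _; split.
- by apply: srB; [exact: sr0|exact: srM].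
- by rewrite e1 rsdB ?rsd0 ?rsdM //; [exact: sr0|exact: srM].
- by apply: srB => //; exact: srM.
- by rewrite e1 e2 rsdB ?rsdM //; exact: srM.
Qed.

Lemma unity_O x n : (0 < n)%N -> x ^+ n = 1 -> O x.
Proof.
move=> n0 xn; apply: contrapT => nO; have h := vinv_vm nO.
have : vm O (x^-1 ^+ n).
 by rewrite -(prednK n0) exprS; apply: vmMr => //; apply: srX; exact: vm_O.
by rewrite exprVn xn invr1; exact: vm1.
Qed.
End Residue.

Lemma prim_root_ex (L : closedFieldType) n : (0 < n)%N -> n%:R != 0 :> L ->
 exists z : L, n.-primitive_root z.
Proof.
move=> n0 nz; have [r er] := closed_field_poly_normal ('X^n - 1 : {poly L}).
have m1 : ('X^n - 1 : {poly L}) \is monic by rewrite monicXnsubC.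
rewrite (monicP m1) scale1r in er.
have ur : uniq r by rewrite -separable_prod_XsubC -er separable_Xn_sub_1.
have sr : size r = n.
 by apply: succn_inj; rewrite -(size_prod_XsubC r id) -er size_XnsubC.
have : has n.-primitive_root r.
 apply: has_prim_root => //; last by rewrite sr.
 apply/allP => x xr; rewrite unity_rootE -subr_eq0.
 have : root ('X^n - 1) x by rewrite er root_prod_XsubC.
 by rewrite /root !hornerE.
by case/hasP => z _; exists z.
Qed.

Section Frobenius.
Variables (F : fieldType) (Fb : algClosure F) (O : valring Fb).
Local Notation emb := (ac_emb Fb).
Local Notation vm := (vm O).
Local Notation rsd := (@rsd Fb O).
Local Notation k := (@kres Fb O).
Hypothesis char0 : forall n, n.+1%:R != 0 :> Fb.
Hypothesis Ogal : forall (s : absGal Fb) x, O x -> O (s x).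
Variable l : nat.
Hypotheses (pl : prime l) (ml : vm l%:R).
Variables (m : nat) (a : 'I_m -> F).
Hypotheses (Oa : forall i, O (emb (a i)))
 (ind : forall c : 'I_m -> int, vm (\sum_i (c i)%:~R * emb (a i)) -> forall i, (l%:Z %| c i)%Z)
 (spn : forall x : F, O (emb x) -> exists c : 'I_m -> 'I_l,
  vm (emb x - \sum_i (c i)%:R * emb (a i))).
Let q := (l ^ m)%N.

Lemma vm_gal (s : absGal Fb) x : vm x -> vm (s x).
Proof.
case=> [->|h]; first by left; rewrite rmorph0.
by right=> h'; apply: h; rewrite -(gal_invK s x^-1) fmorphV; exact: Ogal.
Qed.

Lemma res_char : l \in [pchar k].
Proof.
rewrite inE pl /= -rsd_nat; apply/eqP/rsd_eq0 => //; exact: sr_nat.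
Qed.

Lemma q_gt1 : (1 < q)%N.
Proof.
rewrite /q; case: m a Oa ind spn => [|m'] a' _ _ sp; last first.
 by rewrite expnS; apply: (leq_trans (prime_gt1 pl)); rewrite leq_pmulr // expn_gt0 prime_gt0.
have [|c] := sp 1; first by rewrite rmorph1; exact: sr1.
by rewrite rmorph1 big_ord0 subr0 => /vm1.
Qed.

Lemma frobD (x y : k) n : (x + y) ^+ (q ^ n) = x ^+ (q ^ n) + y ^+ (q ^ n).
Proof.
apply: exprDn_pchar; rewrite /q -expnM pnatX; apply/orP; left.
by rewrite pnatE // res_char.
Qed.
Lemma frob0 n : (0 : k) ^+ (q ^ n) = 0.
Proof. by rewrite expr0n expn_eq0; have := q_gt1; case: q. Qed.
Lemma frob01 : (0 : k) ^+ q = 0. Proof. exact: frob0 1. Qed.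
Lemma frobB (x y : k) n : (x - y) ^+ (q ^ n) = x ^+ (q ^ n) - y ^+ (q ^ n).
Proof. by apply/(addIr (y ^+ (q ^ n))); rewrite -frobD !subrK. Qed.
Lemma frob_sum I (r : seq I) (E : I -> k) n :
 (\sum_(i <- r) E i) ^+ (q ^ n) = \sum_(i <- r) E i ^+ (q ^ n).
Proof.
by elim: r => [|i r IH]; rewrite ?big_nil ?frob0 // !big_cons frobD IH.
Qed.
Lemma frob_iter (x : k) i j : x ^+ (q ^ i) ^+ (q ^ j) = x ^+ (q ^ (i + j)).
Proof. by rewrite -exprM -expnD. Qed.

Let sm (c : {ffun 'I_m -> 'I_l}) := \sum_i (c i)%:R * emb (a i).
Let rF : seq k := [seq rsd (sm c) | c : {ffun 'I_m -> 'I_l}].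

Lemma sm_O c : O (sm c).
Proof. by apply: sr_sum => i _; apply: srM; [exact: sr_nat|exact: Oa]. Qed.

Lemma rF_size : size rF = q.
Proof. by rewrite size_map -cardE card_ffun !card_ord. Qed.

Lemma rF_uniq : uniq rF.
Proof.
rewrite map_inj_in_uniq ?enum_uniq // => c d _ _ /rsd_eq-/(_ (sm_O _) (sm_O _)).
rewrite /sm -sumrB => h; apply/ffunP => i; apply: val_inj => /=.
have := ind (c := fun i => (c i)%:Z - (d i)%:Z); rewrite (eq_bigr (fun i => (c i)%:R * emb (a i) - (d i)%:R * emb (a i))); last first.
 by move=> j _; rewrite intrB mulrBl.
move=> /(_ h i); rewrite -eqz_mod_dvd !modz_nat !modn_small ?ltn_ord //.
by move/eqP=> [].
Qed.

Lemma rF_mem (x : F) : O (emb x) -> rsd (emb x) \in rF.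
Proof.
move=> hx; have [c hc] := spn hx; apply/mapP; exists (finfun c); first by rewrite mem_enum.
apply/rsd_eq => //; first exact: sm_O.
by rewrite /sm; under eq_bigr do rewrite ffunE.
Qed.

Lemma rF_ex z : z \in rF -> exists2 x : F, O (emb x) & z = rsd (emb x).
Proof.
case/mapP => c _ ->; exists (\sum_i (c i)%:R * a i); rewrite rmorph_sum /=.
 by under eq_bigr do rewrite rmorphM rmorph_nat; exact: sm_O.
by under eq_bigr do rewrite rmorphM rmorph_nat.
Qed.

(** Multiplication by a nonzero [z] permutes the nonzero elements of [rF]; comparing their products
    gives [z^(q-1) = 1]. *)
Lemma frobF z : z \in rF -> z ^+ q = z.
Proof.
move=> zr; have [->|z0] := eqVneq z 0; first exact: frob01.
have [x hx ex] := rF_ex zr.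
pose nz := rem 0 rF.
have u0 : 0 \in rF by rewrite -(rsd0 O) -(rmorph0 emb); apply: rF_mem; rewrite rmorph0; exact: sr0.
have sz : size nz = q.-1 by rewrite size_rem // rF_size.
have unz : uniq nz by rewrite rem_uniq // rF_uniq.
have mnz y : (y \in nz) = (y != 0) && (y \in rF) by rewrite (mem_rem_uniq _ rF_uniq) inE.
have pe : perm_eq (map (fun y => z * y) nz) nz.
 have um : uniq (map (fun y => z * y) nz) by rewrite map_inj_uniq //; exact: mulfI.
 have sb : {subset map (fun y => z * y) nz <= nz}.
  move=> w /mapP[y]; rewrite mnz => /andP[y0 /rF_ex[u hu ey]] ew.
  rewrite mnz ew mulf_neq0 //= ex ey -rsdM // -rmorphM; apply: rF_mem.
  by rewrite rmorphM; exact: srM.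
 apply: uniq_perm => //; apply: (uniq_min_size um sb _).2.
 by rewrite size_map.
have : z ^+ q.-1 = 1.
 have p0 : \prod_(y <- nz) y != 0.
  by rewrite prodf_seq_neq0; apply/allP => y; rewrite mnz => /andP[].
 apply: (mulIf p0); rewrite mul1r -[RHS](perm_big _ pe) big_map big_split /=.
 by rewrite big_const_seq count_predT sz iter_mulr_1.
by move=> h; rewrite -(prednK (ltnW q_gt1)) exprS h mulr1.
Qed.

Lemma resF z : z ^+ q = z -> z \in rF.
Proof.
move=> hz; apply: (@root_counted _ ('X^q - 'X)).
- by rewrite -size_poly_gt0 size_polyDl ?size_polyXn // size_polyN size_polyX ltnS q_gt1.
- exact: rF_uniq.
- by move=> x /frobF hx; rewrite /root !hornerE hx subrr.
- by rewrite rF_size size_polyDl ?size_polyXn // size_polyN size_polyX ltnS q_gt1.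
- by rewrite /root !hornerE hz subrr.
Qed.

Lemma frob_poly (P : {poly k}) z : (forall i, P`_i ^+ q = P`_i) -> P.[z ^+ q] = P.[z] ^+ q.
Proof.
move=> h; rewrite !horner_coef -[q in RHS]expn1 frob_sum; apply: eq_bigr => i _.
by rewrite expn1 exprMn h -!exprM mulnC.
Qed.

(** The reduced orbit polynomial of [x] has coefficients in the field with [q] elements, so the
    [q]-power map sends its roots to roots. Two iterates coincide, and the power map is
    injective. *)
Lemma res_alg x : O x -> exists2 t, (0 < t)%N & rsd x ^+ (q ^ t) = rsd x.
Proof.
move=> hx; have [P [r [ur hr eP]]] := orbit_poly x char0.
have rO : {in r, forall y, O y} by move=> y /hr[s ->]; exact: Ogal.
pose Q : {poly k} := \prod_(y <- r) ('X - (rsd y)%:P).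
have Qq i : Q`_i ^+ q = Q`_i.
 have [h1 ->] := prodXsub_coef rO i; apply: frobF.
 by rewrite -eP coef_map; apply: rF_mem; rewrite -coef_map eP.
have Q0 : Q != 0 by apply: monic_neq0; exact: monic_prod_XsubC.
have Qx : Q.[rsd x] = 0.
 rewrite horner_prod; apply/eqP; rewrite prodf_seq_eq0; apply/hasP; exists x.
  by apply/hr; exists (gal_one Fb).
 by rewrite !hornerE subrr /=.
have Qn i : Q.[rsd x ^+ (q ^ i)] = 0.
 elim: i => [//|i IH]; rewrite expnSr exprM frob_poly // IH; exact: frob01.
have [rs us hrs] : exists2 rs : seq k, uniq rs & {subset root Q <= rs}.
 exists (undup [seq rsd y | y <- r]); first exact: undup_uniq.
 move=> z; rewrite mem_undup /Q -topredE /= -(big_map rsd predT (fun y => 'X - y%:P)) root_prod_XsubC.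
 by [].
have [i [j [ij e]]] := @nat_pigeonhole _ rs (fun i => rsd x ^+ (q ^ i)) (fun i => hrs _ (introT rootP (Qn i))).
exists (j - i)%N; first by rewrite subn_gt0.
apply/eqP; rewrite -subr_eq0; have : (rsd x ^+ (q ^ (j - i)) - rsd x) ^+ (q ^ i) = 0.
 by rewrite frobB frob_iter subnK ?(ltnW ij) // e subrr.
by move/eqP; rewrite expf_eq0 => /andP[].
Qed.

Lemma frob_mult (z : k) t n : z ^+ (q ^ t) = z -> z ^+ (q ^ (t * n)) = z.
Proof.
by move=> h; elim: n => [|n IH]; rewrite ?muln0 // mulnS -frob_iter h IH.
Qed.

Lemma res_alg_seq (r : seq Fb) : {in r, forall x, O x} ->
 exists2 t, (0 < t)%N & {in r, forall x, rsd x ^+ (q ^ t) = rsd x}.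
Proof.
elim: r => [|x r IH] h; first by exists 1%N.
have [t t0 ht] := IH (fun y yr => h y (@mem_behead _ (x :: r) y yr)).
have [u u0 hu] := res_alg (h x (mem_head _ _)).
exists (t * u)%N; first by rewrite muln_gt0 t0.
move=> y; rewrite inE => /predU1P[->|/ht]; last exact: frob_mult.
by rewrite mulnC; exact: frob_mult.
Qed.

Lemma unity_res_inj n (b : Fb) : (0 < n)%N -> n%:R != 0 :> k -> b ^+ n = 1 -> rsd b = 1 -> b = 1.
Proof.
move=> n0 nk bn pb; have Ob := unity_O O n0 bn.
apply/eqP; rewrite -subr_eq0; have := subrX1 b n; rewrite bn subrr => /esym/eqP.
rewrite mulf_eq0 => /orP[//|/eqP h]; case/eqP: nk.
have := congr1 rsd h; rewrite rsd0 rsd_sum; last by move=> i; exact: srX.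
under eq_bigr do rewrite rsdX // pb expr1n.
by rewrite sumr_const card_ord.
Qed.

Lemma gal_exp_unity (phi : absGal Fb) (al : Fb) n : phi al = al ^+ q ->
 gal_exp phi n al = al ^+ (q ^ n).
Proof.
move=> h; elim: n => [|n IH] //; rewrite /gal_exp iterS -/(gal_exp phi n) /= IH rmorphXn h.
by rewrite -exprM expnS.
Qed.

(** The residues of a finite list lie in one field with [q^t] elements. The roots of unity of order
    [N = q^t - 1], prime to the residue characteristic, have distinct residues, hence by counting
    represent all its nonzero elements. *)
Lemma teichmuller (r : seq Fb) : {in r, forall x, O x} -> exists t N al, [/\ (0 < t)%N /\ (q ^ t = N.+1)%N,
 (0 < N)%N /\ N.-primitive_root al, {in r, forall x, rsd x ^+ (q ^ t) = rsd x},
 forall b c, b ^+ N = 1 -> c ^+ N = 1 -> rsd b = rsd c -> b = c &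
 forall z : k, z ^+ (q ^ t) = z -> z = 0 \/ exists i, z = rsd (al ^+ i)].
Proof.
move=> rO; have [t t0 ht] := res_alg_seq rO.
have q1 := q_gt1.
pose N := (q ^ t).-1.
have N1 : (q ^ t = N.+1)%N by rewrite prednK // expn_gt0 ltnW.
have N0 : (0 < N)%N by rewrite -ltnS -N1 -{1}(exp1n t) ltn_exp2r.
have kq : q%:R = 0 :> k.
 by rewrite /q natrX (pcharf0 res_char) expr0n; move: q1; rewrite /q; case: (m).
have Nk : N%:R != 0 :> k.
 apply: contra_eq_neq (_ : (q ^ t)%:R = 0 :> k) => [h|].
  by rewrite N1 -natr1 h add0r oner_eq0.
 by rewrite natrX kq expr0n; case: (t) t0.
have NF : N%:R != 0 :> Fb by move: N0; case: (N).
have [al pal] := prim_root_ex N0 NF.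
have aN : al ^+ N = 1 := prim_expr_order pal.
have aO : O al := unity_O O N0 aN.
have at_ : al ^+ (q ^ t) = al by rewrite N1 exprS aN mulr1.
have inj b c : b ^+ N = 1 -> c ^+ N = 1 -> rsd b = rsd c -> b = c.
 move=> hb hc e; have Ob := unity_O O N0 hb; have Oc := unity_O O N0 hc.
 have hV : (c^-1) ^+ N = 1 by rewrite exprVn hc invr1.
 have OV := unity_O O N0 hV.
 have c0 : c != 0 by apply: contra_eq_neq hc => ->; rewrite expr0n; case: (N) N0 => // n _; rewrite eq_sym oner_eq0.
 have : b / c = 1.
  by apply: (unity_res_inj N0 Nk); rewrite ?exprMn ?hb ?hV ?mulr1 // rsdM // e -rsdM // divff // rsd1.
 by move/divr1_eq.
have ax i : (al ^+ i) ^+ N = 1 by rewrite -exprM mulnC exprM aN expr1n.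
have teich z : z ^+ (q ^ t) = z -> z = 0 \/ exists i, z = rsd (al ^+ i).
 move=> hz; have [->|z0] := eqVneq z 0; [by left|right].
 have zN : z ^+ N = 1 by apply: (mulfI z0); rewrite -exprS -N1 hz mulr1.
 have /mapP[i _ ->] : z \in [seq rsd (al ^+ i) | i <- iota 0 N]; last by exists i.
 apply: (@root_counted _ ('X^N - 1)).
 - by apply: monic_neq0; exact: monicXnsubC.
 - rewrite map_inj_in_uniq ?iota_uniq // => i j; rewrite !mem_iota /= !add0n => iN jN.
  by move=> /inj-/(_ (ax i) (ax j))/eqP; rewrite (eq_prim_root_expr pal) !modn_small // => /eqP.
 - by move=> _ /mapP[i _ ->]; rewrite /root !hornerE -rsdX ?ax ?rsd1 ?subrr //; exact: srX.
 - by rewrite size_XnsubC // size_map size_iota.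
 - by rewrite /root !hornerE zN subrr.
by exists t, N, al.
Qed.

(** Each residue in question is zero or a power of the residue of the root of unity [al] from
    [teichmuller], so it suffices to follow the action on [al]. *)
Lemma frobenius_lift (r : seq Fb) : {in r, forall x, O x} ->
 exists phi : absGal Fb, {in r, forall x, forall j, rsd (gal_exp phi j x) = rsd x ^+ (q ^ j)} /\
 forall s : absGal Fb, exists j, {in r, forall x, rsd (s x) = rsd (gal_exp phi j x)}.
Proof.
move=> rO; have [t [N [al [[t0 N1] [N0 pal] ht inj teich]]]] := teichmuller rO.
have aN : al ^+ N = 1 := prim_expr_order pal.
have aO : O al := unity_O O N0 aN.
have at_ : al ^+ (q ^ t) = al by rewrite N1 exprS aN mulr1.
have ax i : (al ^+ i) ^+ N = 1 by rewrite -exprM mulnC exprM aN expr1n.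
have galN (s : absGal Fb) : s al ^+ N = 1 by rewrite -rmorphXn aN rmorph1.
(* The orbit polynomial of [al] reduces to one over the field with [q] elements, so [al^q] has the
   residue of some conjugate of [al]. Roots of unity of order [N] are determined by their residues,
   hence [al^q] is that conjugate. *)
have [phi hphi] : exists phi : absGal Fb, phi al = al ^+ q.
 have [P [o [uo ho eP]]] := orbit_poly al char0.
 have oO : {in o, forall y, O y} by move=> y /ho[s ->]; exact: Ogal.
 pose Q : {poly k} := \prod_(y <- o) ('X - (rsd y)%:P).
 have Qq i : Q`_i ^+ q = Q`_i.
  have [h1 ->] := prodXsub_coef oO i; apply: frobF.
  by rewrite -eP coef_map; apply: rF_mem; rewrite -coef_map eP.
 have : Q.[rsd al ^+ q] = 0.
  rewrite frob_poly // (_ : Q.[rsd al] = 0); first exact: frob01.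
  rewrite horner_prod; apply/eqP; rewrite prodf_seq_eq0; apply/hasP; exists al.
   by apply/ho; exists (gal_one Fb).
  by rewrite !hornerE subrr /=.
 rewrite horner_prod => /eqP; rewrite prodf_seq_eq0 => /hasP[y /ho[s ->]] /=.
 rewrite !hornerE subr_eq0 -rsdX // => /eqP/inj h; exists s.
 by rewrite h ?ax ?galN.
have hexp := gal_exp_unity _ hphi.
exists phi.
have act (s : absGal Fb) j : s al = al ^+ (q ^ j) -> {in r, forall x, rsd (s x) = rsd x ^+ (q ^ j)}.
 move=> hs x xr; have hx := rO _ xr; have [e|[i e]] := teich _ (ht _ xr).
  rewrite e frob0; apply/rsd_eq0; first exact: Ogal.
  by apply: vm_gal; exact/rsd_eq0.
 have ai : O (al ^+ i) by exact: srX.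
 have -> : rsd (s x) = rsd (s (al ^+ i)).
  apply/rsd_eq; [exact: Ogal|exact: Ogal|rewrite -rmorphB; apply: vm_gal; exact/rsd_eq].
 by rewrite rmorphXn hs e -rsdX // -!exprM mulnC.
split=> [x xr j|s]; first by apply: act => //; exact: hexp.
suff [j hj] : exists j, s al = al ^+ (q ^ j).
 by exists j => x xr; rewrite (act _ _ hj x xr) (act _ _ (hexp j) x xr).
(* Conversely, the polynomial whose roots are the residues of the [al^(q^j)] has coefficients in the
   field with [q] elements, so it also kills the residue of every conjugate [s al]. *)
pose B := [seq al ^+ (q ^ j) | j <- iota 0 t].
have BO : {in B, forall y, O y} by move=> _ /mapP[j _ ->]; exact: srX.
pose Q : {poly k} := \prod_(y <- B) ('X - (rsd y)%:P).
have Qk : Q = \prod_(j < t) ('X - (rsd al ^+ (q ^ j))%:P).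
 rewrite /Q /B big_map -{1}[t]subn0 -/(index_iota 0 t) big_mkord.
 by apply: eq_bigr => j _; rewrite rsdX.
have pt : rsd al ^+ (q ^ t) = rsd al by rewrite -rsdX // at_.
have frp : {morph (fun p : {poly k} => map_poly (fun x => x ^+ q) p) : x y / x * y}.
 move=> p1 p2; apply/polyP => i; rewrite coef_map_id0; last exact: frob01.
 rewrite !coefM -[q in LHS]expn1 frob_sum; apply: eq_bigr => j _.
 by rewrite expn1 exprMn !coef_map_id0 //; exact: frob01.
have fr0 := frob01.
have frX c : map_poly (fun x => x ^+ q) ('X - c%:P) = 'X - (c ^+ q)%:P :> {poly k}.
 apply/polyP => i; rewrite coef_map_id0 // !coefB !coefX !coefC.
 have frb (u w : k) : (u - w) ^+ q = u ^+ q - w ^+ q by have := frobB u w 1; rewrite expn1.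
 rewrite frb; congr (_ - _); first by case: (_ == _); rewrite ?expr1n ?fr0.
 by case: (_ == _); rewrite ?fr0.
have Qq i : Q`_i ^+ q = Q`_i.
 have -> : Q`_i ^+ q = (map_poly (fun x => x ^+ q) Q)`_i by rewrite coef_map_id0.
 congr (_`_i); rewrite Qk (big_morph _ frp (_ : _ = 1)); last first.
  by apply/polyP => j; rewrite coef_map_id0 // !coefC; case: (_ == _); rewrite ?expr1n ?fr0.
 under eq_bigr do rewrite frX -exprM -expnSr.
 have := pt; move: t0; case: (t) => // t' _ pt'.
 by rewrite big_ord_recr /= pt' big_ord_recl /= expn0 expr1 mulrC.
have Qal : Q.[rsd al] = 0.
 rewrite Qk horner_prod; apply/eqP/prodf_eq0; exists (Ordinal t0) => //.
 by rewrite /= !hornerE expn0 expr1 subrr.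
have sQ : Q.[rsd (s al)] = 0.
 have /choice[c hc] : forall i, exists x : F, O (emb x) /\ Q`_i = rsd (emb x).
  by move=> i; have [x h1 h2] := rF_ex (resF (Qq i)); exists x.
 have ev x : O x -> Q.[rsd x] = rsd (\sum_(i < size Q) emb (c i) * x ^+ i).
  move=> hx; rewrite horner_coef rsd_sum; last by move=> i; apply: srM; [exact: (hc i).1|exact: srX].
  by apply: eq_bigr => i _; rewrite rsdM ?rsdX ?(hc i).2 //; [exact: (hc i).1|exact: srX].
 rewrite ev; last exact: Ogal.
 have e : \sum_(i < size Q) emb (c i) * s al ^+ i = s (\sum_(i < size Q) emb (c i) * al ^+ i).
  by rewrite rmorph_sum; apply: eq_bigr => i _; rewrite rmorphM rmorphXn gal_fix.
 have hO : O (\sum_(i < size Q) emb (c i) * al ^+ i).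
  by apply: sr_sum => i _; apply: srM; [exact: (hc i).1|exact: srX].
 rewrite e; apply/rsd_eq0; first exact: Ogal.
 by apply: vm_gal; apply/rsd_eq0 => //; rewrite -ev.
move/eqP: sQ; rewrite Qk horner_prod => /prodf_eq0[j _].
rewrite !hornerE subr_eq0 -rsdX // => /eqP/inj h; exists j.
by rewrite h ?ax ?galN.
Qed.
(** The form used for resolvents: to act trivially on the residues of [r] it is enough to fix the
    single root of unity [al]. *)
Lemma unity_generator (r : seq Fb) : {in r, forall x, O x} -> exists N al, [/\ (0 < N)%N, al ^+ N = 1,
 forall b c, b ^+ N = 1 -> c ^+ N = 1 -> vm (b - c) -> b = c &
 forall s : absGal Fb, s al = al -> {in r, forall x, vm (s x - x)}].
Proof.
move=> rO; have [t [N [al [[t0 N1] [N0 pal] ht inj teich]]]] := teichmuller rO.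
have aN : al ^+ N = 1 := prim_expr_order pal.
have aO : O al := unity_O O N0 aN.
exists N, al; split=> // [b c hb hc h|s sa x xr].
 by apply: inj => //; apply/rsd_eq => //; exact: unity_O N0 _.
have hx := rO _ xr; have [/rsd_eq0-/(_ hx) h|[i /rsd_eq h]] := teich _ (ht _ xr).
 by apply: vmB => //; exact: vm_gal.
have {h} : vm (x - al ^+ i) by apply: h => //; exact: srX.
move=> h; rewrite -(subrKA (al ^+ i)); apply: vmD; last by rewrite -opprB; exact: vmN.
by have := vm_gal s h; rewrite rmorphB rmorphXn sa.
Qed.
End Frobenius.

(** * Reduction *)

Section GaloisPoints.
Variables (F : fieldType) (Fb : algClosure F) (E : weierstrass F) (W : goodcurve Fb).
Hypothesis eW : gc_eqn W = map_weierstrass (ac_emb Fb) E.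

Lemma gal_weierstrass (s : absGal Fb) : map_weierstrass s W = W.
Proof. by rewrite eW /map_weierstrass /= !gal_fix. Qed.

Lemma gpt_on (s : absGal Fb) (P : ecpt W) : on_curve W (map_point s P).
Proof. by rewrite -{1}(gal_weierstrass s) map_on_curve pt_on. Qed.
Definition gpt (s : absGal Fb) (P : ecpt W) : ecpt W := Ecpt (gpt_on s P).

Lemma gptE s P : pt (gpt s P) = map_point s P. Proof. by []. Qed.
Lemma gptD s P Q : gpt s (P + Q) = gpt s P + gpt s Q.
Proof. by apply: pt_inj; rewrite gptE !ptD map_paddE gal_weierstrass. Qed.
Lemma gptN s P : gpt s (- P) = - gpt s P.
Proof. by apply: pt_inj; rewrite gptE !ptN map_poppE gal_weierstrass. Qed.
Lemma gptB s P Q : gpt s (P - Q) = gpt s P - gpt s Q.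
Proof. by rewrite gptD gptN. Qed.
Lemma gpt0 s : gpt s 0 = 0. Proof. exact: pt_inj. Qed.
Lemma gptMn s P n : gpt s (P *+ n) = gpt s P *+ n.
Proof. by elim: n => [|n IH]; rewrite ?mulr0n ?gpt0 // !mulrS gptD IH. Qed.
Lemma gpt_sum s I (r : seq I) (f : I -> ecpt W) :
 gpt s (\sum_(i <- r) f i) = \sum_(i <- r) gpt s (f i).
Proof. by elim: r => [|i r IH]; rewrite ?big_nil ?gpt0 // !big_cons gptD IH. Qed.
Lemma gptM s t P : gpt (gal_mul s t) P = gpt s (gpt t P).
Proof. by apply: pt_inj; rewrite !gptE; case: (pt P). Qed.
Lemma gpt1 P : gpt (gal_one Fb) P = P.
Proof. by apply: pt_inj; rewrite !gptE; case: (pt P). Qed.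
Lemma gptK s : cancel (gpt s) (gpt (gal_inv s)).
Proof. by move=> P; rewrite -gptM gal_Vmul gpt1. Qed.
Lemma gptVK s : cancel (gpt (gal_inv s)) (gpt s).
Proof. by move=> P; rewrite -gptM gal_mulV gpt1. Qed.
Lemma sq_gpt s P : sq (gpt s P) = map_point s (sq P).
Proof.
have e1 : s (wa1 W) = wa1 W by have := congr1 (@wa1 Fb) (gal_weierstrass s).
have e3 : s (wa3 W) = wa3 W by have := congr1 (@wa3 Fb) (gal_weierstrass s).
rewrite /sq /sqpt gptE; case: (pt P) => //= x y.
by rewrite rmorphD rmorphM rmorphD rmorphM fmorphV rmorph_nat e1 e3.
Qed.

Lemma gpt_agree (s t : absGal Fb) (P : ecpt W) : (forall x y, sq P = Aff x y -> s x = t x /\ s y = t y) -> gpt s P = gpt t P.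
Proof.
move=> h; apply: sq_inj; rewrite !sq_gpt; case e : (sq P) => [|x y] //=.
by have [-> ->] := h _ _ e.
Qed.
End GaloisPoints.

Section Reduction.
Variables (L : closedFieldType) (O : valring L) (W : goodcurve L).
Local Notation vm := (vm O).
Hypotheses (O2 : O (sqa2 W)) (O4 : O (sqa4 W)) (O6 : O (sqa6 W)) (Oh : O 2^-1).
Hypothesis nonsing : forall x, O x -> vm (wf W x) -> vm (wf' W x) -> False.

(** The kernel of reduction, expressed on abscissas so that no reduced curve appears. For the point
    0 the condition is void. *)
Definition ker_red (P : ecpt W) := forall x y, sq P = Aff x y -> ~ O x.

Lemma O_sqr x : O (x ^+ 2) -> O x.
Proof.
move=> h; apply: contrapT => n; have v := vinv_vm n.
have x0 := v_not_O n.
apply: (vm1 (O := O)); rewrite -(divff (expf_neq0 2 x0)); apply: vmMl => //.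
by rewrite -exprVn expr2; apply: vmMl => //; exact: vm_O.
Qed.
Lemma not_O_sqr x : ~ O x -> ~ O (x ^+ 2).
Proof. by move=> h /O_sqr. Qed.
Lemma not_OB x y : ~ O x -> O y -> ~ O (x - y).
Proof. by move=> h hy h'; apply: h; rewrite -(subrK y x); apply: srD. Qed.
Lemma not_O_div x y : O x -> ~ vm x -> vm y -> y != 0 -> ~ O (x / y).
Proof.
move=> Ox nx vy y0 h; apply: nx; rewrite -(divfK y0 x); exact: vmMl.
Qed.
Lemma O_wf x : O x -> O (wf W x).
Proof. by move=> hx; rewrite /wf; do !apply: srD => //; do ?apply: srM => //; exact: srX. Qed.
Lemma O_wf' x : O x -> O (wf' W x).
Proof.
by move=> hx; rewrite /wf'; do !apply: srD => //; do ?apply: srM => //; do ?apply: srX => //; exact: sr_nat.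
Qed.
Lemma O_y (P : ecpt W) x y : sq P = Aff x y -> O x -> O y.
Proof. by move=> e hx; apply: O_sqr; rewrite (sq_onE e); exact: O_wf. Qed.
Lemma two_unit : ~ vm 2.
Proof. by apply: vmP => //; exact: gc_char0 W 1. Qed.

Lemma ker_red0 : ker_red 0. Proof. by move=> x y; rewrite sq0. Qed.
Lemma ker_redN P : ker_red P -> ker_red (- P).
Proof.
move=> h x y e; apply: (h x (- y)); rewrite -[P]opprK; exact: sqNE.
Qed.

Lemma wf_div u : ~ O u -> O (wf W u / u ^+ 4) /\ vm (u^-1).
Proof.
move=> n; have v := vinv_vm n; have u0 := v_not_O n; split=> //.
have -> : wf W u / u ^+ 4 = u^-1 + sqa2 W * u^-1 ^+ 2 + sqa4 W * u^-1 ^+ 3 + sqa6 W * u^-1 ^+ 4.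
 by rewrite /wf; field.
have Ov := vm_O v.
by do !apply: srD => //; apply: srM => //; exact: srX.
Qed.

(** The chord formula is rewritten in terms of [1 / x2] and [y2 / x2^2], which are integral when
    [x2] is not. *)
Lemma integral_ker_add (P Q : ecpt W) x1 y1 x2 y2 : sq P = Aff x1 y1 -> O x1 -> sq Q = Aff x2 y2 -> ~ O x2 ->
 exists x3 y3, sq (P + Q) = Aff x3 y3 /\ O x3.
Proof.
move=> eP h1 eQ h2; have n12 : x1 != x2 by apply: contra_notN h2 => /eqP <-.
have [y3 e3] := chord_x eP eQ n12.
exists (((y2 - y1) / (x2 - x1)) ^+ 2 - sqa2 W - x1 - x2), y3; split=> //.
have [hw v] := wf_div h2; have x20 := v_not_O h2; have Ov := vm_O v.
have hy : O (y2 / x2 ^+ 2).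
 by apply: O_sqr; rewrite exprMn (sq_onE eQ) exprVn -exprM.
have Oy1 := O_y eP h1.
have u1 : O (1 - x1 / x2)^-1 /\ 1 - x1 / x2 != 0.
 have [] // := @vunit _ O (1 - x1 / x2).
  by apply: srB; [exact: sr1|exact: srM].
 move=> h; apply: (@vm1 _ O); rewrite -[1](subrK (x1 / x2)).
 by apply: vmD => //; exact: vmMl.
case: u1 => u1 u0.
have e2 := sq_onE eQ; rewrite /wf in e2.
have -> : ((y2 - y1) / (x2 - x1)) ^+ 2 - sqa2 W - x1 - x2 =
 (sqa2 W + 2 * x1 + (sqa4 W - x1 ^+ 2) / x2 + (sqa6 W + y1 ^+ 2) * x2^-1 ^+ 2 - 2 * y1 * (y2 / x2 ^+ 2))
 * (1 - x1 / x2)^-1 ^+ 2 - sqa2 W - x1.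
 have n21 : x2 - x1 != 0 by rewrite subr_eq0 eq_sym.
 have -> : sqa6 W = y2 ^+ 2 - (x2 ^+ 3 + sqa2 W * x2 ^+ 2 + sqa4 W * x2) by rewrite e2; ring.
 field; apply/andP; split => //.
have O2' : O 2 by exact: sr_nat.
apply: srB => //; apply: srB => //; apply: srM; last exact: srX.
apply: srB; last by apply: srM => //; exact: srM.
do !apply: srD => //; try (by apply: srM).
 by apply: srM => //; apply: srB => //; exact: srX.
by apply: srM; [apply: srD => //|]; exact: srX.
Qed.

(** If [P + Q] were integral, then so would be [P = (P + Q) - Q], by [integral_ker_add]. *)
Lemma ker_redD P Q : ker_red P -> ker_red Q -> ker_red (P + Q).
Proof.
move=> hP hQ x y e Ox.
case: (sq_cases Q) => [q0|[u [w eQ]]].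
 by apply: (hP x y) => //; rewrite -e q0 addr0.
have [x3 [y3 [e3 O3]]] := integral_ker_add e Ox (sqNE eQ) (hQ _ _ eQ).
by apply: (hP x3 y3) => //; rewrite -e3 addrK.
Qed.
Lemma ker_redB P Q : ker_red P -> ker_red Q -> ker_red (P - Q).
Proof. by move=> hP hQ; apply: ker_redD => //; exact: ker_redN. Qed.
(* Integral points with the same reduction differ by a point of the kernel: the
  chord or tangent of [P - P'] has a pole, seen from the slope
  [(y + y') / (x' - x) = G / (y' - y)] when [y] is not a unit. *)
Lemma same_reduction P P' x y x' y' : sq P = Aff x y -> sq P' = Aff x' y' -> O x -> O x' ->
 vm (x' - x) -> vm (y' - y) -> ker_red (P - P').
Proof.
move=> e e' Ox Ox' vx vy x3 y3 e3.
have Oy := O_y e Ox; have Oy' := O_y e' Ox'.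
have eN := sqNE e'.
have sq2 (a b : L) : vm y -> a = b -> vm (2 * y) by move=> hy _; apply: vmMl => //; exact: sr_nat.
have nsy : vm y -> ~ vm (wf' W x).
 move=> hy; apply: nonsing => //; rewrite -(sq_onE e) expr2; exact: vmMl.
have [ex|nx] := eqVneq x x'.
 rewrite -ex in e'; case: (sq_same e e') => eP.
  by move: e3; rewrite eP subrr sq0.
 have ey : y' = - y by move: e'; rewrite eP (sqNE e) => -[].
 have vy0 : vm y.
  have : vm (2 * y) by rewrite (_ : 2 * y = - (y' - y)); [exact: vmN|rewrite ey; ring].
  by case/vm_prime => //; [exact: sr_nat|move=> /two_unit].
 have y0 : y != 0.
  apply/eqP => y0; move: e3; rewrite eP opprK.
  have -> : P + P = 0 by rewrite -{2}(_ : - P = P) ?subrr //; apply: sq_inj; rewrite (sqNE e) e y0 oppr0.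
  by rewrite sq0.
 have [w ew] := tangent_x e y0.
 move: e3; rewrite eP opprK ew => -[<- _].
 have n2 : 2 * y != 0 by rewrite mulf_neq0 //; exact: gc_char0 W 1.
 have nl : ~ O (wf' W x / (2 * y)).
  by apply: not_O_div => //; [exact: O_wf'|exact: nsy|apply: vmMl => //; exact: sr_nat].
 by do 3!apply: not_OB => //; exact: not_O_sqr.
have [w ew] := chord_x e eN nx; move: e3; rewrite ew => -[<- _].
have dx : x' - x != 0 by rewrite subr_eq0 eq_sym.
suff nl : ~ O ((- y' - y) / (x' - x)) by do 3!apply: not_OB => //; exact: not_O_sqr.
have [hy|ny] := pselect (vm y); last first.
 apply: not_O_div => //; first by apply: srB => //; exact: srN.
 move=> h; have : vm (2 * y) by rewrite (_ : 2 * y = - (- y' - y) - (y' - y)); [apply: vmB => //; exact: vmN|ring].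
 by case/vm_prime => //; [exact: sr_nat|move=> /two_unit].
pose G := x' ^+ 2 + x' * x + x ^+ 2 + sqa2 W * (x' + x) + sqa4 W.
have eG : (y' - y) * (y' + y) = (x' - x) * G.
 transitivity (y' ^+ 2 - y ^+ 2); first by ring.
 by rewrite (sq_onE e) (sq_onE e') /wf /G; ring.
have nG : ~ vm G.
 move=> h; apply: (nsy hy).
 have -> : wf' W x = G - (x' - x) * (x' + 2 * x + sqa2 W) by rewrite /wf' /G; ring.
 by apply: vmB => //; apply: vmMr => //; do !apply: srD => //; apply: srM => //; exact: sr_nat.
have OG : O G.
 by rewrite /G; do !apply: srD => //; do ?apply: srM => //; do ?apply: srD => //; exact: srX.
have yy : y' - y != 0.
 apply/eqP => h; move: eG; rewrite h mul0r => /esym/eqP; rewrite mulf_eq0 (negbTE dx) /= => /eqP g0.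
 by apply: nG; rewrite g0; exact: vm0.
have -> : (- y' - y) / (x' - x) = - (G / (y' - y)).
 apply: (mulIf dx); rewrite divfK // mulNr mulrAC [G * _]mulrC -eG.
 by rewrite [(y' - y) * _]mulrC mulfK // opprD.
move=> /srN; rewrite opprK; exact: not_O_div.
Qed.

Section Torsion.
Variables (F : fieldType) (E : weierstrass F) (e : {rmorphism F -> L}).
Hypothesis eW : gc_eqn W = map_weierstrass e E.
Variables (n d : nat) (a : F) (A B Z : {poly F}).
Hypotheses (a0 : a != 0) (lA : lcof d.+1 a A) (lB : lcof d (n%:R ^+ 2 * a) B) (mp : mulpoly E n A B Z).
Hypotheses (hZ : forall x, evp e x Z = 0 -> O x) (hA : O (e (A`_d / a))) (On : O n%:R^-1).
Hypothesis n0 : (0 < n)%N.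

Lemma ker_red_torsion P : ker_red P -> P *+ n = 0 -> P = 0.
Proof.
move=> h Pn; case: (sq_cases P) => [//|[x [y eP]]].
have nx := h _ _ eP.
have Zx : evp e x Z != 0 by apply/eqP => /hZ.
have [_ [y' e']] := mp eW eP Zx.
by rewrite Pn sq0 in e'.
Qed.

(** Let [c] be the abscissa of [Q]. By Vieta the roots of [A - c B] sum to [n^2 c - A_d / a], which
    is not integral since [n] is a unit. So some root is not integral, and it is the abscissa of a
    point of the kernel. *)
Lemma ker_red_divisible Q : ker_red Q -> exists2 P, ker_red P & P *+ n = Q.
Proof.
move=> h; case: (sq_cases Q) => [->|[c [b eQ]]].
 by exists 0; rewrite ?mul0rn //; exact: ker_red0.
have nc := h _ _ eQ.
pose p := map_poly e A - c *: map_poly e B.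
have pd1 : p`_d.+1 = e a.
 rewrite coefB coefZ !coef_map /= lA.2 (nth_default _ (leq_trans lB.1 (leqnn _))) rmorph0 mulr0 subr0 //.
have ea0 : e a != 0 by rewrite fmorph_eq0.
have sp : size p = d.+2.
 apply/eqP; rewrite eqn_leq; apply/andP; split; last first.
  by rewrite ltnNge; apply: contra ea0 => hs; rewrite -pd1 nth_default.
 apply: leq_trans (size_polyD _ _) _; rewrite size_polyN geq_max size_map_poly lA.1 /=.
 apply: leq_trans (size_scale_leq _ _) _; rewrite size_map_poly.
 exact: leq_trans lB.1 (leqnSn _).
have p0 : p != 0 by rewrite -size_poly_gt0 sp.
have [r er] := closed_field_poly_normal p.
have lp : lead_coef p = e a by rewrite lead_coefE sp /= pd1.
have sr : size r = d.+1.
 by apply: succn_inj; rewrite -(size_prod_XsubC r id) -sp er size_scale ?lp.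
have sumr : \sum_(z <- r) z = e (n%:R ^+ 2) * c - e (A`_d / a).
 have := coefPn_prod_XsubC (ps := r); rewrite sr => /(_ isT) /= hh.
 have hd : (lead_coef p *: \prod_(z <- r) ('X - z%:P))`_d = p`_d by rewrite -er.
 move: hd; rewrite coefZ hh lp coefB coefZ !coef_map /= lB.2 => hd.
 apply: (mulfI ea0); apply: oppr_inj; rewrite -mulrN hd fmorph_div rmorphM mulrBr mulrC.
 by field.
have [x xr nx] : exists2 x, x \in r & ~ O x.
 apply: contrapT => hn; have hr z : z \in r -> O z.
  by move=> zr; apply: contrapT => nz; apply: hn; exists z.
 apply: nc; have n2 : n%:R != 0 :> L by case: n n0 => // m _; exact: gc_char0.
 have -> : c = (\sum_(z <- r) z + e (A`_d / a)) * (n%:R^-1) ^+ 2.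
  by rewrite sumr subrK rmorphXn rmorph_nat; field.
 by apply: srM; [apply: srD => //; exact: sr_sum_seq|exact: srX].
have Zx : evp e x Z != 0 by apply/eqP => /hZ.
have [P [y eP]] := sq_ex W x.
have [Bx [y' e']] := mp eW eP Zx.
have px : evp e x A = c * evp e x B.
 have : p.[x] = 0.
  by apply/eqP; rewrite er hornerZ mulf_eq0 -/(root _ x) root_prod_XsubC xr orbT.
 by rewrite hornerD hornerN hornerZ => /subr0_eq.
rewrite px mulfK // in e'.
have kP : ker_red P by move=> x1 y1; rewrite eP => -[<- _].
case: (sq_same e' eQ) => ->; first by exists P.
by exists (- P); rewrite ?mulNrn //; exact: ker_redN.
Qed.
End Torsion.
End Reduction.

(** * Local conditions *)

Section LocalConditions.
Variables (F : fieldType) (Fb : algClosure F) (p : nat) (E : weierstrass F) (W : goodcurve Fb).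
Hypothesis eW : gc_eqn W = map_weierstrass (ac_emb Fb) E.
Local Notation G := (absGal Fb).
Local Notation "s @@ P" := (gpt eW s P) (at level 40, left associativity).

Definition ecocycle (d : G -> ecpt W) := [/\ forall s, d s *+ p = 0,
 forall s t, d (gal_mul s t) = d s + s @@ d t & gal_continuous d].

Lemma ptorsionE (P : ecpt W) : ptorsion (map_weierstrass (ac_emb Fb) E) p P <-> P *+ p = 0.
Proof.
rewrite /ptorsion -eW pt_on -ptMn; split=> [[_ h]|->]; first exact: pt_inj.
by [].
Qed.

Lemma ptorsion_ex Q : ptorsion (map_weierstrass (ac_emb Fb) E) p Q ->
 exists2 P : ecpt W, P *+ p = 0 & Q = pt P.
Proof.
move=> h; have o : on_curve W Q by rewrite eW; case: h.
by exists (Ecpt o) => //; apply/ptorsionE.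
Qed.

Lemma cocycle_lift c : cocycle p E c -> exists2 d : G -> ecpt W, ecocycle d & forall s, c s = pt (d s).
Proof.
move=> [h1 h2 h3]; have /choice[d hd] : forall s, exists P : ecpt W, P *+ p = 0 /\ c s = pt P.
 by move=> s; have [P] := ptorsion_ex (h1 s); exists P.
exists d => [|s]; last exact: (hd s).2.
split=> [s|s t|s]; first exact: (hd s).1.
 by apply: pt_inj; rewrite -(hd _).2 h2 -eW ptD gptE -!(hd _).2.
by have [r hr] := h3 s; exists r => t /hr e; apply: pt_inj; rewrite -!(hd _).2.
Qed.

Lemma cocycle_pt d c : ecocycle d -> (forall s, c s = pt (d s)) -> cocycle p E c.
Proof.
move=> [h1 h2 h3] e; split=> [s|s t|s]; rewrite ?e.
- by apply/ptorsionE; exact: h1.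
- by rewrite h2 ptD gptE -eW.
- by have [r hr] := h3 s; exists r => t /hr; rewrite !e => ->.
Qed.

Lemma ecocycle1 d : ecocycle d -> d (gal_one Fb) = 0.
Proof.
case=> _ h _; have := h (gal_one Fb) (gal_one Fb); rewrite gal_mul1 gpt1 => /eqP.
by rewrite -subr_eq0 opprD addNKr oppr_eq0 => /eqP.
Qed.
Lemma ecocycleV d s : ecocycle d -> s @@ d (gal_inv s) = - d s.
Proof.
move=> c; have := ecocycle1 c; case: c => _ h _; rewrite -(gal_mulV s) h => /eqP.
by rewrite addr_eq0 => /eqP ->; rewrite opprK.
Qed.

Lemma cohomologousE (d d' : G -> ecpt W) :
 cohomologous p E (fun s => pt (d s)) (fun s => pt (d' s)) <->
 exists2 T : ecpt W, T *+ p = 0 & forall s, d' s = d s + (s @@ T - T).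
Proof.
split=> [[Q hQ h]|[T hT h]].
 have [T hT e] := ptorsion_ex hQ; exists T => // s; apply: pt_inj.
 by rewrite h e -eW.
exists (pt T); first exact/ptorsionE.
by move=> s; rewrite /= h -eW.
Qed.

Section Gamma.
Variables (M : fieldType) (psi : G -> M).
Hypothesis psiM : forall s t, psi (gal_mul s t) = psi s * psi t.
Hypothesis psip : forall s, psi s ^+ p = 1.
Hypothesis p0 : (0 < p)%N.

Lemma psi1 : psi (gal_one Fb) = 1.
Proof.
have n0 : psi (gal_one Fb) != 0.
 by apply/eqP => h; have /eqP := psip (gal_one Fb); rewrite h expr0n eqn0Ngt p0 eq_sym oner_eq0.
by apply: (mulfI n0); rewrite -psiM gal_mul1 mulr1.
Qed.
Lemma psi_neq0 s : psi s != 0.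
Proof. by apply/eqP => h; have /eqP := psip s; rewrite h expr0n eqn0Ngt p0 eq_sym oner_eq0. Qed.
Lemma psiV s : psi (gal_inv s) = (psi s)^-1.
Proof. by apply: (mulfI (psi_neq0 s)); rewrite -psiM gal_mulV psi1 divff ?psi_neq0. Qed.
Lemma psiX s n : psi (gal_exp s n) = psi s ^+ n.
Proof. by elim: n => [|n IH]; rewrite ?psi1 // /gal_exp iterS -/(gal_exp s n) psiM IH exprS. Qed.

(* [P] is the value at 1 of a point of the twist dividing the given one, and the
  value at [s] is then [s P - d s]; the second clause says that it lies in the
  kernel of the norm. *)
Definition egamma (d : G -> ecpt W) := exists P : ecpt W,
 (forall s, psi s = 1 -> d s = s @@ P - P) /\
 forall g, psi g <> 1 -> \sum_(k < p) (gal_exp g k @@ P - d (gal_exp g k)) = 0.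

(** From a Kummer datum [R], its value at 1 plus the torsion point of the coboundary gives [P].
    Conversely [R s = s P - d s] depends only on [psi s], its norm vanishes by the second clause of
    [egamma], and its image under [twist_pi] is rational because [psi] takes commuting values. *)
Lemma gammaE (d : G -> ecpt W) c : ecocycle d -> (forall s, c s = pt (d s)) ->
 gamma p E psi c <-> egamma d.
Proof.
move=> cd ec; have [h1 h2 h3] := cd; split.
 move=> [_ [d0 [Q hQ hd0] cases]].
 have [T hT eT] := ptorsion_ex hQ.
 case: cases => [[triv [_ [R0 [_ oR _ hR]]]]|[_ [g0 [_ [R0 [_ _ [oR psiR sumR] _ hR]]]]]].
  rewrite -eW in oR; pose R := Ecpt oR.
  exists (R + T); split=> [s _|g /(_ (triv g))//]; apply: pt_inj.
  rewrite -ec hd0 hR eT -eW.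
  by rewrite (_ : padd _ _ _ = pt ((s @@ R - R) + (s @@ T - T))) // gptD; congr pt; rewrite addrACA -opprD.
 have oR' s : on_curve W (R0 s) by rewrite eW.
 pose R s := Ecpt (oR' s).
 have ed s : d s = s @@ R (gal_one Fb) - R s + (s @@ T - T).
  apply: pt_inj; rewrite -ec hd0 -(hR s s) /twist_act gal_Vmul eT -eW.
  by [].
 exists (R (gal_one Fb) + T); split=> [s ps|g pg].
  have -> : d s = s @@ R (gal_one Fb) - R (gal_one Fb) + (s @@ T - T).
   by rewrite ed (_ : R s = R (gal_one Fb)) //; apply: pt_inj; apply: psiR; rewrite ps psi1.
  by rewrite gptD addrACA -opprD.
 rewrite (eq_bigr (fun k : 'I_p => R (gal_exp g k) + T)); last first.
  by move=> k _; rewrite ed gptD opprD addrACA !subKr.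
 rewrite big_split /= sumr_const card_ord hT addr0; apply: pt_inj; rewrite pt_sum.
 by have := sumR g pg; rewrite -eW.
move=> [P [hP sP]]; split; first exact: cocycle_pt ec.
exists c.
 exists Infty; first exact: (ptorsionE 0).2 (mul0rn _ _).
 by move=> s; rewrite ec -eW /= -[X in padd _ _ X]/(pt (0 - 0 : ecpt W)) subr0 -ptD addr0.
have [nt|triv] := pselect (exists s, psi s <> 1); last first.
 have {}triv s : psi s = 1 by apply: contrapT => h; apply: triv; exists s.
 left; split=> //; exists (pt (P *+ p)), (pt P); rewrite -eW.
 split; [|exact: pt_on|by rewrite ptMn|by move=> s; rewrite ec hP // triv].
 split=> [|s]; first by rewrite -eW pt_on.
 rewrite -(gptE eW) gptMn; congr pt; apply/eqP; rewrite -subr_eq0 -mulrnBl.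
 by rewrite -hP ?triv // h1.
right; split=> //.
have [R RE] : exists R : G -> ecpt W, forall s, R s = s @@ P - d s by eexists.
have Rpsi s t : psi s = psi t -> R s = R t.
 move=> e; pose u := gal_mul (gal_inv s) t.
 have pu : psi u = 1 by rewrite psiM psiV e mulVf ?psi_neq0.
 have -> : t = gal_mul s u by rewrite /u gal_mulA gal_mulV gal_1mul.
 by rewrite !RE gptM h2 (hP u pu) gptB opprD opprB addrCA [X in _ = _ + X]addrC subrK addrC.
have Rs s t : R (gal_mul s t) = s @@ R t - d s.
 by rewrite !RE gptM h2 gptB opprD addrA addrAC.
have [g pg] := nt.
have [Q QE] : exists Q : G -> ecpt W, forall t, Q t = R (gal_mul (gal_inv g) t) - R t by eexists.
exists g, (fun s => pt (Q s)), (fun s => pt (R s)).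
have onR : on_twist p E psi (fun s => pt (R s)).
 split=> [s|s t e|h ph]; first by rewrite -eW pt_on.
  by rewrite (Rpsi _ _ e).
 by rewrite -eW -(pt_sum (fun k : 'I_p => R (gal_exp h k))); under eq_bigr do rewrite RE; rewrite sP.
split=> //.
- split.
  split=> [s|s t e|h ph]; first by rewrite -eW pt_on.
   by rewrite !QE (Rpsi _ _ e) (Rpsi (gal_mul (gal_inv g) s) (gal_mul (gal_inv g) t)) // !psiM e.
  rewrite -eW -(pt_sum (fun k : 'I_p => Q (gal_exp h k))).
  have sR : \sum_(k < p) R (gal_exp h k) = 0 by under eq_bigr do rewrite RE; rewrite sP.
  under eq_bigr do rewrite QE Rs.
  by rewrite !sumrB -gpt_sum sR gpt0 sumr_const card_ord h1 !subr0.
 move=> s t; rewrite /twist_act /= -(gptE eW); congr pt; rewrite !QE.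
 rewrite (Rpsi (gal_mul (gal_inv g) (gal_mul (gal_inv s) t)) (gal_mul (gal_inv s) (gal_mul (gal_inv g) t))); last first.
  by rewrite !psiM mulrCA.
 rewrite !(Rs (gal_inv s)) !gptB !gptVK.
 by rewrite opprB addrA subrK.
- by move=> t; rewrite /twist_pi QE -eW.
move=> s t; rewrite ec -eW /twist_act /= -(gptE eW) -ptB; congr pt.
by rewrite Rs gptB gptVK (ecocycleV _ cd) opprK addrC addKr.
Qed.

Lemma egammaB d d' : egamma d -> egamma d' -> egamma (fun s => d s - d' s).
Proof.
move=> [P [h1 h2]] [P' [h1' h2']]; exists (P - P'); split=> [s e|g e].
 by rewrite h1 // h1' // gptB !opprD addrACA.
transitivity (\sum_(k < p) (gal_exp g k @@ P - d (gal_exp g k)) -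
 \sum_(k < p) (gal_exp g k @@ P' - d' (gal_exp g k))); last by rewrite h2 // h2' // subr0.
rewrite -sumrB; apply: eq_bigr => k _.
by rewrite gptB !opprD addrACA.
Qed.

Lemma egamma_cob (T : ecpt W) : T *+ p = 0 -> egamma (fun s => s @@ T - T).
Proof.
move=> hT; exists T; split=> // g _.
under eq_bigr do rewrite subKr.
by rewrite sumr_const card_ord.
Qed.

(** [psi g] is a power of the primitive root [psi g0], so the powers of [g] run through the same
    classes modulo the kernel of [psi] in another order, and the summand depends only on the
    class. *)
Lemma twist_sum_one (d : G -> ecpt W) (P : ecpt W) g0 : prime p -> ecocycle d ->
 (forall s, psi s = 1 -> d s = s @@ P - P) -> psi g0 <> 1 ->
 \sum_(k < p) (gal_exp g0 k @@ P - d (gal_exp g0 k)) = 0 ->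
 forall g, psi g <> 1 -> \sum_(k < p) (gal_exp g k @@ P - d (gal_exp g k)) = 0.
Proof.
move=> pp [_ h2 _] hP n0 s0 g ng.
have [R RE] : exists R : G -> ecpt W, forall s, R s = s @@ P - d s by eexists.
have Rpsi s t : psi s = psi t -> R s = R t.
 move=> e; pose u := gal_mul (gal_inv s) t.
 have pu : psi u = 1 by rewrite psiM psiV e mulVf ?psi_neq0.
 have -> : t = gal_mul s u by rewrite /u gal_mulA gal_mulV gal_1mul.
 by rewrite !RE gptM h2 (hP u pu) gptB opprD opprB addrCA [X in _ = _ + X]addrC subrK addrC.
have prim s : psi s <> 1 -> p.-primitive_root (psi s).
 move=> ns; have [m hm dv] := prim_order_exists p0 (psip s).
 move/primeP: (pp) => [_ /(_ m dv) /orP[]/eqP em]; last by rewrite em in hm.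
 by case: ns; have := prim_expr_order hm; rewrite em expr1.
have [a ea] := prim_rootP (prim _ n0) (psip g).
have na : ~~ (p %| a)%N.
 by apply/negP => /dvdnP[b eb]; apply: ng; rewrite ea eb mulnC exprM psip expr1n.
pose h (k : 'I_p) : 'I_p := Ordinal (ltn_pmod (a * k) p0).
have hinj : injective h.
 move=> i j /(congr1 val)/= /eqP e; apply: val_inj; apply/eqP; move: e.
 wlog le : i j / (i <= j)%N.
  by move=> H; case: (leqP i j) => [/H//|/ltnW/H{}H]; rewrite eq_sym => /H; rewrite eq_sym.
 rewrite eq_sym eqn_mod_dvd; last by rewrite leq_mul2l le orbT.
 rewrite -mulnBr Euclid_dvdM // (negbTE na) /= => dv.
 have lt : (j - i < p)%N by apply: leq_ltn_trans (leq_subr _ _) (ltn_ord j).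
 by rewrite eqn_leq le /= -subn_eq0; move: dv; rewrite /dvdn modn_small.
rewrite -[RHS]s0 [RHS](reindex_inj hinj) /=; apply: eq_bigr => k _.
rewrite -!RE; apply: (Rpsi); rewrite !psiX /= ea -!exprM expr_mod //; exact: psip.
Qed.
End Gamma.
End LocalConditions.

Definition py (L : fieldType) (P : point L) : L := if P is Aff _ y then y else 0.

Section GoodReduction.
Variables (F : fieldType) (Fb : algClosure F) (O : valring Fb).
Hypothesis Ogal : forall (s : absGal Fb) x, O x -> O (s x).
Variables (E : weierstrass F) (W : goodcurve Fb).
Hypothesis eW : gc_eqn W = map_weierstrass (ac_emb Fb) E.
Variables (p q : nat).
Hypotheses (pp : prime p) (p3 : (3 <= p)%N) (q1 : (1 < q)%N).
Local Notation G := (absGal Fb).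
Local Notation vm := (vm O).
Local Notation rsd := (@rsd Fb O).
Local Notation kr := (@ker_red Fb O W).
Local Notation "s @@ P" := (gpt eW s P) (at level 40, left associativity).
Hypothesis krB : forall P Q, kr P -> kr Q -> kr (P - Q).
Hypothesis krT : forall P, kr P -> P *+ p = 0 -> P = 0.
Hypothesis krDiv : forall Q, kr Q -> exists2 P, kr P & P *+ p = Q.
Hypothesis krS : forall (P P' : ecpt W) x y x' y', sq P = Aff x y -> sq P' = Aff x' y' ->
 O x -> O x' -> vm (x' - x) -> vm (y' - y) -> kr (P - P').
Hypothesis krY : forall (P : ecpt W) x y, sq P = Aff x y -> O x -> O y.
Hypothesis frob : forall r : seq Fb, {in r, forall x, O x} ->
 exists phi : G, {in r, forall x, forall j, rsd (gal_exp phi j x) = rsd x ^+ (q ^ j)} /\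
 forall s : G, exists j, {in r, forall x, rsd (s x) = rsd (gal_exp phi j x)}.

Definition fixes (r : seq Fb) (s : G) := {in r, forall x, vm (s x - x)}.
(** Triviality on inertia with continuity built in: fixing the residues of a finite list of integral
    elements already forces the value [t0]. *)
Definition unram (T : Type) (t0 : T) (f : G -> T) :=
 exists2 r : seq Fb, {in r, forall x, O x} & forall s, fixes r s -> f s = t0.

Lemma fixes_cat r1 r2 s : fixes (r1 ++ r2) s <-> fixes r1 s /\ fixes r2 s.
Proof.
split=> [h|[h1 h2] x]; last by rewrite mem_cat => /orP[/h1|/h2].
by split=> x xr; apply: h; rewrite mem_cat xr ?orbT.
Qed.

Lemma kr0 : kr 0. Proof. by move=> x y; rewrite sq0. Qed.
Lemma krN P : kr P -> kr (- P). Proof. by move=> h; rewrite -sub0r; apply: krB => //; exact: kr0. Qed.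
Lemma krD P Q : kr P -> kr Q -> kr (P + Q).
Proof. by move=> hP hQ; rewrite -[Q]opprK; apply: krB => //; exact: krN. Qed.

Lemma kr_gal s P : kr P -> kr (s @@ P).
Proof.
move=> h x y; rewrite sq_gpt; case e : (sq P) => [|x0 y0] //= [<- _] /(Ogal (gal_inv s)).
by rewrite gal_invK; exact: h e.
Qed.

(** Nothing is listed for points in the kernel of reduction, so that the list always consists of
    integral elements. *)
Definition cl (P : ecpt W) : seq Fb :=
 if sq P is Aff x y then (if pselect (O x) then [:: x; y] else [::]) else [::].
Lemma cl_O P : {in cl P, forall x, O x}.
Proof.
rewrite /cl; case e : (sq P) => [|x y] //; case: pselect => // h z.
by rewrite !inE => /orP[]/eqP-> //; exact: krY e h.
Qed.
Lemma clE P x y : sq P = Aff x y -> O x -> cl P = [:: x; y].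
Proof. by move=> e h; rewrite /cl e; case: pselect. Qed.

Lemma red_fix P s : fixes (cl P) s -> kr (s @@ P - P).
Proof.
move=> h; have [k|nk] := pselect (kr P); first by apply: krB => //; exact: kr_gal.
have [x [y [e Ox]]] : exists x y, sq P = Aff x y /\ O x.
 by apply: contrapT => n; apply: nk => x y e Ox; apply: n; exists x, y.
have e' : sq (s @@ P) = Aff (s x) (s y) by rewrite sq_gpt e.
have Osx : O (s x) by apply: Ogal.
move: h; rewrite (clE e Ox) => h; apply: (krS e' e Osx Ox).
 by rewrite -opprB; apply: vmN; apply: h; rewrite mem_head.
by rewrite -opprB; apply: vmN; apply: h; rewrite !inE eqxx orbT.
Qed.

Lemma kr_ptors j P : kr P -> P *+ p ^ j = 0 -> P = 0.
Proof.
elim: j => [|j IH] kP; rewrite ?expn0 // expnSr mulrnA => h; apply: IH => //; apply: krT => //.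
by elim: (p ^ j)%N => [|n IHn]; rewrite ?mulr0n ?mulrS; [exact: kr0|exact: krD].
Qed.

Lemma ptors_fix j P s : P *+ p ^ j = 0 -> fixes (cl P) s -> s @@ P = P.
Proof.
move=> h /red_fix k; apply/eqP; rewrite -subr_eq0; apply/eqP/(kr_ptors (j := j)) => //.
by rewrite mulrnBl -gptMn h gpt0 subr0.
Qed.

Lemma torsion_list n : (0 < n)%N -> exists2 l : seq (ecpt W), uniq l &
 forall P, (P \in l) = (P *+ n == 0).
Proof.
move=> n0; have [l hl] := torsion_finite eW n0.
exists (undup [seq P <- l | P *+ n == 0]); first exact: undup_uniq.
move=> P; rewrite mem_undup mem_filter; case: eqP => //= /hl.
by [].
Qed.

Lemma V_coords : exists2 r : seq Fb, {in r, forall x, O x} &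
 forall s, fixes r s -> forall T : ecpt W, T *+ p = 0 -> s @@ T = T.
Proof.
have [l ul hl] := torsion_list (prime_gt0 pp).
exists (flatten [seq cl P | P <- l]).
 by move=> x /flattenP[_ /mapP[P _ ->]]; exact: cl_O.
move=> s h T hT; apply: (ptors_fix (j := 1)); first by rewrite expn1.
move=> x xc; apply: h; apply/flattenP; exists (cl T) => //; apply: map_f.
by rewrite hl hT.
Qed.

Lemma gal_expS (s : G) n : gal_exp s n.+1 = gal_mul s (gal_exp s n). Proof. by []. Qed.
Lemma gal_expD (s : G) m n : gal_exp s (m + n) = gal_mul (gal_exp s m) (gal_exp s n).
Proof.
by elim: m => [|m IH]; rewrite ?gal_1mul // addSn !gal_expS IH gal_mulA.
Qed.

Section Psi.
Variables (M : fieldType) (psi : G -> M).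
Hypothesis psiM : forall s t, psi (gal_mul s t) = psi s * psi t.
Hypothesis psip : forall s, psi s ^+ p = 1.
Let p0 : (0 < p)%N := prime_gt0 pp.
Variable d : G -> ecpt W.
Hypothesis cd : ecocycle p eW d.

(** If [s] fixes the residues of the coordinates of [P], then [d s = s P - P] lies in the kernel of
    reduction and is killed by [p], hence is 0. *)
Lemma gamma_unram : unram 1 psi -> egamma p eW psi d -> unram 0 d.
Proof.
move=> [r rO hr] [P [hP _]]; exists (r ++ cl P).
 by move=> x; rewrite mem_cat => /orP[/rO//|/cl_O].
move=> s /fixes_cat[/hr ps /red_fix k]; rewrite hP //; apply: krT => //.
by rewrite -hP //; case: cd.
Qed.

Lemma count_fibers (S T : eqType) (f : S -> T) (s : seq S) B :
 (forall y, (count (fun x => f x == y) s <= B)%N) -> (size s <= B * size (undup (map f s)))%N.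
Proof.
move=> h; have -> : size s = \sum_(y <- undup (map f s)) count (fun x => f x == y) s.
 have -> : (size s = \sum_(x <- s) \sum_(y <- undup (map f s)) (f x == y))%N.
  rewrite -sum1_size big_seq [RHS]big_seq; apply: eq_bigr => x xs.
  have := count_uniq_mem (f x) (undup_uniq (map f s)); rewrite mem_undup map_f // => /esym e1.
  rewrite [LHS]e1 -sum1_count big_mkcond /=.
  by apply: eq_bigr => y _; rewrite eq_sym; case: eqP.
 rewrite exchange_big /=; apply: eq_bigr => y _.
 by rewrite -sum1_count [RHS]big_mkcond /=; apply: eq_bigr => x _; case: eqP.
apply: (@leq_trans (\sum_(y <- undup (map f s)) B)); first exact: leq_sum.
by rewrite big_const_seq count_predT iter_addn_0.
Qed.

(* [W / f W] has as many elements as the kernel of [f], so fewer than [p ^ m]. *)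
Lemma solve_torsion (f : ecpt W -> ecpt W) B m :
 (forall P Q, f (P - Q) = f P - f Q) ->
 (forall l : seq (ecpt W), uniq l -> {in l, forall P, P *+ p ^ m.+1 = 0 /\ f P = 0} -> (size l <= B)%N) ->
 (B < p ^ m)%N -> forall v, v *+ p = 0 -> exists2 R, R *+ p ^ m.+1 = 0 & f R = v.
Proof.
move=> fB hk Bm v hv; set N := (p ^ m.+1)%N in hk *.
have N0 : (0 < N)%N by rewrite expn_gt0 p0.
have [Wl uW hW] := torsion_list N0.
have f0 : f 0 = 0 by have := fB 0 0; rewrite !subrr.
have fN P : f (- P) = - f P by rewrite -sub0r fB f0 sub0r.
have fD P Q : f (P + Q) = f P + f Q by rewrite -[Q in LHS]opprK fB fN opprK.
have fMn P n : f (P *+ n) = f P *+ n by elim: n => [|n IH]; rewrite ?mulr0n ?f0 // !mulrS fD IH.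
have pm0 : (0 < p ^ m)%N by rewrite expn_gt0 p0.
have [u eu] := divisible eW pm0 v.
have uN : u *+ N = 0 by rewrite /N expnSr mulrnA eu.
pose fW := undup (map f Wl).
have fWP y : y \in fW -> exists2 w, w *+ N = 0 & y = f w.
 by rewrite mem_undup => /mapP[w]; rewrite hW => /eqP; exists w.
have fWm w : w *+ N = 0 -> f w \in fW.
 by move=> h; rewrite mem_undup; apply: map_f; rewrite hW h.
have c1 : (size Wl <= B * size fW)%N.
 apply: count_fibers => y; rewrite -size_filter.
 case e : [seq x <- Wl | f x == y] => [//|x1 t]; rewrite -e.
 have m1 : x1 \in [seq x <- Wl | f x == y] by rewrite e mem_head.
 rewrite -(size_map (fun x => x - x1)); apply: hk.
  by rewrite map_inj_uniq ?filter_uniq //; exact: addIr.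
 move: m1; rewrite mem_filter hW => /andP[/eqP f1 /eqP h1] z /mapP[x].
 rewrite mem_filter hW => /andP[/eqP fx /eqP hx] ->.
 by rewrite mulrnBl hx h1 fB fx f1 !subrr.
(* The cosets of [0, u, ..., B u] modulo the image of [f] cannot all differ, so some [k u] with
   [0 < k <= B] lies in the image. As [B < p^m], the gcd of [k] and [N] divides [p^m], and therefore
   [v = p^m u] is in the image too. *)
have [k [k0 kB [w hw ew]]] : exists k, [/\ (0 < k)%N, (k <= B)%N & exists2 w, w *+ N = 0 & u *+ k = f w].
 apply: contrapT => nk; have nk' k w : (0 < k)%N -> (k <= B)%N -> w *+ N = 0 -> u *+ k <> f w.
  by move=> h1 h2 h3 h4; apply: nk; exists k; split=> //; exists w.
 have key i j y z : (i < j)%N -> (j <= B)%N -> y \in fW -> z \in fW -> u *+ i + y <> u *+ j + z.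
  move=> ij jB /fWP[y' hy ->] /fWP[z' hz ->] e.
  apply: (@nk' (j - i)%N (y' - z')); [by rewrite subn_gt0|by rewrite (leq_trans (leq_subr _ _))|by rewrite mulrnBl hy hz subrr|].
  by rewrite mulrnBr ?(ltnW ij) // fB; apply/eqP; rewrite subr_eq addrAC -subr_eq opprK -e addrC.
 pose al := [seq u *+ i + y | i <- iota 0 B.+1, y <- fW].
 have : (size al <= size Wl)%N.
  apply: uniq_leq_size.
   apply: allpairs_uniq; rewrite ?iota_uniq ?undup_uniq //.
   move=> [i y] [j z] /allpairsP[[i' y'] [hi hy [-> ->]]] /allpairsP[[j' z'] [hj hz [-> ->]]] /= e.
   move: hi hj; rewrite !mem_iota !add0n /= !ltnS => hi hj.
   case: (ltngtP i' j') => ij; last by move: e; rewrite ij => /addrI ->.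
    by case: (key i' j' y' z').
   by case: (key j' i' z' y').
  move=> z /allpairsP[[i y] [_ /fWP[w hw ->] ->]] /=.
  by rewrite hW mulrnDl -mulrnA mulnC mulrnA uN mul0rn add0r -fMn hw f0.
 rewrite size_allpairs size_iota => c2; have := leq_trans c2 c1.
 rewrite mulSn -{2}[(B * _)%N]add0n leq_add2r leqNgt -has_predT; case/negP; apply/hasP.
 by exists (f 0) => //; apply: fWm; rewrite mul0rn.
have [g dg eg] : exists2 g, (g %| p ^ m)%N & exists2 w, w *+ N = 0 & u *+ g = f w.
 exists (gcdn k N).
  have /(dvdn_pfactor _ _ pp)[a am ea] : (gcdn k N %| p ^ m.+1)%N by exact: dvdn_gcdr.
  rewrite ea; apply: dvdn_exp2l; rewrite -ltnS ltn_neqAle am andbT; apply/eqP => e.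
  have : (gcdn k N <= k)%N by apply: dvdn_leq => //; exact: dvdn_gcdl.
  rewrite ea e leqNgt; case/negP; apply: (leq_ltn_trans kB); apply: (leq_trans Bm).
  by rewrite leq_exp2l ?prime_gt1.
 case: (egcdnP N k0) => x y exy _; exists (w *+ x); first by rewrite -mulrnA mulnC mulrnA hw mul0rn.
 by rewrite fMn -ew -mulrnA mulnC exy mulrnDr mulnC mulrnA uN mul0rn add0r.
case: eg => w' hw' ew'; exists (w' *+ (p ^ m %/ g)).
 by rewrite -mulrnA mulnC mulrnA hw' mul0rn.
by rewrite fMn -ew' -mulrnA mulnC divnK.
Qed.

(** A nonzero torsion point fixed by the [j]-th power of [phi] is integral and determined by the
    residues of its two coordinates, which lie in the field with [q^j] elements. The extra 1 counts
    the point 0. *)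
Lemma kernel_bound (phi : G) (r : seq Fb) n j (l : seq (ecpt W)) : (0 < j)%N ->
 {in r, forall x, forall j, rsd (gal_exp phi j x) = rsd x ^+ (q ^ j)} ->
 uniq l -> {in l, forall P, [/\ P *+ p ^ n = 0, {subset cl P <= r} & gal_exp phi j @@ P = P]} ->
 (size l <= (q ^ j * q ^ j).+1)%N.
Proof.
move=> j0 hr ul hl; pose l0 := rem 0 l.
have sl : (size l <= (size l0).+1)%N.
 rewrite /l0; case h : (0 \in l); first by rewrite size_rem // -ltnS prednK //; case: (l) h.
 by rewrite rem_id ?h // leqW.
apply: (leq_trans sl); rewrite ltnS.
have m0 P : P \in l0 = (P != 0) && (P \in l) by rewrite (mem_rem_uniq _ ul) inE.
pose Xc (P : ecpt W) := rsd (px (sq P)); pose Yc (P : ecpt W) := rsd (py (sq P)).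
have co P : P \in l0 -> exists x y, [/\ sq P = Aff x y, O x, O y, Xc P = rsd x & Yc P = rsd y]
  /\ (rsd x ^+ (q ^ j) = rsd x /\ rsd y ^+ (q ^ j) = rsd y).
 rewrite m0 => /andP[P0 /hl[hP sub fP]].
 case: (sq_cases P) => [e|[x [y e]]]; first by rewrite e eqxx in P0.
 have Ox : O x.
  apply: contrapT => nx; case/eqP: P0; apply: (kr_ptors (j := n)) => // x' y'.
  by rewrite e => -[<- _].
 have Oy := krY e Ox.
 exists x, y; split; first by split=> //; rewrite /Xc /Yc e.
 rewrite (clE e Ox) in sub.
 have := sq_gpt eW (gal_exp phi j) P; rewrite fP e /= => -[ex ey].
 by split; rewrite -hr -?ex -?ey //; apply: sub; rewrite !inE eqxx ?orbT.
have bnd (T : ecpt W -> kres O) : {in l0, forall P, T P ^+ (q ^ j) = T P} ->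
  (size (undup (map T l0)) <= q ^ j)%N.
 move=> hT; have Q1 : (1 < q ^ j)%N by rewrite -{1}(exp1n j) ltn_exp2r.
 have sz : size ('X^(q ^ j) - 'X : {poly kres O}) = (q ^ j).+1.
  by rewrite size_polyDl ?size_polyXn // size_polyN size_polyX ltnS.
 have := @max_poly_roots _ ('X^(q ^ j) - 'X) (undup (map T l0)).
 rewrite sz ltnS; apply; rewrite ?undup_uniq //; first by rewrite -size_poly_gt0 sz.
 apply/allP => z; rewrite mem_undup => /mapP[P /hT h ->].
 by rewrite /root !hornerE h subrr.
have bX := bnd Xc; have bY := bnd Yc.
have sub : (size (map (fun P => (Xc P, Yc P)) l0) <= size [seq (x, y) | x <- undup (map Xc l0), y <- undup (map Yc l0)])%N.
 apply: uniq_leq_size.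
  rewrite map_inj_in_uniq ?rem_uniq // => P P' hP hP' [eX eY].
  have [x [y [[e Ox Oy e1 e2] _]]] := co P hP; have [x' [y' [[e' Ox' Oy' e1' e2'] _]]] := co P' hP'.
  apply/eqP; rewrite -subr_eq0; apply/eqP/(kr_ptors (j := n)).
   have vx : vm (x' - x) by apply/rsd_eq => //; rewrite -e1 -e1'.
   have vy : vm (y' - y) by apply/rsd_eq => //; rewrite -e2 -e2'.
   exact: (krS e e' Ox Ox' vx vy).
  move: hP hP'; rewrite !m0 => /andP[_ /hl[h _ _]] /andP[_ /hl[h' _ _]].
  by rewrite mulrnBl h h' subrr.
 move=> z /mapP[P hP ->]; apply/allpairsP; exists (Xc P, Yc P); rewrite !mem_undup.
 by split=> //; exact: map_f.
rewrite size_map size_allpairs in sub; apply: (leq_trans sub); apply: leq_mul.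
 by apply: bX => P /co[x [y [[_ _ _ -> _] [h _]]]].
by apply: bY => P /co[x [y [[_ _ _ _ ->] [_ h]]]].
Qed.

(** For the data at hand the group is generated by Frobenius [phi]. If [psi phi = 1], it is enough
    to solve [phi P - P = d phi]. Otherwise the sum of the conjugates of [P] under the powers
    [phi^k], [k < p], must equal the sum of the [d (phi^k)]. [solve_torsion] solves both equations
    in the [p]-power torsion. *)
Lemma unram_gamma : unram 1 psi -> unram 0 d -> egamma p eW psi d.
Proof.
move=> [r1 r1O hpsi] [r2 r2O hd].
(* [B] bounds the kernels of both operators, whose elements are fixed by [phi] or by [phi^p]. Only
   [B < p^m] matters for [m], and [m = B] achieves it. *)
pose B := (q ^ p * q ^ p).+1; pose m := B.
have Bm : (B < p ^ m)%N by exact: ltn_expl (prime_gt1 pp).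
have N0 : (0 < p ^ m.+1)%N by rewrite expn_gt0 p0.
have [Wl uW hW] := torsion_list N0.
pose r3 := flatten [seq cl P | P <- Wl]; pose r := r1 ++ (r2 ++ r3).
have r3s (P : ecpt W) : P *+ p ^ m.+1 = 0 -> {subset cl P <= r3}.
 by move=> h x xc; apply/flattenP; exists (cl P) => //; apply: map_f; rewrite hW h.
have rs (P : ecpt W) : P *+ p ^ m.+1 = 0 -> {subset cl P <= r}.
 by move=> h x /(r3s _ h); rewrite !mem_cat => ->; rewrite !orbT.
have rO : {in r, forall x, O x}.
 move=> x; rewrite !mem_cat => /or3P[/r1O//|/r2O//|/flattenP[_ /mapP[P _ ->]]]; exact: cl_O.
have [phi [hphi hs]] := frob rO.
have dec s : exists j u, s = gal_mul (gal_exp phi j) u /\ fixes r u.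
 have [j hj] := hs s; exists j, (gal_mul (gal_inv (gal_exp phi j)) s).
 rewrite gal_mulA gal_mulV gal_1mul; split=> // x xr.
 have -> : gal_mul (gal_inv (gal_exp phi j)) s x - x =
   gal_inv (gal_exp phi j) (s x - gal_exp phi j x) by rewrite rmorphB gal_invK.
 apply: (vm_gal Ogal); apply/rsd_eq; [by apply: Ogal; exact: rO|by apply: Ogal; exact: rO|exact: hj].
have [h1 h2 _] := cd.
have psi_u u : fixes r u -> psi u = 1 by move=> /fixes_cat[/hpsi].
have d_u u : fixes r u -> d u = 0 by move=> /fixes_cat[_ /fixes_cat[/hd]].
have P_u u (P : ecpt W) : P *+ p ^ m.+1 = 0 -> fixes r u -> u @@ P = P.
 move=> hP hu; apply: (ptors_fix hP) => x /(rs _ hP); exact: hu.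
have ds j u : fixes r u -> d (gal_mul (gal_exp phi j) u) = d (gal_exp phi j).
 by move=> hu; rewrite h2 (d_u u hu) gpt0 addr0.
have kb (f : ecpt W -> ecpt W) j : (0 < j)%N -> (j <= p)%N ->
  (forall P, f P = 0 -> gal_exp phi j @@ P = P) ->
  forall l : seq (ecpt W), uniq l -> {in l, forall P, P *+ p ^ m.+1 = 0 /\ f P = 0} -> (size l <= B)%N.
 move=> j0 jp hf l ul hl; apply: leq_trans (_ : ((q ^ j * q ^ j).+1 <= B)%N).
  apply: (@kernel_bound phi r m.+1 j) => // P /hl[hP /hf fP]; split=> //; exact: rs.
 by rewrite /B ltnS leq_mul // leq_pexp2l // ltnW.
have dexp P k : d (gal_exp phi k) = gal_exp phi k @@ P - P ->
  forall i, d (gal_exp phi (k * i)) = gal_exp phi (k * i) @@ P - P.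
 move=> e; elim=> [|i IH]; first by rewrite muln0 /= (ecocycle1 cd) gpt1 subrr.
 by rewrite mulnS gal_expD h2 e IH gptM gptB addrC subrKA.
have [e1|n1] := pselect (psi phi = 1).
 have triv s : psi s = 1.
  by have [j [u [-> hu]]] := dec s; rewrite psiM (psiX psiM psip p0) e1 expr1n mul1r psi_u.
 have [||//|P hP eP] := @solve_torsion (fun P => phi @@ P - P) B m _ _ Bm (d phi).
 - by move=> P Q; rewrite gptB opprD addrACA -opprD.
 - apply: (kb _ 1%N isT p0).
  by move=> P /subr0_eq h; rewrite /gal_exp /= gal_mul1.
 exists P; split=> [s _|g /(_ (triv g))//].
 have [j [u [-> hu]]] := dec s; rewrite (ds j u hu) gptM (P_u u P hP hu) -[j]mul1n; apply: dexp.
 by rewrite /gal_exp /= gal_mul1 eP.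
pose N (P : ecpt W) := \sum_(k < p) gal_exp phi k @@ P.
pose D := \sum_(k < p) d (gal_exp phi k).
have shift (f : nat -> ecpt W) : \sum_(k < p) f k.+1 = \sum_(k < p) f k + (f p - f 0%N).
 elim: (p) => [|n IH]; first by rewrite !big_ord0 subrr addr0.
 by rewrite !big_ord_recr /= IH -!addrA; congr (_ + (_ + _)); exact: addrC.
have Nphi P : gal_exp phi p @@ P - P = phi @@ N P - N P.
 rewrite /N gpt_sum; under eq_bigr do rewrite -gptM -gal_expS.
 by rewrite (shift (fun k => gal_exp phi k @@ P)) [RHS]addrC addKr gpt1.
have D0 : D *+ p = 0 by rewrite /D -sumrMnl big1 // => k _; rewrite h1.
have [|| |P hP eP] := @solve_torsion N B m _ _ Bm D.
- by move=> P Q; rewrite /N -sumrB; apply: eq_bigr => k _; rewrite gptB.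
- apply: (kb _ p p0 (leqnn _)) => P h; apply/eqP; rewrite -subr_eq0 Nphi h gpt0 subrr //.
- exact: D0.
(* Telescoping: [phi - 1] applied to the sum of the [d (phi^k)] leaves [d (phi^p)], because the [p]
   copies of [d phi] add up to 0. *)
have ep : d (gal_exp phi p) = gal_exp phi p @@ P - P.
 rewrite Nphi eP /D gpt_sum.
 rewrite (eq_bigr (fun k : 'I_p => d (gal_exp phi k.+1) - d phi)); last first.
  by move=> k _; rewrite gal_expS h2 addrC addKr.
 rewrite sumrB sumr_const card_ord h1 subr0 (shift (fun k => d (gal_exp phi k))) [RHS]addrC addKr.
 by rewrite (ecocycle1 cd) subr0.
have kerP s : psi s = 1 -> d s = s @@ P - P.
 have [j [u [-> hu]]] := dec s; rewrite psiM (psiX psiM psip p0) (psi_u u hu) mulr1 => ej.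
 have dv : (p %| j)%N.
  have [o ho dvo] := prim_order_exists p0 (psip phi).
  have eo : o = p.
   move/primeP: (pp) => [_ /(_ o dvo) /orP[]/eqP em //].
   by case: n1; have := prim_expr_order ho; rewrite em expr1.
  by rewrite -eo (prim_order_dvd ho) ej.
 by rewrite (ds j u hu) gptM (P_u u P hP hu) -(divnK dv) mulnC; apply: dexp.
exists P; split=> // g; apply: (twist_sum_one psiM psip p0 pp cd kerP n1).
by rewrite sumrB -/(N P) eP subrr.
Qed.

Lemma ramified_elt (r : seq Fb) : ~ unram 1 psi -> {in r, forall x, O x} ->
 exists2 g, fixes r g & psi g <> 1.
Proof.
move=> nu rO; apply: contrapT => h; apply: nu; exists r => // s hs.
by apply: contrapT => hn; apply: h; exists s.
Qed.

Lemma d_power g : (forall T : ecpt W, T *+ p = 0 -> g @@ T = T) ->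
 forall k, d (gal_exp g k) = d g *+ k.
Proof.
case: (cd) => h1 h2 _ hg; elim=> [|k IH]; first by rewrite mulr0n; exact: ecocycle1 cd.
by rewrite gal_expS h2 IH gptMn hg ?h1 // mulrS.
Qed.

(** This is where [p] is odd: [d (g^k) = k d g], and the sum of the [k < p] is [p (p - 1) / 2], a
    multiple of [p]. *)
Lemma d_power_sum g : (forall T : ecpt W, T *+ p = 0 -> g @@ T = T) ->
 \sum_(k < p) d (gal_exp g k) = 0.
Proof.
move=> hg; have [h1 _ _] := cd.
under eq_bigr do rewrite d_power //.
have -> : \sum_(k < p) d g *+ k = d g *+ (\sum_(k < p) k)%N.
 by elim: (p) => [|n IH]; rewrite ?big_ord0 // !big_ord_recr /= IH mulrnDr.
rewrite -(big_mkord predT id) bin2_sum bin2odd; last by case: (even_prime pp) => // e; move: p3; rewrite e.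
by rewrite mulrnA h1 mul0rn.
Qed.

(** Choose [g] with [psi g] nontrivial, acting trivially on [E[p]] and on the residues of the
    coordinates of [P]. The norm condition gives zero for the sum of the [g^k P], so [p P] is in the
    kernel of reduction, and dividing there writes [P] as a torsion point [T] plus a kernel point
    [P1]. Then [d s - (s T - T) = s P1 - P1] is torsion in the kernel, hence 0. The converse uses
    such a [g] and [d_power_sum]. *)
Lemma gamma_ramified : ~ unram 1 psi -> (egamma p eW psi d <->
 exists2 T : ecpt W, T *+ p = 0 & forall s, psi s = 1 -> d s = s @@ T - T).
Proof.
move=> nu; have [rV rVO hV] := V_coords; have [h1 h2 _] := cd; split.
 move=> [P [hP sP]].
 have [|g hg pg] := @ramified_elt (rV ++ cl P) nu.
  by move=> x; rewrite mem_cat => /orP[/rVO//|/cl_O].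
 have [gV gP] := (fixes_cat rV (cl P) g).1 hg.
 have := sP g pg; rewrite sumrB (d_power_sum (hV g gV)) subr0 => sg.
 have kg k : kr (gal_exp g k @@ P - P).
  elim: k => [|k IH]; first by rewrite gpt1 subrr; exact: kr0.
  rewrite gal_expS gptM -[_ - P](subrKA (g @@ P)) -gptB; apply: krD; last exact: red_fix.
  exact: kr_gal.
 have kp : kr (P *+ p).
  have -> : P *+ p = - \sum_(k < p) (gal_exp g k @@ P - P).
   by rewrite sumrB sg sub0r opprK sumr_const card_ord.
  by apply: krN; apply: (big_ind kr kr0 krD) => k _; exact: kg.
 have [P1 k1 e1] := krDiv kp.
 have T0 : (P - P1) *+ p = 0 by rewrite mulrnBl e1 subrr.
 exists (P - P1) => // s ps; apply/eqP; rewrite -subr_eq0; apply/eqP; apply: krT; last first.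
  by rewrite mulrnBl h1 mulrnBl -gptMn T0 gpt0 !subr0.
 have -> : d s - (s @@ (P - P1) - (P - P1)) = s @@ P1 - P1.
  rewrite hP // gptB; set a := gpt _ _ _; set b := gpt _ _ _.
  by rewrite !opprB -(addrA P) subrKA [LHS]addrC -[LHS]addrA subrK [LHS]addrC.
 by apply: krB => //; exact: kr_gal.
move=> [T hT kT]; exists T; split=> //.
have [g hg pg] := ramified_elt nu rVO.
apply: (twist_sum_one psiM psip p0 pp cd kT pg).
rewrite sumrB (d_power_sum (hV g hg)) subr0.
have gk k : gal_exp g k @@ T = T.
 by elim: k => [|k IH]; [exact: gpt1|rewrite gal_expS gptM IH; exact: hV].
by under eq_bigr do rewrite gk; rewrite sumr_const card_ord.
Qed.
End Psi.
End GoodReduction.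

(** * Good places *)

Lemma fmorph_char0 (A B : fieldType) (e : {rmorphism A -> B}) :
 (forall n, n.+1%:R != 0 :> A) -> forall n, n.+1%:R != 0 :> B.
Proof. by move=> h n; rewrite -(rmorph_nat e) fmorph_eq0. Qed.

Lemma rat_alg_char0 (K : fieldExtType rat) n : n.+1%:R != 0 :> K.
Proof. by apply: (fmorph_char0 (in_alg K)) => m; rewrite pnatr_eq0. Qed.

Lemma pos_natr0 (A : fieldType) n : (forall n, n.+1%:R != 0 :> A) -> (0 < n)%N -> n%:R != 0 :> A.
Proof. by case: n. Qed.

Section Away.

(** Integrality wherever [N] is invertible, for all valuation rings of all extension fields at once,
    so that one [N] serves every local datum and passes through embeddings. *)
Definition away (A : fieldType) (N : nat) (x : A) := forall (L : fieldType) (O : valring L)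
 (e : {rmorphism A -> L}), O N%:R^-1 -> O (e x).

Lemma O_invM (L : fieldType) (O : valring L) m n : n%:R != 0 :> L -> O (m * n)%:R^-1 -> O m%:R^-1.
Proof.
move=> n0 h; have -> : m%:R^-1 = (m * n)%:R^-1 * n%:R :> L by rewrite natrM invfM mulfVK.
by apply: srM => //; exact: sr_nat.
Qed.

Variable A : fieldType.
Hypothesis char0 : forall n, n.+1%:R != 0 :> A.

Lemma away_mul m n (x : A) : (0 < n)%N -> away m x -> away (m * n) x.
Proof.
move=> n0 h L O e hO; apply: h; apply: O_invM hO.
exact: pos_natr0 (fmorph_char0 e char0) n0.
Qed.

Lemma away_seq (S : seq A) : {in S, forall x, exists2 N, (0 < N)%N & away N x} ->
 exists2 N, (0 < N)%N & {in S, forall x, away N x}.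
Proof.
elim: S => [|x S IH] h; first by exists 1%N.
have [N N0 hN] := IH (fun y yS => h y (@mem_behead _ (x :: S) y yS)).
have [N' N0' hN'] := h x (mem_head _ _).
exists (N * N')%N; first by rewrite muln_gt0 N0.
move=> y; rewrite inE => /predU1P[->|/hN]; last exact: away_mul.
by rewrite mulnC; exact: away_mul.
Qed.

Lemma away_root (p : {poly A}) x : p \is monic -> p.[x] = 0 ->
 (forall i, exists2 N, (0 < N)%N & away N p`_i) -> exists2 N, (0 < N)%N & away N x.
Proof.
move=> mp px h; have [|N N0 hN] := @away_seq p.
 by move=> y /(nthP 0)[i _ <-]; exact: h.
exists N => // L O e hO; apply: vr_integ; exists (map_poly e p); split; first by rewrite map_monic.
 move=> i; rewrite coef_map /=; have [lt|ge] := ltnP i (size p).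
  by apply: hN => //; exact: mem_nth.
 by rewrite nth_default // rmorph0; exact: sr0.
by rewrite horner_map px rmorph0.
Qed.

End Away.

Lemma away_comp (A B : fieldType) (i : {rmorphism A -> B}) N x : away N x -> away N (i x).
Proof. by move=> h L O e hO; exact: (h L O (e \o i)). Qed.

Lemma away_number (K : fieldExtType rat) (x : K) : exists2 N, (0 < N)%N & away N x.
Proof.
have c0 := @rat_alg_char0 K; have [q mq qx] := number_alg x.
apply: (away_root c0 _ qx); first by rewrite map_monic.
move=> i; rewrite coef_map /= -/(in_alg K _); exists `|denq q`_i|%N; first by rewrite absz_gt0 denq_neq0.
move=> L O e hO; suff -> : e (GRing.in_alg K q`_i) = (numq q`_i)%:~R / (denq q`_i)%:~R.
 by apply: srM; [exact: sr_int|rewrite -absz_denq].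
apply: etrans (congr1 e (in_alg_ratE K q`_i)) _.
by rewrite rmorphM fmorphV !rmorph_int.
Qed.

Lemma away_bar (K : fieldExtType rat) (Kb : algClosure K) (x : Kb) : exists2 N, (0 < N)%N & away N x.
Proof.
have c0 := fmorph_char0 (ac_emb Kb) (@rat_alg_char0 K).
have [q [mq qx _]] := min_poly_ex x.
apply: (away_root c0 _ qx); first by rewrite map_monic.
move=> i; rewrite coef_map; have [N N0 hN] := away_number q`_i.
by exists N => //; exact: away_comp.
Qed.

Lemma away_bar_seq (K : fieldExtType rat) (Kb : algClosure K) (S : seq Kb) :
 exists2 N, (0 < N)%N & {in S, forall x, away N x}.
Proof.
apply: away_seq; first exact: fmorph_char0 (ac_emb Kb) (@rat_alg_char0 K).
by move=> x _; exact: away_bar.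
Qed.

Section CurveAway.
Variables (K : fieldExtType rat) (Kb : algClosure K) (E : ellipticCurve K) (p : nat).
Hypothesis pp : prime p.
Let c0 := @rat_alg_char0 K.

Record good_data (L : closedFieldType) (O : valring L) (W : goodcurve L) := GoodData {
 gd_B : forall P Q, ker_red O P -> ker_red O Q -> @ker_red L O W (P - Q);
 gd_T : forall P, @ker_red L O W P -> P *+ p = 0 -> P = 0;
 gd_Div : forall Q, @ker_red L O W Q -> exists2 P, ker_red O P & P *+ p = Q;
 gd_S : forall (P P' : ecpt W) x y x' y', sq P = Aff x y -> sq P' = Aff x' y' ->
  O x -> O x' -> vm O (x' - x) -> vm O (y' - y) -> ker_red O (P - P');
 gd_Y : forall (P : ecpt W) x y, sq P = Aff x y -> O x -> O y }.

(** Outside [N] everything that the reduction arguments need is integral: the coefficients, the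
    Bezout relation of [f] and [f'] that excludes singular reductions, the coefficients of [Z] made
    monic, so that its roots are integral, and the inverse of [2 p]. *)
Lemma good_data_away : exists2 N, (0 < N)%N & forall (L : closedFieldType) (O : valring L)
 (W : goodcurve L) (e : {rmorphism K -> L}), gc_eqn W = map_weierstrass e E ->
 O N%:R^-1 -> good_data O W.
Proof.
pose a2 := sqa2 E; pose a4 := sqa4 E; pose a6 := sqa6 E.
pose f : {poly K} := 'X^3 + a2 *: 'X^2 + a4 *: 'X + a6%:P.
pose f' : {poly K} := 3 *: 'X^2 + (2 * a2) *: 'X + a4%:P.
have evf (L : closedFieldType) (e : {rmorphism K -> L}) (W : goodcurve L) x :
 gc_eqn W = map_weierstrass e E -> evp e x f = wf W x /\ evp e x f' = wf' W x.
 move=> eW; have [e2 e4 e6] := sqa_map e E; rewrite -eW in e2 e4 e6.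
 by rewrite /f /f' !evpE /wf /wf' e2 e4 e6 !(rmorphM, rmorph_nat).
have cop : coprimep f f'.
 have d0 : wdisc (map_weierstrass (ac_emb Kb) E) != 0.
  have -> : wdisc (map_weierstrass (ac_emb Kb) E) = ac_emb Kb (wdisc E).
   by rewrite /wdisc /wb2 /wb4 /wb6 /wb8 /= !(rmorphD, rmorphN, rmorphM, rmorphXn, rmorph_nat); ring.
  by rewrite fmorph_eq0 ec_disc_neq0.
 pose W := GoodCurve (fmorph_char0 (ac_emb Kb) c0) d0.
 rewrite -(coprimep_map (ac_emb Kb)); apply: Pdiv.ClosedField.root_coprimep => x.
 have [e1 e2] := evf _ (ac_emb Kb) W x erefl.
 rewrite /root -/(evp _ x f) -/(evp _ x f') e1 e2 => /eqP h.
 exact: (sq_nonsing (gc_char0 W) (gc_disc W) h).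
have /Bezout_eq1_coprimepP[[u w] /= uw] := cop.
have [d [a [A [B [Z [a0 lA lB Z0 mp]]]]]] := mulpoly_exists E c0 (prime_gt0 pp).
pose S := [:: a2; a4; a6; A`_d / a] ++ (u ++ (w ++ ((lead_coef Z)^-1 *: Z))).
have [|N N0 hN] := @away_seq K c0 S; first by move=> x _; exact: away_number.
exists (N * (2 * p))%N; first by rewrite !muln_gt0 N0 (prime_gt0 pp).
move=> L O W e eW hO.
have cL := fmorph_char0 e c0.
have n2p : (2 * p)%:R != 0 :> L by apply: pos_natr0 => //; rewrite muln_gt0 (prime_gt0 pp).
have nN : N%:R != 0 :> L by apply: pos_natr0.
have np : p%:R != 0 :> L by apply: pos_natr0 => //; exact: prime_gt0.
have ON : O N%:R^-1 by exact: O_invM hO.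
have O2p : O (2 * p)%:R^-1 by apply: (@O_invM _ _ _ N) => //; rewrite mulnC.
have O2 : O 2%:R^-1 by apply: O_invM O2p.
have Op : O p%:R^-1 by apply: (@O_invM _ _ _ 2) => //; rewrite mulnC.
have OS x : x \in S -> O (e x) by move=> /hN; exact.
have [e2 e4 e6] := sqa_map e E; rewrite -eW in e2 e4 e6.
have h2 : O (sqa2 W) by rewrite e2; apply: OS; rewrite mem_head.
have h4 : O (sqa4 W) by rewrite e4; apply: OS; rewrite !inE eqxx orbT.
have h6 : O (sqa6 W) by rewrite e6; apply: OS; rewrite !inE eqxx !orbT.
have hA : O (e (A`_d / a)) by apply: OS; rewrite !inE eqxx !orbT.
have Opoly (g : {poly K}) : {subset (g : seq K) <= S} -> forall i, O (e g`_i).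
 move=> sub i; have [lt|ge] := ltnP i (size g); first by apply: OS; apply: sub; exact: mem_nth.
 by rewrite nth_default // rmorph0; exact: sr0.
have Oev (g : {poly K}) x : {subset (g : seq K) <= S} -> O x -> O (evp e x g).
 by move=> /Opoly h hx; apply: sr_horner => // i; rewrite coef_map; exact: h.
have su : {subset (u : seq K) <= S} by move=> x h; rewrite !mem_cat h !orbT.
have sw : {subset (w : seq K) <= S} by move=> x h; rewrite !mem_cat h !orbT.
have sZ : {subset ((lead_coef Z)^-1 *: Z : seq K) <= S} by move=> x h; rewrite !mem_cat h !orbT.
have ns x : O x -> vm O (wf W x) -> vm O (wf' W x) -> False.
 have [<- <-] := evf _ e W x eW => hx v1 v2; apply: (@vm1 _ O).
 have <- : evp e x (u * f + w * f') = 1 by rewrite uw evp1.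
 by rewrite evpD !evpM; apply: vmD; apply: vmMl => //; exact: Oev.
have hZ x : evp e x Z = 0 -> O x.
 move=> zx; apply: vr_integ; exists (map_poly e ((lead_coef Z)^-1 *: Z)); split.
 - by rewrite map_monic monicE lead_coefZ mulVf // lead_coef_eq0.
 - by move=> i; rewrite coef_map; exact: Opoly.
 - by rewrite -/(evp e x _) evpZ zx mulr0.
have p0 := prime_gt0 pp.
split.
- exact: ker_redB.
- exact: (ker_red_torsion eW mp hZ).
- exact: (ker_red_divisible eW a0 lA lB mp hZ hA Op p0).
- exact: same_reduction.
- exact: O_y.
Qed.
End CurveAway.

Section LocalField.
Variables (R : realType) (K : fieldExtType rat) (Kb : algClosure K) (D : localData R Kb).
Hypothesis na : nonarch (ld_place D).
Local Notation F := (ld_field D).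
Local Notation Fb := (ld_bar D).
Local Notation v := (ld_place D).

Definition naD := completion_nonarch (F := ld_field D) na.
Definition OD : valring Fb := Obv Fb naD (@co_complete _ _ _ F).

Lemma OD_gal (s : absGal Fb) x : OD x -> OD (s x). Proof. exact: Ob_gal. Qed.
Lemma OD_emb (a : K) : OD (ac_emb Fb (co_emb F a)) <-> v a <= 1.
Proof. by have := Ob_emb Fb naD (co_emb F a); rewrite co_absE. Qed.
Lemma vmD_emb (a : K) : vm OD (ac_emb Fb (co_emb F a)) <-> v a < 1.
Proof. by have := mb_emb Fb naD (@co_complete _ _ _ F) (co_emb F a); rewrite co_absE. Qed.
Lemma Fb_char0 n : n.+1%:R != 0 :> Fb.
Proof. exact: fmorph_char0 (ld_emb D) (fmorph_char0 (ac_emb Kb) (@rat_alg_char0 K)) n. Qed.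

Lemma number_zspan (x : K) : zspan (fun j : 'I_(\dim {:K}) => (vbasis {:K})`_j) x.
Proof.
pose c i := coord (vbasis {:K}) i x.
have ex : x = \sum_i c i *: (vbasis {:K})`_i := coord_vbasis (memvf x).
pose d := \prod_i denq (c i); exists d.
have /choice[z hz] : forall i, exists z : int, z%:~R = d%:~R * c i.
 move=> i; rewrite /d (bigD1 i) //= intrM.
 exists (\prod_(j < _ | j != i) denq (c j) * numq (c i)).
 by rewrite intrM numqE; ring.
exists z; split; first by apply/prodf_neq0 => i _; exact: denq_neq0.
rewrite {1}ex mulr_sumr; apply: eq_bigr => i _.
have <- : in_alg K (z i)%:~R = (z i)%:~R by rewrite rmorph_int.
have <- : in_alg K d%:~R = d%:~R by rewrite rmorph_int.
by rewrite hz /= !mulr_algl scalerA.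
Qed.

(** By density the residue field of the completion comes from [K], and there the elements of
    absolute value at most 1 modulo those below 1 have rank at most the degree of [K], by
    [quotient_basis]. *)
Lemma local_basis : exists l m (b : 'I_m -> F), [/\ prime l, vm OD l%:R, forall i, OD (ac_emb Fb (b i)),
 forall c : 'I_m -> int, vm OD (\sum_i (c i)%:~R * ac_emb Fb (b i)) -> forall i, (l%:Z %| c i)%Z &
 forall x : F, OD (ac_emb Fb x) -> exists c : 'I_m -> 'I_l,
  vm OD (ac_emb Fb x - \sum_i (c i)%:R * ac_emb Fb (b i))].
Proof.
have [l pl vl] := residue_char na (pl_nontrivial v).
have [||||||m [a [ha ind spn]]] := @quotient_basis K _ (fun j : 'I_(\dim {:K}) => (vbasis {:K})`_j) (@rat_alg_char0 K) l (fun x => v x <= 1) (fun x => v x < 1) pl.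
- by move=> x _; exact: number_zspan.
- by rewrite av0.
- by move=> x y; exact: naB.
- by rewrite av0.
- move=> x y hx hy; apply: le_lt_trans (na x (- y)) _.
 by rewrite gt_max hx avN.
- move=> x hx; rewrite av_mul; apply: (le_lt_trans _ vl).
 by rewrite -[leRHS]mulr1 ler_wpM2l ?av_ge0.
pose b i := co_emb F (a i).
have em (c : 'I_m -> int) : \sum_i (c i)%:~R * ac_emb Fb (b i) =
  ac_emb Fb (co_emb F (\sum_i (c i)%:~R * a i)).
 by rewrite !rmorph_sum; apply: eq_bigr => i _; rewrite !rmorphM /= !rmorph_int.
have b1 i : OD (ac_emb Fb (b i)) by apply/OD_emb.
have b2 (c : 'I_m -> int) : vm OD (\sum_i (c i)%:~R * ac_emb Fb (b i)) -> forall i, (l%:Z %| c i)%Z.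
 by rewrite em => /vmD_emb; exact: ind.
have b3 (x : F) : OD (ac_emb Fb x) -> exists c : 'I_m -> 'I_l,
  vm OD (ac_emb Fb x - \sum_i (c i)%:R * ac_emb Fb (b i)).
 move=> hx; have vx : co_abs F x <= 1 by exact/(Ob_emb Fb naD).
 have [y hy] := co_dense x (@ltr01 R).
 have vy : v y <= 1.
  rewrite -(co_absE F) -[co_emb F y](subKr x); apply: (@naB _ _ _ naD) => //; exact: ltW.
 have [c hc] := spn y vy; exists c; rewrite (em (fun i => (c i)%:Z)).
 rewrite -rmorphB; apply/(mb_emb Fb naD (@co_complete _ _ _ F)).
 rewrite -(subrKA (co_emb F y)) -rmorphB; apply: le_lt_trans (naD _ _) _.
 by rewrite gt_max hy co_absE.
have vml : vm OD l%:R.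
 by rewrite -(rmorph_nat (ac_emb Fb)) -(rmorph_nat (co_emb F)); apply/vmD_emb.
by exists l, m, b.
Qed.

Lemma local_frobenius : exists q, (1 < q)%N /\ forall r : seq Fb, {in r, forall x, OD x} ->
 exists phi : absGal Fb, {in r, forall x, forall j, rsd OD (gal_exp phi j x) = rsd OD x ^+ (q ^ j)} /\
 forall s : absGal Fb, exists j, {in r, forall x, rsd OD (s x) = rsd OD (gal_exp phi j x)}.
Proof.
have [l [m [b [pl vml b1 b2 b3]]]] := local_basis.
exists (l ^ m)%N; split; first exact: (q_gt1 pl b1 b2 b3).
exact: (frobenius_lift Fb_char0 OD_gal pl vml b1 b2 b3).
Qed.

Lemma local_unity (r : seq Fb) : {in r, forall x, OD x} -> exists N al, [/\ (0 < N)%N, al ^+ N = 1,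
 forall b c, b ^+ N = 1 -> c ^+ N = 1 -> vm OD (b - c) -> b = c &
 forall s : absGal Fb, s al = al -> fixes OD r s].
Proof.
have [l [m [b [pl vml b1 b2 b3]]]] := local_basis.
exact: (unity_generator Fb_char0 OD_gal pl vml b1 b2 b3).
Qed.

End LocalField.

(* Away from [N] the local condition can be read off [d] and [psi] alone: unramified classes if [psi] is
  unramified, classes split by the extension that [psi] cuts out otherwise. *)
Definition good_away (R : realType) (K : fieldExtType rat) (Kb : algClosure K) (E : ellipticCurve K) p (N : nat) :=
 forall (D : localData R Kb) (na : nonarch (ld_place D))
 (W : goodcurve (ld_bar D))
 (eW : gc_eqn W = map_weierstrass (ac_emb (ld_bar D)) (map_weierstrass (co_emb (ld_field D)) E)),
 OD na N%:R^-1 -> forall (M : fieldType) (psi : absGal (ld_bar D) -> M),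
 (forall s t, psi (gal_mul s t) = psi s * psi t) -> (forall s, psi s ^+ p = 1) ->
 forall d, ecocycle p eW d ->
 (unram (OD na) 1 psi -> (egamma p eW psi d <-> unram (OD na) 0 d)) /\
 (~ unram (OD na) 1 psi -> (egamma p eW psi d <->
   exists2 T : ecpt W, T *+ p = 0 & forall s, psi s = 1 -> d s = gpt eW s T - T)).

Lemma good_place (R : realType) (K : fieldExtType rat) (Kb : algClosure K) (E : ellipticCurve K) p :
 prime p -> (3 <= p)%N -> exists2 N, (0 < N)%N & good_away R Kb E p N.
Proof.
move=> pp p3; have [N N0 hN] := good_data_away Kb E pp; exists N => // D na W eW hO M psi psiM psip d cd.
have [gB gT gDiv gS gY] := hN _ _ W (ac_emb (ld_bar D) \o co_emb (ld_field D)) eW hO.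
have [q [q1 frob]] := local_frobenius na.
split=> hpsi; last exact: (gamma_ramified (OD_gal (na := na)) pp p3 gB gT gDiv gS gY psiM psip cd hpsi).
split; first exact: (gamma_unram (OD_gal (na := na)) gB gT gS gY cd hpsi).
exact: (unram_gamma (OD_gal (na := na)) pp q1 gB gT gS gY frob psiM psip cd hpsi).
Qed.

(** * Places of the algebraic closure *)

Lemma intS1 (A : fieldType) : exists z : int, 1 = z%:~R :> A. Proof. by exists 1. Qed.
Lemma intSB (A : fieldType) (x y : A) : (exists z : int, x = z%:~R) -> (exists z : int, y = z%:~R) ->
 exists z : int, x - y = z%:~R.
Proof. by move=> [a ->] [b ->]; exists (a - b); rewrite intrB. Qed.
Lemma intSM (A : fieldType) (x y : A) : (exists z : int, x = z%:~R) -> (exists z : int, y = z%:~R) ->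
 exists z : int, x * y = z%:~R.
Proof. by move=> [a ->] [b ->]; exists (a * b); rewrite intrM. Qed.
Definition intS (A : fieldType) := SubringP (@intS1 A) (@intSB A) (@intSM A).
Definition algint (A : fieldType) := integR (intS A).

Section Chevalley.
Variables (A : fieldType) (S : subringP A) (y : A).
Hypothesis ny : ~ integ S y.
Let u := y^-1.

Let y0 : y != 0.
Proof. by apply/eqP => e; apply: ny; rewrite e; apply: sub_integ; exact: sr0. Qed.

Let G0 : set A := fun x => exists2 q : {poly A}, (forall i, S q`_i) & x = q.[u].
Let good (H : set A) := [/\ (G0 `<=` H)%classic, forall a b, H a -> H b -> H (a - b),
 forall a b, H a -> H b -> H (a * b) & ~ H y].

Let good0 : good G0.
Proof.
split=> //.
- move=> _ _ [p hp ->] [q hq ->]; exists (p - q); last by rewrite hornerD hornerN.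
 by move=> i; rewrite coefB; exact: srB.
- move=> _ _ [p hp ->] [q hq ->]; exists (p * q); last by rewrite hornerM.
 by move=> i; rewrite coefM; apply: sr_sum => j _; exact: srM.
move=> [q hq ey]; apply: ny.
pose n := size q.
pose r : {poly A} := \poly_(i < n.+1) (if i == 0%N then 0 else q`_(n - i)).
pose P := 'X^(n.+1) - r.
have sz : (size r < size ('X^(n.+1) : {poly A}))%N.
 by rewrite size_polyXn ltnS size_poly.
exists P; split.
- by rewrite monicE lead_coefDl ?size_polyN // lead_coefXn.
- move=> i; rewrite coefB coefXn coef_poly; apply: srB; first by case: (_ == _); [exact: sr1|exact: sr0].
 by case: ifP => _; last exact: sr0; case: ifP => _; [exact: sr0|exact: hq].
rewrite hornerD hornerN hornerXn horner_poly; apply/eqP; rewrite subr_eq0; apply/eqP.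
rewrite exprSr {2}ey horner_coef mulr_sumr big_ord_recl /= mul0r add0r -/n.
rewrite (reindex_inj rev_ord_inj) /=; apply: eq_bigr => i _.
rewrite /bump /= add1n mulrCA; congr (_ * _).
by rewrite -{1}(subnKC (ltn_ord i)) exprD -mulrA /u exprVn divff ?mulr1 ?expf_neq0.
Qed.

Let max_good : exists2 H, good H & forall H', good H' -> (H `<=` H')%classic -> (H' `<=` H)%classic.
Proof.
have gE H : good H <-> subring_within G0 (fun a => a <> y) H.
 split=> [[h1 h2 h3 h4]|[h1 h2 h3 h4]]; split=> //; last by move=> /h4.
 by move=> a Ha ea; apply: h4; rewrite -ea.
have [H /gE gH Hm] := max_subring_within ((gE _).1 good0).
by exists H => // H' /gE; exact: Hm.
Qed.

(** If [y] were in [S[1/y]] it would satisfy an integral equation. So there is a subring maximal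
    among those containing [S[1/y]] but not [y], and such a ring is a valuation ring. *)
Lemma valring_avoid : exists2 O : valring A, (forall x, S x -> O x) & ~ O y.
Proof.
have [H [G0H HB HM Hy] Hmax] := max_good.
have H1 : H 1 by apply: G0H; exists 1%:P; [move=> i; rewrite coefC; case: (_ == _); [exact: sr1|exact: sr0]|rewrite hornerC].
have SH x : S x -> H x.
 by move=> Sx; apply: G0H; exists x%:P; [move=> i; rewrite coefC; case: (_ == _) => //; exact: sr0|rewrite hornerC].
have Hu : H u by apply: G0H; exists 'X; [move=> i; rewrite coefX; case: (_ == _); [exact: sr1|exact: sr0]|rewrite hornerX].
pose O' := SubringP H1 HB HM.
have HB' := HB; have HM' := HM.
have ext (H' : set A) : (H `<=` H')%classic -> (forall a b, H' a -> H' b -> H' (a - b)) ->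
  (forall a b, H' a -> H' b -> H' (a * b)) -> ~ H' y -> (H' `<=` H)%classic.
 by move=> h1 h2 h3 h4; apply: Hmax => //; split=> // x /G0H /h1.
(* Inverting [1 + u a] does not bring in [y], so by maximality the inverse is already in [H]: [u]
   lies in the Jacobson radical. *)
have unit a : H a -> 1 + u * a != 0 /\ H (1 + u * a)^-1.
 move=> Ha; set w := 1 + u * a.
 have w0 : w != 0.
  apply/eqP => e; apply: Hy; have -> : y = - a; last exact: (srN (S := O')).
  move/eqP: e; rewrite /w addr_eq0 => /eqP e; apply: (mulfI (_ : u != 0)); first by rewrite invr_eq0.
  by rewrite mulrN -e mulVf.
 split=> //; have Hw : H w by apply: (srD (S := O')) => //; exact: (HM').
 apply: (ext (fun x => exists k, H (w ^+ k * x))).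
 - by move=> x Hx; exists 0%N; rewrite mul1r.
 - move=> x z [k hk] [j hj]; exists (k + j)%N.
  have -> : w ^+ (k + j) * (x - z) = w ^+ j * (w ^+ k * x) - w ^+ k * (w ^+ j * z) by rewrite exprD; ring.
  by apply: (HB'); apply: (HM') => //; exact: (srX (S := O')).
 - move=> x z [k hk] [j hj]; exists (k + j)%N.
  have -> : w ^+ (k + j) * (x * z) = (w ^+ k * x) * (w ^+ j * z) by rewrite exprD; ring.
  exact: (HM').
 - move=> [k hk]; apply: Hy.
  have [b Hb eb] : exists2 b, H b & w ^+ k = 1 + u * b.
   elim: (k) => [|j [b Hb IH]]; first by exists 0; rewrite ?mulr0 ?addr0 //; exact: (sr0 O').
   exists (a + b + u * a * b); last by rewrite exprS IH /w; ring.
   by apply: (srD (S := O')); [exact: (srD (S := O'))|do 2 apply: (HM') => //].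
  have -> : y = w ^+ k * y - b by rewrite eb mulrDl mul1r mulrAC [u * y]mulVf // mul1r addrK.
  exact: (HB').
 - by exists 1%N; rewrite expr1 divff.
(* If [z] is not in [H] then [y] lies in [H[z]], that is, 1 is a combination of powers of [z], up to
   some degree [n], with coefficients in [u H]. *)
pose Q (z : A) n := exists a : nat -> A, (forall i, H (a i)) /\ 1 = \sum_(i < n.+1) u * a i * z ^+ i.
have adj z : z != 0 -> ~ H z -> exists n, Q z n.
 move=> z0 nz.
 have [[n [a [Ha e]]]|hn] := pselect (exists n (a : nat -> A), (forall i, H (a i)) /\ y = \sum_(i < n.+1) a i * z ^+ i).
  exists n, a; split=> //; rewrite -(mulVf y0) {2}e mulr_sumr; apply: eq_bigr => i _.
  by rewrite mulrA.
 case: nz; pose H' : set A := fun x => exists n (a : nat -> A), (forall i, H (a i)) /\ x = \sum_(i < n) a i * z ^+ i.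
 have norm (x : A) : H' x <-> exists2 q : {poly A}, forall i, H q`_i & x = q.[z].
  split=> [[n [a [Ha ->]]]|[q hq ->]].
   exists (\poly_(i < n) a i); last by rewrite horner_poly.
   by move=> i; rewrite coef_poly; case: ifP => // _; exact: (sr0 O').
  by exists (size q), (fun i => q`_i); rewrite horner_coef.
 apply: (ext H').
 - by move=> x Hx; apply/norm; exists x%:P; [move=> i; rewrite coefC; case: (_ == _) => //; exact: (sr0 O')|rewrite hornerC].
 - move=> a b /norm[p hp ->] /norm[q hq ->]; apply/norm; exists (p - q); last by rewrite hornerD hornerN.
  by move=> i; rewrite coefB; exact: (HB').
 - move=> a b /norm[p hp ->] /norm[q hq ->]; apply/norm; exists (p * q); last by rewrite hornerM.
  by move=> i; rewrite coefM; apply: (sr_sum (S := O')) => j _; exact: (HM').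
 - move=> [[|n] [a [Ha e]]]; last by apply: hn; exists n, a.
  by move: y0; rewrite e big_ord0 eqxx.
 - by apply/norm; exists 'X; [move=> i; rewrite coefX; case: (_ == _) => //; exact: (sr0 O')|rewrite hornerX].
have Q0 z : ~ Q z 0%N.
 move=> [a [Ha]]; rewrite big_ord1 expr0 mulr1 => e; apply: Hy.
 by rewrite -[y]mulr1 e mulrA mulfV // mul1r.
(* Given relations for [z] and for [z^-1], the one of smaller degree removes the top power in the
   other. The descent ends at degree 0, which [Q0] excludes. *)
have step (z : A) n m : z != 0 -> (m <= n)%N -> Q z n.+1 -> Q z^-1 m.+1 -> Q z n.
 move=> z0 mn [a [Ha ea]] [b [Hb eb]].
 have [w0 Hw] : 1 + u * - b 0%N != 0 /\ H (1 + u * - b 0%N)^-1 by apply: unit; exact: (srN (S := O')).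
 set w := 1 + u * - b 0%N in w0 Hw.
 pose c j := w^-1 * b j.
 have Hc j : H (c j) by exact: (HM').
 have e1 : w = \sum_(j < m.+1) u * b j.+1 * z^-1 ^+ j.+1.
  by rewrite /w mulrN {1}eb big_ord_recl expr0 mulr1 addrAC subrr add0r.
 have ec : 1 = \sum_(j < m.+1) u * c j.+1 * z^-1 ^+ j.+1.
  apply: (mulfI w0); rewrite mulr1 {1}e1 mulr_sumr; apply: eq_bigr => j _.
  have -> : w * (u * c j.+1 * z^-1 ^+ j.+1) = (w / w) * (u * b j.+1 * z^-1 ^+ j.+1) by rewrite /c; ring.
  by rewrite divff // mul1r.
 have ez : z ^+ n.+1 = \sum_(j < m.+1) u * c j.+1 * z ^+ (n - j).
  rewrite -[LHS]mulr1 ec mulr_sumr; apply: eq_bigr => j _.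
  rewrite mulrCA; congr (_ * _).
  have jn : (j <= n)%N by apply: leq_trans mn; rewrite -ltnS.
  by rewrite -{1}(subnK jn) -addnS exprD exprVn mulfK ?expf_neq0.
 pose a' i := a i + u * a n.+1 * (if (n - i <= m)%N then c (n - i).+1 else 0).
 exists a'; split.
  move=> i; apply: (srD (S := O')) => //; apply: (HM'); first exact: (HM').
  by case: ifP => // _; exact: (sr0 O').
 rewrite {1}ea big_ord_recr /= ez mulr_sumr.
 rewrite [RHS](eq_bigr (fun i : 'I_n.+1 => u * a i * z ^+ i + u * (u * a n.+1 * (if (n - i <= m)%N then c (n - i).+1 else 0)) * z ^+ i)); last first.
  by move=> i _; rewrite /a' mulrDr mulrDl.
 rewrite big_split /=; congr (_ + _).
 rewrite [RHS](reindex_inj rev_ord_inj) /= (big_ord_widen n.+1 (fun j => u * a n.+1 * (u * c j.+1 * z ^+ (n - j))) (_ : m.+1 <= n.+1)%N) // big_mkcond /=.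
 apply: eq_bigr => i _; rewrite subSS subKn ?leq_ord //; rewrite ltnS; case: ifP => _; last by rewrite mulr0 mulr0 mul0r.
 by ring.
have final N : forall z n m, (n + m <= N)%N -> z != 0 -> Q z n -> Q z^-1 m -> False.
 elim: N => [|N IH] z [|n] [|m] // nm z0 q1 q2; try (by apply: (Q0 _ q1)); try (by apply: (Q0 _ q2)).
 have [mn|nm'] := leqP m n.
  by apply: (IH z n m.+1) => //; exact: (step z n m).
 apply: (IH z n.+1 m) => //; first by move: nm; rewrite addnS ltnS.
 apply: (step z^-1 m n); rewrite ?invr_eq0 ?invrK //; exact: ltnW.
have val x : x != 0 -> O' x \/ O' x^-1.
 move=> x0; have [h|h] := pselect (H x); [by left|right].
 apply: contrapT => h'; have [n q1] := adj x x0 h; have [|m q2] := adj x^-1 _ h'; first by rewrite invr_eq0.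
 exact: (final (n + m)%N x n m).
by exists (Valring val).
Qed.
End Chevalley.

Section Uniformizer.
Variables (K : fieldExtType rat) (Kb : algClosure K) (O : valring Kb) (l : nat).
Hypotheses (pl : prime l) (vl : vm O l%:R).
Local Notation emb := (ac_emb Kb).
Let c0 := fmorph_char0 (ac_emb Kb) (@rat_alg_char0 K).
Let l0 : l%:R != 0 :> Kb. Proof. exact: pos_natr0 c0 (prime_gt0 pl). Qed.

Lemma prime_to_unit (b : nat) : ~~ (l %| b)%N -> O b%:R^-1.
Proof.
move=> nb; have : ~ vm O b%:R; last by move=> /(vunit (sr_nat O b))[].
move=> vb; have b0 : (0 < b)%N by case: (b) nb; rewrite ?dvdn0.
have /coprimeP[//|[x1 x2] /= e] : coprime b l by rewrite coprime_sym prime_coprime.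
apply: (@vm1 _ O); have -> : 1 = x1%:R * b%:R - x2%:R * l%:R :> Kb.
 by rewrite -!natrM -natrB ?e //; apply: ltnW; rewrite -subn_gt0 e.
by apply: vmB; apply: vmMl => //; exact: sr_nat.
Qed.

Lemma bounded_root (A : fieldType) (e : {rmorphism A -> Kb}) (q : {poly A}) x : q \is monic ->
 (map_poly e q).[x] = 0 -> (forall a : A, exists j : nat, O (l%:R ^+ j * e a)) ->
 exists j : nat, O (l%:R ^+ j * x).
Proof.
move=> mq qx h.
have mono i j z : (i <= j)%N -> O (l%:R ^+ i * z) -> O (l%:R ^+ j * z).
 by move=> /subnK <- hz; rewrite exprD -mulrA; apply: srM => //; apply: srX; exact: sr_nat.
have [j hj] : exists j : nat, forall i, O (l%:R ^+ j * e q`_i).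
 have [j hj] : exists j : nat, forall i, (i < size q)%N -> O (l%:R ^+ j * e q`_i).
  elim: (size q) => [|n [j hj]]; first by exists 0%N.
  have [k hk] := h q`_n; exists (maxn j k) => i; rewrite ltnS leq_eqVlt => /predU1P[->|/hj].
   by apply: mono hk; exact: leq_maxr.
  by apply: mono; exact: leq_maxl.
 exists j => i; have [/hj//|ge] := ltnP i (size q).
 by rewrite nth_default // rmorph0 mulr0; exact: sr0.
exists j; apply: vr_integ; set L := l%:R ^+ j.
pose n := (size q).-1; have sq : size q = n.+1 by rewrite prednK // size_poly_gt0 monic_neq0.
have qn : q`_n = 1 by rewrite -[n]/(n.+1.-1) -sq -lead_coefE (monicP mq).
pose p := \poly_(i < n.+1) (e q`_i * L ^+ (n - i)).
have sp : size p = n.+1 by rewrite size_poly_eq // subnn expr0 mulr1 qn rmorph1 oner_eq0.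
exists p; split.
- by rewrite monicE lead_coefE sp coef_poly ltnSn subnn expr0 mulr1 qn rmorph1.
- move=> i; rewrite coef_poly; case: ltnP => hi; last exact: sr0.
 have [->|ni] := eqVneq i n; first by rewrite subnn expr0 mulr1 qn rmorph1; exact: sr1.
 have : (0 < n - i)%N by lia.
 case: (n - i)%N => // m _; rewrite exprS mulrA [e _ * L]mulrC; apply: srM; first exact: hj.
 by apply: srX; apply: srX; exact: sr_nat.
rewrite horner_poly; transitivity (L ^+ n * (map_poly e q).[x]); last by rewrite qx mulr0.
rewrite horner_coef size_map_poly sq mulr_sumr; apply: eq_bigr => i _.
rewrite coef_map exprMn [RHS]mulrCA -!mulrA; congr (_ * _).
by rewrite mulrA -exprD subnK // leq_ord.
Qed.

Lemma l_bounded (x : Kb) : exists j : nat, O (l%:R ^+ j * x).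
Proof.
have [q [mq qx _]] := min_poly_ex x.
apply: (bounded_root mq qx) => a; have [r mr ra] := number_alg a.
have ra' : (map_poly (emb \o in_alg K) r).[emb a] = 0.
 by rewrite map_poly_comp horner_map ra rmorph0.
apply: (bounded_root mr ra') => c.
have ec : emb (in_alg K c) = (numq c)%:~R / (denq c)%:~R.
 by apply: etrans (congr1 emb (in_alg_ratE K c)) _; rewrite rmorphM fmorphV !rmorph_int.
suff [j hj] : exists j : nat, O (l%:R ^+ j * ((numq c)%:~R / (denq c)%:~R)).
 by exists j; rewrite -ec in hj.
pose d := `|denq c|%N; have d0 : (0 < d)%N by rewrite absz_gt0 denq_neq0.
have ed : (denq c)%:~R = d%:R :> Kb by rewrite -absz_denq.
exists (logn l d); rewrite ed mulrCA; apply: srM; first exact: sr_int.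
have e : d = (d`_l^' * l ^ logn l d)%N by rewrite -{1}(partnC l d0) mulnC p_part.
rewrite {2}e natrM invfM natrX mulrCA mulfV ?expf_neq0 // mulr1; apply: prime_to_unit.
by have := part_pnat l^' d; rewrite p'natE.
Qed.

Lemma O_expr x n : (0 < n)%N -> O (x ^+ n) -> O x.
Proof.
move=> n0 h; apply: contrapT => nO; have v := vinv_vm nO; have x0 := v_not_O nO.
apply: (@vm1 _ O); rewrite -(divff (expf_neq0 n x0)); apply: vmMl => //.
rewrite -exprVn -(prednK n0) exprS; apply: vmMr => //; apply: srX; exact: vm_O.
Qed.

(** Discreteness on [K] comes from the finiteness of the integral elements modulo [l]. By pigeonhole
    there is no infinite chain of elements of the maximal ideal of strictly increasing size, and no
    nonzero [x] divisible by every power of [w]. *)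
Lemma uniformizer : exists2 w : K, w != 0 /\ vm O (emb w) & forall x : K, x != 0 ->
 exists n : int, O (emb (x * w ^ n)) /\ O (emb (x * w ^ n))^-1.
Proof.
pose A (x : K) := O (emb x); pose B (x : K) := O (emb x / l%:R).
have [||||||m [a [Aa _ spn]]] := @quotient_basis K _ (fun j : 'I_(\dim {:K}) => (vbasis {:K})`_j)
  (@rat_alg_char0 K) l A B pl.
- by move=> x _; exact: number_zspan.
- by rewrite /A rmorph0; exact: sr0.
- by move=> x y; rewrite /A rmorphB; exact: srB.
- by rewrite /B rmorph0 mul0r; exact: sr0.
- by move=> x y; rewrite /B rmorphB mulrBl; exact: srB.
- by move=> x; rewrite /B rmorphM rmorph_nat mulrAC mulfV // mul1r.
pose C := #|{ffun 'I_m -> 'I_l}|.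
(* Among [C + 1] integral elements two agree modulo [l]. *)
have bound (f : nat -> K) : (forall i, A (f i)) ->
  (forall i j, (i < j)%N -> (j <= C)%N -> ~ B (f i - f j)) -> False.
 move=> Af nB; have /choice[c hc] : forall i, exists c : {ffun 'I_m -> 'I_l},
   B (f i - \sum_k (c k)%:R * a k).
  move=> i; have [c hc] := spn _ (Af i); exists (finfun c).
  by under eq_bigr do rewrite ffunE.
 have : injective (fun i : 'I_C.+1 => c i).
  move=> i j e; apply: val_inj => /=; apply: contrapT => ne.
  wlog lt : i j e ne / (i < j)%N.
   by move=> H; case: (ltngtP i j) => // lt; [exact: (H i j)|apply: (H j i) => // h; apply: ne].
  apply: (nB i j lt); first by rewrite -ltnS.
  have -> : f i - f j = (f i - \sum_k (c i k)%:R * a k) - (f j - \sum_k (c j k)%:R * a k).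
   by rewrite e opprB addrA subrK.
  by rewrite /B rmorphB mulrBl; apply: srB; exact: hc.
 by move=> /leq_card; rewrite card_ord ltnn.
have lv (x : K) : x != 0 -> B x -> ~ vm O (l%:R / emb x).
 move=> x0 Bx v; apply: (@vm1 _ O).
 have -> : 1 = (emb x / l%:R) * (l%:R / emb x) by rewrite mulrA divfK // divff ?fmorph_eq0.
 exact: vmMl.
(* [z - 1] is a unit when [z] is in the maximal ideal, so [l] divides [w] as soon as it divides
   [w (z - 1)]. This turns the congruences from the pigeonhole into divisibility by [l]. *)
have sub1 (z w : K) : vm O (emb z) -> O (emb (w * (z - 1)) / l%:R) -> O (emb w / l%:R).
 move=> vz h; have nu : ~ vm O (emb (z - 1)).
  rewrite rmorphB rmorph1 => h'; apply: (@vm1 _ O); rewrite -[1](subKr (emb z)); exact: vmB.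
 rewrite rmorphB rmorph1 in nu; have [n0 hV] := vunit (srB (vm_O vz) (sr1 O)) nu.
 have -> : emb w / l%:R = (emb (w * (z - 1)) / l%:R) * (emb z - 1)^-1.
  by rewrite rmorphM rmorphB rmorph1 mulrAC mulfK.
 exact: srM.
have el : emb l%:R = l%:R by rewrite rmorph_nat.
have lK : l%:R != 0 :> K by exact: pos_natr0 (@rat_alg_char0 K) (prime_gt0 pl).
have [w [w0 vw] wmin] : exists2 w : K, w != 0 /\ vm O (emb w) &
  forall x, x != 0 -> vm O (emb x) -> O (emb (x / w)).
 apply: contrapT => nw.
 have next (w : K) : exists x : K, w != 0 -> vm O (emb w) -> [/\ x != 0, vm O (emb x) & vm O (emb (w / x))].
  have [[w0 vw]|h] := pselect (w != 0 /\ vm O (emb w)); last by exists 0 => h1 h2; case: h.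
  have [x [x0 vx nx]] : exists x : K, [/\ x != 0, vm O (emb x) & ~ O (emb (x / w))].
   apply: contrapT => h; apply: nw; exists w => // x x0 vx; apply: contrapT => h'; apply: h; by exists x.
  by exists x => _ _; split=> //; have := vinv_vm nx; rewrite -fmorphV invf_div.
 have [f hf] := choice next.
 pose g i := iter i f l%:R.
 have hg i : g i != 0 /\ vm O (emb (g i)).
  elim: i => [|i [h1 h2]]; first by rewrite /g /= el.
  by have [] := hf (g i) h1 h2.
 have hgS i : vm O (emb (g i / g i.+1)) by have [h1 h2] := hg i; have [] := hf (g i) h1 h2.
 have hgd i d : vm O (emb (g i / g (i + d.+1)%N)).
  elim: d => [|d IH]; first by rewrite addn1.
  have -> : g i / g (i + d.+2)%N = (g i / g (i + d.+1)%N) * (g (i + d.+1)%N / g (i + d.+1).+1).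
   by rewrite mulrA divfK ?(hg _).1 // addnS.
  by rewrite rmorphM; apply: vmMl; [exact: vm_O|rewrite -[X in emb X]/(_ / _); exact: hgS].
 apply: (bound (fun i => g i.+1)) => [i|i j lt _].
  by apply: vm_O; exact: (hg _).2.
 have e : g i.+1 - g j.+1 = g j.+1 * (g i.+1 / g j.+1 - 1).
  by rewrite mulrBr mulrC divfK ?(hg _).1 // mulr1.
 rewrite /B e => /sub1 h.
 have lt' : j.+1 = (i.+1 + (j - i.+1).+1)%N by lia.
 have {}h : B (g j.+1) by apply: h; rewrite lt'; exact: hgd.
 apply: (lv _ (hg _).1 h); have := hgd 0%N j; rewrite add0n fmorph_div.
 by rewrite [emb (g 0%N)]el.
exists w => //.
have ew0 : emb w != 0 by rewrite fmorph_eq0.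
have notall (x : K) : x != 0 -> ~ (forall k, O (emb (x / w ^+ k))).
 move=> x0 hall; have [j hj] := l_bounded (emb x)^-1.
 have hl k : O (l%:R / emb w ^+ k).
  have [j0|j0] := posnP j.
   apply: (False_ind _); apply: (@vm1 _ O).
   have -> : 1 = emb (x / w ^+ 1) * (emb x)^-1 * emb w by rewrite expr1 fmorph_div mulrAC divfK // divff ?fmorph_eq0.
   by apply: vmMl => //; apply: srM => //; move: hj; rewrite j0 mul1r.
  apply: (O_expr j0); rewrite exprMn exprVn -exprM.
  have -> : l%:R ^+ j / emb w ^+ (k * j) = (l%:R ^+ j * (emb x)^-1) * emb (x / w ^+ (k * j)).
   by rewrite fmorph_div rmorphXn mulrA mulfVK // fmorph_eq0.
  exact: srM.
 apply: (bound (fun i => w ^+ i)) => [i|i j' lt _].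
  by rewrite /A rmorphXn; apply: srX; exact: vm_O.
 have e : w ^+ i - w ^+ j' = - (w ^+ i * (w ^+ (j' - i) - 1)).
  by rewrite mulrBr mulr1 -exprD subnKC ?(ltnW lt) // opprB.
 rewrite /B e rmorphN mulNr => /srN; rewrite opprK => /sub1 h.
 have {}h : O (emb (w ^+ i) / l%:R).
  apply: h; rewrite rmorphXn; have : (0 < j' - i)%N by lia.
  by case: (j' - i)%N => // d _; rewrite exprS; apply: vmMr => //; apply: srX; exact: vm_O.
 apply: (vmP ew0 _ vw); have -> : (emb w)^-1 = (emb (w ^+ i) / l%:R) * (l%:R / emb w ^+ i.+1).
  by rewrite mulrA divfK // rmorphXn exprSr invfM mulrA divff ?mul1r ?expf_neq0.
 exact: srM.
have pos (x : K) : x != 0 -> O (emb x) -> exists k : nat, O (emb (x / w ^+ k)) /\ O (emb (x / w ^+ k))^-1.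
 move=> x0 Ox; pose P k := `[< ~ O (emb (x / w ^+ k)) >].
 have exP : exists k, P k.
  apply: contrapT => h; apply: (notall x x0) => k; apply: contrapT => h'; apply: h.
  by exists k; apply/asboolP.
 case: (ex_minnP exP) => k /asboolP nk kmin.
 have k0 : (0 < k)%N by rewrite lt0n; apply/eqP => e; apply: nk; rewrite e expr0 divr1.
 have Ok : O (emb (x / w ^+ k.-1)).
  apply: contrapT => h; have /kmin : P k.-1 by apply/asboolP.
  by rewrite leqNgt prednK // leqnn.
 exists k.-1; split=> //.
 suff nv : ~ vm O (emb (x / w ^+ k.-1)) by have [] := vunit Ok nv.
 move=> v; apply: nk; have := wmin _ _ v; rewrite -mulrA -invfM -exprSr prednK //; apply.
 by rewrite mulf_neq0 // invr_eq0 expf_neq0.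
move=> x x0; have [Ox|nO] := pselect (O (emb x)).
 have [k [h1 h2]] := pos x x0 Ox; exists (- k%:Z).
 by rewrite -exprnN in h1 h2 *.
have vx := vinv_vm nO; have [||k [h1 h2]] := pos x^-1.
- by rewrite invr_eq0.
- by rewrite fmorphV; exact: vm_O.
exists k%:Z; rewrite -exprnP.
have e : x * w ^+ k = (x^-1 / w ^+ k)^-1 by rewrite invf_div invrK mulrC.
by rewrite e fmorphV invrK.
Qed.
End Uniformizer.

(** * Completions and a common closed overfield *)

Section NonarchCompletion.
Variables (R : realType) (K : fieldType) (v : place R K).
Hypothesis na : nonarch v.

Definition cauchy (u : nat -> K) := forall e : R, 0 < e -> exists N, forall m n,
 (N <= m)%N -> (N <= n)%N -> v (u m - u n) < e.
Definition nullseq (u : nat -> K) := forall e : R, 0 < e -> exists N, forall n, (N <= n)%N -> v (u n) < e.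

Let vlt (e : R) x y : v x < e -> v y < e -> v (x - y) < e.
Proof. by move=> hx hy; apply: le_lt_trans (na x (- y)) _; rewrite gt_max hx avN. Qed.

Lemma isosceles x y : v (x - y) < v y -> v x = v y.
Proof.
move=> h; apply/eqP; rewrite eq_le; apply/andP; split.
 rewrite -[x in leLHS](subrK y); apply: le_trans (na _ _) _.
 by rewrite ge_max lexx andbT ltW.
rewrite leNgt; apply/negP => lt.
have : v y < v y; last by rewrite ltxx.
rewrite -{1}[y](subKr x); apply: vlt => //.
Qed.

Lemma cauchyB u w : cauchy u -> cauchy w -> cauchy (u - w).
Proof.
move=> hu hw e e0; have [N1 h1] := hu e e0; have [N2 h2] := hw e e0; exists (maxn N1 N2) => m n.
rewrite !geq_max => /andP[a1 a2] /andP[b1 b2].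
have -> : (u - w) m - (u - w) n = (u m - u n) - (w m - w n) by rewrite !fctE; ring.
by apply: vlt; [exact: h1|exact: h2].
Qed.

Lemma cauchy_bounded u : cauchy u -> exists2 C : R, 0 < C & forall n, v (u n) <= C.
Proof.
move=> hu; have [N hN] := hu 1 ltr01.
pose C := \big[Num.max/1]_(i < N.+1) v (u i) + 1.
have C1 : 1 <= \big[Num.max/1]_(i < N.+1) v (u i) by exact: bigmax_ge_id.
have ci (i : 'I_N.+1) : v (u i) <= C - 1.
 by rewrite addrK; exact: (@le_bigmax_cond _ _ _ _ i predT (fun i : 'I_N.+1 => v (u i))).
exists C; first by rewrite /C ltr_wpDl // (le_trans _ C1).
move=> n; have [lt|ge] := ltnP n N.+1.
 by apply: (le_trans (ci (Ordinal lt))); rewrite gerBl.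
rewrite -[u n](subrK (u N)); apply: (le_trans (av_add _ _ _)); rewrite addrC; apply: lerD.
 by have := ci (Ordinal (ltnSn N)); rewrite /C addrK.
by apply: ltW; apply: hN => //; exact: ltnW.
Qed.

Lemma cauchyM u w : cauchy u -> cauchy w -> cauchy (u * w).
Proof.
move=> hu hw; have [C C0 hC] := cauchy_bounded hu; have [D D0 hD] := cauchy_bounded hw.
move=> e e0; have [N1 h1] := hu (e / D) (divr_gt0 e0 D0); have [N2 h2] := hw (e / C) (divr_gt0 e0 C0).
exists (maxn N1 N2) => m n; rewrite !geq_max => /andP[a1 a2] /andP[b1 b2].
have -> : (u * w) m - (u * w) n = u m * (w m - w n) - w n * (u n - u m) by rewrite !fctE; ring.
apply: vlt; rewrite av_mul.
 apply: (@le_lt_trans _ _ (C * v (w m - w n))); first by rewrite ler_wpM2r ?av_ge0.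
 by rewrite mulrC -ltr_pdivlMr //; exact: h2.
apply: (@le_lt_trans _ _ (D * v (u n - u m))); first by rewrite ler_wpM2r ?av_ge0.
by rewrite mulrC -ltr_pdivlMr //; exact: h1.
Qed.

Lemma cauchy_cst x : cauchy (fun=> x).
Proof. by move=> e e0; exists 0%N => m n _ _; rewrite subrr av0. Qed.

Lemma null_cauchy u : nullseq u -> cauchy u.
Proof. by move=> h e e0; have [N hN] := h e e0; exists N => m n hm hn; apply: vlt; exact: hN. Qed.

(** By the isosceles property the absolute values along a Cauchy sequence that is not null become
    constant; this eventual value defines the absolute value on the completion. *)
Lemma cauchy_cases u : cauchy u -> ~ nullseq u -> exists2 r : R, 0 < r &
 exists N, forall n, (N <= n)%N -> v (u n) = r.
Proof.
move=> cu nu; have [e e0 he] : exists2 e : R, 0 < e & forall N, exists2 n, (N <= n)%N & e <= v (u n).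
 apply: contrapT => h; apply: nu => e e0; apply: contrapT => h'; apply: h; exists e => // N.
 apply: contrapT => h2; apply: h'; exists N => n hn; rewrite ltNge; apply/negP => h3.
 by apply: h2; exists n.
have [N hN] := cu e e0; have [n nN en] := he N.
exists (v (u n)); first exact: lt_le_trans en.
exists N => m mN; apply: isosceles; apply: lt_le_trans en; exact: hN.
Qed.

(** Cauchy sequences modulo null sequences. The map [pi] is part of the conclusion because elements
    of the completion are later traded for sequences in [K]. *)
Lemma completion_ex : exists (F : completion v) (pi : (nat -> K) -> F),
 [/\ forall x, pi (fun=> x) = co_emb F x,
  forall u w, cauchy u -> cauchy w -> pi (u - w) = pi u - pi w,
  forall u w, cauchy u -> cauchy w -> pi (u * w) = pi u * pi w,
  forall a, exists2 u, cauchy u & pi u = a & forall u, cauchy u -> (pi u = 0 <-> nullseq u) /\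
   forall e, co_abs F (pi u) < e -> exists N, forall n, (N <= n)%N -> v (u n) < e].
Proof.
have nS u w : nullseq u -> nullseq w -> nullseq (u - w).
 move=> hu hw e e0; have [N1 h1] := hu e e0; have [N2 h2] := hw e e0; exists (maxn N1 N2) => n.
 by rewrite geq_max => /andP[a1 a2]; apply: vlt; [exact: h1|exact: h2].
have nM u w : cauchy u -> nullseq w -> nullseq (u * w).
 move=> cu hw e e0; have [C C0 hC] := cauchy_bounded cu.
 have [N hN] := hw (e / C) (divr_gt0 e0 C0); exists N => n hn.
 rewrite fctE av_mul; apply: (@le_lt_trans _ _ (C * v (w n))); first by rewrite ler_wpM2r ?av_ge0.
 by rewrite mulrC -ltr_pdivlMr //; exact: hN.
have n1 : ~ nullseq 1.
 by move=> /(_ 1 ltr01)[N /(_ N (leqnn _))]; rewrite av1 ltxx.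
have n0 : nullseq 0 by move=> e e0; exists 0%N => n _; rewrite av0.
have nmax u : cauchy u -> ~ nullseq u -> exists2 w, cauchy w & nullseq (u * w - 1).
 move=> cu nu; have [r r0 [N hN]] := cauchy_cases cu nu.
 have un n : (N <= n)%N -> u n != 0.
  by move=> /hN h; apply: contraTneq r0 => e; rewrite -h e av0 ltxx.
 exists (fun n => (u n)^-1); last first.
  by move=> e e0; exists N => n hn; rewrite !fctE divff ?un // subrr av0.
 move=> e e0; have [N' hN'] := cu (e * (r * r)) (mulr_gt0 e0 (mulr_gt0 r0 r0)).
 exists (maxn N N') => m n; rewrite !geq_max => /andP[a1 a2] /andP[b1 b2].
 have -> : (u m)^-1 - (u n)^-1 = (u n - u m) / (u m * u n) by field; rewrite !un.
 rewrite av_mul avV av_mul !hN // ltr_pdivrMr ?mulr_gt0 //; exact: hN'.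
have [F0 [pi [pi1 piB piM surj ker]]] := max_quotient (cauchy_cst 1) cauchyB cauchyM null_cauchy nS nM n1 n0 nmax.
pose em x := pi (fun=> x).
have emB : zmod_morphism em by move=> x y; rewrite /em -piB //; exact: cauchy_cst.
have emM : monoid_morphism em by split=> [|x y]; [exact: pi1|rewrite /em -piM //; exact: cauchy_cst].
pose eA := GRing.isZmodMorphism.Build _ _ em emB.
pose eR := GRing.isMonoidMorphism.Build _ _ em emM.
pose eK : {rmorphism K -> F0} := HB.pack em eA eR.
pose val (u : nat -> K) (r : R) := (nullseq u /\ r = 0) \/ (0 < r /\ exists N, forall n, (N <= n)%N -> v (u n) = r).
have val_ex u : cauchy u -> exists r, val u r.
 move=> cu; have [h|h] := pselect (nullseq u); first by exists 0; left.
 by have [r r0 h'] := cauchy_cases cu h; exists r; right.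
have val_uniq u w r s : val u r -> val w s -> nullseq (u - w) -> r = s.
 move=> [[n_u ->]|[r0 [N hN]]] [[n_w ->]|[s0 [M hM]]] h //.
 - have : nullseq w.
   have -> : w = u - (u - w) by apply/funext => k; rewrite !fctE subKr.
   exact: nS.
  move=> /(_ s s0)[N hN]; have := hN (maxn N M) (leq_maxl _ _); rewrite hM ?leq_maxr //.
  by rewrite ltxx.
 - have : nullseq u.
   have -> : u = (u - w) - (0 - w) by apply/funext => k; rewrite !fctE sub0r opprK subrK.
   by apply: (nS) => //; exact: (nS).
  move=> /(_ r r0)[M hM]; have := hM (maxn N M) (leq_maxr _ _); rewrite hN ?leq_maxl //.
  by rewrite ltxx.
 have [L hL] := h s s0; pose k := maxn L (maxn N M).
 have kL : (L <= k)%N by exact: leq_maxl.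
 have kN : (N <= k)%N by rewrite /k !leq_max leqnn !orbT.
 have kM : (M <= k)%N by rewrite /k !leq_max leqnn !orbT.
 by rewrite -(hN k kN) -(hM k kM); apply: isosceles; rewrite hM //; exact: hL.
have abs_ex (x : F0) : exists r, exists2 u, cauchy u & pi u = x /\ val u r.
 have [u cu eu] := surj x; have [r hr] := val_ex u cu.
 by exists r, u.
pose ab x := sval (cid (abs_ex x)).
have abE u r : cauchy u -> val u r -> ab (pi u) = r.
 move=> cu hr; rewrite /ab; case: cid => s /= [w cw [ew hs]].
 apply: (val_uniq _ _ _ _ hs hr); apply/ker; first exact: cauchyB.
 by rewrite piB // ew subrr.
have val_ge0 u r : val u r -> 0 <= r by move=> [[_ ->]|[/ltW]].
have ab_ge0 x : 0 <= ab x by rewrite /ab; case: cid => r /= [u _ [_ /val_ge0]].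
have ab_eq0 x : ab x = 0 <-> x = 0.
 have [u cu <-] := surj x; have [r hr] := val_ex u cu; rewrite (abE _ _ cu hr) ker //.
 case: hr => [[h ->]|[r0 [N hN]]]; first by split.
 split=> [e|h]; first by rewrite e ltxx in r0.
 have [M hM] := h r r0; have := hM (maxn N M) (leq_maxr _ _); rewrite hN ?leq_maxl //.
 by rewrite ltxx.
have ab_mul x y : ab (x * y) = ab x * ab y.
 have [u cu <-] := surj x; have [w cw <-] := surj y.
 have [r hr] := val_ex u cu; have [s hs] := val_ex w cw.
 rewrite (abE _ _ cu hr) (abE _ _ cw hs) -piM //; apply: abE; first exact: cauchyM.
 case: hr => [[h ->]|[r0 [N hN]]]; first by left; rewrite mul0r mulrC; split=> //; exact: nM.
 case: hs => [[h ->]|[s0 [M hM]]]; first by left; rewrite mulr0; split=> //; exact: nM.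
 right; split; first exact: mulr_gt0.
 by exists (maxn N M) => n; rewrite geq_max => /andP[a1 a2]; rewrite fctE av_mul hN ?hM.
have ab_lim u e : cauchy u -> 0 < e -> (exists N, forall n, (N <= n)%N -> v (u n) < e) -> ab (pi u) < e.
 move=> cu e0 [N hN]; have [r hr] := val_ex u cu; rewrite (abE _ _ cu hr).
 case: hr => [[_ ->] //|[r0 [M hM]]].
 by rewrite -(hM (maxn N M)) ?leq_maxr // hN // leq_maxl.
have ab_lim2 u e : cauchy u -> ab (pi u) < e -> exists N, forall n, (N <= n)%N -> v (u n) < e.
 move=> cu; have [r hr] := val_ex u cu; rewrite (abE _ _ cu hr).
 case: hr => [[h ->] /h //|[r0 [M hM]] re].
 by exists M => n /hM ->.
have ab_na x y e : ab x < e -> ab y < e -> ab (x - y) < e.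
 have [u cu <-] := surj x; have [w cw <-] := surj y => h1 h2.
 have e0 : 0 < e by exact: le_lt_trans h1.
 rewrite -piB //; apply: ab_lim => //; first exact: cauchyB.
 have [N hN] := ab_lim2 _ _ cu h1; have [M hM] := ab_lim2 _ _ cw h2; exists (maxn N M) => n.
 by rewrite geq_max => /andP[a1 a2]; apply: vlt; [exact: hN|exact: hM].
have abN x : ab (- x) = ab x.
 have [u cu <-] := surj x; have [r hr] := val_ex u cu; rewrite (abE _ _ cu hr).
 have c0 : cauchy 0 by exact: (cauchy_cst 0).
 have <- : pi (0 - u) = - pi u by rewrite piB // (ker 0 c0).2 // sub0r.
 apply: abE; first exact: cauchyB.
 case: hr => [[h ->]|[r0 [N hN]]]; [left|right]; split=> //; first exact: nS.
 by exists N => n /hN; rewrite !fctE sub0r avN.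
have ab_add x y : ab (x + y) <= ab x + ab y.
 rewrite leNgt; apply/negP => h; have : ab (x + y) < ab (x + y); last by rewrite ltxx.
 have lx : ab x < ab (x + y) by apply: le_lt_trans h; rewrite lerDl.
 have ly : ab y < ab (x + y) by apply: le_lt_trans h; rewrite lerDr.
 by rewrite -{1}[y]opprK; apply: ab_na; rewrite ?abN.
pose av := AbsVal ab_ge0 ab_eq0 ab_mul ab_add.
have ab_emb x : av (eK x) = v x.
 apply: abE; first exact: cauchy_cst.
 have [->|x0] := eqVneq x 0; first by left; split; [exact: n0|rewrite av0].
 by right; split; [exact: av_neq0|exists 0%N].
have dense (x : F0) (e : R) : 0 < e -> exists a, av (x - eK a) < e.
 move=> e0; have [u cu <-] := surj x; have [N hN] := cu e e0; exists (u N).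
 rewrite /= -piB //; last exact: cauchy_cst.
 by apply: ab_lim => //; [apply: cauchyB => //; exact: cauchy_cst|exists N => n hn; exact: hN].
have compl (u : nat -> F0) : (forall e : R, 0 < e -> exists N, forall m n,
   (N <= m)%N -> (N <= n)%N -> av (u m - u n) < e) ->
 exists l, forall e : R, 0 < e -> exists N, forall n, (N <= n)%N -> av (u n - l) < e.
 move=> cu; have pos n : 0 < (2 : R)^-1 ^+ n by rewrite exprn_gt0 // invr_gt0.
 have /choice[a ha] : forall n, exists a, av (u n - eK a) < 2^-1 ^+ n by move=> n; exact: dense.
 have sm (e : R) : 0 < e -> exists N, forall n, (N <= n)%N -> av (u n - eK (a n)) < e.
  move=> e0; have [//|//|N hN] := @expr_small R 2^-1 e _ _ e0; first by rewrite invr_ge0.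
   by rewrite invf_lt1 ?ltr1n.
  exists N => n hn; apply: lt_le_trans (ha n) _; apply: le_trans (ltW hN).
  by apply: ler_wiXn2l => //; rewrite ?invr_ge0 // invf_le1 ?ler1n.
 have ca : cauchy a.
  move=> e e0; have [N1 h1] := cu e e0; have [N2 h2] := sm e e0; exists (maxn N1 N2) => m n.
  rewrite !geq_max => /andP[a1 a2] /andP[b1 b2]; rewrite -ab_emb.
  have -> : eK (a m - a n) = (u m - u n) - ((u m - eK (a m)) - (u n - eK (a n))) by rewrite rmorphB; ring.
  by apply: (ab_na); [exact: h1|apply: (ab_na); exact: h2].
 exists (pi a) => e e0; have [N1 h1] := sm e e0; have [N2 h2] := ca e e0.
 exists (maxn N1 N2) => n; rewrite geq_max => /andP[n1' n2'].
 have -> : u n - pi a = (u n - eK (a n)) - (pi a - eK (a n)) by rewrite opprB addrA subrK.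
 apply: ab_na; first exact: h1.
 rewrite /= -piB //; last exact: cauchy_cst.
 by apply: ab_lim => //; [apply: cauchyB => //; exact: cauchy_cst|exists N2 => k hk; exact: h2].
exists (Completion ab_emb dense compl), pi; split=> // u cu; split; first exact: ker.
by move=> e; exact: ab_lim2.
Qed.
End NonarchCompletion.

Section AlgebraicElements.
Variables (F : fieldType) (Om : closedFieldType) (e : {rmorphism F -> Om}).

Definition algp : {pred Om} := fun x => `[< algebraicOver e x >].
Lemma algp_closed : divring_closed algp.
Proof.
split; first by apply/asboolP; rewrite -(rmorph1 e); exact: algebraic_id.
 by move=> x y /asboolP hx /asboolP hy; apply/asboolP; exact: algebraic_sub.
by move=> x y /asboolP hx /asboolP hy; apply/asboolP; exact: algebraic_div.
Qed.

Record algt := Algt { algt_val : Om; algt_p : algp algt_val }.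
HB.instance Definition _ := [isSub for algt_val].
HB.instance Definition _ := [Choice of algt by <:].
HB.instance Definition _ := GRing.SubChoice_isSubIntegralDomain.Build Om algp algt algp_closed.
Lemma algt_unit : {mono (val : algt -> Om) : u / u \is a GRing.unit}. Proof. by []. Qed.
HB.instance Definition _ := GRing.SubIntegralDomain_isSubField.Build Om algp algt algt_unit.

Lemma algt_closed : GRing.closed_field_axiom algt.
Proof.
move=> n P n0; have [x hx] := @solve_monicpoly Om n (fun i => val (P i)) n0.
have ax : algp x.
 apply/asboolP/integral_algebraic.
 pose p : {poly Om} := 'X^n - \poly_(i < n) val (P i).
 have sz : (size (\poly_(i < n) val (P i) : {poly Om}) < size ('X^n : {poly Om}))%N.
  by rewrite size_polyXn ltnS size_poly.
 apply: (@integral_root_monic _ _ e x p).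
 - by rewrite monicE lead_coefDl ?size_polyN // lead_coefXn.
 - by apply/rootP; rewrite hornerD hornerN hornerXn horner_poly hx subrr.
 move=> y /(nthP 0)[i _ <-]; apply/integral_algebraic; rewrite coefB coefXn coef_poly.
 apply: algebraic_sub.
  by rewrite -(rmorph_nat e); exact: algebraic_id.
 case: ifP => _; last by rewrite -(rmorph0 e); exact: algebraic_id.
 by have /asboolP := algt_p (P i).
exists (Algt ax); apply: val_inj; transitivity (x ^+ n); first by rewrite rmorphXn.
rewrite hx rmorph_sum; apply: eq_bigr => i _.
by rewrite rmorphM rmorphXn.
Qed.
HB.instance Definition _ := Field_isAlgClosed.Build algt algt_closed.

Lemma alg_closure_in : exists (Fb : algClosure F) (j : {rmorphism Fb -> Om}),
 (forall x, j (ac_emb Fb x) = e x) /\ forall y, algebraicOver e y -> exists z, j z = y.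
Proof.
have hp x : algp (e x) by apply/asboolP; exact: algebraic_id.
pose f x := Algt (hp x).
have fB : zmod_morphism f by move=> x y; apply: val_inj; rewrite /= !rmorphB.
have fM : monoid_morphism f by split=> [|x y]; apply: val_inj; rewrite /= ?rmorphM ?rmorph1.
pose fA := GRing.isZmodMorphism.Build _ _ f fB.
pose fR := GRing.isMonoidMorphism.Build _ _ f fM.
pose g : {rmorphism F -> algt} := HB.pack f fA fR.
have galg (x : algt) : algebraicOver g x.
 have /asboolP[q q0 qx] := valP x; exists q => //.
 apply/rootP; apply: val_inj; rewrite rmorph0 -(horner_map (val : {rmorphism algt -> Om})) -map_poly_comp.
 exact/rootP.
exists (AlgClosure galg), (val : {rmorphism algt -> Om}); split=> // y hy.
by exists (Algt (introT (asboolP _) hy)).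
Qed.
End AlgebraicElements.

Section ClosedOf.
Variables (F0 : fieldType) (ax : GRing.closed_field_axiom F0).
(** An alias carrying the axiom as an argument, so that the closed field structure can be attached
    to a field obtained inside a proof. *)
Definition closedT (_ : GRing.closed_field_axiom F0) : Type := F0.
HB.instance Definition _ := GRing.Field.on (closedT ax).
HB.instance Definition _ := Field_isAlgClosed.Build (closedT ax) ax.
End ClosedOf.

Section BoundedSequences.
Variables (A : closedFieldType) (O : valring A) (w : A).
Hypotheses (w0 : w != 0) (vw : vm O w) (bnd : forall x, exists r : nat, O (w ^+ r * x)).
Local Notation T := (nat -> A).
Let Ow := vm_O vw.

Definition bseq (u : T) := exists r : nat, forall k, O (w ^+ r * u k).

Lemma bseq_mono r s x : (r <= s)%N -> O (w ^+ r * x) -> O (w ^+ s * x).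
Proof. by move=> /subnK <- h; rewrite exprD -mulrA; apply: srM => //; exact: srX. Qed.

Lemma bseq1 : bseq 1. Proof. by exists 0%N => k; rewrite mul1r; exact: sr1. Qed.
Lemma bseqB u t : bseq u -> bseq t -> bseq (u - t).
Proof.
move=> [r hr] [s hs]; exists (maxn r s) => k; rewrite !fctE mulrBr; apply: srB.
 by apply: bseq_mono (hr k); exact: leq_maxl.
by apply: bseq_mono (hs k); exact: leq_maxr.
Qed.
Lemma bseqM u t : bseq u -> bseq t -> bseq (u * t).
Proof.
move=> [r hr] [s hs]; exists (r + s)%N => k; rewrite fctE exprD mulrACA; exact: srM.
Qed.
Lemma bseq_cst x : bseq (fun=> x).
Proof. by have [r hr] := bnd x; exists r. Qed.

(** Bounded sequences modulo those divisible by every power of [w] along an ultrafilter. Monic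
    equations are solved term by term, so the quotient is algebraically closed. It receives constant
    sequences as well as limits of Cauchy sequences. *)
Lemma ultraproduct : exists (Om : closedFieldType) (pi : T -> Om), [/\ pi 1 = 1,
 forall u t, bseq u -> bseq t -> pi (u - t) = pi u - pi t,
 forall u t, bseq u -> bseq t -> pi (u * t) = pi u * pi t,
 forall u, (forall r : nat, exists N, forall k, (N <= k)%N -> O (u k / w ^+ r)) -> pi u = 0 &
 forall u, bseq u -> pi u = 0 -> exists k, vm O (u k)].
Proof.
pose cof : set_system nat := fun X => exists N, forall k, (N <= k)%N -> X k.
have cofP : ProperFilter cof.
 split; first by move=> [N /(_ N (leqnn _))].
 split; first by exists 0%N.
  move=> X Y [N hN] [M hM]; exists (maxn N M) => k; rewrite geq_max => /andP[a b].
  by split; [exact: hN|exact: hM].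
 by move=> X Y sub [N hN]; exists N => k /hN /sub.
have [U [UU subU]] := ultraFilterLemma cofP.
have FU : Filter U by apply: (@filter_filter _ U); exact: (@ultra_proper _ U UU).
have Une (X : set nat) : U X -> exists k, X k.
 move=> UX; apply: contrapT => h; have PU : ProperFilter U := @ultra_proper _ U UU.
 apply: (@filter_not_empty _ U PU); suff <- : X = set0 by [].
 by apply/seteqP; split=> // k Xk; apply: h; exists k.
pose nl (u : T) := bseq u /\ forall r : nat, U (fun k : nat => O (u k / w ^+ r)).
have nB u : nl u -> bseq u by case.
have nS u t : nl u -> nl t -> nl (u - t).
 move=> [bu hu] [bt ht]; split; first exact: bseqB.
 move=> r; apply: filterS (filterI (hu r) (ht r)) => k [/= h1 h2].
 by rewrite !fctE mulrBl; exact: srB.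
have nM u t : bseq u -> nl t -> nl (u * t).
 move=> bu [bt ht]; split; first exact: bseqM.
 move=> r; have [s hs] := bu; apply: filterS (ht (r + s)%N) => k /= h.
 have -> : (u * t) k / w ^+ r = (w ^+ s * u k) * (t k / w ^+ (r + s)).
  by rewrite fctE exprD; field; rewrite !expf_neq0.
 exact: srM.
have n1 : ~ nl 1.
 move=> [_ /(_ 1%N)/Une[k /=]]; rewrite expr1 div1r => h.
 exact: (vmP w0 h vw).
have n0 : nl 0.
 split; first by exists 0%N => k; rewrite mulr0; exact: sr0.
 by move=> r; apply: filterS filterT => k _ /=; rewrite mul0r; exact: sr0.
have nmax u : bseq u -> ~ nl u -> exists2 t, bseq t & nl (u * t - 1).
 move=> bu nu; have [r hr] : exists r : nat, ~ U (fun k : nat => O (u k / w ^+ r)).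
  apply: contrapT => h; apply: nu; split=> // r; apply: contrapT => h'; apply: h; by exists r.
 (* The ultrafilter contains the set where [u k] is divisible by [w^r] or its complement. The first
    is excluded, so [u] is inverted on the complement and replaced by 0 elsewhere. *)
 have hC : U (fun k : nat => ~ O (u k / w ^+ r)).
  by case: (@in_ultra_setVsetC _ _ (fun k : nat => O (u k / w ^+ r)) UU).
 pose t k := if pselect (O (u k / w ^+ r)) then 0 else (u k)^-1.
 have bt : bseq t.
  exists r => k; rewrite /t; case: pselect => h /=; first by rewrite mulr0; exact: sr0.
  by have := vm_O (vinv_vm h); rewrite invf_div.
 exists t => //; split; first by apply: bseqB; [exact: bseqM|exact: bseq1].
 move=> s; apply: filterS hC => k /= h; rewrite !fctE /t; case: pselect => h' //=.
 have uk : u k != 0 by apply/eqP => e; apply: h; rewrite e mul0r; exact: sr0.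
 by rewrite divff // subrr mul0r; exact: sr0.
have [Om0 [pi [pi1 piB piM surj ker]]] := max_quotient bseq1 bseqB bseqM nB nS nM n1 n0 nmax.
have b0 : bseq 0 by exact: nB.
have pi0 : pi 0 = 0 by apply/ker.
have bseqD u t : bseq u -> bseq t -> bseq (u + t).
 move=> hu ht; have -> : u + t = u - (0 - t) by apply/funext => k; rewrite !fctE sub0r opprK.
 by apply: bseqB => //; exact: bseqB.
have piD u t : bseq u -> bseq t -> pi (u + t) = pi u + pi t.
 move=> hu ht; have -> : u + t = u - (0 - t) by apply/funext => k; rewrite !fctE sub0r opprK.
 have b : bseq (0 - t) by exact: bseqB.
 by rewrite (piB u (0 - t) hu b) (piB 0 t b0 ht) pi0 sub0r opprK.
have bseqX u n : bseq u -> bseq (u ^+ n).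
 by move=> hu; elim: n => [|n IH]; rewrite ?expr0 ?exprS; [exact: bseq1|exact: bseqM].
have piX u n : bseq u -> pi (u ^+ n) = pi u ^+ n.
 by move=> hu; elim: n => [|n IH]; rewrite ?expr0 // !exprS piM ?IH //; exact: bseqX.
have fX (u : T) n k : (u ^+ n) k = u k ^+ n by elim: n => [|n IH]; rewrite ?expr0 // !exprS fctE IH.
have closed : GRing.closed_field_axiom Om0.
 move=> n P n0'; have /choice[c hc] : forall i, exists u, bseq u /\ pi u = P i.
  by move=> i; have [u h1 h2] := surj (P i); exists u.
 have /choice[x hx] : forall k, exists x : A, x ^+ n = \sum_(i < n) c i k * x ^+ i.
  by move=> k; exact: (@solve_monicpoly A n (fun i => c i k) n0').
 have [r hr] : exists r : nat, forall i k, (i < n)%N -> O (w ^+ r * c i k).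
  elim: (n) => [|m [r hr]]; first by exists 0%N.
  have [s hs] := (hc m).1; exists (maxn r s) => i k; rewrite ltnS leq_eqVlt => /predU1P[->|im].
   by apply: bseq_mono (hs k); exact: leq_maxr.
  by apply: bseq_mono (hr i k im); exact: leq_maxl.
 have bx : bseq x.
  exists r => k; apply: vr_integ.
  pose q : {poly A} := \poly_(i < n) (w ^+ (r * (n - i)) * c i k).
  have sz : (size q < size ('X^n : {poly A}))%N by rewrite size_polyXn ltnS size_poly.
  exists ('X^n - q); split.
  - by rewrite monicE lead_coefDl ?size_polyN // lead_coefXn.
  - move=> i; rewrite coefB coefXn coef_poly; apply: srB; first by case: (_ == _); [exact: sr1|exact: sr0].
   case: ltnP => lt; last exact: sr0.
   apply: bseq_mono (hr i k lt); apply: leq_pmulr; by rewrite subn_gt0.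
  rewrite hornerD hornerN hornerXn horner_poly exprMn hx mulr_sumr -sumrB big1 // => i _.
  rewrite exprMn -!exprM; apply/eqP; rewrite subr_eq0; apply/eqP.
  have -> : (r * n = r * (n - i) + r * i)%N by rewrite -mulnDr subnK // ltnW.
  by rewrite exprD; ring.
 exists (pi x); rewrite -piX //.
 have -> : x ^+ n = \sum_(i < n) c i * x ^+ i.
  apply/funext => k; rewrite fX hx; elim: (n) => [|m IH]; first by rewrite !big_ord0.
  by rewrite !big_ord_recr /= IH -fX.
 have [_ ->] : bseq (\sum_(i < n) c i * x ^+ i) /\ pi (\sum_(i < n) c i * x ^+ i) = \sum_(i < n) pi (c i) * pi x ^+ i.
  elim: (n) => [|m [IH1 IH2]]; first by rewrite !big_ord0.
  have bm : bseq (c m * x ^+ m) by apply: bseqM; [exact: (hc m).1|exact: bseqX].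
  rewrite !big_ord_recr /=; split; first exact: bseqD.
  by rewrite piD // IH2 piM ?piX //; [exact: (hc m).1|exact: bseqX].
 by apply: eq_bigr => i _; rewrite (hc i).2.
exists (closedT closed : closedFieldType), pi; split=> //.
- move=> u h; have bu : bseq u.
  have [N hN] := h 0%N.
  have [r hr] : exists r : nat, forall k, (k < N)%N -> O (w ^+ r * u k).
   elim: (N) => [|m [r hr]]; first by exists 0%N.
   have [s hs] := bnd (u m); exists (maxn r s) => k; rewrite ltnS leq_eqVlt => /predU1P[->|km].
    by apply: bseq_mono hs; exact: leq_maxr.
   by apply: bseq_mono (hr k km); exact: leq_maxl.
  exists r => k; have [/hr//|/hN] := ltnP k N; rewrite expr0 divr1 => hk.
  by apply: srM => //; exact: srX.
 apply/ker => //; split=> // r; apply: subU; have [N hN] := h r; by exists N.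
move=> u bu /ker[//|_ /(_ 1%N)/Une[k /=]]; rewrite expr1 => h; exists k.
by rewrite -(divfK w0 (u k)); exact: vmMl.
Qed.
End BoundedSequences.

(** [valring_avoid] gives a valuation ring [O] of [Kb] without [y], and its restriction to [K] is
    discrete, hence a place. To compare [O] with integrality in the local closure, the completion
    and [Kb] are both mapped to an ultraproduct over [O]. *)
Lemma detection (R : realType) (K : fieldExtType rat) (Kb : algClosure K) (y : Kb) :
 ~ algint Kb y -> exists (D : localData R Kb) (na : nonarch (ld_place D)), ~ OD na (ld_emb D y).
Proof.
move=> ny; have [O _ Oy] := valring_avoid ny.
have c0 := fmorph_char0 (ac_emb Kb) (@rat_alg_char0 K).
have [l pl vl] : exists2 l, prime l & vm O l%:R.
 have [N N0 hN] := away_bar y; have nN : ~ O N%:R^-1 by move=> h; apply: Oy; exact: (hN _ O idfun).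
 have vN : vm O N%:R by rewrite -[N%:R]invrK; exact: vinv_vm.
 move: vN; rewrite (prod_prime_decomp N0) prime_decompE big_map natr_prod => /vm_prod[].
  by move=> i _; exact: sr_nat.
 move=> l; rewrite mem_primes => /and3P[pl _ _] /=; rewrite natrX => h; exists l => //.
 case: (logn l N) h => [/vm1//|k]; apply: vm_exp; exact: sr_nat.
have [w [w0 vw] unif] := uniformizer pl vl.
have ew0 : ac_emb Kb w != 0 by rewrite fmorph_eq0.
pose emb := ac_emb Kb.
(* [o x] is minus the normalised valuation of [x]; the absolute value below is 2 to the power
   [o x]. *)
have [o ho] : exists o : K -> int, forall x, x != 0 -> O (emb (x * w ^ o x)) /\ O (emb (x * w ^ o x))^-1.
 have ex x : exists n : int, x != 0 -> O (emb (x * w ^ n)) /\ O (emb (x * w ^ n))^-1.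
  by have [->|x0] := eqVneq x 0; [exists 0|have [n hn] := unif x x0; exists n].
 by have [o ho] := choice ex; exists o.
have wz (n : int) : O (emb (w ^ n)) -> 0 <= n.
 case: n => // n; rewrite NegzE -exprnN fmorphV rmorphXn => h.
 case: (vmP (expf_neq0 n.+1 ew0) h).
 by rewrite exprS; apply: vmMr => //; apply: srX; exact: vm_O.
have oE x n : x != 0 -> O (emb (x * w ^ n)) -> O (emb (x * w ^ n))^-1 -> o x = n.
 move=> x0 h1 h2; have [k1 k2] := ho x x0; apply/eqP; rewrite eq_le; apply/andP; split.
  rewrite -subr_ge0; apply: wz; rewrite expfzDr //.
  have -> : w ^ n * w ^ (- o x) = (x * w ^ n) * (x * w ^ o x)^-1.
   by rewrite -invr_expz invfM mulrACA divff // mul1r.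
  by rewrite rmorphM fmorphV; exact: srM.
 rewrite -subr_ge0; apply: wz; rewrite expfzDr //.
 have -> : w ^ o x * w ^ (- n) = (x * w ^ o x) * (x * w ^ n)^-1.
  by rewrite -invr_expz invfM mulrACA divff // mul1r.
 by rewrite rmorphM fmorphV; exact: srM.
have oM x z : x != 0 -> z != 0 -> o (x * z) = o x + o z.
 move=> x0 z0; have [h1 h2] := ho x x0; have [k1 k2] := ho z z0.
 apply: oE; rewrite ?mulf_neq0 // expfzDr // mulrACA rmorphM ?invfM; exact: srM.
have oO x : x != 0 -> (O (emb x) <-> o x <= 0).
 move=> x0; have [h1 h2] := ho x x0; have wo0 : w ^ o x != 0 by rewrite expfz_neq0.
 split=> h.
  rewrite -oppr_ge0; apply: wz; have -> : w ^ (- o x) = x * (x * w ^ o x)^-1.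
   by rewrite -invr_expz invfM mulrA divff // mul1r.
  by rewrite rmorphM fmorphV; exact: srM.
 have -> : x = (x * w ^ o x) * w ^ (- o x) by rewrite -invr_expz mulfK.
 rewrite rmorphM; apply: srM => //; move: h; rewrite -oppr_ge0; case: (- o x) => // n _.
 by rewrite -exprnP rmorphXn; apply: srX; exact: vm_O.
pose v x : R := if x == 0 then 0 else 2 ^ (o x).
have v0 : v 0 = 0 by rewrite /v eqxx.
have vE x : x != 0 -> v x = 2 ^ (o x) by rewrite /v => /negbTE ->.
have vge0 x : 0 <= v x by rewrite /v; case: eqP => // _; rewrite exprz_ge0.
have veq0 x : v x = 0 <-> x = 0.
 split=> [|->//]; rewrite /v; case: eqP => // _ /eqP; rewrite expfz_eq0.
 by rewrite pnatr_eq0 andbF.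
have vM x z : v (x * z) = v x * v z.
 have [->|x0] := eqVneq x 0; first by rewrite mul0r v0 mul0r.
 have [->|z0] := eqVneq z 0; first by rewrite mulr0 v0 mulr0.
 by rewrite !vE ?mulf_neq0 // oM // expfzDr // pnatr_eq0.
have gt1 : (1 : R) < 2 by rewrite ltr1n.
have vO x : v x <= 1 <-> O (emb x).
 have [->|x0] := eqVneq x 0; first by rewrite v0 rmorph0; split=> // _; exact: sr0.
 by rewrite oO // vE // -[X in _ <= X](expr0z (2 : R)) ler_eXz2l.
have vna x z : v (x + z) <= Num.max (v x) (v z).
 wlog le : x z / v x <= v z.
  move=> H; have [h|/ltW h] := leP (v x) (v z).
   by have := H x z h; rewrite (max_r h).
  by have := H z x h; rewrite (max_r h) addrC.
 rewrite (max_r le); have [z0|z0] := eqVneq z 0.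
  by move: le; rewrite z0 v0 addr0.
 have vz : 0 < v z by rewrite lt_neqAle vge0 andbT eq_sym; apply/eqP => /veq0 /eqP; rewrite (negbTE z0).
 have -> : x + z = (x / z + 1) * z by rewrite mulrDl divfK // mul1r.
 rewrite vM ger_pMl //; apply/vO; rewrite rmorphD rmorph1; apply: srD; last exact: sr1.
 by apply/vO; rewrite -(ler_pM2r vz) -vM divfK // mul1r.
have vadd x z : v (x + z) <= v x + v z.
 by apply: (le_trans (vna x z)); rewrite ge_max lerDl lerDr !vge0.
pose va := AbsVal vge0 veq0 vM vadd.
have ow : o w = -1.
 have e1 : w * w ^ (-1) = 1 by rewrite -[w ^ (-1)]/(w^-1) divff.
 by apply: oE; rewrite // e1 rmorph1 ?invr1; exact: sr1.
have vw2 : v w = 2^-1 by rewrite vE // ow.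
have w1 : v w < 1 by rewrite vw2 invf_lt1.
have nt : exists x, x <> 0 /\ va x <> 1.
 by exists w; split; [exact/eqP|move=> /= h; rewrite h ltxx in w1].
pose pl_ := Place nt.
have nav : nonarch pl_ by exact: vna.
have bnd (x : Kb) : exists r : nat, O (emb w ^+ r * x).
 have [j hj] := l_bounded pl vl x.
 have lK : (l%:R : K) != 0 by exact: pos_natr0 (@rat_alg_char0 K) (prime_gt0 pl).
 have ol : o l%:R <= 0 by apply/oO => //; rewrite rmorph_nat; exact: sr_nat.
 have [h1 h2] := ho l%:R lK.
 exists (`|o l%:R| * j)%N; rewrite exprM.
 have eo : o l%:R = - `|o l%:R|%N%:Z by rewrite -[LHS]opprK abszE ler0_norm.
 move: h1 h2; rewrite eo -exprnN; set W := w ^+ _ => h1 h2.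
 have -> : emb w ^+ `|- `|o l%:R|%N%:Z| = emb W by rewrite rmorphXn abszN.
 have W0 : W != 0 by rewrite expf_neq0.
 have -> : emb W ^+ j * x = (emb (l%:R / W))^-1 ^+ j * (l%:R ^+ j * x).
  rewrite fmorph_div rmorph_nat exprVn exprMn invfM exprVn invrK mulrA; congr (_ * _).
  by rewrite mulrAC mulVf ?mul1r // expf_neq0 // pos_natr0 // prime_gt0.
 by apply: srM => //; exact: srX.
have [F [pf [pfc pfB pfM pfs pfk]]] := completion_ex nav.
have [Om [po [po1 poB poM poN poK]]] := ultraproduct ew0 vw bnd.
pose em (u : nat -> K) : nat -> Kb := fun k => emb (u k).
have emB u t : em (u - t) = em u - em t by apply/funext => k; rewrite /em !fctE rmorphB.
have emM u t : em (u * t) = em u * em t by apply/funext => k; rewrite /em !fctE rmorphM.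
have ww r : v (w ^+ r) = v w ^+ r by exact: (avX va).
have emb_b u : cauchy pl_ u -> bseq O (emb w) (em u).
 move=> cu; have [C C0 hC] := cauchy_bounded cu.
 have [r hr] : exists r : nat, v w ^+ r < C^-1 by apply: expr_small; rewrite ?vge0 ?invr_gt0.
 exists r => k; rewrite /em -rmorphXn -rmorphM; apply/vO; rewrite vM ww.
 apply: (@le_trans _ _ (C^-1 * C)); last by rewrite mulVf ?lt0r_neq0.
 by apply: ler_pM; rewrite ?exprn_ge0 ?vge0 ?hC // ltW.
have emb_n u : nullseq pl_ u -> po (em u) = 0.
 move=> nu; apply: poN => r.
 have [|N hN] := nu (v w ^+ r); first by rewrite exprn_gt0 // vw2 invr_gt0.
 exists N => k /hN /= h; rewrite /em -rmorphXn -fmorph_div; apply/vO.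
 have wr : 0 < v w ^+ r by rewrite exprn_gt0 // vw2 invr_gt0.
 have e1 := avV va (w ^+ r); rewrite /= in e1.
 by rewrite vM e1 ww ler_pdivrMr // mul1r; exact: ltW.
have /choice[rep hrep] : forall x : F, exists u, cauchy pl_ u /\ pf u = x.
 by move=> x; have [u h1 h2] := pfs x; exists u.
pose e0 x := po (em (rep x)).
have e0E u : cauchy pl_ u -> e0 (pf u) = po (em u).
 move=> cu; apply/eqP; rewrite -subr_eq0; apply/eqP; rewrite /e0 -poB; last 2 first.
 - by apply: emb_b; exact: (hrep _).1.
 - exact: emb_b.
 have cr := (hrep (pf u)).1; rewrite -emB; apply: emb_n; apply/(pfk _ _).1; first exact: cauchyB.
 by rewrite pfB // (hrep _).2 subrr.
have e0B : zmod_morphism e0.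
 move=> x z; have [u cu <-] := pfs x; have [t ct <-] := pfs z.
 by rewrite -pfB // !e0E ?emB ?poB //; [exact: emb_b|exact: emb_b|exact: cauchyB].
have e0M : monoid_morphism e0.
 split=> [|x z].
  have <- : pf (fun=> 1) = 1 by rewrite pfc rmorph1.
  rewrite e0E; last exact: cauchy_cst.
  by have -> : em (fun=> 1) = 1 by apply/funext => k; rewrite /em rmorph1.
 have [u cu <-] := pfs x; have [t ct <-] := pfs z.
 by rewrite -pfM // !e0E ?emM ?poM //; [exact: emb_b|exact: emb_b|exact: cauchyM].
pose eA := GRing.isZmodMorphism.Build _ _ e0 e0B.
pose eR := GRing.isMonoidMorphism.Build _ _ e0 e0M.
pose e : {rmorphism F -> Om} := HB.pack e0 eA eR.
have [Fb [j [jE jS]]] := alg_closure_in e.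
pose k0 (x : Kb) := po (fun=> x).
have bc := bseq_cst bnd.
have k0B : zmod_morphism k0 by move=> x z; rewrite /k0 -poB.
have k0M : monoid_morphism k0 by split=> [|x z]; rewrite /k0 ?po1 // -poM.
pose kA := GRing.isZmodMorphism.Build _ _ k0 k0B.
pose kR := GRing.isMonoidMorphism.Build _ _ k0 k0M.
pose kc : {rmorphism Kb -> Om} := HB.pack k0 kA kR.
have kE x : kc (emb x) = e (co_emb F x).
 rewrite -pfc; transitivity (e0 (pf (fun=> x))); last by [].
 by rewrite e0E //; exact: cauchy_cst.
have kalg x : algebraicOver e (kc x).
 have [q q0 qx] := ac_alg x; exists (map_poly (co_emb F) q); first by rewrite map_poly_eq0.
 have := congr1 kc (rootP qx); rewrite rmorph0 -horner_map -map_poly_comp => h.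
 by apply/rootP; rewrite -h -map_poly_comp; congr (_.[_]); apply: eq_map_poly => c; first [exact: kE|exact: esym (kE c)].
have /choice[i0 hi] : forall x, exists z, j z = kc x by move=> x; exact: jS.
have ji : injective j := fmorph_inj j.
have iB : zmod_morphism i0 by move=> x z; apply: ji; rewrite rmorphB !hi rmorphB.
have iM : monoid_morphism i0 by split=> [|x z]; apply: ji; rewrite ?rmorphM !hi ?rmorphM ?rmorph1.
pose iA := GRing.isZmodMorphism.Build _ _ i0 iB.
pose iR := GRing.isMonoidMorphism.Build _ _ i0 iM.
pose i : {rmorphism Kb -> Fb} := HB.pack i0 iA iR.
have ic x : i (ac_emb Kb x) = ac_emb Fb (co_emb F x) by apply: ji; rewrite jE hi kE.
(* Suppose [y] is locally integral. The coefficients of its equation are represented by sequences in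
   [O]. Divided by [y^n0], the equation says that 1 plus a sequence in the maximal ideal vanishes in
   the ultraproduct, which puts 1 in that ideal at some index. *)
pose D := LocalData ic; exists D, nav => -[q [mq hq qy]].
have [n0 hn0] : exists n, size q = n.+1 by exists (size q).-1; rewrite prednK // size_poly_gt0 monic_neq0.
have y0 := v_not_O Oy; have vt := vinv_vm Oy.
have /choice[g hg] : forall k, exists g : nat -> Kb, (forall n, O (g n)) /\ j q`_k = po g.
 move=> k; have [a va1 ea] := hq k.
 have [u cu eu] := pfs a.
 have [|N hN] := (pfk u cu).2 2; first by rewrite eu; apply: le_lt_trans gt1.
 have hle n : (N <= n)%N -> O (emb (u n)).
  move=> /hN /=; have [->|un0] := eqVneq (u n) 0; first by rewrite rmorph0 => _; exact: sr0.
  rewrite vE // -[X in _ < X]expr1z ltr_eXz2l // oO //; lia.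
 exists (fun n => if (N <= n)%N then emb (u n) else 0); split.
  by move=> n; case: ifP => [/hle//|_]; exact: sr0.
 rewrite ea jE -eu; transitivity (e0 (pf u)); first by [].
 rewrite e0E //; apply/eqP; rewrite -subr_eq0 -poB; last 2 first.
 - exact: emb_b.
 - by exists 0%N => n; rewrite mul1r; case: ifP => [/hle//|_]; exact: sr0.
 apply/eqP/poN => r; exists N => n hn; rewrite !fctE hn subrr mul0r; exact: sr0.
have bg k : bseq O (emb w) (g k) by exists 0%N => n; rewrite mul1r; exact: (hg k).1.
pose t := y^-1.
pose h : nat -> Kb := \sum_(k < n0) g k * (fun=> t ^+ (n0 - k)).
have hO (m : nat) : (m <= n0)%N -> bseq O (emb w) (\sum_(k < m) g k * (fun=> t ^+ (n0 - k)) : nat -> Kb) /\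
  po (\sum_(k < m) g k * (fun=> t ^+ (n0 - k)) : nat -> Kb) = \sum_(k < m) j q`_k * kc (t ^+ (n0 - k))
  /\ forall n, vm O ((\sum_(k < m) g k * (fun=> t ^+ (n0 - k)) : nat -> Kb) n).
 have po0 : po 0 = 0 by apply: poN => r; exists 0%N => n _; rewrite mul0r; exact: sr0.
 elim: m => [|m IH] mn.
  rewrite !big_ord0; split; first by exists 0%N => n; rewrite mulr0; exact: sr0.
  by split=> // n; exact: vm0.
 have [I1 [I2 I3]] := IH (ltnW mn); rewrite !big_ord_recr /=.
 have bm : bseq O (emb w) (g m * (fun=> t ^+ (n0 - m)) : nat -> Kb) by apply: bseqM => //; exact: vm_O vw.
 have eqs (a b : nat -> Kb) : a + b = a - (0 - b) by apply/funext => z; rewrite !fctE sub0r opprK.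
 have bz : bseq O (emb w) (0 : nat -> Kb) by exists 0%N => n; rewrite mulr0; exact: sr0.
 have Ow := vm_O vw.
 split; first by rewrite eqs; apply: bseqB => //; exact: bseqB.
 split.
  rewrite eqs !poB //; last exact: bseqB.
  by rewrite po0 sub0r opprK I2 poM // -(hg m).2.
 move=> n; rewrite fctE; apply: vmD => //; apply: (@vmMl _ O (g m n) (t ^+ (n0 - m))); first exact: (hg m).1.
 have : (0 < n0 - m)%N by rewrite subn_gt0.
 by case: (n0 - m)%N => // d _; rewrite exprS; apply: vmMr => //; apply: srX; exact: vm_O.
have [bh [ph vh]] := hO n0 (leqnn _).
have key : po (h - (fun=> - 1)) = 0.
 have b1 : bseq O (emb w) (fun=> -1) by exact: bc.
 rewrite poB // ph; have -> : po (fun=> -1) = -1 by rewrite -[LHS]/(kc (-1)) rmorphN rmorph1.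
 rewrite opprK; have ky : kc y != 0 by rewrite fmorph_eq0.
 apply: (mulIf (expf_neq0 n0 ky)); rewrite mul0r mulrDl mul1r mulr_suml.
 have := congr1 j qy; rewrite rmorph0 horner_coef hn0 big_ord_recr /= rmorphD rmorph_sum /=.
 have -> : q`_n0 = 1 by rewrite -[n0]/(n0.+1.-1) -hn0 -lead_coefE (monicP mq).
 rewrite mul1r rmorphXn hi => qe; rewrite -[RHS]qe; congr (_ + _); apply: eq_bigr => k _.
 rewrite rmorphM rmorphXn hi -mulrA; congr (_ * _).
 have -> : k0 (t ^+ (n0 - k)) = (kc y)^-1 ^+ (n0 - k) by rewrite -[LHS]/(kc _) rmorphXn fmorphV.
 have -> : k0 y ^+ n0 = kc y ^+ (n0 - k) * kc y ^+ k by rewrite -exprD subnK // ltnW.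
 by rewrite mulrA exprVn mulVf ?mul1r ?expf_neq0.
have [|n hn] := poK _ _ key; first by apply: bseqB => //; exact: vm_O vw.
apply: (@vm1 _ O); rewrite !fctE opprK in hn.
by rewrite -[1](addKr (h n)) addrC; apply: vmB.
Qed.

(** * Finiteness *)

(** An interval cut into cells of width [w]: the box principle that takes the place of volumes in
    the lattice arguments. *)
Lemma cell_ex (F : archiRealFieldType) (B w : F) : 0 < w -> 0 <= B ->
 exists2 f : F -> nat, (forall x, `|x| <= B -> (f x <= Num.truncn (2 * B / w))%N) &
 forall x y, `|x| <= B -> `|y| <= B -> f x = f y -> `|x - y| < w.
Proof.
move=> w0 B0; exists (fun x => Num.truncn ((x + B) / w)) => [x|x y].
 rewrite ler_norml => /andP[h1 h2]; apply: le_truncn; rewrite ler_pM2r ?invr_gt0 //; lra.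
rewrite !ler_norml => /andP[x1 x2] /andP[y1 y2] e.
have xg : 0 <= (x + B) / w by apply: divr_ge0; [lra|exact: ltW].
have yg : 0 <= (y + B) / w by apply: divr_ge0; [lra|exact: ltW].
have := truncn_itv xg; have := truncn_itv yg; rewrite e -natr1 => /andP[a1 a2] /andP[b1 b2].
have : `|(x + B) / w - (y + B) / w| < 1 by rewrite ltr_norml; lra.
have -> : (x + B) / w - (y + B) / w = (x - y) / w by rewrite -mulrBl; congr (_ / _); ring.
by rewrite normrM normfV (gtr0_norm w0) ltr_pdivrMr // mul1r.
Qed.

Section RationalIntegers.
Variables (A : fieldType) (e : {rmorphism rat -> A}).

Lemma algint_rat (q : rat) : algint A (e q) -> exists z : int, q = z%:~R.
Proof.
case=> r [mr /choice[z hz] er].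
pose s : {poly int} := \poly_(i < size r) z i.
have sE : map_poly intr s = r :> {poly A}.
 apply/polyP => i; rewrite coef_map coef_poly; case: ltnP => h /=; first by rewrite hz.
 by rewrite nth_default.
have sm : s \is monic.
 have nz : z (size r).-1 = 1.
  have c0 : forall n, n.+1%:R != 0 :> A by apply: (fmorph_char0 e) => k; rewrite pnatr_eq0.
  have : (z (size r).-1 - 1)%:~R = 0 :> A by rewrite intrB -hz -lead_coefE (monicP mr) subrr.
  by have [//|h /eqP] := eqVneq (z (size r).-1) 1; rewrite (negbTE (intr0 c0 _)) // subr_eq0.
 have r0 : (0 < size r)%N by rewrite size_poly_gt0 monic_neq0.
 have sz : size s = size r.
  by apply: size_poly_eq; rewrite nz oner_neq0.
 by rewrite monicE lead_coefE sz coef_poly prednK // leqnn nz.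
have rq : root (map_poly intr s : {poly rat}) q.
 rewrite -(fmorph_root e) /root -map_poly_comp -[X in X.[_]](_ : r = _) ?er //.
 by rewrite -sE; apply: eq_map_poly => a /=; rewrite rmorph_int.
have ai : (ratr q : algC) \in Aint.
 apply: (@root_monic_Aint (map_poly intr s)).
 - rewrite -(fmorph_root (@ratr algC)) -map_poly_comp in rq.
  by rewrite (eq_map_poly (g := ratr \o intr)) // => a /=; rewrite ratr_int.
 - by rewrite monicE lead_coef_map_inj ?(monicP sm) //; exact: intr_inj.
 - by apply/polyOverP => i; rewrite coef_map /= intr_int.
have /intrP[m em] := Cint_rat_Aint (Crat_rat q) ai.
exists m; have : ratr (q - m%:~R) = 0 :> algC by rewrite rmorphB /= em ratr_int subrr.
by move=> /eqP; rewrite fmorph_eq0 subr_eq0 => /eqP.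
Qed.

End RationalIntegers.

Lemma algint_scale (A : algClosure rat) (x : A) : exists2 d : nat, (0 < d)%N & algint A (d%:R * x).
Proof.
have [q [mq qx _]] := min_poly_ex x.
have [r [a a0 qE]] := rat_poly_scale q.
have ra i : q`_i * a%:~R = (r`_i)%:~R by rewrite qE coefZ coef_map mulrC mulrA divff ?mul1r ?intr_eq0.
exists `|a|%N; first by rewrite absz_gt0.
have : algint A (a%:~R * x); last first.
 have -> : (`|a|%N%:R : A) = (`|a|%:Z)%:~R by [].
 rewrite abszE; have [h|h] := leP 0 a; first by rewrite ger0_norm.
 by rewrite ltr0_norm // mulrNz mulNr => h'; exact: srN.
pose n := (size q).-1; have sq : size q = n.+1 by rewrite prednK // size_poly_gt0 monic_neq0.
have qn : q`_n = 1 by rewrite -lead_coefE (monicP mq).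
pose s : {poly A} := \poly_(i < n.+1) (if i == n then 1 else (r`_i)%:~R * a%:~R ^+ (n.-1 - i)).
exists s; split.
- by rewrite monicE lead_coefE size_poly_eq /= ?eqxx ?oner_neq0 // coef_poly leqnn eqxx.
- move=> i; rewrite coef_poly; case: ifP => _; last exact: sr0.
 by case: eqP => _; [exact: sr1|apply: srM; [exists (r`_i)|apply: srX; exists a]].
apply/eqP; rewrite horner_poly; apply/eqP.
transitivity (a%:~R ^+ n * (map_poly (ac_emb A) q).[x]); last by rewrite qx mulr0.
rewrite horner_coef size_map_poly sq mulr_sumr; apply: eq_bigr => i _; rewrite coef_map /=.
case: eqP => [->|/eqP ni]; first by rewrite qn rmorph1 !mul1r exprMn.
have lt : (i < n)%N by have := ltn_ord i; rewrite ltnS leq_eqVlt (negbTE ni).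
have -> : (r`_i)%:~R = ac_emb A q`_i * a%:~R by rewrite -(rmorph_int (ac_emb A)) -ra rmorphM /= rmorph_int.
have -> : a%:~R ^+ n = a%:~R * a%:~R ^+ (n.-1 - i) * a%:~R ^+ i :> A.
 by rewrite -exprS -exprD; congr (_ ^+ _); lia.
by rewrite exprMn; ring.
Qed.

Lemma complex_embedding (R : realType) (A : algClosure rat) : exists tau : {rmorphism A -> R[i]}, True.
Proof.
have [|g _] := @field_embedding_extends _ A R[i] (ac_emb A) (@ratr R[i]) (@ac_alg _ A) 0 0; last by exists g.
by move=> q; rewrite !horner_coef0 !coef_map /= => /eqP; rewrite fmorph_eq0 => /eqP ->; rewrite rmorph0.
Qed.

(** * Geometry of numbers in a totally complex field *)

Section Lattice.
Variables (R : realType) (A : algClosure rat) (tau : {rmorphism A -> R[i]}).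
Let nmf (x : A) : R := Normc.normc (tau x).
Lemma nm_ge0 x : 0 <= nmf x.
Proof. by rewrite /nmf; case: (tau x) => a b; exact: sqrtr_ge0. Qed.
Lemma nm_eq0 x : nmf x = 0 <-> x = 0.
Proof.
split=> [/Normc.eq0_normc /eqP|->]; last by rewrite /nmf rmorph0 Normc.normc0.
by rewrite fmorph_eq0 => /eqP.
Qed.
Lemma nm_mul x y : nmf (x * y) = nmf x * nmf y.
Proof. by rewrite /nmf rmorphM Normc.normcM. Qed.
Lemma nm_add x y : nmf (x + y) <= nmf x + nmf y.
Proof. by rewrite /nmf rmorphD; exact: le_normcD. Qed.
Definition nm := AbsVal nm_ge0 nm_eq0 nm_mul nm_add.

Lemma nm_parts x : [/\ `|complex.Re (tau x)| <= nm x, `|complex.Im (tau x)| <= nm x &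
 nm x <= `|complex.Re (tau x)| + `|complex.Im (tau x)|].
Proof.
rewrite /= /nmf; case: (tau x) => a b /=.
have sq (c : R) : `|c| = Num.sqrt (c ^+ 2) by rewrite sqrtr_sqr.
split; first by rewrite sq ler_sqrt ?addr_ge0 ?sqr_ge0 // lerDl sqr_ge0.
 by rewrite sq ler_sqrt ?addr_ge0 ?sqr_ge0 // lerDr sqr_ge0.
rewrite -[X in _ <= X]ger0_norm ?addr_ge0 // sq ler_sqrt ?sqr_ge0 //.
rewrite sqrrD !real_normK ?num_real // -mulr_natl; have : 0 <= `|a| * `|b| by rewrite mulr_ge0. lra.
Qed.

Lemma nm_rat q : nm (ac_emb A q) = `|ratr q|.
Proof.
rewrite /= /nmf; have -> : tau (ac_emb A q) = (ratr q : R)%:C%C.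
 have e1 := fmorph_eq_rat (tau \o ac_emb A) q; rewrite /= in e1; rewrite e1.
 by have e2 := fmorph_eq_rat (@real_complex R \o @ratr R) q; rewrite /= in e2; rewrite e2.
by rewrite /= expr0n /= addr0 sqrtr_sqr.
Qed.
Lemma nm_int (z : int) : nm z%:~R = `|z%:~R|.
Proof. by rewrite -(rmorph_int (ac_emb A)) nm_rat ratr_int. Qed.
Lemma nm_nat (n : nat) : nm n%:R = n%:R.
Proof. by rewrite -[n%:R]/((n%:Z)%:~R) nm_int ger0_norm ?ler0z. Qed.
Lemma nm_sum I (r : seq I) (E : I -> A) : nm (\sum_(i <- r) E i) <= \sum_(i <- r) nm (E i).
Proof.
elim: r => [|i r IH]; first by rewrite !big_nil av0.
by rewrite !big_cons; apply: le_trans (av_add nm _ _) _; rewrite lerD2l.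
Qed.

Variables (I th : A).
Hypotheses (I2 : I ^+ 2 = -1) (thO : algint A th) (hI : forall s : absGal A, s th = th -> s I = I).
Let c0 : forall n, n.+1%:R != 0 :> A.
Proof. by move=> n; rewrite -(rmorph_nat (ac_emb A)) fmorph_eq0 pnatr_eq0. Qed.

Definition Lf (x : A) := forall s : absGal A, s th = th -> s x = x.
Lemma LfB x y : Lf x -> Lf y -> Lf (x - y).
Proof. by move=> hx hy s hs; rewrite rmorphB hx ?hy. Qed.
Lemma LfM x y : Lf x -> Lf y -> Lf (x * y).
Proof. by move=> hx hy s hs; rewrite rmorphM hx ?hy. Qed.
Lemma LfV x : Lf x -> Lf x^-1.
Proof. by move=> hx s hs; rewrite fmorphV hx. Qed.
Lemma LfX x n : Lf x -> Lf (x ^+ n).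
Proof. by move=> hx s hs; rewrite rmorphXn hx. Qed.
Lemma Lf_nat n : Lf n%:R. Proof. by move=> s _; rewrite rmorph_nat. Qed.
Lemma Lf_sum J (r : seq J) (E : J -> A) : (forall i, Lf (E i)) -> Lf (\sum_(i <- r) E i).
Proof. by move=> h s hs; rewrite rmorph_sum; apply: eq_bigr => i _; exact: h. Qed.

Lemma gal_algint (s : absGal A) x : algint A x -> algint A (s x).
Proof. by apply: integ_map => _ [z ->]; exists z; rewrite rmorph_int. Qed.

(** The field of [th] contains [I], a square root of -1, so it is totally complex. The conjugates of
    [th] over the field of [I] give one embedding from each complex conjugate pair, and [g y] is an
    automorphism realising the conjugate [y]. *)
Lemma orbit_data : exists (o : seq A) (g : A -> absGal A), [/\ uniq o, th \in o,
 forall y, y \in o -> g y I = I /\ g y th = y & forall s : absGal A, s I = I -> s th \in o].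
Proof.
have [o uo ho] := orbit_list (fun s : absGal A => s I = I) th.
have /choice[g hg] : forall y, exists s : absGal A, y \in o -> s I = I /\ s th = y.
 move=> y; case: (boolP (y \in o)) => [/ho[s h1 h2]|_]; last by exists (gal_one A).
 by exists s.
exists o, g; split=> //; first by apply/ho; exists (gal_one A).
by move=> s hs; apply/ho; exists s.
Qed.

Variables (o : seq A) (g : A -> absGal A).
Hypotheses (uo : uniq o) (tho : th \in o) (gI : forall y, y \in o -> g y I = I)
 (gth : forall y, y \in o -> g y th = y) (so : forall s : absGal A, s I = I -> s th \in o).
Let n := size o.
Let n0 : (0 < n)%N. Proof. by rewrite /n; case: (o) tho. Qed.

(** The norm [z] of [x^p] to the field of [I] is an algebraic integer [a + b I], and the square of
    its absolute value is [a^2 + b^2], a positive integer. Asking only that [x^p] lie in the field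
    of [th] covers Kummer generators. *)
Lemma norm_ge1 (p : nat) x : (0 < p)%N -> algint A x -> x != 0 -> Lf (x ^+ p) ->
 1 <= \prod_(y <- o) nm (g y x).
Proof.
move=> p0 Ox x0 Lx; pose z := \prod_(y <- o) g y (x ^+ p).
have zS (s : absGal A) : s I = I -> s z = z.
 move=> sI; rewrite /z rmorph_prod.
 have pe : perm_eq o [seq s y | y <- o].
  apply: perm_map_stable => //; first exact: fmorph_inj.
  move=> _ /mapP[y yo ->]; rewrite -(gth yo) -gal_mulE; apply: so; by rewrite gal_mulE gI.
 rewrite [RHS](perm_big _ pe) big_map; apply: eq_big_seq => y yo.
 have sy : s y \in o by rewrite -(gth yo) -gal_mulE; apply: so; rewrite gal_mulE gI.
 apply: (can_inj (gal_invVK (g (s y)))); rewrite gal_invK.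
 have := Lx (gal_mul (gal_inv (g (s y))) (gal_mul s (g y))); rewrite !gal_mulE; apply.
 by rewrite gth // -{2}(gth sy) gal_invK.
(* Such an automorphism exists because every rational polynomial that kills [I] is divisible by
   ['X^2 + 1]. It plays complex conjugation on the field of [I]. *)
have [k kI] : exists k : absGal A, k I = - I.
 apply: gal_conj => q /eqP qI; apply/eqP.
 have dv : (('X^2 + 1 : {poly rat}) %| q).
  have [m [mm mI hm]] := min_poly_ex I.
  have mX : m %| 'X^2 + 1.
   by apply: hm; rewrite rmorphD rmorph1 /= map_polyXn !hornerE I2 addNr.
  have sX : size ('X^2 + 1 : {poly rat}) = 3%N by rewrite size_addl ?size_polyXn // size_poly1.
  apply: dvdp_trans (hm q (eqP qI)).
  have m0 := monic_neq0 mm.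
  have : (size m <= 3)%N by rewrite -sX; apply: dvdp_leq; [rewrite -size_poly_gt0 sX|apply: hm; rewrite rmorphD rmorph1 /= map_polyXn !hornerE I2 addNr].
  rewrite leq_eqVlt => /predU1P[h|h]; first by have := dvdp_size_eqp mX; rewrite h sX eqxx => /esym/eqp_dvdl <-; exact: dvdpp.
  have [u hu] : exists u : rat, I = ac_emb A u.
   move: mI; rewrite horner_coef size_map_poly.
   have : (0 < size m)%N by rewrite size_poly_gt0.
   case E : (size m) h => [|[|[|]]] // _ _; rewrite ?big_ord_recl ?big_ord0 !coef_map /= ?expr0 ?mulr1 ?addr0 /bump /= ?add1n ?expr1.
    move=> /eqP; rewrite fmorph_eq0 => /eqP h; have := monicP mm; rewrite lead_coefE E /= h => /eqP.
    by rewrite eq_sym oner_eq0.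
   have := monicP mm; rewrite lead_coefE E /= => ->; rewrite rmorph1 mul1r => h.
   by exists (- m`_0); rewrite rmorphN; apply/eqP; rewrite -addr_eq0 addrC h.
  move: I2; rewrite hu -rmorphXn -(rmorph1 (ac_emb A)) -rmorphN => /fmorph_inj h'.
  by have := sqr_ge0 u; rewrite h' oppr_ge0 ler10.
 move/dvdpP: dv => [w ->]; rewrite rmorphM hornerM rmorphD rmorph1 /= map_polyXn !hornerE sqrrN I2 addNr.
 by rewrite mulr0.
have kk (s : absGal A) : s I = I \/ s I = - I.
 have : (s I - I) * (s I + I) = 0 by rewrite -subr_sqr -rmorphXn I2 rmorphN rmorph1 subrr.
 by move=> /eqP; rewrite mulf_eq0 subr_eq0 addr_eq0 => /orP[/eqP|/eqP]; [left|right].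
have fixk (s : absGal A) : (s I = I -> s z = z /\ s (k z) = k z) /\ (s I = - I -> s z = k z /\ s (k z) = z).
 have kV : gal_inv k I = - I by apply: (can_inj (gal_invK k)); rewrite gal_invVK rmorphN kI opprK.
 split=> sI; split.
 - exact: zS.
 - have := zS (gal_mul (gal_inv k) (gal_mul s k)); rewrite !gal_mulE kI rmorphN sI rmorphN kV opprK.
  by move=> /(_ erefl) h; rewrite -{2}h gal_invVK.
 - have := zS (gal_mul (gal_inv k) s); rewrite !gal_mulE sI rmorphN kV opprK => /(_ erefl) h.
  by rewrite -{2}h gal_invVK.
 - by have := zS (gal_mul s k); rewrite !gal_mulE kI rmorphN sI opprK => /(_ erefl).
have i0 : I != 0 by apply/eqP => h; move: I2; rewrite h expr0n /= => /eqP; rewrite eq_sym oppr_eq0 oner_eq0.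
have [a ha] : exists a : rat, (z + k z) / 2 = ac_emb A a.
 apply: gal_fixed => // s; rewrite fmorph_div rmorph_nat rmorphD.
 by case: (kk s) => sI; [have [-> ->] := (fixk s).1 sI|have [-> ->] := (fixk s).2 sI; rewrite addrC].
have [b hb] : exists b : rat, (z - k z) / 2 / I = ac_emb A b.
 apply: gal_fixed => // s; rewrite !fmorph_div rmorph_nat rmorphB.
 case: (kk s) => sI; first by have [-> ->] := (fixk s).1 sI; rewrite sI.
 by have [-> ->] := (fixk s).2 sI; rewrite sI invrN mulrN -!mulNr opprB.
have t0 : 2 != 0 :> A := c0 1.
have zE : z = ac_emb A a + ac_emb A b * I by rewrite -ha -hb divfK //; field; exact: t0.
have kE : k z = ac_emb A a - ac_emb A b * I.
 by rewrite zE rmorphD rmorphM !gal_fix kI mulrN.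
have [q hq] : exists q : int, a ^+ 2 + b ^+ 2 = q%:~R.
 apply: (@algint_rat _ (ac_emb A)).
 have -> : ac_emb A (a ^+ 2 + b ^+ 2) = z * k z.
  by rewrite kE zE mulrC -subr_sqr exprMn I2 mulrN1 opprK rmorphD !rmorphXn.
 have Oz : algint A z by apply: sr_prod => y _; apply: gal_algint; exact: srX.
 by apply: srM => //; exact: gal_algint.
have nz : nm z ^+ 2 = q%:~R.
 have tI : tau I = 'i%C \/ tau I = - 'i%C.
  have : (tau I - 'i%C) * (tau I + 'i%C) = 0 by rewrite -subr_sqr -rmorphXn I2 rmorphN rmorph1 sqr_i subrr.
  by move=> /eqP; rewrite mulf_eq0 subr_eq0 addr_eq0 => /orP[/eqP|/eqP]; [left|right].
 have tr (u : rat) : tau (ac_emb A u) = (ratr u : R)%:C%C.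
  have e1 := fmorph_eq_rat (tau \o ac_emb A) u; rewrite /= in e1; rewrite e1.
  by have e2 := fmorph_eq_rat (@real_complex R \o @ratr R) u; rewrite /= in e2; rewrite e2.
 have -> : (q%:~R : R) = ratr a ^+ 2 + ratr b ^+ 2 by have e := congr1 (@ratr R) hq; rewrite ratr_int rmorphD !rmorphXn in e; rewrite -e.
 rewrite /= /nmf zE rmorphD rmorphM !tr.
 have -> : Normc.normc ((ratr a)%:C + (ratr b)%:C * tau I)%C = Num.sqrt (ratr a ^+ 2 + ratr b ^+ 2 : R).
  case: tI => ->; rewrite /= ?oppr0 ?mulr0 ?mul0r ?mulr1 ?mulrN1 ?subr0 ?addr0 ?add0r ?oppr0 ?mulr0 ?addr0 //.
  by rewrite sqrrN.
 by rewrite sqr_sqrtr ?addr_ge0 ?sqr_ge0.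
have zx : nm z = (\prod_(y <- o) nm (g y x)) ^+ p.
 by rewrite /z av_prod -prodrXl; apply: eq_bigr => y _; rewrite rmorphXn avX.
have xp y : 0 < nm (g y x) by apply: av_neq0; rewrite fmorph_eq0.
have Pp : 0 < \prod_(y <- o) nm (g y x) by apply: prodr_gt0.
have q1 : 1 <= q.
 by rewrite -gtz0_ge1 -(ltr0z R) -nz exprn_gt0 // zx exprn_gt0.
rewrite leNgt; apply/negP => lt.
have : nm z ^+ 2 < 1 by rewrite zx -exprM exprn_ilt1 ?ltW // muln_eq0 /= negb_or -lt0n p0.
by rewrite nz ltNge ler1z q1.
Qed.

Lemma Lf_coords : exists N, forall x, Lf x -> exists c : 'I_N -> rat, x = \sum_i ac_emb A (c i) * th ^+ i.
Proof.
have [q [mq qth _]] := min_poly_ex th; exists (size q) => x /(fixed_by_stabilizer c0)[h ->].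
have q0 := monic_neq0 mq.
exists (fun i => (h %% q)%R`_i); rewrite {1}(divp_eq h q) rmorphD rmorphM hornerD hornerM qth mulr0 add0r.
have le : (size (map_poly (ac_emb A) (h %% q)) <= size q)%N.
 by rewrite size_map_poly; apply: ltnW; rewrite ltn_modp.
by rewrite (horner_coef_wide _ le); apply: eq_bigr => i _; rewrite coef_map.
Qed.

(** Dirichlet's argument on rational coordinates: two of the multiples of [x] by [0, ..., H] have
    fractional parts in the same cells of side [1 / m]. The constant [C] converts coordinates into
    absolute values. *)
Lemma small_multiples : exists2 H : nat, (0 < H)%N & forall x, Lf x -> exists k w,
 [/\ (0 < k <= H)%N, Lf w, algint A w & forall y, y \in o -> nm (g y (k%:R * x - w)) < 1 / 2].
Proof.
have [N hN] := Lf_coords.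
pose C : R := 1 + \sum_(y <- o) \sum_(i < N) nm y ^+ i.
have sp y : 0 <= \sum_(i < N) nm y ^+ i by apply: sumr_ge0 => i _; rewrite exprn_ge0 ?av_ge0.
have C0 : 0 < C by rewrite ltr_pwDl // sumr_ge0.
have hC y : y \in o -> \sum_(i < N) nm y ^+ i < C.
 move=> yo; rewrite /C (big_rem y) //= addrA addrC ltr_wpDl ?sumr_ge0 //; lra.
pose m := (Num.truncn (2 * C)).+1.
have mC : 2 * C < m%:R by exact: truncnS_gt.
have m0 : (0 : rat) < m%:R^-1 by rewrite invr_gt0 ltr0n.
have [f f1 f2] := cell_ex m0 (@ler01 rat).
set M := Num.truncn _ in f1.
pose fr (x : rat) : rat := x - (Num.floor x)%:~R.
have fr1 x : `|fr x| <= 1.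
 have := floor_itv x; rewrite /fr intrD => /andP[h1 h2].
 by rewrite ger0_norm; lra.
pose H := #|{ffun 'I_N -> 'I_M.+1}|.
exists H; first by rewrite /H card_ffun !card_ord expn_gt0.
move=> x /hN[c ->].
pose col (k : 'I_H.+1) : {ffun 'I_N -> 'I_M.+1} := [ffun i => inord (f (fr (k%:R * c i)))].
have [k [k' [lt ek]]] : exists k k' : 'I_H.+1, (k < k')%N /\ col k = col k'.
 have : ~~ injectiveb col by apply/negP => /injectiveP/leq_card; rewrite card_ord ltnn.
 move=> /injectivePn[a [b ab e]]; have := neq_ltn a b; rewrite ab => /esym/orP[h|h].
  by exists a, b.
 by exists b, a.
have df i : `|fr (k'%:R * c i) - fr (k%:R * c i)| < m%:R^-1.
 apply: f2 => //; have := congr1 (fun h : {ffun 'I_N -> 'I_M.+1} => val (h i)) ek.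
 by rewrite /= !ffunE !inordK ?ltnS ?f1.
pose z i := Num.floor (k'%:R * c i) - Num.floor (k%:R * c i).
exists (k' - k)%N, (\sum_i (z i)%:~R * th ^+ i); split.
- by rewrite subn_gt0 lt /=; apply: leq_trans (leq_subr _ _) _; rewrite -ltnS.
- by apply: Lf_sum => i s hs; rewrite rmorphM rmorph_int rmorphXn hs.
- by apply: sr_sum => i _; apply: srM; [exact: sr_int|exact: srX].
move=> y yo; rewrite mulr_sumr -sumrB rmorph_sum.
apply: le_lt_trans (nm_sum _ _) _.
apply: (@le_lt_trans _ _ (\sum_(i < N) m%:R^-1 * nm y ^+ i)).
 apply: ler_sum => i _.
 have -> : (k' - k)%N%:R * (ac_emb A (c i) * th ^+ i) - (z i)%:~R * th ^+ i =
   ac_emb A (fr (k'%:R * c i) - fr (k%:R * c i)) * th ^+ i.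
  rewrite /z /fr natrB ?(ltnW lt) // !(rmorphB, rmorphM, rmorph_nat, rmorph_int) /= ?intrB; ring.
 rewrite rmorphM gal_fix rmorphXn gth // av_mul avX ler_wpM2r ?exprn_ge0 ?av_ge0 //.
 rewrite nm_rat -ratr_norm; apply: ltW; have := df i.
 by rewrite -(ltr_rat R) fmorphV /= ratr_nat.
rewrite -mulr_sumr mulrC ltr_pdivrMr ?ltr0n //; have := hC y yo; lra.
Qed.

(** Hurwitz's finiteness proof for ideal classes: take [b] in [J] of nearly minimal norm. For [a] in
    [J] some [k <= H] brings [k a / b] close to an integer [w], and minimality forces [k a = w b].
    The factorial of [H] serves all [k]. *)
Lemma hurwitz : exists2 t : nat, (0 < t)%N & forall J : A -> Prop,
 (exists2 a, J a & a != 0) -> (forall a, J a -> Lf a /\ algint A a) ->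
 (forall a b, J a -> J b -> J (a - b)) -> (forall a b, Lf a -> algint A a -> J b -> J (a * b)) ->
 exists b, [/\ J b, b != 0 & forall a, J a -> algint A (t%:R * a / b)].
Proof.
have [H H0 hH] := small_multiples; exists H`!; first exact: fact_gt0.
move=> J [a0 Ja0 a00] JL JB JM.
pose N x := \prod_(y <- o) nm (g y x).
have Nge0 x : 0 <= N x by apply: prodr_ge0 => y _; exact: av_ge0.
have Nge1 x : J x -> x != 0 -> 1 <= N x.
 by move=> /JL[h1 h2] x0; apply: (@norm_ge1 1) => //; rewrite expr1.
(* The norms are only known to be real and at least 1, so the minimum is taken up to a factor 2; the
   bound [1 / 2] in [small_multiples] pays for it. *)
have [b [Jb b0 bmin]] : exists b, [/\ J b, b != 0 & forall x, J x -> x != 0 -> N b <= 2 * N x].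
 apply: contrapT => nb.
 have desc (k : nat) : exists x, [/\ J x, x != 0 & 2 ^+ k * N x <= N a0].
  elim: k => [|k [x [Jx x0 hx]]]; first by exists a0; split=> //; rewrite mul1r.
  apply: contrapT => h; apply: nb; exists x; split=> // x' Jx' x'0.
  rewrite leNgt; apply/negP => lt; apply: h; exists x'; split=> //.
  by apply: le_trans hx; rewrite exprSr -mulrA ler_pM2l ?exprn_gt0 // ltW.
 have [x [Jx x0 hx]] := desc (Num.truncn (N a0)).
 have h1 := truncnS_gt (N a0); have h2 := Nge1 x Jx x0.
 have h3 : (Num.truncn (N a0)).+1%:R <= 2 ^+ Num.truncn (N a0) :> R by rewrite -natrX ler_nat ltn_expl.
 have : 2 ^+ Num.truncn (N a0) * 1 <= 2 ^+ Num.truncn (N a0) * N x by rewrite ler_pM2l ?exprn_gt0.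
 lra.
exists b; split=> // a Ja; have [La Oa] := JL a Ja; have [Lb Ob] := JL b Jb.
have [k [w [/andP[k0 kH] Lw Ow sm]]] := hH (a / b) (LfM La (LfV Lb)).
have e0 : k%:R * a - w * b = 0.
 apply/eqP/negP => /negP n0'.
 have Jn : J (k%:R * a - w * b).
  by apply: JB; apply: JM => //; [exact: Lf_nat|exact: sr_nat].
 have := bmin _ Jn n0'; rewrite leNgt => /negP; apply.
 have -> : N (k%:R * a - w * b) = (\prod_(y <- o) nm (g y (k%:R * (a / b) - w))) * N b.
  rewrite /N -big_split /=; apply: eq_bigr => y _; rewrite -nm_mul -rmorphM; congr (nm (g y _)).
  by rewrite mulrBl mulrA divfK.
 have Nb : 0 < N b by apply: prodr_gt0 => y _; rewrite av_neq0 // fmorph_eq0.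
 rewrite mulrA gtr_pMl // (big_rem th) //=.
 have h1 := sm th tho.
 have : \prod_(y <- rem th o) nm (g y (k%:R * (a / b) - w)) <= 1.
  rewrite big_seq; apply: prodr_ile1 => y /mem_rem /sm h2; apply/andP; split; [exact: av_ge0|lra].
 have := av_ge0 nm (g th (k%:R * (a / b) - w)); move: h1; set u := nm _; set v := \prod_(_ <- _) _ => h1 h2 h3.
 have h4 : u * v <= u * 1 by apply: ler_wpM2l.
 by change (2 * (u * v) < 1); lra.
have -> : H`!%:R * a / b = (H`! %/ k)%N%:R * w.
 have kd : (k %| H`!)%N by apply: dvdn_fact; rewrite k0.
 rewrite -{1}(divnK kd) natrM -!mulrA; congr (_ * _).
 by rewrite mulrA; apply: (mulIf b0); rewrite divfK //; apply/eqP; rewrite -subr_eq0 e0.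
by apply: srM => //; exact: sr_nat.
Qed.

(** Integers whose conjugates fall in the same cells of side [1 / 4] have a difference with all
    conjugates below [1 / 2], hence of norm below 1, and [norm_ge1] makes it zero. *)
Lemma bounded_finite (B : R) : exists (q : nat) (f : A -> 'I_q.+1), forall x x', Lf x -> Lf x' ->
 algint A x -> algint A x' -> (forall y, y \in o -> nm (g y x) <= B /\ nm (g y x') <= B) ->
 f x = f x' -> x = x'.
Proof.
have [B0|B0] := ltP B 0.
 exists 0%N, (fun=> ord0) => x x' h1 h2 h3 h4 hb; have [h _] := hb _ tho.
 by have := le_lt_trans (le_trans (av_ge0 nm _) h) B0; rewrite ltxx.
have w0 : (0 : R) < 1 / 4 by lra.
have [f f1 f2] := cell_ex w0 B0; set M := Num.truncn _ in f1.
pose T := {ffun 'I_n * bool -> 'I_M.+1}.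
pose co (x : A) (jb : 'I_n * bool) := let z := tau (g (nth th o jb.1) x) in
 if jb.2 then complex.Re z else complex.Im z.
pose F x : T := [ffun jb => inord (f (co x jb))].
have T0 : (0 < #|T|)%N by rewrite card_ffun !card_ord expn_gt0.
exists #|T|.-1, (fun x => cast_ord (esym (prednK T0)) (enum_rank (F x))).
move=> x x' Lx Lx' Ox Ox' hb /cast_ord_inj/enum_rank_inj eF; apply/eqP; rewrite -subr_eq0.
apply/negP => /negP d0.
have := @norm_ge1 1 (x - x') isT (srB Ox Ox') d0; rewrite expr1 => /(_ (LfB Lx Lx')).
rewrite leNgt => /negP; apply; rewrite (big_nth th) big_mkord.
have cb x0 jb : (forall y, y \in o -> nm (g y x0) <= B) -> `|co x0 jb| <= B.
 move=> h; have hy := h _ (mem_nth th (ltn_ord jb.1)).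
 by have [h1 h2 _] := nm_parts (g (nth th o jb.1) x0); rewrite /co; case: jb.2; apply: le_trans hy.
have dc jb : `|co x jb - co x' jb| < 1 / 4.
 apply: f2; try by apply: cb => y /hb[].
 have := congr1 (fun h : T => val (h jb)) eF; rewrite /F /= !ffunE !inordK ?ltnS ?f1 //; by apply: cb => y /hb[].
have sm (j : 'I_n) : nm (g (nth th o j) (x - x')) < 1 / 2.
 have [_ _ h] := nm_parts (g (nth th o j) (x - x')); apply: le_lt_trans h _.
 have := dc (j, true); have := dc (j, false); rewrite /co /= !rmorphB.
 case: (tau _) => a1 b1; case: (tau _) => a2 b2 /=; lra.
rewrite -[ltRHS]mulr1 -/n; move: n0 sm; case: (n) => // k _ sm; rewrite big_ord_recl.
apply: (@le_lt_trans _ _ (nm (g (nth th o (@ord0 k)) (x - x')) * 1)).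
 apply: ler_wpM2l; first exact: av_ge0.
 apply: prodr_ile1 => i _; apply/andP; split; first exact: av_ge0.
 by have := sm (lift ord0 i); lra.
by have := sm ord0; rewrite !mulr1; lra.
Qed.

(** Minkowski's theorem by pigeonhole: of the [H^(2n)] combinations of powers of [th] with Gaussian
    coefficients below [H], two fall in one box with sides proportional to the absolute values of
    [Y]. There are fewer boxes because the product of these values is at least 1, by [norm_ge1]. *)
Lemma short_multiple (p : nat) : (0 < p)%N -> exists2 T : R, 0 < T & forall Y, algint A Y -> Y != 0 ->
 Lf (Y ^+ p) -> exists a, [/\ Lf a, algint A a, a != 0 &
  forall y, y \in o -> nm (g y a) <= T * nm (g y Y)].
Proof.
move=> p0; pose C : R := \sum_(y <- o) \sum_(i < n) 2 * nm y ^+ i.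
have sp y : 0 <= \sum_(i < n) 2 * nm y ^+ i by apply: sumr_ge0 => i _; rewrite mulr_ge0 // exprn_ge0 ?av_ge0.
have hC y : y \in o -> \sum_(i < n) 2 * nm y ^+ i <= C.
 by move=> yo; rewrite /C (big_rem y) //= lerDl sumr_ge0.
have C0 : 0 < C.
 apply: lt_le_trans (hC th tho); move: n0; case: (n) => // k _; rewrite big_ord_recl expr0 mulr1.
 rewrite ltr_wpDr // ?sumr_ge0 // => i _; by rewrite mulr_ge0 // exprn_ge0 ?av_ge0.
(* The cells have side [8 C nY y] for the real and for the imaginary part, which gives twice that
   for the absolute value. *)
exists (16 * C); first by rewrite mulr_gt0.
move=> Y OY Y0 LY; pose nY y := nm (g y Y).
have nY0 y : 0 < nY y by rewrite av_neq0 // fmorph_eq0.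
pose H := (Num.truncn (4 * \sum_(y <- o) nY y)).+1.
have hH y : y \in o -> 4 * nY y <= H%:R.
 move=> yo; apply: le_trans (ltW (truncnS_gt _)); rewrite ler_pM2l // (big_rem y) //=.
 by rewrite lerDl sumr_ge0 // => i _; exact: ltW.
have B0 : 0 <= C * H%:R by rewrite mulr_ge0 // ltW.
have /choice[f hf] : forall y, exists f : R -> nat,
  (forall x, `|x| <= C * H%:R -> (f x <= Num.truncn (2 * (C * H%:R) / (8 * C * nY y)))%N) /\
  forall x x', `|x| <= C * H%:R -> `|x'| <= C * H%:R -> f x = f x' -> `|x - x'| < 8 * C * nY y.
 by move=> y; have [|f f1 f2] := @cell_ex R (C * H%:R) (8 * C * nY y) _ B0; [rewrite !mulr_gt0|exists f].
pose M y := Num.truncn (2 * (C * H%:R) / (8 * C * nY y)).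
(* [H] is at least four times each [nY y], so even after rounding up there are at most
   [H / (2 nY y)] cells per coordinate. *)
have MH y : y \in o -> (M y).+1%:R <= H%:R / 2 / nY y.
 move=> yo; have h := hH y yo; have y0 := nY0 y.
 have e1 : 2 * (C * H%:R) / (8 * C * nY y) = H%:R / 4 / nY y by field; rewrite !gt_eqF.
 have e2 : 1 <= H%:R / 4 / nY y by rewrite ler_pdivlMr // mul1r ler_pdivlMr // mulrC.
 have : (M y)%:R <= H%:R / 4 / nY y by rewrite /M e1 truncn_le; lra.
 have -> : H%:R / 2 / nY y = H%:R / 4 / nY y + H%:R / 4 / nY y by field; rewrite gt_eqF.
 have -> : (M y).+1%:R = (M y)%:R + 1 :> R by rewrite natr1.
 lra.
pose Ix := ('I_n * bool)%type; pose Z (x : {ffun Ix -> 'I_H}) : A :=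
 \sum_(i < n) ((x (i, true))%:R + I * (x (i, false))%:R) * th ^+ i.
pose co (z : A) (jb : Ix) := let w := tau (g (nth th o jb.1) z) in
 if jb.2 then complex.Re w else complex.Im w.
have yj (j : 'I_n) : nth th o j \in o by exact: mem_nth.
have nI : nm I = 1.
 have : nm I ^+ 2 = 1 by rewrite -avX I2 avN1.
 by move/eqP; rewrite sqrf_eq1 => /orP[/eqP//|/eqP h]; have := av_ge0 nm I; rewrite h; lra.
have Zb x y : y \in o -> nm (g y (Z x)) <= C * H%:R.
 move=> yo; rewrite rmorph_sum; apply: le_trans (nm_sum _ _) _.
 apply: (@le_trans _ _ (\sum_(i < n) 2 * nm y ^+ i * H%:R)); last by rewrite -mulr_suml ler_wpM2r // hC.
 apply: ler_sum => i _; rewrite rmorphM rmorphXn gth // av_mul avX mulrAC ler_wpM2r ?exprn_ge0 ?av_ge0 //.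
 rewrite rmorphD rmorphM gI // !rmorph_nat; apply: le_trans (av_add nm _ _) _.
 rewrite av_mul nI mul1r !nm_nat.
 have a1 : (x (i, true))%:R <= H%:R :> R by rewrite ler_nat ltnW.
 have a2 : (x (i, false))%:R <= H%:R :> R by rewrite ler_nat ltnW.
 lra.
have cb x jb : `|co (Z x) jb| <= C * H%:R.
 have hy := Zb x _ (yj jb.1).
 by have [h1 h2 _] := nm_parts (g (nth th o jb.1) (Z x)); rewrite /co; case: jb.2; apply: le_trans hy.
pose Mx := \max_(y <- o) M y.
have Mm (j : 'I_n) : (M (nth th o j) <= Mx)%N by apply: leq_bigmax_seq.
pose F (x : {ffun Ix -> 'I_H}) : {ffun Ix -> 'I_Mx.+1} := [ffun jb : Ix => inord (f (nth th o jb.1) (co (Z x) jb))].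
have Fv x jb : F x jb = f (nth th o jb.1) (co (Z x) jb) :> nat.
 by rewrite ffunE inordK // ltnS; apply: leq_trans (Mm jb.1); exact: (hf _).1.
pose Fam (jb : Ix) : pred 'I_Mx.+1 := fun c => (c <= M (nth th o jb.1))%N.
have Ff x : F x \in family Fam.
 by apply/familyP => jb; rewrite unfold_in /Fam Fv; exact: (hf _).1.
have card1 jb : (#|Fam jb| <= (M (nth th o jb.1)).+1)%N.
 have inj : {in Fam jb &, injective (fun c : 'I_Mx.+1 => inord c : 'I_(M (nth th o jb.1)).+1)}.
  move=> a b ha hb /(congr1 val) /=; rewrite !inordK ?ltnS // => e; exact: val_inj.
 by rewrite -(card_in_image inj) -[X in (_ <= X)%N]card_ord; exact: max_card.
have cardF : (#|family Fam| <= \prod_(jb : Ix) (M (nth th o jb.1)).+1)%N.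
 rewrite card_family foldrE big_map enumT -[X in (X <= _)%N]big_enum /= big_enum.
 exact: leq_prod.
have lt : (#|family Fam| < #|{ffun Ix -> 'I_H}|)%N.
 apply: leq_ltn_trans cardF _; rewrite card_ffun card_ord -(ltr_nat R) natr_prod natrX.
 pose u (j : 'I_n) : R := H%:R / 2 / nY (nth th o j).
 have u0 j : 0 <= u j by rewrite !mulr_ge0 ?invr_ge0 ?ltW.
 apply: (@le_lt_trans _ _ (\prod_(jb : Ix) u jb.1)).
  by apply: ler_prod => jb _; rewrite ler0n MH.
 rewrite -(pair_bigA _ (fun j (_ : bool) => u j)) /= (eq_bigr (fun j => u j ^+ 2)); last first.
  by move=> j _; rewrite big_bool /= expr2.
 have up : \prod_j u j <= (H%:R / 2) ^+ n.
  rewrite big_split /= prodr_const card_ord prodfV; apply: ler_piMr; first by rewrite exprn_ge0 // divr_ge0.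
  rewrite invf_le1.
   by have := norm_ge1 p0 OY Y0 LY; rewrite (big_nth th) big_mkord.
  by apply: prodr_gt0 => j _; exact: nY0.
 have H0 : (0 : R) < H%:R by rewrite ltr0n.
 rewrite prodrXl card_prod card_ord card_bool exprM ltr_pXn2r // ?nnegrE ?prodr_ge0 ?exprn_ge0 ?ltW //.
 by apply: le_lt_trans up _; rewrite ltr_pXn2r // ?nnegrE ?divr_ge0 ?ltW //; lra.
have [x [x' [nx eF]]] : exists x x', x != x' /\ F x = F x'.
 apply: contrapT => h; move: lt; rewrite ltnNge => /negP; apply.
 have inj : {in predT &, injective F}.
  by move=> x x' _ _ e; apply/eqP/negP => /negP ne; apply: h; exists x, x'.
 rewrite -(card_in_image inj); apply: subset_leq_card; apply/fintype.subsetP => u /fintype.imageP[x _ ->]; exact: Ff.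
exists (Z x - Z x'); split.
- by apply: LfB; apply: Lf_sum => i s hs; rewrite rmorphM rmorphXn hs rmorphD rmorphM !rmorph_nat hI.
- have OI : algint A I.
  exists ('X^2 + 1); split; last by rewrite !hornerE I2 addNr.
  - by rewrite monicE lead_coefDl ?lead_coefXn // size_polyXn size_poly1.
  - by move=> i; rewrite coefD coefXn coef1; apply: srD; exact: sr_nat.
 have OZ u : algint A (Z u).
  apply: (@sr_sum _ (algint A)) => j _; apply: (@srM _ (algint A)); last exact: srX.
  by apply: (@srD _ (algint A)); [exact: sr_nat|apply: (@srM _ (algint A)) => //; exact: sr_nat].
 exact: srB.
- apply/negP; rewrite subr_eq0 => /eqP eZ; case/eqP: nx; apply/ffunP.
 pose P : {poly A} := \poly_(i < n) if insub i is Some j then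
  ((x (j, true))%:R - (x' (j, true))%:R) + I * ((x (j, false))%:R - (x' (j, false))%:R) else 0.
 have Pv y : P.[y] = \sum_(i < n) (((x (i, true))%:R - (x' (i, true))%:R) + I * ((x (i, false))%:R - (x' (i, false))%:R)) * y ^+ i.
  by rewrite horner_poly; apply: eq_bigr => i _; rewrite valK.
 have P0 : P = 0.
  apply/eqP/negP => /negP Pn; have /(max_poly_roots Pn) : all (root P) o.
   apply/allP => y yo; apply/rootP; rewrite Pv.
   have : g y (Z x - Z x') = 0 by rewrite eZ subrr rmorph0.
   rewrite -sumrB rmorph_sum => h; rewrite -[RHS]h; apply: eq_bigr => i _.
   by rewrite -mulrBl rmorphM rmorphXn gth // !(rmorphB, rmorphD, rmorphM) /= gI // !rmorph_nat; ring.
  by move=> /(_ uo); rewrite ltnNge size_poly.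
 have ab (a b : int) : a%:~R + I * b%:~R = 0 :> A -> a = 0 /\ b = 0.
  move=> h; have : (a ^+ 2 + b ^+ 2)%:~R = 0 :> A.
   rewrite intrD !rmorphXn /=; have -> : a%:~R = - (I * b%:~R) :> A by apply/eqP; rewrite -addr_eq0 h.
   by rewrite sqrrN exprMn I2; ring.
  have [e|ne /eqP] := eqVneq (a ^+ 2 + b ^+ 2) 0; last by rewrite (negbTE (intr0 c0 ne)).
  by move: e => /eqP; rewrite paddr_eq0 ?sqr_ge0 // !sqrf_eq0 => /andP[/eqP -> /eqP ->].
 move=> [i b]; have := congr1 (fun P : {poly A} => P`_i) P0; rewrite coef0 coef_poly ltn_ord valK.
 move=> h; have [] := ab ((x (i, true))%:Z - (x' (i, true))%:Z) ((x (i, false))%:Z - (x' (i, false))%:Z).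
  by rewrite -[RHS]h !intrB.
 by move=> /eqP; rewrite subr_eq0 => /eqP[e1] /eqP; rewrite subr_eq0 => /eqP[e2]; apply: val_inj; case: b.
move=> y /(nthP th)[j jn <-]; rewrite -[j]/(val (Ordinal jn)); set j' := Ordinal jn.
have dc b : `|co (Z x) (j', b) - co (Z x') (j', b)| < 8 * C * nY (nth th o j').
 by apply: (hf _).2; rewrite ?cb //; have := Fv x (j', b); rewrite eF Fv => ->.
have [_ _ h] := nm_parts (g (nth th o j') (Z x - Z x')); apply: le_trans h _.
have := dc true; have := dc false; rewrite -/(nY (nth th o j')); move: (nY (nth th o j')) => N.
rewrite /co /= !rmorphB.
case: (tau _) => a1 b1; case: (tau _) => a2 b2 /=; lra.
Qed.

End Lattice.

Lemma mul_div_cancel (A : fieldType) (a f c u : A) : f != 0 -> c != 0 -> u != 0 ->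
 a * u / c = a / f * (f / (c / u)).
Proof. by move=> f0 c0 u0; field; rewrite f0 c0 u0. Qed.

Lemma div_div_cancel (A : fieldType) (x y u : A) : y != 0 -> u != 0 -> x / y = x / (y / u) * u^-1.
Proof. by move=> y0 u0; field; rewrite u0 y0. Qed.

(** * Local Kummer theory at unramified places *)

Section UnramifiedKummer.
Variables (R : realType) (K : fieldExtType rat) (Kb : algClosure K) (D : localData R Kb).
Variable na : nonarch (ld_place D).
Local Notation F := (ld_field D).
Local Notation Fb := (ld_bar D).
Local Notation O := (OD na).
Local Notation i := (ld_emb D).

(** A Lagrange resolvent built on the root of unity [al] of [local_unity]. Its conjugates have
    distinct residues, so [weighted_power_sum] applies in the residue field and the resolvent is a
    unit. *)
Lemma unit_resolvent (p : nat) (H : absGal Fb -> Prop) (h : absGal Fb -> Fb) : (0 < p)%N ->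
 H (gal_one Fb) -> (forall s t, H s -> H t -> H (gal_mul s t)) -> (forall s, H s -> H (gal_inv s)) ->
 (forall s t, H s -> H t -> h (gal_mul s t) = h s * h t) -> (forall s t, H s -> H t -> s (h t) = h t) ->
 (forall s, H s -> h s ^+ p = 1) ->
 (exists2 r : seq Fb, {in r, forall x, O x} & forall s, H s -> fixes O r s -> h s = 1) ->
 exists U, [/\ O U, U != 0, O U^-1 & forall s, H s -> s U = h s * U].
Proof.
move=> p0 H1 HM HV hM hF hp [r rO hr].
have [N [al [N0 aN inj ha]]] := local_unity rO.
have h0 s : H s -> h s != 0.
 by move=> /hp; exact: expr1_neq0.
have h1 : h (gal_one Fb) = 1.
 by apply: (mulfI (h0 _ H1)); rewrite mulr1 -hM // gal_mul1.
have [o uo ho] := orbit_list H al.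
have /choice[w hw] : forall b, exists w, forall s, H s -> b = s al -> w = (h s)^-1.
 move=> b; have [[s Hs e]|nx] := pselect (exists2 s, H s & b = s al); last first.
  by exists 0 => s Hs e; case: nx; exists s.
 exists (h s)^-1 => t Ht e'; congr (_^-1).
 have : h (gal_mul (gal_inv t) s) = 1.
  apply: hr; first by apply: HM => //; exact: HV.
  by apply: ha; rewrite gal_mulE -e e' gal_invK.
 rewrite hM //; last exact: HV.
 have : h (gal_mul t (gal_inv t)) = 1 by rewrite gal_mulV.
 rewrite hM //; last exact: HV.
 by move=> e1 e2; rewrite -[h s]mul1r -e1 -mulrA e2 mulr1.
have oN b : b \in o -> b ^+ N = 1 by move=> /ho[s _ ->]; rewrite -rmorphXn aN rmorph1.
have oO b : b \in o -> O b by move=> /oN; exact: unity_O N0.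
have wO b : b \in o -> O (w b) /\ w b != 0.
 move=> /ho[s Hs e]; rewrite (hw _ s Hs e) invr_eq0 h0 //; split=> //.
 by apply: (unity_O O p0); rewrite exprVn hp // invr1.
have ro : {in o &, injective (rsd O)}.
 by move=> b c bo co e; apply: inj; [exact: oN|exact: oN|apply/(rsd_eq (oO _ bo) (oO _ co))].
have uro : uniq [seq rsd O b | b <- o] by rewrite map_inj_in_uniq.
pose W z := rsd O (w (nth 0 o (index z [seq rsd O b | b <- o]))).
have WE b : b \in o -> W (rsd O b) = rsd O (w b).
 move=> bo; rewrite /W; congr (rsd O (w _)); set j := index _ _.
 have jl : (j < size o)%N by rewrite -(size_map (rsd O)) index_mem map_f.
 apply: ro => //; first exact: mem_nth.
 by rewrite -(nth_map 0 0) // nth_index // map_f.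
have alo : al \in o by apply/ho; exists (gal_one Fb).
have [||k hk] := @weighted_power_sum _ _ W (rsd O al) uro.
- exact: map_f.
- rewrite WE //; apply/eqP => e0; have [wo wn] := wO al alo; have hv := (rsd_eq0 wo).1 e0.
 case: (vmP wn _ hv); rewrite (hw al (gal_one Fb) H1) // h1 !invr1; exact: sr1.
pose U := \sum_(b <- o) w b * b ^+ k.
have UO : O U by apply: sr_sum_seq => b bo; apply: srM; [exact: (wO b bo).1|apply: srX; exact: oO].
have rU : rsd O U = \sum_(y <- [seq rsd O b | b <- o]) W y * y ^+ k.
 rewrite /U big_map; have : {subset o <= o} by []. move: {1 3 4}o => o'.
 elim: o' => [|b o' IH] sub; first by rewrite !big_nil rsd0.
 have bo : b \in o by apply: sub; rewrite mem_head.
 have sub' : {subset o' <= o} by move=> c co; apply: sub; rewrite inE co orbT.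
 rewrite !big_cons rsdD ?IH // ?WE // ?rsdM ?rsdX //; try exact: oO.
 - exact: (wO b bo).1.
 - apply: srX; exact: oO.
 - by apply: srM; [exact: (wO b bo).1|apply: srX; exact: oO].
 - by apply: sr_sum_seq => c /sub' co; apply: srM; [exact: (wO c co).1|apply: srX; exact: oO].
have [U0 UV] : U != 0 /\ O U^-1.
 by apply: vunit => // /(rsd_eq0 UO).2; rewrite rU => /eqP; rewrite (negbTE hk).
exists U; split=> // s Hs; rewrite /U rmorph_sum mulr_sumr.
have pe : perm_eq o [seq s y | y <- o].
 apply: perm_map_stable => //; first exact: fmorph_inj.
 by move=> _ /mapP[y /ho[t Ht ->] ->]; apply/ho; exists (gal_mul s t) => //; exact: HM.
rewrite [RHS](perm_big _ pe) big_map; apply: eq_big_seq => b /ho[t Ht e].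
rewrite rmorphM rmorphXn (hw b t Ht e) fmorphV hF // (hw (s b) (gal_mul s t)) ?e //; last exact: HM.
by rewrite hM // invfM mulrA mulrA divff ?h0 // mul1r.
Qed.

Lemma nontrivial_field : exists2 a : F, 0 < co_abs F a & co_abs F a < 1.
Proof.
have [l pl vl] := residue_char na (pl_nontrivial (ld_place D)).
exists (co_emb F l%:R); rewrite co_absE // av_neq0 //.
exact: pos_natr0 (@rat_alg_char0 K) (prime_gt0 pl).
Qed.

(** Locally [Y = U c0] with [U] a unit and [c0] in the field of [i th]. Replacing the coefficients
    of [c0] by close elements of [K] changes it by a factor near 1, so [Y] has the valuation of an
    element [c] of the global field of [th]. *)
Lemma unramified_approx (p : nat) (th Y : Kb) : (0 < p)%N -> th != 0 -> Y != 0 ->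
 let H (s : absGal Fb) := s (i th) = i th in
 (forall s, H s -> forall z, z ^+ p = 1 -> s z = z) ->
 (forall s, H s -> s (i Y) ^+ p = i Y ^+ p) ->
 (exists2 r : seq Fb, {in r, forall x, O x} & forall s, H s -> fixes O r s -> s (i Y) = i Y) ->
 exists g : {poly K}, let c := (map_poly (ac_emb Kb) g).[th] in
  [/\ c != 0, O (i (c / Y)) & O (i (Y / c))].
Proof.
move=> p0 th0 Y0 H Hmu HY [r rO hr].
have iY0 : i Y != 0 by rewrite fmorph_eq0.
have ith0 : i th != 0 by rewrite fmorph_eq0.
pose h s := s (i Y) / i Y.
have hE s : s (i Y) = h s * i Y by rewrite divfK.
have hp s : H s -> h s ^+ p = 1 by move=> Hs; rewrite expr_div_n HY // divff // expf_neq0.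
have [|||||||U [UO U0 UV sU]] := @unit_resolvent p H h p0.
- by [].
- by move=> s t; rewrite /H gal_mulE => hs ->.
- by move=> s hs; rewrite /H -{1}hs gal_invK.
- move=> s t Hs Ht; apply: (mulIf iY0); rewrite -hE gal_mulE hE rmorphM (Hmu s Hs _ (hp t Ht)) hE; ring.
- by move=> s t Hs Ht; rewrite Hmu // hp.
- exact: hp.
- by exists r => // s Hs fs; rewrite /h hr // divff.
have [g0 hg0] : exists g0 : {poly F}, i Y / U = (map_poly (ac_emb Fb) g0).[i th].
 apply: fixed_by_stabilizer; first exact: Fb_char0.
 move=> s Hs; rewrite fmorph_div sU // hE; have hs0 : h s != 0.
  exact: expr1_neq0 (hp s Hs).
 by rewrite invfM mulrACA divff // mul1r.
set c0 := i Y / U in hg0; have c00 : c0 != 0 by rewrite mulf_neq0 // invr_eq0.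
have /choice[a ha] : forall j, exists a : K,
  vm O (ac_emb Fb (co_emb F a - g0`_j) * i th ^+ j / c0).
 move=> j; have [|f f0 hf] := @small_below _ _ _ Fb (naD na) (@co_complete _ _ _ F) nontrivial_field (c0 / i th ^+ j).
  by rewrite mulf_neq0 // invr_eq0 expf_neq0.
 have [x hx] := co_dense g0`_j (av_neq0 (co_abs F) f0); exists x.
 have -> : ac_emb Fb (co_emb F x - g0`_j) * i th ^+ j / c0 =
  ac_emb Fb ((co_emb F x - g0`_j) / f) * (ac_emb Fb f / (c0 / i th ^+ j)).
  by rewrite fmorph_div; apply: mul_div_cancel; rewrite ?expf_neq0 ?fmorph_eq0.
 apply: vmMl => //; apply/(Ob_emb Fb (naD na)); rewrite av_mul avV ler_pdivrMr ?av_neq0 // mul1r -avN opprB.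
 exact: ltW.
pose g : {poly K} := \poly_(j < size g0) a j; exists g; rewrite /=.
set c := _.[th].
have ce : vm O (i c / c0 - 1).
 have -> : i c / c0 - 1 = \sum_(j < size g0) ac_emb Fb (co_emb F (a j) - g0`_j) * i th ^+ j / c0.
  rewrite -mulr_suml -[X in _ - X = _](divff c00) -mulrBl; congr (_ / _).
  rewrite hg0 /c -horner_map -map_poly_comp.
  have -> : (map_poly (i \o ac_emb Kb) g).[i th] = \sum_(j < size g0) ac_emb Fb (co_emb F (a j)) * i th ^+ j.
   rewrite (@horner_coef_wide _ (size g0)); last by rewrite size_map_poly size_poly.
   by apply: eq_bigr => j _; rewrite coef_map coef_poly ltn_ord /= ld_compat.
  by rewrite horner_coef size_map_poly -sumrB; apply: eq_bigr => j _; rewrite rmorphB coef_map mulrBl.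
 by apply: vm_sum => j _; exact: ha.
have uO : O (i c / c0) by rewrite -(subrK 1 (i c / c0)); apply: srD; [exact: vm_O|exact: sr1].
have [u0 uV] : i c / c0 != 0 /\ O (i c / c0)^-1.
 apply: vunit => // hv; apply: (@vm1 _ O); rewrite -(subKr (i c / c0) 1); exact: vmB.
have c_0 : c != 0 by apply: contraNneq u0 => ->; rewrite rmorph0 mul0r.
split=> //.
 by rewrite fmorph_div (@div_div_cancel _ (i c) _ U) //; exact: (@srM _ O).
have -> : i (Y / c) = (i c / c0)^-1 * U.
 by rewrite -[U]invrK -invfM -div_div_cancel // -fmorph_div -fmorphV invf_div.
exact: (@srM _ O).
Qed.
End UnramifiedKummer.

Lemma valring_algint (A : fieldType) (V : valring A) x : algint A x -> V x.
Proof. by move=> h; apply: vr_integ; apply: integ_mono h => _ [z ->]; exact: sr_int. Qed.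

Lemma algintP (A : fieldType) (x : A) : (forall V : valring A, V x) -> algint A x.
Proof. by move=> h; apply: contrapT => /valring_avoid[V _]; apply. Qed.

Lemma algint_root (A : fieldType) (x : A) n : (0 < n)%N -> algint A (x ^+ n) -> algint A x.
Proof.
move=> n0 h; apply: algintP => V; apply: contrapT => nx.
have := valring_algint V h; have := vinv_vm nx => v1 v2.
have x0 := v_not_O nx; apply: (@vmP _ V (x^-1 ^+ n)).
- by rewrite expf_neq0 // invr_eq0.
- by rewrite exprVn invrK.
by case: (n) n0 => // k _; rewrite exprS; apply: vmMr => //; apply: srX; exact: vm_O.
Qed.

(* The partial Horner sums of a primitive integral equation of [x] are integral,
  and so are their multiples by [x]; not all of them are in the maximal ideal. *)
Lemma integral_multiplier (A : algClosure rat) (V : valring A) (x : A) : V x ->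
 exists P : {poly int}, let d := (map_poly intr P).[x] in
 [/\ algint A d, algint A (d * x), d != 0 & V d^-1].
Proof.
move=> Vx; have [q [mq qx _]] := min_poly_ex x.
have [r0 [a a0 qE]] := rat_poly_scale q.
pose r := zprimitive r0.
have c0 : forall n, n.+1%:R != 0 :> A by move=> n; rewrite -(rmorph_nat (ac_emb A)) fmorph_eq0 pnatr_eq0.
have r00 : r0 != 0.
 by apply: contraTneq mq => e; rewrite qE e map_poly0 scaler0 monicE lead_coef0 eq_sym oner_eq0.
have rx : (map_poly intr r).[x] = 0 :> A.
 have : (map_poly intr r0).[x] = 0 :> A.
  have : (map_poly (ac_emb A) (a%:~R *: q)).[x] = 0 by rewrite map_polyZ hornerZ qx mulr0.
  rewrite qE scalerA divff ?intr_eq0 // scale1r -map_poly_comp => <-; congr (_.[_]).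
  by apply: eq_map_poly => z /=; rewrite rmorph_int.
 rewrite {1}(zpolyEprim r0) map_polyZ hornerZ => /eqP; rewrite mulf_eq0 => /orP[|/eqP//].
 by rewrite (negbTE (intr0 c0 _)) // zcontents_eq0.
(* Primitivity: otherwise a prime in the maximal ideal would divide every coefficient. *)
have [j jv] : exists j : nat, ~ vm V (r`_j)%:~R.
 apply: contrapT => h; have hv j : vm V (r`_j)%:~R by apply: contrapT => h'; apply: h; exists j.
 have r_0 : r != 0 by rewrite zprimitive_eq0.
 have vl0 : vm V `|lead_coef r|%N%:R.
  have := hv (size r).-1; rewrite -lead_coefE => h1.
  rewrite -[`|_|%N%:R]/((`|lead_coef r|%N%:Z)%:~R) abszE.
  by case: (ger0P (lead_coef r)) => _ //; rewrite mulrNz; exact: vmN.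
 have l0 : (0 < `|lead_coef r|)%N by rewrite absz_gt0 lead_coef_eq0.
 have [l pl vl] : exists2 l, prime l & vm V l%:R.
  move: vl0; rewrite (prod_prime_decomp l0) prime_decompE big_map natr_prod => /vm_prod[].
   by move=> k _; exact: sr_nat.
  move=> l; rewrite mem_primes => /and3P[pl _ _] /=; rewrite natrX => h1; exists l => //.
  case: (logn _ _) h1 => [/vm1//|k]; apply: vm_exp; exact: sr_nat.
 have dv k : (l%:Z %| r`_k)%Z.
  apply: contrapT => /negP nd; have := hv k.
  have /coprimezP[[u w] /= e] : coprimez (r`_k) l%:Z by rewrite coprimez_sym coprimezE /= prime_coprime.
  move=> h1; apply: (@vm1 _ V); have -> : 1 = u%:~R * (r`_k)%:~R + w%:~R * l%:R :> A.
   by rewrite -[l%:R]/((l%:Z)%:~R) -!intrM -intrD e.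
  by apply: vmD; apply: vmMl => //; exact: sr_int.
 have : (l%:Z %| zcontents r)%Z by rewrite dvdz_contents; apply/polyOverP => k; exact: dv.
 by rewrite zcontents_primitive r00 dvdz1 /= => /eqP l1; rewrite l1 in pl.
pose n := size r; pose S m := \sum_(k < n - m) (r`_(k + m))%:~R * x ^+ k.
have Sn : S n = 0 by rewrite /S subnn big_ord0.
have S0 : S 0%N = 0.
 have ii : injective (intr : int -> A).
  move=> u w e; apply/eqP; rewrite -subr_eq0; apply/negP => /negP/(intr0 c0)/negP; apply.
  by rewrite intrB e subrr.
 rewrite -rx horner_coef (size_map_inj_poly ii) ?mulr0z // /S subn0.
 by apply: eq_bigr => k _; rewrite coef_map addn0.
have SS m : (m < n)%N -> S m = (r`_m)%:~R + S m.+1 * x.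
 move=> mn; rewrite /S -(subnSK mn) big_ord_recl expr0 mulr1 add0n; congr (_ + _).
 by rewrite mulr_suml; apply: eq_bigr => k _; rewrite /bump /= exprSr mulrA addnS addSn.
(* At a valuation ring containing [x] this is visible from the sum. At the others [x^-1] is
   integral, and the recursion that gives [S m.+1 * x] from [S m] is climbed from [S 0 = 0]. *)
have Sint m : (m <= n)%N -> algint A (S m) /\ algint A (S m * x).
 move=> mn; suff h (W : valring A) : W (S m) /\ W (S m * x).
  by split; apply: algintP => W; have [] := h W.
 have [Wx|nWx] := pselect (W x).
  have h : W (S m) by apply: sr_sum => k _; apply: srM; [exact: sr_int|exact: srX].
  by split=> //; exact: srM.
 have x0 := v_not_O nWx; have wx := vm_O (vinv_vm nWx).
 elim: m mn => [|m IH] mn; first by rewrite S0 mul0r; split; exact: sr0.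
 have [h1 h2] := IH (ltnW mn); have e : S m.+1 * x = S m - (r`_m)%:~R by rewrite (SS m mn) addrC addKr.
 have h3 : W (S m.+1 * x) by rewrite e; apply: srB => //; exact: sr_int.
 by split=> //; rewrite -[S m.+1](mulfK x0); exact: srM.
have [m [mn mv]] : exists m, (m <= n)%N /\ ~ vm V (S m).
 apply: contrapT => h; have hv m : (m <= n)%N -> vm V (S m) by move=> mn; apply: contrapT => h'; apply: h; exists m.
 have [jn|nj] := ltnP j n; last by apply: jv; rewrite nth_default //; exact: vm0.
 apply: jv; have -> : (r`_j)%:~R = S j - S j.+1 * x by rewrite (SS j jn) addrK.
 by apply: vmB; [apply: hv; exact: ltnW|apply: vmMr => //; exact: hv].
have [h1 h2] := Sint m mn; have [h3 h4] := vunit (valring_algint V h1) mv.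
exists (\poly_(k < n - m) r`_(k + m)).
have -> : (map_poly intr (\poly_(k < n - m) r`_(k + m))).[x] = S m.
 rewrite (@horner_coef_wide _ (n - m)); last by apply: leq_trans (size_poly _ _) _; rewrite size_poly.
 by apply: eq_bigr => k _; rewrite coef_map coef_poly ltn_ord.
by [].
Qed.

Section SubfieldArithmetic.
Variables (K : fieldExtType rat) (Kb : algClosure K) (p : nat).
Hypothesis p0 : (0 < p)%N.
Local Notation emb := (ac_emb Kb).
Let c0 := fmorph_char0 (ac_emb Kb) (@rat_alg_char0 K).

Lemma rational_algebraic (x : Kb) : algebraicOver (emb \o in_alg K : {rmorphism rat -> Kb}) x.
Proof.
have [q [mq qx _]] := min_poly_ex x.
apply/integral_algebraic; apply: (@integral_root_monic _ _ _ x (map_poly emb q)).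
- by rewrite map_monic.
- exact/rootP.
move=> y /(nthP 0)[i _ <-]; rewrite coef_map; apply/integral_algebraic.
have [r mr rx] := number_alg q`_i.
by exists r; [exact: monic_neq0|rewrite map_poly_comp; apply/rootP; rewrite horner_map rx rmorph0].
Qed.
(** [Kb] itself, seen as an algebraic closure of the rationals, where the lattice arguments live.
    Automorphisms fixing [th] agree for both base fields once the field of [th] contains [K]. *)
Definition Kq : algClosure rat := AlgClosure rational_algebraic.

Lemma to_rational (s : absGal Kb) : exists s' : absGal Kq, forall x, s' x = s x.
Proof.
have fx (x : rat) : s (ac_emb Kq x) = ac_emb Kq x by exact: gal_fix.
by exists (@AbsGal rat Kq (gal_fun s) fx (gal_bij s)).
Qed.
Lemma of_rational (s : absGal Kq) : (forall x : K, s (emb x) = emb x) ->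
 exists s' : absGal Kb, forall x, s' x = s x.
Proof. by move=> fx; exists (@AbsGal K Kb (gal_fun s) fx (gal_bij s)). Qed.

Definition Lk (th x : Kb) := forall s : absGal Kb, s th = th -> s x = x.

(* [t Y'^-1] is, up to elements of the field of [th], as close to a unit as
  local information on [Y] permits. *)
Definition reduction (th : Kb) (t : nat) := forall Y, Y != 0 -> Lk th (Y ^+ p) ->
 exists Y', [/\ Y' != 0, algint Kb Y', Lk th (Y' * Y) & forall (V : valring Kb) (M c' : Kb),
  Lk th c' -> c' != 0 -> V (c' / Y) -> V (M * Y / c') -> V (t%:R * M / Y')].

(** Kummer finiteness outside [M], in the role of the unit theorem: up to factors in the field of
    [th], finitely many integers [Y] with [Y^p] in that field divide [t M]. *)
Definition finite_classes (th : Kb) (t : nat) := forall M : nat, (0 < M)%N ->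
 exists (q : nat) (f : Kb -> 'I_q.+1), forall Y1 Y2, Y1 != 0 -> Y2 != 0 ->
  algint Kb Y1 -> algint Kb Y2 -> Lk th (Y1 ^+ p) -> Lk th (Y2 ^+ p) ->
  algint Kb (t%:R * M%:R / Y1) -> algint Kb (t%:R * M%:R / Y2) -> f Y1 = f Y2 -> Lk th (Y1 / Y2).

(** The field of [th] contains [I], the [p]-th roots of unity, [K] and [r0], and is Galois over the
    rationals; normality is the clause that the stabiliser of [th] fixes every conjugate [s th]. *)
Lemma field_package (R : realType) (r0 : seq Kb) : exists (th : Kb) (t : nat),
 [/\ th != 0 /\ (0 < t)%N, forall s : absGal Kb, s th = th -> {in r0, forall x, s x = x},
   forall s u : absGal Kb, u th = th -> u (s th) = s th,
   reduction th t /\ finite_classes th t &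
   exists n (e : 'I_n -> Kb), forall x, Lk th x -> zspan e x].
Proof.
have cq : forall n, n.+1%:R != 0 :> Kq by exact: c0.
have [I I2] : exists I : Kb, I ^+ 2 = -1.
 have [I] := @solve_monicpoly Kb 2 (fun i => if i == 0%N then -1 else 0) isT.
 by rewrite !big_ord_recl big_ord0 /= expr0 mulr1 mul0r !addr0; exists I.
have [mu _ hmu] := root_list (p := 'X^p - 1 : {poly Kb}) (monic_neq0 (monicXnsubC 1 p0)).
pose l1 := I :: mu ++ [seq emb x | x <- vbasis {:K}] ++ r0.
have [th1 h1] := @primitive_elt rat Kq cq l1.
have [o1 _ ho1] := @orbit_list rat Kq (fun=> True) th1.
(* Taking a generator for all conjugates of [th1] makes the field normal. *)
have [th2 h2] := @primitive_elt rat Kq cq (1 :: o1).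
have [d d0 dO] := @algint_scale Kq th2.
have dn : d%:R != 0 :> Kq by exact: pos_natr0.
have [th [th0 thO h3]] : exists th : Kb, [/\ th != 0, algint Kb th & forall s : absGal Kq, s th = th <-> s th2 = th2].
 have [t2|t2] := eqVneq th2 0.
  exists 1; split; [exact: oner_neq0|exact: sr1|move=> s].
  by rewrite t2 rmorph0 rmorph1.
 exists (d%:R * th2 : Kq); split=> //; first by rewrite mulf_neq0.
 by move=> s; rewrite rmorphM rmorph_nat; split=> [/(mulfI dn)//|->].
have h4 (s : absGal Kq) : s th = th <-> {in o1, forall x, s x = x}.
 rewrite h3 h2; split=> h x; first by move=> xo; apply: h; rewrite inE xo orbT.
 by rewrite inE => /predU1P[->|/h//]; exact: rmorph1.
have hl (s : absGal Kq) : s th = th -> {in l1, forall x, s x = x}.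
 by move=> /h4 h; apply/h1/h/ho1; exists (gal_one Kq).
have hK (s : absGal Kq) : s th = th -> forall x : K, s (emb x) = emb x.
 move=> /hl h x; rewrite (coord_vbasis (memvf x)) !rmorph_sum; apply: eq_bigr => j _.
 rewrite -mulr_algl rmorphM /= rmorphM /=; congr (_ * _); first exact: (gal_fix s).
 by apply: h; rewrite /l1 inE !mem_cat map_f ?orbT // mem_nth // size_tuple.
have LE x : Lk th x <-> @Lf Kq th x.
 split=> h s hs.
  have [s' es] := of_rational (hK s hs); rewrite -es; apply: h; by rewrite es.
 by have [s' es] := to_rational s; rewrite -es; apply: h; rewrite es.
have hI (s : absGal Kq) : s th = th -> s I = I by move=> /hl; apply; rewrite mem_head.
have [tau _] := complex_embedding R Kq.
have [o [g [uo tho ho so]]] := @orbit_data Kq I th.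
have gI y : y \in o -> g y I = I by move=> /ho[].
have gth y : y \in o -> g y th = y by move=> /ho[].
have [t t0 hur] := hurwitz tau I2 thO uo tho gI gth so.
have [T T0 short] := short_multiple tau I2 thO hI uo tho gI gth so p0.
have Lmu z : z ^+ p = 1 -> Lk th z.
 move=> zp; have zr : z \in mu by rewrite hmu; apply/rootP; rewrite !hornerE zp subrr.
 by apply/LE => s /hl; apply; rewrite /l1 inE mem_cat zr orbT.
exists th, t; split.
- by [].
- move=> s hs x xr; have [s' es] := to_rational s; rewrite -es; apply: (hl s'); first by rewrite es.
 by rewrite /l1 inE !mem_cat xr !orbT.
- move=> s u hu; have [s' es] := to_rational s; have [u' eu] := to_rational u.
 have /h4 hu' : u' th = th by rewrite eu.
 have : gal_mul (gal_inv s') (gal_mul u' s') th = th.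
  apply/h4 => x /ho1[v _ ->]; apply: (can_inj (gal_invK s')); rewrite !gal_mulE gal_invVK.
  by apply: hu'; apply/ho1; exists (gal_mul s' v).
 by rewrite !gal_mulE -{2}(gal_invK s' th) => /(can_inj (gal_invVK s')); rewrite eu !es.
- split.
  move=> Y0 Y00 LY0; have [dY dY0 OY] := @algint_scale Kq Y0.
  pose Y : Kb := dY%:R * Y0; have dYn : dY%:R != 0 :> Kb by exact: pos_natr0.
  have Yn : Y != 0 by rewrite mulf_neq0.
  have LY : @Lf Kq th (Y ^+ p) by apply/LE => s hs; rewrite exprMn rmorphM LY0 // -natrX rmorph_nat.
  (* The ideal of elements of the field divisible by [Y]. Its near generator [b] from [hurwitz]
     gives the integral [Y' = b / Y]. *)
  pose J (a : Kq) := @Lf Kq th a /\ algint Kq (a / Y).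
  have [||||b [[Lb Ob] b0 hb]] := hur J.
  + exists (Y ^+ p); last by rewrite expf_neq0.
   split=> //; rewrite -(prednK p0) exprSr mulfK //; exact: srX.
  + move=> a [La Oa]; split=> //; rewrite -(divfK Yn a); exact: srM.
  + by move=> a b [La Oa] [Lb Ob]; split; [exact: LfB|rewrite mulrBl; exact: srB].
  + by move=> a b La Oa [Lb Ob]; split; [exact: LfM|rewrite -mulrA; exact: srM].
  have Yb : b / Y != 0 by rewrite mulf_neq0 // invr_eq0.
  exists (b / Y); split=> //.
   have -> : b / Y * Y0 = b / dY%:R by rewrite /Y; field; rewrite dYn Y00.
   by apply/LE; apply: LfM => //; apply: LfV; exact: Lf_nat.
  move=> V M c' /LE Lc c'0 V1 V2.
  pose f := dY%:R * c' / Y; have fE : f = c' / Y0 by rewrite /f /Y; field; rewrite dYn Y00.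
  have Vf : V (f ^+ p) by apply: srX; rewrite fE.
  (* The multiplier [dd] makes [f^p], hence [f], integral and is a unit at [V]. So [dd dY c'] lies
     in [J], and the global bound [hb] can be read at [V]. *)
  have [P [Od Odf dn0 Vd]] := @integral_multiplier Kq V (f ^+ p) Vf.
  set dd := _.[_] in Od Odf dn0 Vd.
  have Lfp : @Lf Kq th (f ^+ p).
   rewrite /f expr_div_n exprMn; apply: LfM; last exact: LfV.
   by apply: LfM; [rewrite -natrX; exact: Lf_nat|exact: LfX].
  have Ld : @Lf Kq th dd.
   rewrite /dd horner_coef; apply: Lf_sum => j; apply: LfM; last exact: LfX.
   by rewrite coef_map => s _; rewrite rmorph_int.
  have Odf1 : algint Kb (dd * f).
   apply: (algint_root p0); rewrite exprMn -(prednK p0) exprSr -mulrA (prednK p0).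
   by apply: (@srM _ (algint Kb)) => //; exact: srX.
  have := hb (dd * (dY%:R * c')); case.
  + split; first by apply: LfM => //; apply: LfM => //; exact: Lf_nat.
   by rewrite -mulrA.
  move=> qq hqq; have Oq : algint Kb (t%:R * (dd * (dY%:R * c')) / b) by exists qq.
  have -> : t%:R * M / (b / Y) = t%:R * (dd * (dY%:R * c')) / b * (M * Y0 / c') * dd^-1.
   by rewrite /Y; field; rewrite ?dn0 ?c'0 ?b0 ?Y00 ?dYn.
  by apply: (@srM _ V) => //; apply: (@srM _ V) => //; exact: valring_algint Oq.
 move=> M M0; have tM0 : (t%:R * M%:R : Kb) != 0 by rewrite -natrM; apply: pos_natr0; rewrite // muln_gt0 t0.
 have [q [f hf]] := bounded_finite tau I2 uo tho gI gth so (((t * M)%:R * T) ^+ p).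
 have /choice[a ha] : forall Y : Kb, exists a : Kb, algint Kb Y -> Y != 0 -> Lk th (Y ^+ p) ->
   [/\ @Lf Kq th a, algint Kq a, a != 0 & forall y, y \in o -> nm tau (g y a) <= T * nm tau (g y Y)].
  move=> Y; have [[OY Yn LY]|h] := pselect [/\ algint Kb Y, Y != 0 & Lk th (Y ^+ p)].
   by have [a ha] := short Y OY Yn ((LE _).1 LY); exists a.
  by exists 0 => h1' h2' h3'; case: h.
 (* [z Y] is [Y^-1] times an element of the field, integral and with bounded conjugates. If two of
    them have equal [p]-th powers, their ratio is a [p]-th root of unity, which lies in the
    field. *)
 pose z (Y : Kb) : Kb := t%:R * M%:R * a Y / Y.
 have zp Y : algint Kb Y -> Y != 0 -> Lk th (Y ^+ p) -> algint Kb (t%:R * M%:R / Y) ->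
   [/\ z Y != 0, @Lf Kq th (z Y ^+ p), algint Kq (z Y ^+ p) &
    forall y, y \in o -> nm tau (g y (z Y ^+ p)) <= ((t * M)%:R * T) ^+ p].
  move=> OY Yn LY OMY; have [La Oa an ba] := ha Y OY Yn LY; split.
  - by rewrite /z mulf_neq0 ?invr_eq0 // mulf_neq0.
  - rewrite /z expr_div_n; apply: LfM; last by apply: LfV; apply/LE.
   by apply: LfX; apply: LfM => //; rewrite -natrM; exact: Lf_nat.
  - apply: (@srX _ (algint Kq)); rewrite /z mulrAC; exact: (@srM _ (algint Kq)).
  move=> y yo; rewrite rmorphXn avX; apply: lerXn2r; [by rewrite nnegrE av_ge0|by rewrite nnegrE mulr_ge0 // ltW|].
  rewrite /z -natrM fmorph_div rmorphM rmorph_nat !av_mul avV nm_nat ler_pdivrMr ?av_neq0 ?fmorph_eq0 //.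
  by rewrite -mulrA ler_wpM2l // ba.
 exists q, (fun Y => f (z Y ^+ p)) => Y1 Y2 n1 n2 O1 O2 L1 L2 M1 M2 ef.
 have [z1 Lz1 Oz1 b1] := zp Y1 O1 n1 L1 M1; have [z2 Lz2 Oz2 b2] := zp Y2 O2 n2 L2 M2.
 have e : z Y1 ^+ p = z Y2 ^+ p by apply: hf => // y yo; split; [exact: b1|exact: b2].
 have Lz : Lk th (z Y2 / z Y1) by apply: Lmu; rewrite expr_div_n e divff // expf_neq0.
 have [La1 _ an1 _] := ha Y1 O1 n1 L1; have [La2 _ an2 _] := ha Y2 O2 n2 L2.
 have -> : Y1 / Y2 = a Y1 / a Y2 * (z Y2 / z Y1).
  by move: tM0; rewrite /z; set w := _ * _ => w0; field; rewrite w0 an1 an2 n1 n2.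
 move=> s hs; rewrite rmorphM Lz //; congr (_ * _).
 by move: s hs; apply/LE; apply: LfM => //; exact: LfV.
have [n hn] := @Lf_coords Kq th.
exists n, (fun i => th ^+ i) => x /LE/hn[c ->].
pose dd := \prod_i denq (c i).
have dd0 : dd != 0 by apply/prodf_neq0 => i _; exact: denq_neq0.
have /choice[w hw] : forall i, exists w : int, w%:~R = dd%:~R * c i.
 move=> i; rewrite /dd (bigD1 i) //= intrM; exists (\prod_(j < n | j != i) denq (c j) * numq (c i)).
 by rewrite intrM numqE; ring.
exists dd, w; split=> //; rewrite mulr_sumr; apply: eq_bigr => i _; rewrite mulrA; congr (_ * _).
by rewrite -(rmorph_int (ac_emb Kq) (w i)) hw rmorphM rmorph_int.
Qed.
End SubfieldArithmetic.

(** The power trick: if [x > y], Bernoulli at exponent [N + N] gives quadratic growth of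
    [(x / y)^(2N)], against a linear bound. *)
Lemma exp_beats (R : realType) (x y C : R) : 0 <= x -> 0 < y -> 0 <= C ->
 (forall N : nat, x ^+ N <= C * N.+1%:R * y ^+ N) -> x <= y.
Proof.
move=> x0 y0 C0 h; rewrite leNgt; apply/negP => lt.
pose d := x / y - 1; have d0 : 0 < d by rewrite /d subr_gt0 ltr_pdivlMr // mul1r.
have h' (N : nat) : (1 + d) ^+ N <= C * N.+1%:R.
 by rewrite /d addrC subrK expr_div_n ler_pdivrMr ?exprn_gt0.
pose N := (Num.truncn (3 * C / d ^+ 2)).+1.
have hN : 3 * C < N%:R * d ^+ 2 by rewrite -ltr_pdivrMr ?exprn_gt0 //; exact: truncnS_gt.
have N1 : 1 <= N%:R :> R by rewrite ler1n.
have b := bernoulli N (ltW d0); have := h' (N + N)%N; rewrite exprD => h2.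
have h3 : (N%:R * d) ^+ 2 <= (1 + d) ^+ N * (1 + d) ^+ N.
 have Nd : 0 <= N%:R * d by rewrite mulr_ge0 // ltW.
 by rewrite -expr2 lerXn2r ?nnegrE //; [lra|apply: le_trans b; lra].
have h4 : C * (N + N).+1%:R <= 3 * C * N%:R.
 rewrite -natr1 natrD; have : C <= C * N%:R by rewrite ler_peMr.
 lra.
have : N%:R * (3 * C) < N%:R * (N%:R * d ^+ 2) by rewrite ltr_pM2l // ltr0n.
have -> : N%:R * (N%:R * d ^+ 2) = (N%:R * d) ^+ 2 by ring.
lra.
Qed.

Lemma third_sum (R : realFieldType) (X P Q U V e : R) : X <= P + Q -> P <= U + V -> U < e -> V < e -> Q < e ->
 X = 3 * e -> False.
Proof. lra. Qed.
Lemma quarter_sum (R : realFieldType) (X P Q S U V W e : R) : X <= P + Q -> P <= S + W -> S <= U + V ->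
 U <= e -> V <= e -> W <= e -> Q < e -> X = 4 * e -> False.
Proof. lra. Qed.
Lemma map_prod_XsubC (A B : fieldType) (h : {rmorphism A -> B}) (r : seq A) :
 map_poly h (\prod_(z <- r) ('X - z%:P)) = \prod_(z <- r) ('X - (h z)%:P).
Proof. by rewrite rmorph_prod; apply: eq_bigr => z _ /=; exact: map_polyXsubC. Qed.

(** * Archimedean places, in the manner of Ostrowski *)

Section Archimedean.
Variables (R : realType) (K : fieldExtType rat) (Kb : algClosure K) (D : localData R Kb).
Local Notation F := (ld_field D).
Local Notation Fb := (ld_bar D).
Local Notation v := (ld_place D).
Hypothesis arch : ~ nonarch v.

Lemma av_natr_le n : v n%:R <= n%:R.
Proof.
elim: n => [|n IH]; first by rewrite av0.
by rewrite -!natr1; apply: le_trans (av_add v _ _) _; rewrite av1 lerD2r.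
Qed.

Lemma digits_bound n (M x : nat) : (0 < n)%N -> (x < n ^ M)%N ->
 v x%:R <= (M%:R * n%:R) * Num.max 1 (v n%:R) ^+ M.
Proof.
move=> n0; set c := Num.max _ _; have c1 : 1 <= c by rewrite le_max lexx.
have vc : v n%:R <= c by rewrite le_max lexx orbT.
elim: M x => [|M IH] x; first by rewrite expn0 ltnS leqn0 => /eqP ->; rewrite av0 !mul0r.
move=> lt; have /IH h : (x %/ n < n ^ M)%N by rewrite ltn_divLR // -expnSr.
rewrite {1}(divn_eq x n) natrD natrM; apply: le_trans (av_add v _ _) _; rewrite av_mul.
have h1 : v (x %/ n)%:R * v n%:R <= (M%:R * n%:R) * c ^+ M * c.
 by apply: ler_pM; rewrite ?av_ge0.
have h2 : v (x %% n)%:R <= n%:R * c ^+ M.+1.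
 apply: le_trans (av_natr_le _) _; apply: (@le_trans _ _ n%:R).
  by rewrite ler_nat ltnW // ltn_mod.
 by rewrite ler_peMr // exprn_ege1.
by rewrite -natr1 !mulrDl mul1r; apply: lerD => //; rewrite exprSr mulrA.
Qed.

(** Write [a^N] in base [b], with at most [N + 1] digits, and let [N] grow. *)
Lemma av_nat_mono a b : (1 < b)%N -> (a <= b)%N -> v a%:R <= Num.max 1 (v b%:R).
Proof.
move=> b1 ab; set c := Num.max _ _; have c1 : 1 <= c by rewrite le_max lexx.
apply: (@exp_beats _ _ _ (b%:R * c)); rewrite ?av_ge0 ?mulr_ge0 //; try lra.
move=> N; rewrite -avX -natrX; have lt : (a ^ N < b ^ N.+1)%N.
 apply: leq_ltn_trans (_ : b ^ N < _)%N; last by rewrite ltn_exp2l.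
 by case: (N) => // k; rewrite leq_exp2r.
apply: le_trans (digits_bound (ltnW b1) lt) _; rewrite -/c exprS.
by rewrite le_eqVlt; apply/orP; left; apply/eqP; ring.
Qed.

(** If some [b > 1] had [v b <= 1], comparison with powers of [b] would bound all integers by 1; the
    binomial formula and [exp_beats] would then give the ultrametric inequality. *)
Lemma av_nat_gt1 b : (1 < b)%N -> 1 < v b%:R.
Proof.
move=> b1; rewrite ltNge; apply/negP => vb; apply: arch => x y.
have vn a : v a%:R <= 1.
 have [a0|a0] := posnP a; first by rewrite a0 av0.
 have lt : (a <= b ^ a)%N by apply: ltnW; exact: ltn_expl.
 have b1' : (1 < b ^ a)%N by rewrite -(exp1n a) ltn_exp2r.
 have := av_nat_mono b1' lt; rewrite natrX avX.
 by rewrite max_l // exprn_ile1 // av_ge0.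
set M := Num.max _ _; have M0 : 0 <= M by rewrite le_max av_ge0.
have [e|Mn] := eqVneq M 0.
 have h1 : v x <= 0 by rewrite -e le_max lexx.
 have h2 : v y <= 0 by rewrite -e le_max lexx orbT.
 by rewrite e; apply: le_trans (av_add v _ _) _; lra.
apply: (@exp_beats _ _ _ 1); rewrite ?av_ge0 ?lt0r ?Mn // => N.
rewrite -avX exprDn mul1r.
have sum_le (I : Type) (r : seq I) (f : I -> K) : v (\sum_(i <- r) f i) <= \sum_(i <- r) v (f i).
 elim: r => [|i r IH]; first by rewrite !big_nil av0.
 by rewrite !big_cons; apply: le_trans (av_add v _ _) _; rewrite lerD2l.
apply: le_trans (sum_le _ _ _) _; rewrite -[N.+1 in X in _ <= X]card_ord -sumr_const mulr_suml.
apply: ler_sum => i _; rewrite mul1r -mulr_natr !av_mul !avX.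
have h1 : v x ^+ (N - i) <= M ^+ (N - i) by rewrite lerXn2r ?nnegrE ?av_ge0 // le_max lexx.
have h2 : v y ^+ i <= M ^+ i by rewrite lerXn2r ?nnegrE ?av_ge0 // le_max lexx orbT.
apply: (@le_trans _ _ (M ^+ (N - i) * M ^+ i * 1)).
 by apply: ler_pM; rewrite ?mulr_ge0 ?exprn_ge0 ?av_ge0 //; apply: ler_pM; rewrite ?exprn_ge0 ?av_ge0.
by rewrite mulr1 -exprD subnK // -ltnS.
Qed.

Local Notation qK := (in_alg K : {rmorphism rat -> K}).
Local Notation qF q := (co_emb F (qK q)).

(** A nonzero rational that is small in [R] has a denominator exceeding [2^k] times its numerator,
    and [av_nat_mono] carries this comparison over to [v]. *)
Lemma rational_small (e : R) : 0 < e -> exists2 d : R, 0 < d & forall q : rat, `|ratr q| < d -> v (qK q) < e.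
Proof.
move=> e0; have v2 := av_nat_gt1 (isT : (1 < 2)%N).
have [k hk] : exists k : nat, (v 2%:R)^-1 ^+ k < e.
 by apply: expr_small; rewrite ?invr_ge0 ?av_ge0 // invf_lt1 // (lt_trans ltr01 v2).
exists (2^-1 ^+ k); first by rewrite exprn_gt0 // invr_gt0.
move=> q; have [->|q0] := eqVneq q 0; first by rewrite (rmorph0 qK) av0.
have -> : ratr q = (numq q)%:~R / (denq q)%:~R :> R by [].
have d0 : 0 < (denq q)%:~R :> R by rewrite ltr0z denq_gt0.
rewrite normrM normfV (gtr0_norm d0) ltr_pdivrMr // exprVn mulrC ltr_pdivlMr ?exprn_gt0 // => lt.
apply: le_lt_trans hk.
have dE : denq q = `|denq q|%N by rewrite gez0_abs // ltW // denq_gt0.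
have nd : (`|numq q| * 2 ^ k < `|denq q|)%N.
 rewrite -(ltr_nat R) natrM natrX -[X in _ < X]/((`|denq q|%N%:Z)%:~R) -dE.
 by rewrite -[X in X * _ < _]/((`|numq q|%N%:Z)%:~R) abszE intr_norm.
have n0 : (0 < `|numq q|)%N by rewrite absz_gt0 numq_eq0.
have d1 : (1 < `|denq q|)%N by apply: leq_ltn_trans nd; rewrite muln_gt0 n0 expn_gt0.
have := av_nat_mono d1 (ltnW nd); rewrite (max_r (ltW (av_nat_gt1 d1))) natrM natrX av_mul avX.
have qE : qK q * (denq q)%:~R = (numq q)%:~R.
 by rewrite -(rmorph_int qK) -(rmorph_int qK (numq q)) -rmorphM -numqE.
have vq : v (qK q) * v `|denq q|%N%:R = v `|numq q|%N%:R.
 rewrite -av_mul -[`|denq q|%N%:R]/((`|denq q|%N%:Z)%:~R) -dE qE.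
 rewrite -[`|numq q|%N%:R]/((`|numq q|%N%:Z)%:~R) abszE; case: (ger0P (numq q)) => _ //.
 by rewrite mulrNz avN.
have vd : 0 < v `|denq q|%N%:R by apply: lt_trans (av_nat_gt1 d1).
have p2 : 0 < v 2%:R ^+ k by rewrite exprn_gt0 // (lt_trans ltr01 v2).
by rewrite -vq => h; rewrite exprVn -[X in _ <= X]mul1r ler_pdivlMr // -(ler_pM2r vd) mul1r mulrAC.
Qed.

(** The graph of a ring embedding of [R] into the completion: rationals close to the real number [x]
    are close to [y]. *)
Definition rlim (x : R) (y : F) := forall e : R, 0 < e -> exists2 d : R, 0 < d &
 forall q : rat, `|x - ratr q| < d -> co_abs F (y - qF q) < e.

Lemma rat_near (x d : R) : 0 < d -> exists q : rat, `|x - ratr q| < d.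
Proof.
move=> d0; have [|q] := rat_in_itvoo (x := x - d) (y := x + d); first lra.
rewrite in_itv /= => /andP[h1 h2]; exists q; rewrite ltr_norml; lra.
Qed.

Lemma rlim_unique x y y' : rlim x y -> rlim x y' -> y = y'.
Proof.
move=> h h'; apply/eqP; rewrite -subr_eq0; apply/negP => /negP n0.
have e0 : 0 < co_abs F (y - y') / 2 by rewrite divr_gt0 // av_neq0.
have [d d0 hd] := h _ e0; have [d' d'0 hd'] := h' _ e0.
have [|q] := @rat_near x (Num.min d d'); first by rewrite lt_min d0.
rewrite lt_min => /andP[/hd h1 /hd' h2].
have := avB (co_abs F) (y - qF q) (y' - qF q); rewrite opprB addrA subrK; lra.
Qed.

Lemma rlim_ex x : exists y, rlim x y.
Proof.
have /choice[u hu] : forall n : nat, exists q : rat, `|x - ratr q| < n.+1%:R^-1.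
 by move=> n; apply: rat_near; rewrite invr_gt0 ltr0n.
have small (d : R) : 0 < d -> exists N : nat, forall n, (N <= n)%N -> `|x - ratr (u n)| < d.
 move=> d0; exists (Num.truncn d^-1) => n hn; apply: lt_le_trans (hu n) _.
 rewrite -[X in _ <= X]invrK lef_pV2 ?posrE ?invr_gt0 ?ltr0n //.
 by apply: ltW; apply: lt_le_trans (truncnS_gt _) _; rewrite ler_nat ltnS.
have [|y hy] := @co_complete _ _ _ F (fun n => qF (u n)).
 move=> e e0; have [d d0 hd] := rational_small e0.
 have [|N hN] := small (d / 2); first by rewrite divr_gt0.
 exists N => m n /hN h1 /hN h2; rewrite -!rmorphB co_absE; apply: hd; rewrite rmorphB.
 move: h1 h2; rewrite !ltr_norml; lra.
exists y => e e0; have e2 : 0 < e / 2 by rewrite divr_gt0.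
have [d d0 hd] := rational_small e2; have [N hN] := hy _ e2.
exists (d / 2); first by rewrite divr_gt0.
move=> q hq; have [|M hM] := small (d / 2); first by rewrite divr_gt0.
pose n := maxn N M; have h1 := hN n (leq_maxl _ _); have h2 := hM n (leq_maxr _ _).
have h3 : v (qK (u n - q)) < e / 2.
 by apply: hd; rewrite rmorphB; move: h2 hq; rewrite !ltr_norml; lra.
rewrite -(subrKA (qF (u n))); apply: le_lt_trans (av_add _ _ _) _.
rewrite -rmorphB -rmorphB /= co_absE -(avN (co_abs F)) opprB; move: h1 h3; lra.
Qed.

Lemma rlim_rat q : rlim (ratr q) (qF q).
Proof.
move=> e e0; have [d d0 hd] := rational_small e0; exists d => // q' h.
by rewrite -!rmorphB co_absE; apply: hd; rewrite rmorphB.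
Qed.

Lemma rlimB x y x' y' : rlim x y -> rlim x' y' -> rlim (x - x') (y - y').
Proof.
move=> h h'; have [z hz] := rlim_ex (x - x'); suff -> : y - y' = z by [].
apply/eqP; rewrite -subr_eq0; apply/negP => /negP n0.
pose e := co_abs F (y - y' - z) / 3; have e0 : 0 < e by rewrite divr_gt0 // av_neq0.
have [d d0 hd] := h _ e0; have [d' d'0 hd'] := h' _ e0; have [f f0 hf] := hz _ e0.
have [|q] := @rat_near x (Num.min d (f / 2)); first by rewrite lt_min d0 divr_gt0.
rewrite lt_min => /andP[/hd h1 h1f].
have [|q'] := @rat_near x' (Num.min d' (f / 2)); first by rewrite lt_min d'0 divr_gt0.
rewrite lt_min => /andP[/hd' h2 h2f].
have h3 : co_abs F (z - qF (q - q')) < e.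
 by apply: hf; rewrite rmorphB; move: h1f h2f; rewrite !ltr_norml; lra.
have a1 := avB (co_abs F) ((y - qF q) - (y' - qF q')) (z - qF (q - q')).
have a2 := avB (co_abs F) (y - qF q) (y' - qF q').
have e1 : y - qF q - (y' - qF q') - (z - qF (q - q')) = y - y' - z by rewrite !rmorphB /=; ring.
rewrite e1 in a1; have : co_abs F (y - y' - z) = 3 * e by rewrite /e; field.
exact: (third_sum a1 a2 h1 h2 h3).
Qed.

Lemma rlimM x y x' y' : rlim x y -> rlim x' y' -> rlim (x * x') (y * y').
Proof.
move=> h h'; have [z hz] := rlim_ex (x * x'); suff -> : y * y' = z by [].
apply/eqP; rewrite -subr_eq0; apply/negP => /negP n0.
pose A := 1 + co_abs F y + co_abs F y'; pose B := 1 + `|x| + `|x'|.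
have y0 := av_ge0 (co_abs F) y; have y'0 := av_ge0 (co_abs F) y'.
have A0 : 0 < A by rewrite /A; lra.
have yA : co_abs F y <= A by rewrite /A; lra.
have y'A : co_abs F y' <= A by rewrite /A; lra.
have A1 : 1 <= A by rewrite /A; lra.
have B1 : 1 <= B by have := normr_ge0 x; have := normr_ge0 x'; rewrite /B; lra.
have B0 : 0 < B by have := normr_ge0 x; have := normr_ge0 x'; rewrite /B; lra.
pose E := co_abs F (y * y' - z) / 4; have E0 : 0 < E by rewrite divr_gt0 // av_neq0.
pose e := Num.min 1 (E / A); have e0 : 0 < e by rewrite lt_min ltr01 divr_gt0.
have [d d0 hd] := h _ e0; have [d' d'0 hd'] := h' _ e0; have [f f0 hf] := hz _ E0.
pose g := Num.min 1 (f / (3 * B)); have g0 : 0 < g by rewrite lt_min ltr01 divr_gt0 // mulr_gt0.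
have [|q] := @rat_near x (Num.min d g); first by rewrite lt_min d0.
rewrite lt_min => /andP[/hd h1 h1f].
have [|q'] := @rat_near x' (Num.min d' g); first by rewrite lt_min d'0.
rewrite lt_min => /andP[/hd' h2 h2f].
have h3 : co_abs F (z - qF (q * q')) < E.
 apply: hf; rewrite rmorphM /=.
 have -> : x * x' - ratr q * ratr q' = (x - ratr q) * x' + (x' - ratr q') * x - (x - ratr q) * (x' - ratr q') by ring.
 move: h1f h2f; rewrite !lt_min; set a := x - _; set b := x' - _ => /andP[a1 af] /andP[b1 bf].
 have fB : 3 * B * (f / (3 * B)) = f by rewrite mulrC divfK // gt_eqF // mulr_gt0.
 have p1 : `|a| * `|x'| <= f / (3 * B) * B.
  by apply: ler_pM; rewrite ?normr_ge0 // ?ltW // /B; have := normr_ge0 x; lra.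
 have p2 : `|b| * `|x| <= f / (3 * B) * B.
  by apply: ler_pM; rewrite ?normr_ge0 // ?ltW // /B; have := normr_ge0 x'; lra.
 have p3 : `|a| * `|b| < f / (3 * B) * B.
  apply: (@le_lt_trans _ _ (`|a| * 1)); first by rewrite ler_wpM2l // ltW.
  rewrite mulr1; apply: lt_le_trans af _; apply: ler_peMr => //.
  by apply: ltW; rewrite divr_gt0 // mulr_gt0.
 apply: le_lt_trans (ler_normB _ _) _; apply: le_lt_trans (lerD (ler_normD _ _) (lexx _)) _.
 rewrite !normrM; move: p1 p2 p3 fB; set u := f / (3 * B); lra.
have a1 := avB (co_abs F) (y * y' - qF (q * q')) (z - qF (q * q')).
have e1 : y * y' - qF (q * q') - (z - qF (q * q')) = y * y' - z by ring.
have e2 : y * y' - qF (q * q') = (y - qF q) * y' + (y' - qF q') * y - (y - qF q) * (y' - qF q').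
 by rewrite !rmorphM /=; ring.
have a2 := avB (co_abs F) ((y - qF q) * y' + (y' - qF q') * y) ((y - qF q) * (y' - qF q')).
have a3 := av_add (co_abs F) ((y - qF q) * y') ((y' - qF q') * y).
rewrite e1 in a1; rewrite -e2 in a2; rewrite !av_mul in a2 a3.
move: h1 h2; rewrite !lt_min => /andP[b1 bE] /andP[c1 cE].
have EA : E / A * A = E by rewrite divfK // gt_eqF.
have p1 : co_abs F (y - qF q) * co_abs F y' <= E / A * A by apply: ler_pM; rewrite ?av_ge0 //; exact: ltW.
have p2 : co_abs F (y' - qF q') * co_abs F y <= E / A * A by apply: ler_pM; rewrite ?av_ge0 //; exact: ltW.
have p3 : co_abs F (y - qF q) * co_abs F (y' - qF q') <= E / A * A.
 by apply: ler_pM; rewrite ?av_ge0 //; [exact: ltW|apply: le_trans A1; exact: ltW].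
have : co_abs F (y * y' - z) = 4 * E by rewrite /E; field.
rewrite EA in p1 p2 p3; exact: (quarter_sum a1 a2 a3 p1 p2 p3 h3).
Qed.

Lemma real_embedding : exists rho : {rmorphism R -> F}, True.
Proof.
have [f hf] := choice rlim_ex.
have fB : zmod_morphism f by move=> x y; apply: rlim_unique (hf _) (rlimB (hf x) (hf y)).
have f1 : f 1 = 1.
 by apply: rlim_unique (hf 1) _; rewrite -(rmorph1 (@ratr R)) -(rmorph1 (co_emb F)) -(rmorph1 qK); exact: rlim_rat.
have fM : monoid_morphism f by split=> // x y; apply: rlim_unique (hf _) (rlimM (hf x) (hf y)).
pose fA := GRing.isZmodMorphism.Build _ _ f fB.
pose fR := GRing.isMonoidMorphism.Build _ _ f fM.
pose rho : {rmorphism R -> F} := HB.pack f fA fR.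
by exists rho.
Qed.

(** The elements of [Kb] are algebraic over the rationals, so in the local closure they lie in the
    image of [R[i]]. An automorphism over the completion fixes the image of [R], and its effect is
    decided by the sign it gives to [J]. *)
Lemma arch_two (s t : absGal Fb) : [\/ forall x, s (ld_emb D x) = ld_emb D x,
 forall x, t (ld_emb D x) = ld_emb D x | forall x, s (ld_emb D x) = t (ld_emb D x)].
Proof.
have [rho _] := real_embedding.
have [J J2] : exists J : Fb, J ^+ 2 = -1.
 have [J] := @solve_monicpoly Fb 2 (fun i => if i == 0%N then -1 else 0) isT.
 by rewrite !big_ord_recl big_ord0 /= expr0 mulr1 mul0r !addr0; exists J.
pose ro (x : R) := ac_emb Fb (rho x).
pose f (z : R[i]) := ro (complex.Re z) + ro (complex.Im z) * J.
have fB : zmod_morphism f.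
 by move=> [a b] [c d]; rewrite /f /ro /= !rmorphB /=; ring.
have fM : monoid_morphism f.
 split; first by rewrite /f /ro /= !rmorph1 !rmorph0 mul0r addr0.
 move=> [a b] [c d]; rewrite /f /ro /= !(rmorphB, rmorphD, rmorphM) /=.
 set a' := ac_emb Fb _; set b' := ac_emb Fb (rho b); set c' := ac_emb Fb (rho c); set d' := ac_emb Fb (rho d).
 have -> : (a' + b' * J) * (c' + d' * J) = a' * c' + b' * d' * J ^+ 2 + (a' * d' + b' * c') * J by ring.
 by rewrite J2; ring.
pose fA := GRing.isZmodMorphism.Build _ _ f fB.
pose fR := GRing.isMonoidMorphism.Build _ _ f fM.
pose fh : {rmorphism R[i] -> Fb} := HB.pack f fA fR.
have img x : exists z, ld_emb D x = fh z.
 have [q q0 qx] : exists2 q : {poly rat}, q != 0 & (map_poly ratr q).[ld_emb D x] = 0.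
  have [q [mq qx _]] := min_poly_ex x.
  have /integral_algebraic[q' q'0 /rootP h] : integralOver (ld_emb D \o ac_emb Kb \o qK) (ld_emb D x).
   apply: (@integral_root_monic _ _ _ _ (map_poly (ld_emb D) (map_poly (ac_emb Kb) q))).
   - by rewrite !map_monic.
   - by apply/rootP; rewrite horner_map qx rmorph0.
   move=> y /(nthP 0)[j _ <-]; rewrite !coef_map; apply/integral_algebraic.
   have [r mr rx] := number_alg q`_j.
   exists r; first exact: monic_neq0.
   by rewrite !map_poly_comp; apply/rootP; rewrite !horner_map rx !rmorph0.
  exists q' => //; rewrite -[RHS]h; congr (_.[_]); apply: eq_map_poly => a.
  by rewrite -(fmorph_eq_rat (ld_emb D \o ac_emb Kb \o qK)).
 have [r Er] := closed_field_poly_normal (map_poly (@ratr R[i]) q).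
 move: qx; have -> : map_poly ratr q = map_poly fh (map_poly (@ratr R[i]) q).
  by rewrite -map_poly_comp; apply: eq_map_poly => a; rewrite -(fmorph_eq_rat (fh \o @ratr R[i])).
 rewrite Er map_polyZ hornerZ => /eqP; rewrite mulf_eq0 fmorph_eq0 lead_coef_eq0 map_poly_eq0 (negbTE q0) orFb.
 rewrite map_prod_XsubC horner_prod prodf_seq_eq0 => /hasP[z _ /=].
 by rewrite !hornerE subr_eq0 => /eqP ->; exists z.
have sf (u : absGal Fb) z : u (fh z) = ro (complex.Re z) + ro (complex.Im z) * u J.
 by rewrite -[fh z]/(f z) rmorphD rmorphM /ro !gal_fix.
have cs (u : absGal Fb) : u J = J \/ u J = - J.
 have : (u J - J) * (u J + J) = 0 by rewrite -subr_sqr -rmorphXn J2 rmorphN rmorph1 subrr.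
 by move=> /eqP; rewrite mulf_eq0 subr_eq0 addr_eq0 => /orP[/eqP|/eqP]; [left|right].
case: (cs s) => sJ; first by constructor 1 => x; have [z ->] := img x; rewrite sf sJ.
case: (cs t) => tJ; first by constructor 2 => x; have [z ->] := img x; rewrite sf tJ.
by constructor 3 => x; have [z ->] := img x; rewrite !sf sJ tJ.
Qed.
End Archimedean.

(** * Colourings *)

Lemma dvdz_ord_sub l (a b : 'I_l) : (l%:Z %| (a : nat)%:Z - (b : nat)%:Z)%Z -> a = b.
Proof.
rewrite -eqz_mod_dvd !modz_nat => /eqP[]; rewrite !modn_small // => e; exact: val_inj.
Qed.

Section FiniteQuotient.
Variables (T : zmodType) (l : nat) (A B : T -> Prop) (C : finType) (f : T -> C).
Hypotheses (pl : prime l) (A0 : A 0) (AB : forall x y, A x -> A y -> A (x - y)).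
Hypothesis fB : forall x y, A x -> A y -> f x = f y -> B (x - y).

Lemma subgroup_sum m (a : 'I_m -> T) (c : 'I_m -> nat) : (forall i, A (a i)) -> A (\sum_i a i *+ c i).
Proof.
have AN x : A x -> A (- x) by move=> h; rewrite -sub0r; exact: AB.
have AD x y : A x -> A y -> A (x + y) by move=> hx hy; rewrite -[y]opprK; apply: AB => //; exact: AN.
move=> ha; apply: (big_ind A A0 AD) => i _.
by elim: (c i) => [|k IH]; rewrite ?mulr0n // mulrS; exact: AD.
Qed.

(** Combinations with coefficients below [l] that share a colour differ by an element of [B], so
    independence makes them equal; hence there are at most as many as colours. *)
Lemma independent_count m (a : 'I_m -> T) : (forall i, A (a i)) ->
 (forall c : 'I_m -> int, B (\sum_i a i *~ c i) -> forall i, (l%:Z %| c i)%Z) -> (l ^ m <= #|C|)%N.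
Proof.
move=> ha ind; pose F (c : {ffun 'I_m -> 'I_l}) := f (\sum_i a i *+ c i).
have inj : injective F.
 move=> c c' /fB h; apply/ffunP => i; apply: dvdz_ord_sub.
 apply: (ind (fun i => (c i : nat)%:Z - (c' i : nat)%:Z)).
 rewrite (eq_bigr (fun i => a i *+ c i - a i *+ c' i)); last by move=> j _; rewrite mulrzBr.
 by rewrite sumrB; apply: h; exact: subgroup_sum.
by have := leq_card F inj; rewrite card_ffun !card_ord.
Qed.

Lemma finite_basis : B 0 -> (forall x y, B x -> B y -> B (x - y)) -> (forall x, A x -> B (x *+ l)) ->
 exists m (a : 'I_m -> T), [/\ forall i, A (a i),
  forall c : 'I_m -> int, B (\sum_i a i *~ c i) -> forall i, (l%:Z %| c i)%Z &
  forall x, A x -> exists c : 'I_m -> 'I_l, B (x - \sum_i a i *+ c i)].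
Proof.
move=> B0 BB Al; apply: (@independent_basis T #|C| l A B) => // a ha.
apply: contrapT => h; have := @independent_count _ a ha; rewrite leqNgt => h'.
have /negP : ~~ (#|C| < l ^ #|C|.+1)%N.
 apply: h' => c hc i; apply: contrapT => /negP hi; apply: h; exists c => //; by exists i.
apply; apply: ltn_trans (ltnSn _) _; exact: ltn_expl (prime_gt1 pl).
Qed.
End FiniteQuotient.

Section DualBasis.
Variables (T : zmodType) (p : nat) (L : closedFieldType) (r : seq T).
Hypotheses (pp : prime p) (c0 : p%:R != 0 :> L).
Hypothesis hr : forall x : T, x *+ p = 0 -> x \in r.
Local Notation V x := ((x : T) *+ p = 0).

(** The [eta i] read coordinates in a basis of the [p]-torsion as powers of a primitive [p]-th root
    of unity. Through them a cocycle with torsion values is studied one Kummer character at a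
    time. *)
Lemma dual_basis : exists m (eta : 'I_m -> T -> L), [/\ forall i x, V x -> eta i x ^+ p = 1,
 forall i x y, V x -> V y -> eta i (x + y) = eta i x * eta i y,
 forall x, V x -> (forall i, eta i x = 1) -> x = 0,
 forall eps : 'I_m -> L, (forall i, eps i ^+ p = 1) -> exists2 x, V x & forall i, eta i x = eps i &
 forall h : T -> L, (forall x, V x -> h x ^+ p = 1) -> (forall x y, V x -> V y -> h (x + y) = h x * h y) ->
  exists n : 'I_m -> nat, forall x, V x -> h x = \prod_i eta i x ^+ n i].
Proof.
have p0 := prime_gt0 pp; have VB (x y : T) : V x -> V y -> V (x - y) by move=> hx hy; rewrite mulrnBl hx hy subrr.
have VD (x y : T) : V x -> V y -> V (x + y) by move=> hx hy; rewrite mulrnDl hx hy addr0.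
have idx (x : T) : (minn (index x r) (size r) < (size r).+1)%N by rewrite ltnS geq_minr.
have [||||m [a [ha ind spn]]] := @finite_basis T p (fun x => V x) (fun x => x = 0) 'I_(size r).+1 (fun x => Ordinal (idx x)) pp (mul0rn _ _) VB.
- move=> x y hx hy [] /eqP; rewrite !(minn_idPl (index_size _ _)) => /eqP e.
 by rewrite -(nth_index 0 (hr hx)) e nth_index ?hr // subrr.
- by [].
- by move=> x y -> ->; rewrite subrr.
- by [].
have [z pz] := prim_root_ex p0 c0.
have /choice[c hc] : forall x, exists c : 'I_m -> 'I_p, V x -> x = \sum_i a i *+ c i.
 move=> x; have [hx|nx] := pselect (V x); last by exists (fun=> Ordinal p0).
 by have [c /eqP] := spn x hx; rewrite subr_eq0 => /eqP e; exists c.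
pose eta i x := z ^+ c x i.
have etaE i x (n : 'I_m -> nat) : V x -> x = \sum_i a i *+ n i -> eta i x = z ^+ n i.
 move=> hx e; apply/eqP; rewrite (eq_prim_root_expr pz) -eqz_nat -!modz_nat eqz_mod_dvd.
 apply: (ind (fun i => (c x i : nat)%:Z - (n i)%:Z)).
 rewrite (eq_bigr (fun i => a i *+ c x i - a i *+ n i)); last by move=> j _; rewrite mulrzBr.
 by rewrite sumrB -hc // -e subrr.
have etap i x : eta i x ^+ p = 1 by rewrite -exprM mulnC exprM (prim_expr_order pz) expr1n.
have unity x : x ^+ p = 1 -> exists k : nat, x = z ^+ k.
 by move=> /(prim_rootP pz)[k ->]; exists k.
exists m, eta; split.
- by move=> i x _; exact: etap.
- move=> i x y hx hy; rewrite (@etaE i (x + y) (fun i => c x i + c y i)%N) ?exprD //; first exact: VD.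
 by rewrite {1}(hc x hx) {1}(hc y hy) -big_split; apply: eq_bigr => j _; rewrite mulrnDr.
- move=> x hx h; rewrite (hc x hx) big1 // => i _; have := h i; rewrite /eta => /eqP.
 rewrite -(prim_order_dvd pz) => /dvdnP[k ->]; by rewrite mulnC mulrnA ha mul0rn.
- move=> eps he; have /choice[k hk] : forall i, exists k : nat, eps i = z ^+ k by move=> i; exact: unity.
 exists (\sum_i a i *+ k i); first by apply: (@subgroup_sum T (fun x => V x)) => //; exact: mul0rn.
 move=> i; rewrite hk; apply: etaE => //.
 by apply: (@subgroup_sum T (fun x => V x)) => //; exact: mul0rn.
move=> h hp hD; have /choice[n hn] : forall i, exists n : nat, h (a i) = z ^+ n by move=> i; apply: unity; exact: hp.
have h0 : h 0 = 1.
 have h00 : h 0 != 0.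
  have := hp 0 (mul0rn _ _); apply: contra_eq_neq => ->; by rewrite expr0n gtn_eqF // eq_sym oner_eq0.
 by apply: (mulfI h00); rewrite -hD ?addr0 ?mulr1 // mul0rn.
have hM x k : V x -> V (x *+ k) /\ h (x *+ k) = h x ^+ k.
 move=> hx; elim: k => [|k [I1 I2]]; first by rewrite mulr0n expr0 mul0rn.
 by rewrite mulrS exprS; split; [exact: VD|rewrite hD // I2].
exists n => x hx; rewrite {1}(hc x hx).
have [_ ->] : V (\sum_i a i *+ c x i) /\ h (\sum_i a i *+ c x i) = \prod_i h (a i) ^+ c x i.
 apply: (big_ind2 (fun s t => V s /\ h s = t)) => [|s t s' t' [v1 e1] [v2 e2]|i _].
 - by split=> //; exact: mul0rn.
 - by split; [exact: VD|rewrite hD // e1 e2].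
 exact: hM.
by apply: eq_bigr => i _; rewrite hn /eta -!exprM mulnC.
Qed.
End DualBasis.

Section ModularColour.
Variables (K : fieldType) (A : K -> Prop) (n : nat) (e : 'I_n -> K).
Hypotheses (c0 : forall n, n.+1%:R != 0 :> K) (A0 : A 0) (AB : forall x y, A x -> A y -> A (x - y)).
Hypothesis As : forall x, A x -> zspan e x.

(** Induction along the prime factors of [N]: colour by the class modulo a prime [l], finite by
    [quotient_basis], then colour the remainder divided by [l] modulo [N / l]. *)
Lemma modular_colour N : (0 < N)%N -> exists (C : finType) (f : K -> C),
 forall x y, A x -> A y -> f x = f y -> A ((x - y) / N%:R).
Proof.
have AN x : A x -> A (- x) by move=> h; rewrite -sub0r; exact: AB.
have AD x y : A x -> A y -> A (x + y) by move=> hx hy; rewrite -[y]opprK; apply: AB => //; exact: AN.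
have AMn x k : A x -> A (k%:R * x).
 by move=> hx; rewrite mulr_natl; elim: k => [|k IH]; rewrite ?mulr0n // mulrS; exact: AD.
have [k] := ubnP N; elim: k N => // k IH N; rewrite ltnS => Nk N0.
have [N1|N1] := leqP N 1.
 have -> : N = 1%N by lia.
 by exists unit, (fun=> tt) => x y hx hy _; rewrite divr1; exact: AB.
pose l := pdiv N; have pl : prime l by exact: pdiv_prime.
have l0 : l%:R != 0 :> K by apply: pos_natr0 => //; exact: prime_gt0.
have NE : N = (N %/ l * l)%N by rewrite divnK // pdiv_dvd.
have [||C [f hf]] := IH (N %/ l)%N.
- by apply: leq_trans Nk; rewrite ltn_Pdiv ?prime_gt1.
- by rewrite divn_gt0 ?prime_gt0 // pdiv_leq.
pose B x := A (x / l%:R).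
have [|||m [a [ha _ spn]]] := @quotient_basis K n e c0 l A B pl As A0 AB.
- by rewrite /B mul0r.
- by move=> x y hx hy; rewrite /B mulrBl; exact: AB.
- by move=> x hx; rewrite /B mulrC mulrA mulVf // mul1r.
have /choice[c hc] : forall x, exists c : {ffun 'I_m -> 'I_l}, A x -> B (x - \sum_i (c i)%:R * a i).
 move=> x; have [/spn[c hx]|nx] := pselect (A x); last by exists [ffun=> Ordinal (prime_gt0 pl)].
 exists (finfun c) => _; rewrite (eq_bigr (fun i => (c i)%:R * a i)) // => i _; by rewrite ffunE.
exists (prod {ffun 'I_m -> 'I_l} C), (fun x => (c x, f ((x - \sum_i (c x i)%:R * a i) / l%:R))).
move=> x y hx hy [ec /hf h].
have := h (hc x hx) (hc y hy); rewrite ec -mulrBl -mulrA -invfM -natrM.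
rewrite [in X in _ / X](_ : (l * (N %/ l))%N = N) 1?mulnC -?NE //.
by rewrite opprB addrA subrK.
Qed.
End ModularColour.

Section PullBack.
Variables (A B : fieldType) (i : {rmorphism A -> B}) (O : valring B).
Lemma pull1 : O (i 1). Proof. by rewrite rmorph1; exact: sr1. Qed.
Lemma pullB x y : O (i x) -> O (i y) -> O (i (x - y)). Proof. by rewrite rmorphB; exact: srB. Qed.
Lemma pullM x y : O (i x) -> O (i y) -> O (i (x * y)). Proof. by rewrite rmorphM; exact: srM. Qed.
Lemma pullV x : x != 0 -> O (i x) \/ O (i x^-1).
Proof. by move=> x0; rewrite fmorphV; apply: vrV; rewrite fmorph_eq0. Qed.
Definition pull : valring A := @Valring A (SubringP pull1 pullB pullM) pullV.
Lemma pull_vm x : vm pull x <-> vm O (i x).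
Proof.
rewrite /vm -fmorphV; split=> -[h|h]; [left|right|left|right] => //; first by rewrite h rmorph0.
by move/eqP: h; rewrite fmorph_eq0 => /eqP.
Qed.
End PullBack.

Lemma ld_resE (R : realType) (K : fieldType) (Kb : algClosure K) (D : localData R Kb) s x :
 ld_emb D (ld_res s x) = s (ld_emb D x).
Proof. by rewrite /ld_res /gal_res; case: cid. Qed.

(** For [w = x / y], the sum of the [1 - w^k] over [k < p] is [p], which exhibits [p / (w - 1)] as a
    combination of powers of [w]. *)
Lemma unity_separated (A : fieldType) (V : valring A) p (x y : A) : (0 < p)%N ->
 x ^+ p = 1 -> y ^+ p = 1 -> x != y -> V (p%:R / (x - y)).
Proof.
move=> p0 xp yp xy; have y0 : y != 0.
 exact: expr1_neq0 yp.
pose w := x / y; have wp : w ^+ p = 1 by rewrite expr_div_n xp yp divr1.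
have w1 : w - 1 != 0 by rewrite subr_eq0; apply: contra xy => /eqP/divr1_eq ->.
have Vw : V w by exact: unity_O p0 wp.
have Vy : V y^-1 by apply: (unity_O V p0); rewrite exprVn yp invr1.
have s0 : \sum_(k < p) w ^+ k = 0.
 by apply: (mulfI w1); rewrite -subrX1 wp subrr mulr0.
have e : p%:R / (w - 1) = - \sum_(k < p) \sum_(j < k) w ^+ j.
 have pE : p%:R = \sum_(k < p) (1 - w ^+ k) by rewrite sumrB s0 subr0 sumr_const card_ord.
 apply: (mulIf w1); rewrite divfK // pE mulNr mulr_suml -sumrN; apply: eq_bigr => k _.
 by rewrite mulrC -subrX1 opprB.
have -> : p%:R / (x - y) = p%:R / (w - 1) * y^-1.
 by rewrite -mulrA -invfM mulrBl divfK // mul1r.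
apply: srM => //; rewrite e; apply: srN; apply: sr_sum => k _; apply: sr_sum => j _; exact: srX.
Qed.

(** [x^p - 1] is the product of the [x - z^k]. If none were divisible by [Q], the product of the
    inverse quotients would lie in the maximal ideal, while its inverse is in [V]. *)
Lemma near_unity (A : fieldType) (V : valring A) p (z Q x : A) : p.-primitive_root z -> Q != 0 ->
 V ((x ^+ p - 1) / Q ^+ p) -> exists k : nat, V ((x - z ^+ k) / Q).
Proof.
move=> pz Q0 h; apply: contrapT => nk.
have nV k : ~ V ((x - z ^+ k) / Q) by move=> hk; apply: nk; exists k.
pose Z := \prod_(0 <= k < p) ((x - z ^+ k) / Q).
have ZE : Z = (x ^+ p - 1) / Q ^+ p.
 rewrite /Z prodf_div prodr_const_nat subn0; congr (_ / _).
 have := congr1 (fun q : {poly A} => q.[x]) (factor_Xn_sub_1 pz).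
 rewrite horner_prod !hornerE => <-; apply: eq_bigr => k _; by rewrite !hornerE.
have Z0 : Z != 0 by rewrite prodf_seq_neq0; apply/allP => k _ /=; exact: v_not_O (nV k).
have vZ : vm V Z^-1.
 rewrite -prodfV; have := prim_order_gt0 pz; case: (p) => // k _.
 rewrite big_nat_recl //; apply: vmMr; last by exact: vinv_vm.
 by apply: sr_prod => j _; apply: vm_O; exact: vinv_vm.
by apply: (@vmP _ V Z^-1) => //; rewrite ?invr_eq0 // invrK ZE.
Qed.

Lemma ratio_near_one (A : fieldType) (V : valring A) (x y P Q : A) : y != 0 -> P != 0 -> Q != 0 ->
 V ((x - y) / (P * Q)) -> V (P / y) -> V ((x / y - 1) / Q).
Proof.
move=> y0 P0 Q0 h1 h2; have -> : (x / y - 1) / Q = (x - y) / (P * Q) * (P / y) by field; rewrite Q0 y0 P0.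
exact: srM.
Qed.

(** * Kummer generators of cocycles and the two colourings *)

Section Colourings.
Variables (R : realType) (K : fieldExtType rat) (Kb : algClosure K) (p : nat) (E : weierstrass K).
Variables (W : goodcurve Kb) (eW : gc_eqn W = map_weierstrass (ac_emb Kb) E).
Hypothesis pp : prime p.
Local Notation G := (absGal Kb).
Local Notation "s @@ P" := (gpt eW s P) (at level 40, left associativity).
Local Notation tor x := ((x : ecpt W) *+ p = 0).
Variable M : nat.
Hypothesis M0 : (0 < M)%N.
Let p0 : (0 < p)%N := prime_gt0 pp.
Let c0 := fmorph_char0 (ac_emb Kb) (@rat_alg_char0 K).
Let Mn : M%:R != 0 :> Kb. Proof. exact: pos_natr0. Qed.

Variables (th : Kb) (t m : nat) (eta : 'I_m -> ecpt W -> Kb).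
Hypotheses (th0 : th != 0) (t0 : (0 < t)%N)
 (thV : forall s : G, s th = th -> forall T, tor T -> s @@ T = T)
 (thmu : forall s : G, s th = th -> forall z : Kb, z ^+ p = 1 -> s z = z)
 (nrm : forall s u : G, u th = th -> u (s th) = s th)
 (red : reduction p th t) (fin : finite_classes p th t).
Hypotheses (etap : forall i x, tor x -> eta i x ^+ p = 1)
 (etaD : forall i x y, tor x -> tor y -> eta i (x + y) = eta i x * eta i y)
 (eta_inj : forall x, tor x -> (forall i, eta i x = 1) -> x = 0)
 (eta_surj : forall eps : 'I_m -> Kb, (forall i, eps i ^+ p = 1) -> exists2 x, tor x & forall i, eta i x = eps i)
 (eta_hom : forall h : ecpt W -> Kb, (forall x, tor x -> h x ^+ p = 1) ->
   (forall x y, tor x -> tor y -> h (x + y) = h x * h y) ->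
   exists n : 'I_m -> nat, forall x, tor x -> h x = \prod_i eta i x ^+ n i).
Let tn : t%:R != 0 :> Kb. Proof. exact: pos_natr0. Qed.

Let torB x y : tor x -> tor y -> tor (x - y).
Proof. by move=> hx hy; rewrite mulrnBl hx hy subrr. Qed.
Let eta_neq0 i x : tor x -> eta i x != 0.
Proof. by move=> /(etap i); exact: expr1_neq0. Qed.
Let eta0 i : eta i 0 = 1.
Proof. by apply: (mulfI (eta_neq0 i (mul0rn _ p))); rewrite -etaD ?mul0rn // addr0 mulr1. Qed.
Let etaB i x y : tor x -> tor y -> eta i (x - y) = eta i x / eta i y.
Proof.
move=> hx hy; apply: (mulIf (eta_neq0 i hy)); rewrite -etaD ?subrK ?divfK ?eta_neq0 //; exact: torB.
Qed.
Let d_hom d (u u' : G) : ecocycle p eW d -> u th = th -> d (gal_mul u u') = d u + d u'.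
Proof. by case=> dt dM _ hu; rewrite dM thV. Qed.

(** [X] is a Kummer generator for [eta i] of [d], with the inverse character because [reduction]
    exchanges [Y] for [Y']. By the last clause, if some [c] in the field of [th] makes [c X] an
    integral divisor of [N] at [V], then [X] itself divides [t N] there. *)
Definition kum (d : G -> ecpt W) i X := [/\ X != 0, algint Kb X,
 forall u : G, u th = th -> u X = (eta i (d u))^-1 * X &
 forall (V : valring Kb) (N c : Kb), Lk th c -> c != 0 -> V (c * X) -> V (N / (c * X)) -> V (t%:R * N / X)].

Lemma kummer_ex d : ecocycle p eW d -> exists X : 'I_m -> Kb, forall i, kum d i (X i).
Proof.
move=> cd; have [dt dM dc] := cd; suff /choice[X hX] : forall i, exists X, kum d i X by exists X.
move=> i.
have [||||||Y Y0 hY] := @kummer_generator _ Kb c0 (fun s => s th = th) (fun s => eta i (d s)).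
- by [].
- by move=> s u hs hu; rewrite gal_mulE hu.
- by move=> s hs; rewrite -{1}hs gal_invK.
- by move=> s u hs hu; rewrite (d_hom _ cd) // etaD.
- by move=> s u hs hu; apply: thmu => //; exact: etap.
- have [r hr] := dc (gal_one Kb); exists r => s _ fs.
 by rewrite (hr s) ?(ecocycle1 cd) ?eta0 // => x xr; rewrite fs.
have LY : Lk th (Y ^+ p) by move=> s hs; rewrite rmorphXn hY // exprMn etap // mul1r.
have [X [X0 OX LX hX]] := red Y0 LY; exists X; split=> //.
 move=> u hu; have e := LX u hu; rewrite rmorphM (hY u hu) in e.
 have en := eta_neq0 i (dt u); apply: (mulfI en); rewrite mulrA divff // mul1r.
 by apply: (mulIf Y0); rewrite -e; ring.
move=> V N c Lc cn V1 V2; apply: (hX V N (c * (X * Y))).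
- by move=> s hs; rewrite rmorphM Lc // LX.
- by rewrite !mulf_neq0.
- by rewrite !mulrA mulfK.
have -> : N * Y / (c * (X * Y)) = N / (c * X) by field; rewrite cn X0 Y0.
by [].
Qed.

(** Let [l] be a prime divisor of [M] in the maximal ideal. If [X] is not already a unit, divide it
    by the last power of [l] that keeps it integral: the result divides [l], hence [M], and the last
    clause of [kum] applies. *)
Lemma bad_bound d i X (V : valring Kb) : kum d i X -> vm V M%:R -> V (t%:R * M%:R / X).
Proof.
move=> [X0 OX _ hX] vM.
have [l pl /andP[vl lM]] : exists2 l, prime l & `[< vm V l%:R >] && (l %| M)%N.
 move: vM; rewrite {1}(prod_prime_decomp M0) prime_decompE big_map natr_prod => /vm_prod[].
  by move=> k _; exact: sr_nat.
 move=> l; rewrite mem_primes => /and3P[pl _ lM] /=; rewrite natrX => h1; exists l; rewrite ?lM ?andbT //.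
 by apply/asboolP; case: (logn _ _) h1 => [/vm1//|k]; apply: vm_exp; exact: sr_nat.
move/asboolP: vl => vl; have l0 : l%:R != 0 :> Kb by apply: pos_natr0 => //; exact: prime_gt0.
have VX := valring_algint V OX.
have exj : exists j : nat, `[< V (l%:R ^+ j / X) >].
 by have [j hj] := l_bounded pl vl X^-1; exists j; apply/asboolP.
have [[|j] /asboolP hj jmin] := ex_minnP exj.
 apply: (hX V M%:R 1); rewrite ?oner_neq0 ?mul1r //; first by move=> s _; rewrite rmorph1.
 by apply: srM; [exact: sr_nat|rewrite -[X^-1]mul1r -(expr0 l%:R)].
have lj0 : l%:R ^+ j != 0 :> Kb by rewrite expf_neq0.
have nj : ~ V (l%:R ^+ j / X) by move=> h; have := jmin j (introT (asboolP _) h); rewrite ltnn.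
apply: (hX V M%:R (l%:R ^+ j)^-1); rewrite ?invr_eq0 //.
- by move=> s _; rewrite fmorphV rmorphXn rmorph_nat.
- by have := vm_O (vinv_vm nj); rewrite invf_div mulrC.
have -> : M%:R / ((l%:R ^+ j)^-1 * X) = (M %/ l)%N%:R * (l%:R ^+ j.+1 / X).
 by rewrite -{1}(divnK lM) natrM exprS; field; rewrite X0 lj0.
by apply: srM => //; exact: sr_nat.
Qed.

Lemma local_unity_fixed (D : localData R Kb) (s : absGal (ld_bar D)) z : s (ld_emb D th) = ld_emb D th ->
 z ^+ p = 1 -> s z = z.
Proof.
move=> hs zp; have [w pw] := prim_root_ex p0 (pos_natr0 c0 p0 : p%:R != 0 :> Kb).
have pw' : p.-primitive_root (ld_emb D w) by rewrite fmorph_primitive_root.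
have [k ->] := prim_rootP pw' zp; rewrite -rmorphXn -(ld_resE s (w ^+ k)) thmu //.
 by apply: (fmorph_inj (ld_emb D)); rewrite ld_resE.
by rewrite -exprM mulnC exprM (prim_expr_order pw) expr1n.
Qed.

Definition unram_at (D : localData R Kb) (na : nonarch (ld_place D)) (d : G -> ecpt W) :=
 exists2 r : seq (ld_bar D), {in r, forall x, OD na x} & forall s, fixes (OD na) r s -> d (ld_res s) = 0.

(** By [unramified_approx] the generator is locally a unit times an element of the field of [th], so
    [kum] applies with [N = 1]. *)
Lemma good_bound (D : localData R Kb) (na : nonarch (ld_place D)) d i X : ecocycle p eW d -> kum d i X ->
 unram_at na d -> OD na (ld_emb D (t%:R / X)).
Proof.
move=> cd [X0 OX uX hX] [r rO hr].
have res (s : absGal (ld_bar D)) : s (ld_emb D th) = ld_emb D th -> ld_res s th = th.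
 by move=> h; apply: (fmorph_inj (ld_emb D)); rewrite ld_resE.
have [|||g [cn c1 c2]] := @unramified_approx R K Kb D na p th X p0 th0 X0.
- by move=> s hs z; exact: local_unity_fixed.
- move=> s hs; rewrite -ld_resE uX ?res // -!rmorphXn exprMn exprVn etap ?invr1 ?mul1r //.
 by have [dt _ _] := cd.
- exists r => // s hs fs; rewrite -ld_resE uX ?res // hr // eta0 invr1 mul1r //.
set c := _.[_] in cn c1 c2.
have Lc : Lk th c.
 move=> s hs; rewrite /c -{2}hs -[in RHS](gal_oneE th) horner_coef rmorph_sum horner_coef.
 apply: eq_bigr => j _; rewrite rmorphM rmorphXn coef_map /= gal_fix; congr (_ * _).
have := hX (pull (ld_emb D) (OD na)) 1 c^-1; rewrite mulr1; apply.
- by move=> s hs; rewrite fmorphV Lc.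
- by rewrite invr_eq0.
- by rewrite mulrC.
by rewrite div1r invfM invrK.
Qed.

Lemma integral_bound d i X : ecocycle p eW d -> kum d i X ->
 (forall (D : localData R Kb) (na : nonarch (ld_place D)), OD na M%:R^-1 -> unram_at na d) ->
 algint Kb (t%:R * M%:R / X).
Proof.
move=> cd kd ur; apply: contrapT => /(@detection R)[D [na]]; apply.
have [h|h] := pselect (OD na M%:R^-1).
 rewrite mulrAC rmorphM rmorph_nat; apply: (@srM _ (OD na)); last exact: sr_nat.
 exact: (good_bound cd kd (ur D na h)).
apply: (@bad_bound d i X (pull (ld_emb D) (OD na)) kd).
by apply/pull_vm; rewrite rmorph_nat -[M%:R]invrK; exact: vinv_vm.
Qed.

Variables (oK : seq Kb) (g : Kb -> G) (lV : seq (ecpt W)).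
Hypotheses (hoK : forall s : G, s th \in oK) (gth : forall y, y \in oK -> g y th = y)
 (hlV : forall x, tor x -> x \in lV).
Let gj (j : 'I_(size oK)) := g (nth th oK j).
Let gu (s : G) : exists (j : 'I_(size oK)) (u : G), u th = th /\ s = gal_mul (gj j) u.
Proof.
have so := hoK s; have jl : (index (s th) oK < size oK)%N by rewrite index_mem.
have [j e] : exists j, gj j th = s th by exists (Ordinal jl); rewrite /gj /= nth_index // gth.
exists j, (gal_mul (gal_inv (gj j)) s); split; first by rewrite gal_mulE -e gal_invK.
by rewrite gal_mulA gal_mulV gal_1mul.
Qed.
Let rep_colour (d : G -> ecpt W) : {ffun 'I_(size oK) -> 'I_(size lV).+1} :=
 [ffun j => inord (index (d (gj j)) lV)].
Let rep_eq d d' : ecocycle p eW d -> ecocycle p eW d' -> rep_colour d = rep_colour d' -> forall j, d (gj j) = d' (gj j).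
Proof.
move=> [dt _ _] [dt' _ _] e j; have := congr1 (fun h : {ffun 'I_(size oK) -> 'I_(size lV).+1} => val (h j)) e.
rewrite /= !ffunE !inordK ?ltnS ?index_size // => ei.
by rewrite -(nth_index 0 (hlV (dt (gj j)))) ei nth_index // hlV.
Qed.

Let Xs : exists X : (G -> ecpt W) -> 'I_m -> Kb, forall d, ecocycle p eW d -> forall i, kum d i (X d i).
Proof.
suff /choice[X hX] : forall d, exists X : 'I_m -> Kb, ecocycle p eW d -> forall i, kum d i (X i) by exists X.
move=> d.
by have [/kummer_ex[X hX]|nd] := pselect (ecocycle p eW d); [exists X|exists (fun=> 0)].
Qed.

(** On the stabiliser of [th] the colours of the Kummer generators determine every [eta i] of [d],
    by [finite_classes]. The values at coset representatives, taken in the finite set of torsion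
    points, are part of the colour. *)
Lemma selmer_colour : exists (C : finType) (f : (G -> ecpt W) -> C), forall d d',
 ecocycle p eW d -> ecocycle p eW d' ->
 (forall (D : localData R Kb) (na : nonarch (ld_place D)), OD na M%:R^-1 -> unram_at na d) ->
 (forall (D : localData R Kb) (na : nonarch (ld_place D)), OD na M%:R^-1 -> unram_at na d') ->
 f d = f d' -> d =1 d'.
Proof.
have [X hX] := Xs; have [q [f hf]] := fin M0.
exists (prod {ffun 'I_(size oK) -> 'I_(size lV).+1} {ffun 'I_m -> 'I_q.+1}),
 (fun d => (rep_colour d, [ffun i => f (X d i)])) => d d' cd cd' ud ud' [er ef] s.
have [dt dM _] := cd; have [dt' dM' _] := cd'.
have on (u : G) : u th = th -> d u = d' u.
 move=> hu; apply/eqP; rewrite -subr_eq0; apply/eqP/eta_inj => [|i]; first exact: torB.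
 have [X0 OX uX _] := hX d cd i; have [X0' OX' uX' _] := hX d' cd' i.
 have LX (e : G -> ecpt W) Z : (forall s, tor (e s)) -> (forall u : G, u th = th -> u Z = (eta i (e u))^-1 * Z) -> Lk th (Z ^+ p).
  by move=> et h v hv; rewrite rmorphXn h // exprMn exprVn etap // invr1 mul1r.
 have /(_ u hu) : Lk th (X d i / X d' i).
  apply: (hf _ _ X0 X0' OX OX' (LX d _ dt uX) (LX d' _ dt' uX')
   (integral_bound cd (hX d cd i) ud) (integral_bound cd' (hX d' cd' i) ud')).
  by have := congr1 (fun h : {ffun _ -> _} => h i) ef; rewrite !ffunE.
 rewrite fmorph_div uX // uX' // etaB // => h.
 have e0 := eta_neq0 i (dt u); have e0' := eta_neq0 i (dt' u).
 have /(mulIf (mulf_neq0 X0 (invr_neq0 X0'))) : eta i (d u) / eta i (d' u) * (X d i / X d' i) = 1 * (X d i / X d' i).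
  by rewrite mul1r -{1}h; field; rewrite e0 e0' X0'.
 by [].
have [j [u [hu ->]]] := gu s; rewrite dM dM' (rep_eq cd cd' er) on //.
Qed.

Variables (n : nat) (e : 'I_n -> Kb).
Hypothesis zs : forall x, Lk th x -> zspan e x.

(** If the [p]-th powers of two Kummer generators are congruent to high order above [M], their ratio
    is near a [p]-th root of unity at each such place. These roots are the coordinates of a torsion
    point [T0], and the cocycles differ locally by the coboundary of [- T0]. *)
Lemma bad_colour : exists (C : finType) (f : (G -> ecpt W) -> C), forall d d',
 ecocycle p eW d -> ecocycle p eW d' -> f d = f d' ->
 forall (D : localData R Kb) (na : nonarch (ld_place D)), vm (OD na) M%:R ->
 exists2 T, tor T & forall s : absGal (ld_bar D), d (ld_res s) - d' (ld_res s) = ld_res s @@ T - T.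
Proof.
have [X hX] := Xs.
have gtor s x : tor x -> tor (s @@ x) by move=> h; rewrite -gptMn h gpt0.
(* The character [eta i] conjugated by the coset representative [gj j]; it is a product of powers of
   the [eta l], with exponents [nn (j, i)]. *)
pose hh j i x := gj j (eta i (gal_inv (gj j) @@ x)).
have hhp j i x : tor x -> hh j i x ^+ p = 1.
 by move=> hx; rewrite /hh -rmorphXn etap ?rmorph1 //; exact: gtor.
have hhD j i x y : tor x -> tor y -> hh j i (x + y) = hh j i x * hh j i y.
 by move=> hx hy; rewrite /hh gptD etaD ?rmorphM //; exact: gtor.
have /choice[nn hnn] : forall ji : 'I_(size oK) * 'I_m, exists k : 'I_m -> nat,
  forall x, tor x -> hh ji.1 ji.2 x = \prod_i eta i x ^+ k i.
 by move=> [j i]; apply: eta_hom => [x|x y]; [exact: hhp|exact: hhD].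
pose tM : Kb := t%:R * M%:R; have tM0 : tM != 0 by rewrite mulf_neq0.
pose nmx := (\sum_(ji : 'I_(size oK) * 'I_m) \sum_l nn ji l)%N.
(* On the stabiliser of [th] the conjugate of [X] transforms by the inverse of [hh], and the second
   factor by [hh]. So [w] lies in the field of [th] and can be coloured. *)
pose w d (ji : 'I_(size oK) * 'I_m) := gj ji.1 (X d ji.2) * \prod_l (tM / X d l) ^+ nn ji l.
pose A x := Lk th x /\ forall V : valring Kb, vm V M%:R -> V x.
have A0 : A 0 by split=> [s _|V _]; rewrite ?rmorph0 //; exact: sr0.
have AB x y : A x -> A y -> A (x - y).
 move=> [h1 h2] [h3 h4]; split=> [s hs|V hV]; first by rewrite rmorphB h1 ?h3.
 by apply: srB; [exact: h2|exact: h4].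
pose pM := (p * M)%N.
have pMn : pM%:R != 0 :> Kb by apply: pos_natr0; rewrite ?muln_gt0 ?p0.
(* [(t M)^p] pays for the division by [X^p], and [(t M)^(nmx + 1)] for the division by [w]. The
   factor [pM^p] leaves a congruence modulo [pM] after extraction of a [p]-th root. *)
pose N := ((t * M) ^ (p + nmx + 1) * pM ^ p)%N.
have N0 : (0 < N)%N by rewrite muln_gt0 !expn_gt0 !muln_gt0 t0 M0 p0.
have [C [f hf]] := @modular_colour Kb A n e c0 A0 AB (fun x h => zs h.1) N N0.
exists (prod {ffun 'I_(size oK) -> 'I_(size lV).+1} (prod {ffun 'I_m -> C} {ffun 'I_(size oK) * 'I_m -> C})),
 (fun d => (rep_colour d, ([ffun i => f (X d i ^+ p)], [ffun ji => f (w d ji)]))) => d d' cd cd' [er ex ew] D na vM.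
have [dt dM _] := cd; have [dt' dM' _] := cd'.
have Xp b : ecocycle p eW b -> forall i, A (X b i ^+ p).
 move=> cb i; have [X0 OX uX _] := hX b cb i; have [bt _ _] := cb; split=> [u hu|V _].
  by rewrite rmorphXn uX // exprMn exprVn etap // invr1 mul1r.
 by apply: srX; exact: valring_algint.
have gO b : ecocycle p eW b -> forall ji, algint Kb (gj ji.1 (X b ji.2)).
 move=> cb ji; have [_ OX _ _] := hX b cb ji.2.
 by apply: integ_map OX => _ [z ->]; exists z; rewrite rmorph_int.
have conj b j (u : G) : ecocycle p eW b -> u th = th ->
  b (gal_mul (gal_inv (gj j)) (gal_mul u (gj j))) = gal_inv (gj j) @@ b u.
 move=> cb hu; have [bt bM _] := cb; rewrite bM bM (thV hu (bt _)) gptD addrCA.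
 have := bM (gal_inv (gj j)) (gj j); rewrite gal_Vmul (ecocycle1 cb) => <-; exact: addr0.
have Aw b : ecocycle p eW b -> forall ji, A (w b ji).
 move=> cb [j i]; have [bt _ _] := cb; split=> [u hu|V hV]; last first.
  apply: srM; first exact: valring_algint (gO b cb (j, i)).
  by apply: sr_prod => l _; apply: srX; exact: bad_bound (hX b cb l) hV.
 pose u' := gal_mul (gal_inv (gj j)) (gal_mul u (gj j)).
 have hu' : u' th = th by rewrite /u' !gal_mulE nrm // gal_invK.
 have e1 : u (gj j (X b i)) = (hh j i (b u))^-1 * gj j (X b i).
  have -> : u (gj j (X b i)) = gj j (u' (X b i)) by rewrite /u' !gal_mulE gal_invVK.
  have [_ _ uX _] := hX b cb i; rewrite uX // rmorphM fmorphV conj //.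
 have e2 : u (\prod_l (tM / X b l) ^+ nn (j, i) l) = hh j i (b u) * \prod_l (tM / X b l) ^+ nn (j, i) l.
  rewrite (hnn (j, i)) // -big_split rmorph_prod; apply: eq_bigr => l _ /=.
  have [_ _ uX _] := hX b cb l; rewrite rmorphXn fmorph_div uX // -exprMn /tM rmorphM !rmorph_nat.
  by rewrite invfM invrK; congr (_ ^+ _); ring.
 have h0 : hh j i (b u) != 0.
  exact: expr1_neq0 (hhp j i _ (bt u)).
 by rewrite /w /= rmorphM e1 e2 mulrACA mulVf // mul1r.
pose V := pull (ld_emb D) (OD na).
have vV : vm V M%:R by apply/pull_vm; rewrite rmorph_nat.
have VtM b i : ecocycle p eW b -> V (tM / X b i) by move=> cb; exact: bad_bound (hX b cb i) vV.
have VtMg b j i : ecocycle p eW b -> V (tM / gj j (X b i)).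
 move=> cb; have v1 : vm (pull (gj j) V) M%:R by apply/pull_vm; rewrite rmorph_nat.
 have -> : tM / gj j (X b i) = gj j (tM / X b i) by rewrite /tM fmorph_div rmorphM !rmorph_nat.
 exact: (@bad_bound b i (X b i) (pull (gj j) V) (hX b cb i) v1).
have VX b i : ecocycle p eW b -> V (X b i) by move=> cb; have [_ OX _ _] := hX b cb i; exact: valring_algint.
have Xn b i : ecocycle p eW b -> X b i != 0 by move=> cb; have [] := hX b cb i.
have VtM' : V tM by rewrite /tM -natrM; exact: sr_nat.
have NE : N%:R = tM ^+ (p + nmx + 1) * pM%:R ^+ p :> Kb by rewrite natrM !natrX natrM.
pose y i := X d i / X d' i.
(* Congruence modulo [p M] and not just [p]: as [M] is in the maximal ideal, congruent [p]-th roots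
   of unity are then equal. *)
pose cg a b := V ((a - b) / pM%:R).
have [z pz] := prim_root_ex p0 (pos_natr0 c0 p0 : p%:R != 0 :> Kb).
have zk k : (z ^+ k) ^+ p = 1 by rewrite -exprM mulnC exprM (prim_expr_order pz) expr1n.
have /choice[k hk] : forall i, exists k : nat, cg (y i) (z ^+ k).
 move=> i; apply: (near_unity pz pMn); rewrite /y expr_div_n.
 apply: (@ratio_near_one _ _ _ _ (tM ^+ (p + nmx + 1)));
  [by rewrite expf_neq0 ?Xn|exact: expf_neq0|exact: (expf_neq0 p pMn)|rewrite -NE|].
  have h : f (X d i ^+ p) = f (X d' i ^+ p).
   by have := congr1 (fun h : {ffun _ -> _} => h i) ex; rewrite !ffunE.
  by have [_] := hf _ _ (Xp d cd i) (Xp d' cd' i) h; apply.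
 have -> : tM ^+ (p + nmx + 1) / X d' i ^+ p = tM ^+ (nmx + 1) * (tM / X d' i) ^+ p.
  by rewrite -addnA addnC exprD expr_div_n mulrA.
 by apply: srM; apply: srX => //; exact: VtM.
pose eps i := z ^+ k i.
have [T0 hT0 eT0] := eta_surj (fun i => zk (k i)).
have cgr a : cg a a by rewrite /cg subrr mul0r; exact: sr0.
have cgM a a' b b' : V a -> V b' -> cg a a' -> cg b b' -> cg (a * b) (a' * b').
 move=> Va Vb h1 h2; rewrite /cg; have -> : (a * b - a' * b') / pM%:R = a * ((b - b') / pM%:R) + b' * ((a - a') / pM%:R).
  by field; rewrite pMn.
 by apply: srD; exact: srM.
have Veps i : V (eps i) by exact: unity_O p0 (zk _).
have VpM a b : cg a b -> V b -> V a.
 move=> h Vb; rewrite -(subrK b a) -(divfK pMn (a - b)); apply: srD => //; apply: srM => //; exact: sr_nat.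
have Vy i : V (y i) by exact: VpM (hk i) (Veps i).
have sep a b : a ^+ p = 1 -> b ^+ p = 1 -> cg a b -> a = b.
 move=> ha hb h; apply/eqP/negP => /negP ab; have h2 := unity_separated V p0 ha hb ab.
 apply: (vmP Mn _ vV); have -> : M%:R^-1 = (a - b) / pM%:R * (p%:R / (a - b)).
  by rewrite natrM; field; rewrite Mn subr_eq0 ab (pos_natr0 c0 p0).
 exact: srM.
exists (- T0); first by rewrite mulNrn hT0 oppr0.
move=> s; set sg := ld_res s; have [j [u [hu sE]]] := gu sg.
have Vs x : V x -> V (sg x) by rewrite /V /= /sg ld_resE; exact: OD_gal.
pose ee v := d v - d' v; have et v : tor (ee v) by exact: torB.
have ej : ee (gj j) = 0 by rewrite /ee (rep_eq cd cd' er) subrr.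
have es : ee sg = gj j @@ ee u by rewrite /ee sE dM dM' gptB (rep_eq cd cd' er) opprD addrACA subrr add0r.
have eu : ee u = gal_inv (gj j) @@ ee sg by rewrite es gptK.
have sgT : sg @@ T0 = gj j @@ T0 by rewrite sE gptM (thV hu hT0).
(* Apply [sg] to the congruence of [y i] and [eps i]. The right side becomes [hh j i (sg T0)]. The
   left becomes [gj (y i)] divided by [hh j i (ee sg)], and through [w] the conjugate [gj (y i)] is
   congruent to a product of powers of the [y l], thus to [hh j i T0]. Congruent roots of unity are
   equal. *)
have main i : hh j i (T0 - ee sg - sg @@ T0) = 1.
 have hs0 : tor (sg @@ T0) by exact: gtor.
 have c1 : cg (sg (y i)) (sg (eps i)).
  by have := Vs _ (hk i); rewrite fmorph_div rmorphB rmorph_nat.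
 have s1 : sg (eps i) = hh j i (sg @@ T0).
  have ue : u (eps i) = eps i by exact: (thmu hu (zk _)).
  by rewrite /hh sgT gptK eT0 sE gal_mulE ue.
 have s2 : sg (y i) = (hh j i (ee sg))^-1 * gj j (y i).
  rewrite sE gal_mulE /y fmorph_div; have [_ _ uX _] := hX d cd i; have [_ _ uX' _] := hX d' cd' i.
  rewrite uX // uX' // /hh -sE -eu /ee etaB // -!fmorphV -rmorphM; congr (gj j _).
  have e0 := eta_neq0 i (dt u); have e0' := eta_neq0 i (dt' u); have X0' := Xn d' i cd'.
  by field; rewrite e0 e0' X0'.
 have cw : cg (w d (j, i) / w d' (j, i)) 1.
  have w0 : w d' (j, i) != 0.
   rewrite mulf_neq0 ?fmorph_eq0 ?Xn //; apply/prodf_neq0 => l _.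
   by rewrite expf_neq0 // mulf_neq0 ?invr_eq0 ?Xn.
  apply: (@ratio_near_one _ _ _ _ (tM ^+ (p + nmx + 1) * pM%:R ^+ p.-1));
   [exact: w0|by rewrite mulf_neq0 // expf_neq0|exact: pMn| |].
   have h : f (w d (j, i)) = f (w d' (j, i)).
    by have := congr1 (fun h : {ffun _ -> _} => h (j, i)) ew; rewrite !ffunE.
   have [_] := hf _ _ (Aw d cd (j, i)) (Aw d' cd' (j, i)) h; rewrite NE => /(_ V vV).
   by rewrite -mulrA -exprSr prednK.
  pose sn := (\sum_l nn (j, i) l)%N.
  have snm : (sn <= nmx)%N by rewrite /nmx (bigD1 (j, i)) //= leq_addr.
  have -> : tM ^+ (p + nmx + 1) * pM%:R ^+ p.-1 / w d' (j, i) =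
    (tM ^+ (p + (nmx - sn)) * pM%:R ^+ p.-1) * (tM / gj j (X d' i)) * \prod_l X d' l ^+ nn (j, i) l.
   have e1 : \prod_l (tM / X d' l) ^+ nn (j, i) l = tM ^+ sn / \prod_l X d' l ^+ nn (j, i) l.
    rewrite /sn -prodrXr -prodf_div; apply: eq_bigr => l _; by rewrite expr_div_n.
   have e2 : (p + nmx + 1 = p + (nmx - sn) + sn + 1)%N by lia.
   have Pn : \prod_l X d' l ^+ nn (j, i) l != 0 by apply/prodf_neq0 => l _; rewrite expf_neq0 ?Xn.
   rewrite /w e1 e2 !exprD expr1 /=; have g0 : gj j (X d' i) != 0 by rewrite fmorph_eq0 Xn.
   have t1 : tM ^+ sn != 0 by rewrite expf_neq0.
   move: (tM ^+ p) (tM ^+ (nmx - sn)) (tM ^+ sn) t1 => q1 q2 q3 t1.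
   by field; rewrite Pn t1 g0.
  apply: srM; first apply: srM.
  - by apply: srM; apply: srX => //; exact: sr_nat.
  - exact: VtMg.
  by apply: sr_prod => l _; apply: srX; exact: VX.
 have s3 : gj j (y i) = w d (j, i) / w d' (j, i) * \prod_l y l ^+ nn (j, i) l.
  have e1 b : ecocycle p eW b -> \prod_l (tM / X b l) ^+ nn (j, i) l != 0.
   by move=> cb; apply/prodf_neq0 => l _; rewrite expf_neq0 // mulf_neq0 ?invr_eq0 ?Xn.
  have -> : \prod_l y l ^+ nn (j, i) l = (\prod_l (tM / X d' l) ^+ nn (j, i) l) / \prod_l (tM / X d l) ^+ nn (j, i) l.
   rewrite -prodf_div; apply: eq_bigr => l _; rewrite -expr_div_n /y; congr (_ ^+ _).
   by field; rewrite tM0 !Xn.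
  rewrite /y fmorph_div /w /=; have g0 : gj j (X d' i) != 0 by rewrite fmorph_eq0 Xn.
  have := e1 d cd; have := e1 d' cd'; move: (\prod_l _) (\prod_l _) => q1 q2 n1 n2.
  by field; rewrite n1 n2 g0.
 have c2 : cg (\prod_l y l ^+ nn (j, i) l) (\prod_l eps l ^+ nn (j, i) l).
  suff [] : [/\ V (\prod_l y l ^+ nn (j, i) l), V (\prod_l eps l ^+ nn (j, i) l) &
   cg (\prod_l y l ^+ nn (j, i) l) (\prod_l eps l ^+ nn (j, i) l)] by [].
  apply: (big_ind2 (fun a b => [/\ V a, V b & cg a b])) => [|a a' b b' [v1 v2 v3] [v4 v5 v6]|l _].
  - by split=> //; exact: sr1.
  - by split; [exact: srM|exact: srM|exact: cgM].
  elim: (nn (j, i) l) => [|q [v1 v2 v3]]; first by rewrite !expr0; split=> //; exact: sr1.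
  by rewrite !exprS; split; [exact: srM|exact: srM|apply: cgM => //; exact: hk].
 have s4 : \prod_l eps l ^+ nn (j, i) l = hh j i T0.
  by rewrite (hnn (j, i)) //; apply: eq_bigr => l _; rewrite eT0.
 have h1 := hhp j i _ (et sg); have h2 := hhp j i _ hT0; have h3 := hhp j i _ hs0.
 have a0 (a : Kb) : a ^+ p = 1 -> a != 0.
  exact: expr1_neq0.
 have VP : V (\prod_l eps l ^+ nn (j, i) l) by apply: sr_prod => l _; apply: srX.
 have eqn : (hh j i (ee sg))^-1 * hh j i T0 = hh j i (sg @@ T0).
  apply: sep; rewrite ?exprMn ?exprVn ?h1 ?h2 ?h3 ?invr1 ?mulr1 //.
  have c3 : cg (gj j (y i)) (hh j i T0).
   rewrite s3 -s4 -[X in cg _ X]mul1r; apply: cgM => //.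
   by apply: VpM cw _; exact: sr1.
  have VI : V (hh j i (ee sg))^-1 by apply: (unity_O V p0); rewrite exprVn h1 invr1.
  have c4 : cg (sg (y i)) ((hh j i (ee sg))^-1 * hh j i T0).
   by rewrite s2; apply: cgM => //; exact: unity_O p0 h2.
  rewrite s1 in c1; rewrite /cg; have -> : ((hh j i (ee sg))^-1 * hh j i T0 - hh j i (sg @@ T0)) / pM%:R =
   (sg (y i) - hh j i (sg @@ T0)) / pM%:R - (sg (y i) - (hh j i (ee sg))^-1 * hh j i T0) / pM%:R.
   by rewrite -mulrBl opprB addrACA [X in _ / _ = (_ + X) / _]addrC; congr (_ / _); ring.
  exact: srB.
 have hhB a b : tor a -> tor b -> hh j i (a - b) = hh j i a / hh j i b.
  move=> ha hb; apply: (mulIf (a0 _ (hhp j i _ hb))); rewrite -hhD ?subrK ?divfK ?a0 ?hhp //; exact: torB.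
 rewrite hhB ?torB // hhB // [X in X / _]mulrC eqn divff // a0 //.
have : gal_inv (gj j) @@ (T0 - ee sg - sg @@ T0) = 0.
 apply: eta_inj => [|i]; first exact: (gtor _ _ (torB (torB hT0 (et sg)) (gtor _ _ hT0))).
 by apply: (fmorph_inj (gj j)); rewrite rmorph1 -[LHS]/(hh j i _) main.
move=> /(congr1 (gpt eW (gj j))); rewrite gptVK gpt0 => /eqP.
by rewrite subr_eq0 => /eqP h; rewrite gptN opprK -h opprB subrK.
Qed.
End Colourings.

(** * Selmer groups *)

Lemma goodcurve_ex (K : fieldExtType rat) (E : ellipticCurve K) (L : closedFieldType)
 (e : {rmorphism K -> L}) : exists W : goodcurve L, gc_eqn W = map_weierstrass e E.
Proof.
have d0 : wdisc (map_weierstrass e E) != 0.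
 have -> : wdisc (map_weierstrass e E) = e (wdisc E).
  by rewrite /wdisc /wb2 /wb4 /wb6 /wb8 /= !(rmorphD, rmorphN, rmorphM, rmorphXn, rmorph_nat); ring.
 by rewrite fmorph_eq0 ec_disc_neq0.
by exists (GoodCurve (fmorph_char0 e (@rat_alg_char0 K)) d0).
Qed.

Section LocalPoints.
Variables (R : realType) (K : fieldExtType rat) (Kb : algClosure K) (E : weierstrass K) (p : nat).
Variables (W : goodcurve Kb) (eW : gc_eqn W = map_weierstrass (ac_emb Kb) E) (D : localData R Kb).
Local Notation Fb := (ld_bar D).
Local Notation ED := (map_weierstrass (co_emb (ld_field D)) E).
Variables (WD : goodcurve Fb) (eWD : gc_eqn WD = map_weierstrass (ac_emb Fb) ED).
Local Notation i := (ld_emb D).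

Lemma map_WD : map_weierstrass i W = WD.
Proof. by rewrite eW eWD /map_weierstrass /= !ld_compat. Qed.
Lemma lft_on (P : ecpt W) : on_curve WD (map_point i P).
Proof. by rewrite -{1}map_WD map_on_curve pt_on. Qed.
Definition lft (P : ecpt W) : ecpt WD := Ecpt (lft_on P).

Lemma lftD P Q : lft (P + Q) = lft P + lft Q.
Proof. by apply: pt_inj; rewrite /= map_paddE map_WD. Qed.
Lemma lftN P : lft (- P) = - lft P.
Proof. by apply: pt_inj; rewrite /= map_poppE map_WD. Qed.
Lemma lftB P Q : lft (P - Q) = lft P - lft Q. Proof. by rewrite lftD lftN. Qed.
Lemma lft0 : lft 0 = 0. Proof. exact: pt_inj. Qed.
Lemma lftMn P n : lft (P *+ n) = lft P *+ n.
Proof. by elim: n => [|n IH]; rewrite ?mulr0n ?lft0 // !mulrS lftD IH. Qed.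
Lemma lft_inj : injective lft.
Proof.
move=> P Q /(congr1 (@pt _ _)) /= h; apply: pt_inj; move: h.
by case: (pt P) (pt Q) => [|x y] [|x' y'] //= [/fmorph_inj -> /fmorph_inj ->].
Qed.
Lemma lft_gal (s : absGal Fb) P : lft (gpt eW (ld_res s) P) = gpt eWD s (lft P).
Proof. by apply: pt_inj; rewrite /=; case: (pt P) => //= x y; rewrite !ld_resE. Qed.
Lemma sq_lft P : sq (lft P) = map_point i (sq P).
Proof.
have e1 : i (wa1 W) = wa1 WD by have := congr1 (@wa1 Fb) map_WD.
have e3 : i (wa3 W) = wa3 WD by have := congr1 (@wa3 Fb) map_WD.
rewrite /sq /sqpt /=; case: (pt P) => //= x y.
by rewrite rmorphD rmorphM rmorphD rmorphM fmorphV rmorph_nat e1 e3.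
Qed.

Lemma root_descends (q : {poly Kb}) x : q != 0 -> (map_poly i q).[x] = 0 -> exists y, x = i y.
Proof.
move=> q0; have [r ->] := closed_field_poly_normal q.
rewrite map_polyZ hornerZ => /eqP; rewrite mulf_eq0 fmorph_eq0 lead_coef_eq0 (negbTE q0) /=.
by rewrite map_prod_XsubC horner_prod prodf_seq_eq0 => /hasP[z _ /=]; rewrite !hornerE subr_eq0 => /eqP ->; exists z.
Qed.

(** Abscissas of [p]-torsion points are roots of [Z], a polynomial over [K], so they already come
    from [Kb]. *)
Lemma torsion_descends (P : ecpt WD) : (0 < p)%N -> P *+ p = 0 -> exists2 Q, Q *+ p = 0 & lft Q = P.
Proof.
move=> p0 Pp; have [d [a [A [B [Z [a0 lA lB Z0 h]]]]]] := mulpoly_exists E (@rat_alg_char0 K) p0.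
suff [Q e] : exists Q, lft Q = P by exists Q => //; apply: lft_inj; rewrite lftMn e Pp lft0.
case: (sq_cases P) => [->|[x [y eP]]]; first by exists 0; exact: lft0.
pose em := ac_emb Fb \o co_emb (ld_field D).
have Zx : (map_poly em Z).[x] = 0.
 apply/eqP/negP => /negP Zx.
 have [_ [y' e']] := h Fb em WD eWD P x y eP Zx; by rewrite Pp sq0 in e'.
have [x0 ex] : exists x0, x = i x0.
 apply: (@root_descends (map_poly (ac_emb Kb) Z)); first by rewrite map_poly_eq0.
 by rewrite -[RHS]Zx -map_poly_comp; congr (_.[_]); apply: eq_map_poly => c /=; rewrite ld_compat.
have [Q0 [y0 eQ]] := sq_ex W x0.
have e0 : sq (lft Q0) = Aff x (i y0) by rewrite sq_lft eQ /= ex.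
case: (sq_same e0 eP) => [->|->]; first by exists Q0.
by exists (- Q0); rewrite lftN.
Qed.

Lemma ld_resM (s t : absGal Fb) : ld_res (gal_mul s t) = gal_mul (ld_res s) (ld_res t).
Proof. by apply: gal_ext => x; apply: (fmorph_inj i); rewrite gal_mulE !ld_resE gal_mulE. Qed.

Lemma local_cocycle d : ecocycle p eW d -> ecocycle p eWD (fun s => lft (d (ld_res s))).
Proof.
move=> [dt dM dc]; split=> [s|s t|s].
- by rewrite -lftMn dt lft0.
- by rewrite ld_resM dM lftD lft_gal.
have [r hr] := dc (ld_res s); exists [seq i x | x <- r] => t h; rewrite (hr (ld_res t)) // => x xr.
by apply: (fmorph_inj i); rewrite !ld_resE; apply: h; exact: map_f.
Qed.
End LocalPoints.

Section Coboundary.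
Variables (K : fieldType) (Kb : algClosure K) (E : weierstrass K) (p : nat).
Variables (W : goodcurve Kb) (eW : gc_eqn W = map_weierstrass (ac_emb Kb) E).

Lemma coboundary_cocycle T : T *+ p = 0 -> ecocycle p eW (fun s => gpt eW s T - T).
Proof.
move=> hT; split=> [s|s t|s].
- by rewrite mulrnBl -gptMn hT gpt0 subrr.
- by rewrite gptB gptM [RHS]addrC subrKA.
exists (if sq T is Aff x y then [:: x; y] else [::]) => t h; congr (_ - _); apply: gpt_agree => x y e.
by move: h; rewrite e => h; split; rewrite -h // ?inE ?eqxx ?orbT.
Qed.
Lemma cocycleB d d' : ecocycle p eW d -> ecocycle p eW d' -> ecocycle p eW (d - d').
Proof.
move=> [dt dM dc] [dt' dM' dc']; split=> [s|s t|s]; rewrite ?fctE.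
- by rewrite mulrnBl dt dt' subrr.
- by rewrite dM dM' gptB opprD addrACA.
have [r hr] := dc s; have [r' hr'] := dc' s; exists (r ++ r') => t h.
by rewrite (hr t) ?(hr' t) // => x xr; apply: h; rewrite mem_cat xr ?orbT.
Qed.
End Coboundary.

Section CharacterRamification.
Variables (R : realType) (K : fieldExtType rat) (Kb : algClosure K) (p : nat) (chi : character Kb p).

Lemma chi1 : (0 < p)%N -> chi (gal_one Kb) = 1.
Proof.
move=> p0; have h0 : chi (gal_one Kb) != 0.
 exact: expr1_neq0 (ch_mu chi (gal_one Kb)).
by apply: (mulfI h0); rewrite -ch_mul gal_mul1 mulr1.
Qed.

(** Near 1 the character depends on a finite list [r]. Outside [N] the inverses of the differences
    between its elements and their conjugates are integral, so fixing residues means fixing [r]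
    itself. *)
Lemma character_unramified : (0 < p)%N -> exists2 N, (0 < N)%N & forall (D : localData R Kb) (na : nonarch (ld_place D)),
 OD na N%:R^-1 -> unram (OD na) 1 (fun s : absGal (ld_bar D) => chi (ld_res s)).
Proof.
move=> p0; have [r hr] := ch_cont chi (gal_one Kb).
have /choice[orb ho] : forall x, exists o : seq Kb, forall s : absGal Kb, s x \in o.
 by move=> x; have [o _ h] := orbit_list (fun _ : absGal Kb => True) x; exists o => s; apply/h; exists s.
have [N N0 hN] := away_bar_seq (r ++ flatten [seq [seq (y - x)^-1 | y <- orb x] | x <- r]).
exists N => // D na hO; exists [seq ld_emb D x | x <- r].
 by move=> _ /mapP[x xr ->]; apply: (hN x) => //; rewrite mem_cat xr.
move=> s fs; rewrite (hr (ld_res s)) ?chi1 // => x xr /=.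
apply/esym/eqP/negP => /negP ne.
have h1 : vm (OD na) (ld_emb D (ld_res s x - x)) by rewrite rmorphB ld_resE; apply: fs; exact: map_f.
have h2 : OD na (ld_emb D (ld_res s x - x)^-1).
 apply: (hN (ld_res s x - x)^-1) => //; rewrite mem_cat; apply/orP; right; apply/flattenP.
 exists [seq (y - x)^-1 | y <- orb x]; first by apply/mapP; exists x.
 by apply/mapP; exists (ld_res s x).
apply: vmP h1; first by rewrite fmorph_eq0 subr_eq0.
by rewrite -fmorphV.
Qed.
End CharacterRamification.

Lemma fct_mulrn (T : Type) (U : zmodType) (f : T -> U) n t : (f *+ n) t = f t *+ n.
Proof. by elim: n => [|n IH]; rewrite ?mulr0n // !mulrS fctE IH. Qed.
Lemma fct_sum (T : Type) (U : zmodType) m (f : 'I_m -> T -> U) t : (\sum_i f i) t = \sum_i f i t.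
Proof. by apply: (big_ind2 (fun (u : T -> U) v => u t = v)) => // u v u' v' <- <-. Qed.

Section Selmer.
Variables (R : realType) (K : fieldExtType rat) (Kb : algClosure K) (p : nat) (E : ellipticCurve K).
Variables (W : goodcurve Kb) (eW : gc_eqn W = map_weierstrass (ac_emb Kb) E).
Hypotheses (pp : prime p) (p3 : (3 <= p)%N).
Let p0 : (0 < p)%N := prime_gt0 pp.
Local Notation G := (absGal Kb).
Local Notation tor x := ((x : ecpt W) *+ p = 0).

Definition locg (chi : character Kb p) (D : localData R Kb) (d : G -> ecpt W) :=
 forall (WD : goodcurve (ld_bar D)) (eWD : gc_eqn WD = map_weierstrass (ac_emb (ld_bar D)) (map_weierstrass (co_emb (ld_field D)) E)),
 egamma p eWD (fun s => chi (ld_res s)) (fun s => lft eW eWD (d (ld_res s))).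
Definition sel (chi : character Kb p) (d : G -> ecpt W) := ecocycle p eW d /\ forall D : localData R Kb, locg chi D d.
Definition cob (d : G -> ecpt W) := exists2 T, tor T & d = (fun s => gpt eW s T - T).

Lemma selE chi d : selmer R E chi (fun s => pt (d s)) <-> sel chi d.
Proof.
have psiM (D : localData R Kb) (s t : absGal (ld_bar D)) : chi (ld_res (gal_mul s t)) = chi (ld_res s) * chi (ld_res t).
 by rewrite ld_resM ch_mul.
split=> [[cc h]|[cd h]].
 have [d' cd' e] := cocycle_lift eW cc.
 have cd : ecocycle p eW d by have -> : d = d' by apply/funext => s; apply: pt_inj; rewrite e.
 split=> // D WD eWD; have := h D; rewrite (gammaE _ _ _ (local_cocycle eWD cd)) //.
 - by move=> s; exact: ch_mu.
split; first exact: (cocycle_pt cd).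
move=> D; have [WD eWD] := goodcurve_ex E (ac_emb (ld_bar D) \o co_emb (ld_field D)).
rewrite (gammaE _ _ _ (local_cocycle (eWD : gc_eqn WD = map_weierstrass (ac_emb (ld_bar D)) (map_weierstrass (co_emb (ld_field D)) E)) cd)) //; first exact: h.
by move=> s; exact: ch_mu.
Qed.

Lemma selB chi d d' : sel chi d -> sel chi d' -> sel chi (d - d').
Proof.
move=> [cd h] [cd' h']; split; first exact: cocycleB.
move=> D WD eWD; have := egammaB (h D WD eWD) (h' D WD eWD); congr (egamma _ _ _ _).
by apply/funext => s; rewrite !fctE lftB.
Qed.

Lemma locg_cob chi (D : localData R Kb) d T : tor T -> (forall s : absGal (ld_bar D), d (ld_res s) = gpt eW (ld_res s) T - T) ->
 locg chi D d.
Proof.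
move=> hT h WD eWD.
have -> : (fun s => lft eW eWD (d (ld_res s))) = (fun s => gpt eWD s (lft eW eWD T) - lft eW eWD T).
 by apply/funext => s; rewrite h lftB lft_gal.
apply: egamma_cob => //; rewrite ?p0 // -?lftMn ?hT ?lft0 //; by move=> s; exact: ch_mu.
Qed.

Lemma sel_cob chi d : cob d -> sel chi d.
Proof.
move=> [T hT ->]; split; first exact: coboundary_cocycle.
by move=> D; apply: (locg_cob _ hT).
Qed.

Lemma cob0 : cob 0.
Proof. by exists 0; rewrite ?mul0rn //; apply/funext => s; rewrite gpt0 subrr. Qed.
Lemma cobB d d' : cob d -> cob d' -> cob (d - d').
Proof.
move=> [T hT ->] [T' hT' ->]; exists (T - T'); first by rewrite mulrnBl hT hT' subrr.
by apply/funext => s; rewrite fctE gptB !opprB addrACA [RHS]addrACA; congr (_ + _); exact: addrC.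
Qed.

(** By [arch_two] the image of the local group has order at most 2. For its nontrivial element [sg]
    the cocycle relation gives [sg (d sg) = - d sg], and since [p] is odd one can halve: minus
    [(p + 1) / 2] times [d sg] is the required point. *)
Lemma arch_cob (D : localData R Kb) d : ~ nonarch (ld_place D) -> ecocycle p eW d ->
 exists2 T, tor T & forall s : absGal (ld_bar D), d (ld_res s) = gpt eW (ld_res s) T - T.
Proof.
move=> ar cd; have two := arch_two ar; have [dt dM _] := cd.
have triv (s : absGal (ld_bar D)) : (forall x, s (ld_emb D x) = ld_emb D x) -> ld_res s = gal_one Kb.
 by move=> h; apply: gal_ext => x; apply: (fmorph_inj (ld_emb D)); rewrite ld_resE h.
have [[s0 ns0]|nn] := pselect (exists s0 : absGal (ld_bar D), ~ forall x, s0 (ld_emb D x) = ld_emb D x); last first.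
 exists 0; first exact: mul0rn.
 move=> s; rewrite triv ?(ecocycle1 cd) ?gpt0 ?subrr //.
 by apply: contrapT => h; apply: nn; exists s.
pose sg := ld_res s0.
have s2 : gal_mul sg sg = gal_one Kb.
 rewrite -ld_resM; apply: triv; case: (two (gal_mul s0 s0) s0) => // h; case: ns0 => x.
 by have := h x; rewrite gal_mulE => /fmorph_inj.
have sd : gpt eW sg (d sg) = - d sg.
 by have := dM sg sg; rewrite s2 (ecocycle1 cd) => /eqP; rewrite eq_sym addrC addr_eq0 => /eqP.
pose k := p.+1./2; have kp : (k + k = p.+1)%N.
 have := odd_double_half p.+1; rewrite -addnn /k /=; have -> : odd p = true; last by rewrite add0n.
 by have := p3; case: (even_prime pp) => // ->.
exists (- (d sg *+ k)); first by rewrite mulNrn -mulrnA mulnC mulrnA dt mul0rn oppr0.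
move=> s; case: (two s s0) => [h|h|h].
- by rewrite triv // (ecocycle1 cd) gpt1 subrr.
- by case: ns0.
have -> : ld_res s = sg by apply: gal_ext => x; apply: (fmorph_inj (ld_emb D)); rewrite /sg !ld_resE h.
by rewrite gptN gptMn sd opprK mulNrn opprK -mulrnDr kp mulrS dt addr0.
Qed.

Lemma colour_setup (M : nat) : (0 < M)%N ->
 (exists (C : finType) (f : (G -> ecpt W) -> C), forall d d', ecocycle p eW d -> ecocycle p eW d' ->
  (forall (D : localData R Kb) (na : nonarch (ld_place D)), OD na M%:R^-1 -> unram_at na d) ->
  (forall (D : localData R Kb) (na : nonarch (ld_place D)), OD na M%:R^-1 -> unram_at na d') ->
  f d = f d' -> d =1 d') /\
 (exists (C : finType) (f : (G -> ecpt W) -> C), forall d d', ecocycle p eW d -> ecocycle p eW d' -> f d = f d' ->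
  forall (D : localData R Kb) (na : nonarch (ld_place D)), vm (OD na) M%:R ->
  exists2 T, tor T & forall s : absGal (ld_bar D), d (ld_res s) - d' (ld_res s) = gpt eW (ld_res s) T - T).
Proof.
move=> M0; have c0 := fmorph_char0 (ac_emb Kb) (@rat_alg_char0 K).
have [lV hlV] := torsion_finite eW p0.
have [mu _ hmu] := root_list (p := 'X^p - 1 : {poly Kb}) (monic_neq0 (monicXnsubC 1 p0)).
pose cr (P : ecpt W) : seq Kb := if sq P is Aff x y then [:: x; y] else [::].
have [th [t [[th0 t0] hth nrm [red fin] [n [e zs]]]]] := @field_package K Kb p p0 R (mu ++ flatten [seq cr P | P <- lV]).
have thmu (s : G) : s th = th -> forall z : Kb, z ^+ p = 1 -> s z = z.
 move=> hs z zp; apply: (hth s hs); rewrite mem_cat hmu; apply/orP; left; apply/rootP.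
 by rewrite !hornerE zp subrr.
have thV (s : G) : s th = th -> forall T, tor T -> gpt eW s T = T.
 move=> hs T hT; rewrite -[RHS](gpt1 eW); apply: gpt_agree => x y eT.
 have cx z : z \in cr T -> s z = gal_one Kb z.
  move=> zc; apply: (hth s hs); rewrite mem_cat; apply/orP; right; apply/flattenP.
  by exists (cr T) => //; apply/mapP; exists T => //; exact: hlV.
 by rewrite !cx // /cr eT !inE eqxx ?orbT.
have [m [eta [h1 h2 h3 h4 h5]]] := @dual_basis (ecpt W) p Kb lV pp (pos_natr0 c0 p0) hlV.
have [oK _ hoK] := orbit_list (fun _ : G => True) th.
have /choice[g hg] : forall y, exists s : G, y \in oK -> s th = y.
 move=> y; case: (boolP (y \in oK)) => [/hoK[s _ h]|_]; last by exists (gal_one Kb).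
 by exists s.
have soK (s : G) : s th \in oK by apply/hoK; exists s.
split.
 exact: (selmer_colour R pp M0 th0 thV thmu red fin h1 h2 h3 soK hg hlV).
exact: (bad_colour R pp M0 th0 t0 thV thmu nrm red h1 h2 h3 h4 h5 soK hg hlV zs).
Qed.

(** Only finiteness is wanted, so [M] may depend on [chi]: outside it the curve is good and [chi]
    unramified, hence Selmer cocycles are unramified and the first colouring separates them. *)
Lemma selmer_dim chi : exists m (a : 'I_m -> G -> ecpt W), [/\ forall i, sel chi (a i),
  forall c : 'I_m -> int, cob (\sum_i a i *~ c i) -> forall i, (p%:Z %| c i)%Z &
  forall d, sel chi d -> exists c : 'I_m -> 'I_p, cob (d - \sum_i a i *+ c i)].
Proof.
have [N N0 hN] := good_place R Kb E pp p3.
have [N' N'0 hN'] := character_unramified R chi p0.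
have M0 : (0 < N * N')%N by rewrite muln_gt0 N0.
have [[C [f hf]] _] := colour_setup M0.
have c0 (D : localData R Kb) := @Fb_char0 R K Kb D.
have unr d : sel chi d -> forall (D : localData R Kb) (na : nonarch (ld_place D)), OD na (N * N')%:R^-1 -> unram_at na d.
 move=> [cd h] D na hO; have o1 : OD na N%:R^-1 by apply: O_invM hO; exact: pos_natr0 (c0 D) N'0.
 have o2 : OD na N'%:R^-1 by rewrite mulnC in hO; apply: O_invM hO; exact: pos_natr0 (c0 D) N0.
 have [WD eWD] := goodcurve_ex E (ac_emb (ld_bar D) \o co_emb (ld_field D)).
 have [r rO hr] : unram (OD na) 0 (fun s => lft eW eWD (d (ld_res s))).
  apply/(hN D na WD eWD o1 _ (fun s => chi (ld_res s)) _ _ _ (local_cocycle eWD cd)).1 => //.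
  - by move=> s t; rewrite ld_resM ch_mul.
  - by move=> s; exact: ch_mu.
  - exact: hN'.
  - exact: h.
 by exists r => // s fs; apply: (@lft_inj _ _ _ _ _ eW D WD eWD); rewrite hr // lft0.
apply: (@finite_basis (G -> ecpt W) p (sel chi) cob C f) => //.
- exact: sel_cob cob0.
- exact: selB.
- move=> d d' sd sd' e; have -> : d - d' = 0; last exact: cob0.
 apply/eqP; rewrite subr_eq0; apply/eqP/funext => s.
 exact: (hf d d' sd.1 sd'.1 (unr d sd) (unr d' sd') e).
- exact: cob0.
- exact: cobB.
move=> d [[dt _ _] _]; have -> : d *+ p = 0; last exact: cob0.
by apply/funext => s; rewrite fct_mulrn dt.
Qed.

Lemma lincomb_pt m (a : 'I_m -> G -> ecpt W) (x : 'I_m -> 'F_p) :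
 lincomb E x (fun k s => pt (a k s)) = (fun s => pt ((\sum_k a k *+ x k) s)).
Proof.
apply/funext => s; rewrite /lincomb -eW fct_sum.
apply: (big_ind2 (fun u v => u = pt v)) => [//|u v u' v' -> -> //|k _].
by rewrite fct_mulrn ptMn.
Qed.

Lemma sel_has_dim chi m (a : 'I_m -> G -> ecpt W) : (forall i, sel chi (a i)) ->
  (forall c : 'I_m -> int, cob (\sum_i a i *~ c i) -> forall i, (p%:Z %| c i)%Z) ->
  (forall d, sel chi d -> exists c : 'I_m -> 'I_p, cob (d - \sum_i a i *+ c i)) ->
 has_dim p E (selmer R E chi) m.
Proof.
move=> Sa ind spn; exists (fun k s => pt (a k s)) => [k|c hc]; first exact/selE.
have [d cd ed] := cocycle_lift eW hc.1.
have {ed} ec : c = (fun s => pt (d s)) by apply/funext.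
rewrite {}ec in hc *; have sd : sel chi d by apply/selE.
have coE (x : 'I_m -> 'F_p) : cohomologous p E (lincomb E x (fun k s => pt (a k s))) (fun s => pt (d s)) <->
  cob (d - \sum_k a k *+ x k).
 rewrite lincomb_pt cohomologousE; split=> -[T hT h]; exists T => //.
  by apply/funext => s; rewrite !fctE h addrC addKr.
 move=> s; suff e (S : G -> ecpt W) : d - S = (fun s => gpt eW s T - T) -> d s = S s + (gpt eW s T - T) by exact: e.
 move=> hS; have -> : gpt eW s T - T = (d - S) s by rewrite hS.
 rewrite addrC; symmetry; exact: subrK.
have [x hx] := spn d sd; exists [ffun k => (x k : nat)%:R]; split.
 apply/coE; rewrite (eq_bigr (fun k => a k *+ x k)) // => k _.
 by rewrite ffunE val_Fp_nat // modn_small.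
move=> y /coE hy; apply/ffunP => k; rewrite ffunE; apply: val_inj => /=; rewrite val_Fp_nat // modn_small //.
have yp : (y k < p)%N by have := ltn_ord (y k); rewrite [X in (_ < X)%N](Fp_cast pp).
suff e : x k = Ordinal yp by rewrite e.
apply: dvdz_ord_sub; apply: (ind (fun k => (x k : nat)%:Z - (y k : nat)%:Z)).
have -> : \sum_i a i *~ ((x i : nat)%:Z - (y i : nat)%:Z) = (d - \sum_i a i *+ y i) - (d - \sum_i a i *+ x i).
 rewrite opprB [RHS]addrC subrKA -sumrB; apply: eq_bigr => i _; exact: mulrzBr.
exact: cobB.
Qed.
End Selmer.

Section Comparison.
Variables (R : realType) (K : fieldExtType rat) (Kb : algClosure K) (p : nat).
Hypotheses (pp : prime p) (p3 : (3 <= p)%N).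
Let p0 : (0 < p)%N := prime_gt0 pp.
Local Notation G := (absGal Kb).
Local Notation curve W E := (gc_eqn W = map_weierstrass (ac_emb Kb) (ec_eqn E)).

Record torsion_iso (E1 E2 : ellipticCurve K) (W1 W2 : goodcurve Kb) (e1 : curve W1 E1) (e2 : curve W2 E2)
  (phi : ecpt W1 -> ecpt W2) := TorsionIso {
 ti_tor : forall x, x *+ p = 0 -> phi x *+ p = 0;
 ti_inj : forall x y, x *+ p = 0 -> y *+ p = 0 -> phi x = phi y -> x = y;
 ti_surj : forall y, y *+ p = 0 -> exists2 x, x *+ p = 0 & phi x = y;
 ti_D : forall x y, x *+ p = 0 -> y *+ p = 0 -> phi (x + y) = phi x + phi y;
 ti_gal : forall s x, x *+ p = 0 -> phi (gpt e1 s x) = gpt e2 s (phi x) }.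

Lemma torsion_iso_inv E1 E2 W1 W2 (e1 : curve W1 E1) (e2 : curve W2 E2) phi : torsion_iso e1 e2 phi ->
 exists psi, torsion_iso e2 e1 psi.
Proof.
case=> tor inj surj phiD gal.
have /choice[psi hpsi] : forall y, exists x : ecpt W1, y *+ p = 0 -> x *+ p = 0 /\ phi x = y.
 move=> y; have [/surj[x h1 h2]|n] := pselect (y *+ p = 0); first by exists x.
 by exists 0 => /n.
have tD (W : goodcurve Kb) (x y : ecpt W) : x *+ p = 0 -> y *+ p = 0 -> (x + y) *+ p = 0.
 by move=> hx hy; rewrite mulrnDl hx hy addr0.
exists psi; split=> [y /hpsi[]//|y y' hy hy' e|x hx|y y' hy hy'|s y hy].
- by rewrite -(hpsi y hy).2 e (hpsi y' hy').2.
- exists (phi x); first exact: tor.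
 by have [h1 h2] := hpsi _ (tor _ hx); exact: inj.
- have [h1 h2] := hpsi y hy; have [h1' h2'] := hpsi y' hy'; have [k1 k2] := hpsi _ (tD _ _ _ hy hy').
 by apply: inj => //; [exact: tD|rewrite k2 phiD // h2 h2'].
have hs : gpt e2 s y *+ p = 0 by rewrite -gptMn hy gpt0.
have [h1 h2] := hpsi y hy; have [k1 k2] := hpsi _ hs.
by apply: inj => //; [rewrite -gptMn h1 gpt0|rewrite k2 gal // h2].
Qed.

Variables (E1 E2 : ellipticCurve K) (W1 W2 : goodcurve Kb) (e1 : curve W1 E1) (e2 : curve W2 E2).
Variable phi : ecpt W1 -> ecpt W2.
Hypothesis iso : torsion_iso e1 e2 phi.

Let torB (W : goodcurve Kb) (x y : ecpt W) : x *+ p = 0 -> y *+ p = 0 -> (x - y) *+ p = 0.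
Proof. by move=> hx hy; rewrite mulrnBl hx hy subrr. Qed.
Let phi0 : phi 0 = 0.
Proof.
have h : (0 : ecpt W1) *+ p = 0 by exact: mul0rn.
by apply: (addrI (phi 0)); rewrite -(ti_D iso) // !addr0.
Qed.
Let phiB x y : x *+ p = 0 -> y *+ p = 0 -> phi (x - y) = phi x - phi y.
Proof.
by move=> hx hy; apply: (addIr (phi y)); rewrite subrK -(ti_D iso) ?subrK //; exact: torB.
Qed.
Let gtor s (x : ecpt W1) : x *+ p = 0 -> gpt e1 s x *+ p = 0.
Proof. by move=> h; rewrite -gptMn h gpt0. Qed.
Let phi_cob s T : T *+ p = 0 -> phi (gpt e1 s T - T) = gpt e2 s (phi T) - phi T.
Proof. by move=> hT; rewrite phiB ?(ti_gal iso) //; exact: gtor. Qed.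

Lemma iso_cocycle d : ecocycle p e1 d -> ecocycle p e2 (phi \o d).
Proof.
move=> [dt dM dc]; split=> [s|s t|s] /=.
- exact: (ti_tor iso).
- by rewrite dM (ti_D iso) // ?(ti_gal iso) //; exact: gtor.
by have [r hr] := dc s; exists r => t /hr ->.
Qed.

(** Archimedean conditions always hold, and above [M] the hypothesis gives a coboundary. At the
    other places [good_away] describes the condition in the same way for both curves; in the
    ramified case the local torsion point comes from [Kb], so [phi] can be applied to it. *)
Lemma transport_local chi (M : nat) : good_away R Kb E1 p M -> good_away R Kb E2 p M ->
 forall d, sel (p := p) R e1 chi d ->
 (forall (D : localData R Kb) (na : nonarch (ld_place D)), vm (OD na) M%:R ->
  exists2 T, T *+ p = 0 & forall s : absGal (ld_bar D), d (ld_res s) = gpt e1 (ld_res s) T - T) ->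
 sel (p := p) R e2 chi (phi \o d).
Proof.
move=> g1 g2 d [cd hd] bad; have cd2 := iso_cocycle cd; have [dt _ _] := cd; split=> // D.
have [na|ar] := pselect (nonarch (ld_place D)); last first.
 by have [T hT h] := arch_cob pp p3 ar cd2; apply: (locg_cob chi hT h).
have [hO|nO] := pselect (OD na M%:R^-1); last first.
 have [|T hT h] := bad D na; first by rewrite -[M%:R]invrK; exact: vinv_vm.
 by apply: (locg_cob chi (ti_tor iso hT)) => s /=; rewrite h phi_cob.
move=> WD eWD; have [VD eVD] := goodcurve_ex E1 (ac_emb (ld_bar D) \o co_emb (ld_field D)).
pose psi s := chi (@ld_res _ _ _ D s).
have psiM s t : psi (gal_mul s t) = psi s * psi t by rewrite /psi ld_resM ch_mul.
have psip s : psi s ^+ p = 1 by exact: ch_mu.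
have [u1 r1] := g1 D na VD eVD hO _ psi psiM psip _ (local_cocycle eVD cd).
have [u2 r2] := g2 D na WD eWD hO _ psi psiM psip _ (local_cocycle eWD cd2).
have := hd D VD eVD; have [ur|nur] := pselect (unram (OD na) 1 psi).
 move=> /(u1 ur)[r rO hr]; apply/(u2 ur); exists r => // s /hr h.
 have -> : (phi \o d) (ld_res s) = 0; last exact: lft0.
 by rewrite /= (_ : d (ld_res s) = 0) ?phi0 //; apply: (@lft_inj _ _ _ _ _ e1 D VD eVD); rewrite h lft0.
move=> /(r1 nur)[TD hTD h]; apply/(r2 nur).
have [T hT eT] := torsion_descends e1 eVD p0 hTD.
exists (lft e2 eWD (phi T)); first by rewrite -lftMn (ti_tor iso) // lft0.
move=> s /h hs /=; rewrite -lft_gal -lftB -phi_cob //; congr (lft _ _ (phi _)).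
by apply: (@lft_inj _ _ _ _ _ e1 D VD eVD); rewrite hs -eT lftB lft_gal.
Qed.

(** A cocycle [d] receives the colour [f d] together with the class of [phi (d - d0)] in the second
    Selmer group, where [d0] is a fixed Selmer cocycle of colour [f d]. Equal colours force equal
    classes, so [p^m1] is at most [#|C|] times [p^m2]. The set [C] depends on the curves but not on
    [chi]. *)
Lemma dimension_bound : exists q : nat, forall chi m1 (a1 : 'I_m1 -> G -> ecpt W1) m2 (a2 : 'I_m2 -> G -> ecpt W2),
 (forall i, sel (p := p) R e1 chi (a1 i)) ->
 (forall c : 'I_m1 -> int, cob p e1 (\sum_i a1 i *~ c i) -> forall i, (p%:Z %| c i)%Z) ->
 (forall d, sel (p := p) R e2 chi d -> exists c : 'I_m2 -> 'I_p, cob p e2 (d - \sum_i a2 i *+ c i)) ->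
 (m1 <= m2 + q)%N.
Proof.
have [N1 N10 h1] := good_place R Kb E1 pp p3.
have [N2 N20 h2] := good_place R Kb E2 pp p3.
have M0 : (0 < N1 * N2)%N by rewrite muln_gt0 N10.
have [_ [C [f hf]]] := colour_setup R e1 pp M0.
have c0 (D : localData R Kb) := @Fb_char0 R K Kb D.
have o1 (D : localData R Kb) (na : nonarch (ld_place D)) : OD na (N1 * N2)%:R^-1 -> OD na N1%:R^-1.
 by apply: O_invM; exact: pos_natr0 (c0 D) N20.
have o2 (D : localData R Kb) (na : nonarch (ld_place D)) : OD na (N1 * N2)%:R^-1 -> OD na N2%:R^-1.
 by rewrite mulnC; apply: O_invM; exact: pos_natr0 (c0 D) N10.
exists #|C| => chi m1 a1 m2 a2 Sa1 ind1 spn2.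
have tr d d' : sel (p := p) R e1 chi d -> sel (p := p) R e1 chi d' -> f d = f d' -> sel (p := p) R e2 chi (phi \o (d - d')).
 move=> sd sd' e; apply: (@transport_local chi (N1 * N2)%N).
 - by move=> D na W eW hO; exact: (h1 D na W eW (o1 D na hO)).
 - by move=> D na W eW hO; exact: (h2 D na W eW (o2 D na hO)).
 - exact: selB.
 move=> D na vM; have [T hT h] := hf d d' sd.1 sd'.1 e D na vM.
 by exists T => // s; rewrite fctE h.
have /choice[rep hrep] : forall c : C, exists d0, forall d, sel (p := p) R e1 chi d -> f d = c -> sel (p := p) R e1 chi d0 /\ f d0 = c.
 move=> c; have [[d0 [s0 e0]]|n] := pselect (exists d0, sel (p := p) R e1 chi d0 /\ f d0 = c).
  by exists d0.
 by exists 0 => d sd e; case: n; exists d.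
have /choice[co hco] : forall y, exists c : {ffun 'I_m2 -> 'I_p}, sel (p := p) R e2 chi y -> cob p e2 (y - \sum_i a2 i *+ c i).
 move=> y; have [/spn2[c hc]|n] := pselect (sel (p := p) R e2 chi y); last by exists [ffun=> Ordinal p0].
 by exists (finfun c) => _; rewrite (eq_bigr (fun i => a2 i *+ c i)) // => i _; rewrite ffunE.
pose F d := (f d, co (phi \o (d - rep (f d)))).
have cnt := @independent_count (G -> ecpt W1) p (sel (p := p) R e1 chi) (cob p e1) _ F _ _ _ m1 a1 Sa1 ind1.
have {cnt} : (p ^ m1 <= #|{: C * {ffun 'I_m2 -> 'I_p}}|)%N.
 apply: cnt.
 - by apply: sel_cob; exact: cob0.
 - exact: selB.
 move=> d d' sd sd' [ef]; rewrite -ef => ec.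
 have [sr er] := hrep (f d) d sd erefl.
 have s1 := tr d _ sd sr (esym er); have s2 := tr d' _ sd' sr (etrans (esym ef) (esym er)).
 have k1 := hco _ s1; have k2 := hco _ s2; rewrite -ec in k2.
 have [T hT eT] := cobB k1 k2.
 have [T1 hT1 eT1] := ti_surj iso hT; exists T1 => //; apply/funext => s.
 have [[dt _ _] _] := sd; have [[dt' _ _] _] := sd'; have [[rt _ _] _] := sr.
 apply: (ti_inj iso); [exact: torB|by apply: torB => //; exact: gtor|].
 have := congr1 (fun u => u s) eT; rewrite -eT1 -phi_cob // => <-.
 by rewrite opprB addrA subrK !fctE /= -phiB //; [congr (phi _); rewrite opprB addrA subrK|exact: torB|exact: torB].
rewrite card_prod card_ffun !card_ord => le.
(* The crude bound [#|C| < p ^ #|C|] turns the number of colours into a bound on dimensions, so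
   [q = #|C|] works. *)
have : (p ^ m1 < p ^ (m2 + #|C|).+1)%N.
 apply: leq_ltn_trans le _; rewrite expnS expnD mulnC.
 have h : (#|C| < p ^ #|C|)%N by apply: ltn_expl; exact: prime_gt1.
 apply: (@leq_ltn_trans (p ^ m2 * p ^ #|C|)); first by rewrite leq_mul2l (ltnW h) orbT.
 by rewrite ltn_Pmull ?prime_gt1 // muln_gt0 !expn_gt0 p0.
by rewrite ltn_exp2l ?prime_gt1 // ltnS.
Qed.
End Comparison.

Theorem theorem1p7 (R : realType) (p : nat) (K : fieldExtType rat)
  (Kb : algClosure K) (E1 E2 : ellipticCurve K) :
 prime p -> (3 <= p)%N ->
 torsion_isomorphic Kb p E1 E2 ->
 near_companions R Kb p E1 E2.
Proof.
move=> pp p3 [f [f1 f2 f3 f4 f5]].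
have [W1 e1] := goodcurve_ex E1 (ac_emb Kb); have [W2 e2] := goodcurve_ex E2 (ac_emb Kb).
have p0 := prime_gt0 pp.
have tE1 (x : ecpt W1) := ptorsionE p e1 x; have tE2 (x : ecpt W2) := ptorsionE p e2 x.
have /choice[phi hphi] : forall x : ecpt W1, exists y : ecpt W2, x *+ p = 0 -> y *+ p = 0 /\ pt y = f (pt x).
 move=> x; have [hx|n] := pselect (x *+ p = 0); last by exists 0 => /n.
 by have [y hy ey] := ptorsion_ex e2 (f1 _ ((tE1 x).2 hx)); exists y.
have iso : torsion_iso p e1 e2 phi.
 have tD (x y : ecpt W1) : x *+ p = 0 -> y *+ p = 0 -> (x + y) *+ p = 0.
  by move=> hx hy; rewrite mulrnDl hx hy addr0.
 split=> [x /hphi[]//|x y hx hy e|y hy|x y hx hy|s x hx].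
 - apply: pt_inj; apply: f2; [exact/tE1|exact/tE1|].
  by rewrite -(hphi x hx).2 e (hphi y hy).2.
 - have [P hP eP] := f3 _ ((tE2 y).2 hy); have [x hx ex] := ptorsion_ex e1 hP.
  by exists x => //; apply: pt_inj; rewrite (hphi x hx).2 -ex.
 - apply: pt_inj; rewrite (hphi _ (tD _ _ hx hy)).2 ptD e1 f4; try exact/tE1.
  by rewrite ptD e2 (hphi x hx).2 (hphi y hy).2.
 have hs : gpt e1 s x *+ p = 0 by rewrite -gptMn hx gpt0.
 by apply: pt_inj; rewrite (hphi _ hs).2 !gptE f5 ?(hphi x hx).2 //; exact/tE1.
have [psi iso'] := torsion_iso_inv iso.
have [q1 b1] := dimension_bound R pp p3 iso; have [q2 b2] := dimension_bound R pp p3 iso'.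
(* The isomorphism and its inverse bound the difference from the two sides; the successor makes the
   inequality strict. *)
exists (q1 + q2).+1%:Z => chi.
have [m1 [a1 [s1 i1 sp1]]] := selmer_dim R e1 pp p3 chi.
have [m2 [a2 [s2 i2 sp2]]] := selmer_dim R e2 pp p3 chi.
exists m1, m2; split.
- exact: sel_has_dim s1 i1 sp1.
- exact: sel_has_dim s2 i2 sp2.
have := b1 chi m1 a1 m2 a2 s1 i1 sp2; have := b2 chi m2 a2 m1 a1 s2 i2 sp1; lia.
Qed.
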